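(* Every graph $G\in\mathcal{A}$ either is a clique or has a special even pair. Every graph $G\in\mathcal{A}$ is perfectly contractile.
   Context: Graphs are finite and simple; ''$G$ contains $F$'' means as an induced subgraph. The length of a path is its number of edges; a path (or cycle) is chordless if it is an induced path (cycle). A hole is a chordless cycle with at least four vertices; it is odd if it has an odd number of vertices. An antihole is the complement of a hole, and its length is its number of vertices. A prism is a graph consisting of two vertex-disjoint triangles together with three vertex-disjoint paths between them (each joining a vertex of one triangle to a vertex of the other), with no edges other than those of the two triangles and of the three paths. $\mathcal{A}$ is the class of graphs that contain no odd hole, no antihole of length at least $5$, and no prism. An even pair of $G$ is a pair $\{x,y\}$ of non-adjacent (distinct) vertices such that every chordless path between $x$ and $y$ has even length. An $(a,b)$-snake is a graph consisting of four vertex-disjoint chordless paths $S_1=a\cdots a'$, $S_2=b\cdots b'$, $S_3=c\cdots c'$, $S_4=d\cdots d'$, where $S_1,S_2$ may have length $0$ but $S_3,S_4$ have length at least $1$, and whose edge-set is $E(S_1)\cup E(S_2)\cup E(S_3)\cup E(S_4)\cup\{a'c,a'd,cd,b'c',b'd',c'd'\}$. The snake is proper if at least one of $S_1,S_2$ has length at least $1$. An even pair $\{a,b\}$ of $G$ is special if $G$ contains no proper $(a,b)$-snake. For two vertices $x,y$ of $G$, $G/xy$ denotes the graph obtained by removing $x$ and $y$ and adding one new vertex adjacent to exactly those vertices of $G\setminus\{x,y\}$ that are adjacent in $G$ to at least one of $x,y$. A graph $G$ is even-contractile if either $G$ is a clique or there is a sequence $G_0,\ldots,G_k$ of graphs such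 that $G=G_0$, for $i=0,\ldots,k-1$ the graph $G_i$ has an even pair $\{x_i,y_i\}$ with $G_{i+1}=G_i/x_iy_i$, and $G_k$ is a clique. A graph is perfectly contractile if each of its induced subgraphs is even-contractile. *)

(* Defs.v *)
From HB Require Import structures.
From mathcomp Require Import all_boot.

Set Implicit Arguments.
Unset Strict Implicit.
Unset Printing Implicit Defensive.

Record sgraph := SGraph {
  vertex :> finType;
  adj : rel vertex;
  adj_sym : symmetric adj;
  adj_irrefl : irreflexive adj }.

Arguments adj {_}.
Notation "x -- y" := (adj x y) (at level 30, no associativity).

Definition is_clique (G : sgraph) : Prop := forall x y : G, x != y -> x -- y.

Section Induced.
Variables (G : sgraph) (S : {set G}).

Definition ind_adj (u v : {x : G | x \in S}) : bool := val u -- val v.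

Fact ind_adj_sym : symmetric ind_adj.
Proof. by move=> u v; apply: adj_sym. Qed.

Fact ind_adj_irrefl : irreflexive ind_adj.
Proof. by move=> u; apply: adj_irrefl. Qed.

Definition induced : sgraph := SGraph ind_adj_sym ind_adj_irrefl.
End Induced.

Section Complement.
Variable G : sgraph.

Definition compl_adj (u v : G) : bool := (u != v) && ~~ (u -- v).

Fact compl_adj_sym : symmetric compl_adj.
Proof. by move=> u v; rewrite /compl_adj eq_sym adj_sym. Qed.

Fact compl_adj_irrefl : irreflexive compl_adj.
Proof. by move=> u; rewrite /compl_adj eqxx. Qed.

Definition compl : sgraph := SGraph compl_adj_sym compl_adj_irrefl.
End Complement.

(* [G / x y]; the vertex [None] is the new one. *)
Section Contract.
Variables (G : sgraph) (x y : G).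

Definition contract_adj (u v : option {z : G | z \notin [:: x; y]}) : bool :=
  match u, v with
  | Some z, Some t => val z -- val t
  | Some z, None | None, Some z => (x -- val z) || (y -- val z)
  | None, None => false
  end.

Fact contract_adj_sym : symmetric contract_adj.
Proof. by move=> [u|] [v|] //=; apply: adj_sym. Qed.

Fact contract_adj_irrefl : irreflexive contract_adj.
Proof. by move=> [u|] //=; apply: adj_irrefl. Qed.

Definition contract : sgraph := SGraph contract_adj_sym contract_adj_irrefl.
End Contract.

(* The classes of graphs [F] used here are defined below by how their whole
   vertex set is laid out, and are invariant under isomorphism; so having an
   induced subgraph isomorphic to a member of [F] amounts to this. *)
Definition contains (G : sgraph) (F : sgraph -> Prop) : Prop :=
  exists S : {set G}, F (induced S).

Definition path_edge (T : eqType) (s : seq T) (u v : T) : bool :=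
  infix [:: u; v] s || infix [:: v; u] s.

(* For [c] duplicate-free. *)
Definition cycle_edge (T : eqType) (c : seq T) (u v : T) : bool :=
  (v == next c u) || (u == next c v).

Definition triangle_edge (T : eqType) (a b c u v : T) : bool :=
  [&& u != v, u \in [:: a; b; c] & v \in [:: a; b; c]].

(* The path visits [x :: p] in this order, so its length is [size p]. *)
Definition chordless_path (G : sgraph) (x : G) (p : seq G) (y : G) : Prop :=
  [/\ path adj x p, last x p = y, uniq (x :: p)
    & {in x :: p &, forall u v, u -- v -> path_edge (x :: p) u v}].

Definition chordless_cycle (G : sgraph) (c : seq G) : Prop :=
  [/\ 3 <= size c, ucycle adj c
    & {in c &, forall u v, u -- v -> cycle_edge c u v}].

Definition is_hole (H : sgraph) : Prop :=
  exists c : seq H, [/\ chordless_cycle c, 4 <= size c & forall v, v \in c].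

Definition is_odd_hole (H : sgraph) : Prop := is_hole H /\ odd #|H|.

Definition is_antihole (H : sgraph) : Prop := is_hole (compl H).

Definition is_long_antihole (H : sgraph) : Prop := is_antihole H /\ 5 <= #|H|.

(* The paths are [ai :: pi], ending at [bi := last ai pi]; the triangles are
   [a1 a2 a3] and [b1 b2 b3].  Since these are disjoint, [pi] is nonempty. *)
Definition is_prism (H : sgraph) : Prop :=
  exists (a1 a2 a3 : H) (p1 p2 p3 : seq H),
  let P1 := a1 :: p1 in let P2 := a2 :: p2 in let P3 := a3 :: p3 in
  let b1 := last a1 p1 in let b2 := last a2 p2 in let b3 := last a3 p3 in
  [/\ [/\ p1 != [::], p2 != [::] & p3 != [::]],
      uniq (P1 ++ P2 ++ P3),
      forall v, v \in P1 ++ P2 ++ P3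
    & forall u v, u -- v =
        [|| path_edge P1 u v, path_edge P2 u v, path_edge P3 u v,
            triangle_edge a1 a2 a3 u v | triangle_edge b1 b2 b3 u v]].

Definition class_A (G : sgraph) : Prop :=
  [/\ ~ contains G is_odd_hole, ~ contains G is_long_antihole
    & ~ contains G is_prism].

Definition even_pair (G : sgraph) (x y : G) : Prop :=
  [/\ x != y, ~~ (x -- y)
    & forall p, chordless_path x p y -> ~~ odd (size p)].

(* The whole graph [H] is an (a,b)-snake with paths [S1 = a :: s1], etc.  Their
   chordlessness follows from the description of the edges. *)
Definition snake_on (H : sgraph) (a : H) (s1 : seq H) (b : H) (s2 : seq H)
    (c : H) (s3 : seq H) (d : H) (s4 : seq H) : Prop :=
  let S1 := a :: s1 in let S2 := b :: s2 in
  let S3 := c :: s3 in let S4 := d :: s4 in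
  let a' := last a s1 in let b' := last b s2 in
  let c' := last c s3 in let d' := last d s4 in
  [/\ 1 <= size s3 /\ 1 <= size s4,
      uniq (S1 ++ S2 ++ S3 ++ S4),
      forall v, v \in S1 ++ S2 ++ S3 ++ S4
    & forall u v, u -- v =
        [|| path_edge S1 u v, path_edge S2 u v, path_edge S3 u v,
            path_edge S4 u v, triangle_edge a' c d u v
          | triangle_edge b' c' d' u v]].

Definition is_proper_snake (H : sgraph) (a b : H) : Prop :=
  exists (s1 s2 : seq H) (c : H) (s3 : seq H) (d : H) (s4 : seq H),
  snake_on a s1 b s2 c s3 d s4 /\ (1 <= size s1 \/ 1 <= size s2).

(* Here [a] and [b] are fixed vertices of [G], not just isomorphic copies. *)
Definition contains_proper_snake (G : sgraph) (a b : G) : Prop :=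
  exists (S : {set G}) (aS : a \in S) (bS : b \in S),
  @is_proper_snake (induced S) (exist _ a aS) (exist _ b bS).

Definition special_even_pair (G : sgraph) (a b : G) : Prop :=
  even_pair a b /\ ~ contains_proper_snake a b.

Inductive even_contractile : sgraph -> Prop :=
| EvenContractile_clique G : is_clique G -> even_contractile G
| EvenContractile_step (G : sgraph) (x y : G) :
    even_pair x y -> even_contractile (contract x y) -> even_contractile G.

Definition perfectly_contractile (G : sgraph) : Prop :=
  forall S : {set G}, even_contractile (induced S).

(* Main.v *)
Require Import Defs.
From mathcomp Require Import all_boot.
From mathcomp Require Import zify.
From Stdlib Require Import Classical.

Set Implicit Arguments.
Unset Strict Implicit.
Unset Printing Implicit Defensive.

(** Call a vertex complete if it is adjacent to all of a fixed set [T] that is connected in the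
    complement.  By a lemma of Roussel and Rubio, an induced path whose ends are complete and
    whose inner vertices are not has even length, or length 1.  Take [T] maximal such that its
    complete vertices do not form a clique.  If no path avoiding [T] and its complete vertices
    joins two nonadjacent complete vertices, a special even pair of the subgraph on the complete
    vertices is one of [G].  Otherwise a shortest such path [z 1, ..., z n] defines the cliques
    [A] and [B] of the complete vertices that see only [z 1], respectively only [z n].  An induced
    path from [A] to [B] with no inner vertex in [A] or [B] is even, because it has an even number
    of edges with complete ends between any two consecutive vertices that see the path [z].  Hence
    "some odd induced path from [a] to [B] goes through [a']" is a strict order on [A].  A maximal
    [a] and, symmetrically, a maximal [b] form an even pair, which is special: a proper snake
    would contain a long antihole or a hole with exactly two complete vertices, these being adjacent,
    and such a hole cannot be linked to a further complete vertex away from those two.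

    Contracting a special even pair stays in the class, since an odd hole, long antihole or prism
    through the new vertex gives one in [G], an odd path between the pair, or a proper snake. *)

(** Parity facts have three sources: holes are even, induced paths with only their ends complete are
    even or single edges, and induced paths meeting [A] and [B] only in their ends are even. The
    second says nothing when the two complete vertices are adjacent; this is why holes with two
    adjacent complete vertices need lemmas of their own.

    Maximality of [T] is used once: an inner vertex of the outer path is outside [T] and not
    complete, so adding it keeps [T] connected in the complement, and its complete neighbours form a
    clique. By shortness a complete vertex outside [A] and [B] that sees [z] is adjacent to all of
    both, so it lies inside no long induced path between them.

    The hardest point is asymmetry of the relation on [A]. Opposite witnesses are two even paths to
    [B] with adjacent starts, and their next contact is an edge between their far ends or a
    triangle. An edge clashes with parities or lets [z] complete a prism. A triangle has two
    complete vertices, so [z 1] sees at most one of the three, and the holes and paths through [z 1]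
    lead to a contradiction. *)

Ltac slia := simpl in *; lia.

(* [lia] case-splits on boolean atoms: keep only the arithmetic hypotheses. *)
Ltac arith_only := repeat match goal with
  | H : ?P |- _ => lazymatch type of P with Prop => lazymatch P with
    | context [@adj] => clear H
    | is_true (leq _ _) => fail | is_true (leq _ _ && _) => fail
    | is_true (~~ (leq _ _)) => fail | leq _ _ = _ => fail
    | is_true (odd _) => fail | is_true (~~ odd _) => fail
    | odd _ = _ => fail | ~~ odd _ = _ => fail
    | @eq nat _ _ => fail
    | @eq ?T ?a ?b => tryif unify T nat then change (@eq nat a b) in H else clear H
    | is_true (@eq_op ?E _ _) => tryif unify (Equality.sort E) nat then fail else clear H
    | is_true (~~ (@eq_op ?E _ _)) => tryif unify (Equality.sort E) nat then fail else clear H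
    | is_true (_ || _) => fail | is_true (~~ (_ && _)) => fail
    | _ /\ _ => fail | _ \/ _ => fail
    | _ => clear H end end
  end.
Ltac nlia := arith_only; lia.
(** Meant for goals about index ranges only, where parities and disjunctions would just add case
    splits. *)
Ltac range_lia := arith_only;
  repeat match goal with
  | H : context [odd] |- _ => clear H
  | H : _ \/ _ |- _ => clear H
  end; lia.

(** * Segments and induced paths *)

Section Segments.
Variable T : Type.

(* The segment [f i, ..., f j], traversed downwards if [j < i]; never empty. *)
Definition seg (f : nat -> T) (i j : nat) : seq T :=
  if i <= j then mkseq (fun k => f (i + k)) (j - i).+1
  else mkseq (fun k => f (i - k)) (i - j).+1.

Lemma size_seg f i j : size (seg f i j) = (i - j) + (j - i) + 1.
Proof. by rewrite /seg; case: (leqP i j) => ?; rewrite size_mkseq; lia. Qed.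

Lemma nth_seg x0 f i j k : k <= (i - j) + (j - i) ->
  nth x0 (seg f i j) k = if i <= j then f (i + k) else f (i - k).
Proof. by rewrite /seg; case: (leqP i j) => ? ?; rewrite nth_mkseq //; lia. Qed.

Lemma seg_neq0 f i j : 0 < size (seg f i j).
Proof. by rewrite size_seg; lia. Qed.

Lemma head_seg x0 f i j : head x0 (seg f i j) = f i.
Proof. by rewrite -nth0 nth_seg; [case: ifP => _; rewrite ?addn0 ?subn0|lia]. Qed.

Lemma last_seg x0 f i j : last x0 (seg f i j) = f j.
Proof.
rewrite -nth_last size_seg nth_seg; last by lia.
by case: ifP => ?; congr f; lia.
Qed.

Lemma rev_seg f i j : rev (seg f i j) = seg f j i.
Proof.
apply: (@eq_from_nth _ (f 0)); rewrite ?size_rev ?size_seg; first by lia.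
move=> k lk; rewrite nth_rev ?size_seg; last by lia.
by rewrite !nth_seg; try lia; case: ifP; case: ifP => ? ?; congr f; lia.
Qed.

Lemma all_seg (p : pred T) f i j :
  (forall k, minn i j <= k <= maxn i j -> p (f k)) -> all p (seg f i j).
Proof.
move=> h; apply/(all_nthP (f 0)) => k; rewrite size_seg => lk.
by rewrite nth_seg; [case: ifP => ?; apply: h; lia|lia].
Qed.

Lemma seg_xx f i : seg f i i = [:: f i].
Proof. by rewrite /seg leqnn subnn /mkseq /= addn0. Qed.
End Segments.

Lemma mem_segP (T : eqType) (f : nat -> T) i j x :
  reflect (exists2 k, minn i j <= k <= maxn i j & x = f k) (x \in seg f i j).
Proof.
apply: (iffP idP) => [/(nthP (f 0)) [k]|[k hk ->]].
  rewrite size_seg => lk <-; rewrite nth_seg; last by lia.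
  by case: ifP => ?; [exists (i + k)|exists (i - k)] => //; lia.
apply/(nthP (f 0)); exists (if i <= j then k - i else i - k).
  by rewrite size_seg; case: ifP; lia.
rewrite nth_seg; last by case: (leqP i j) => ?; lia.
by case: (leqP i j) => ?; congr f; lia.
Qed.

Section InducedPaths.
Variable G : sgraph.
Implicit Types (x y : G) (s t : seq G) (f g : nat -> G).

Definition nadj (x y : G) : bool := (x != y) && ~~ (x -- y).
Definition anti s t : bool := all (fun x => all (nadj x) t) s.
Definition att x s : bool :=
  if s is y :: s' then (x -- y) && all (nadj x) s' else true.
(* The only edge between [s] and [t] joins the last of [s] to the first of [t]. *)
Fixpoint link s t : bool :=
  if s is x :: s' then
    if s' is [::] then att x t else all (nadj x) t && link s' t
  else true.
Fixpoint ipath s : bool := if s is x :: s' then att x s' && ipath s' else true.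

Lemma nadj_sym : symmetric nadj.
Proof. by move=> x y; rewrite /nadj eq_sym adj_sym. Qed.

Lemma adj_neq x y : x -- y -> x != y.
Proof. by apply: contraTneq => ->; rewrite adj_irrefl. Qed.

Lemma anti_catl s1 s2 t : anti (s1 ++ s2) t = anti s1 t && anti s2 t.
Proof. exact: all_cat. Qed.

Lemma anti_sym s t : anti s t = anti t s.
Proof.
by rewrite /anti; apply/allP/allP => h x xs; apply/allP => y ys;
  rewrite nadj_sym; move/allP: (h _ ys); apply.
Qed.

Lemma anti_catr s t1 t2 : anti s (t1 ++ t2) = anti s t1 && anti s t2.
Proof. by rewrite anti_sym anti_catl !(anti_sym s). Qed.

Lemma antiP s t : reflect {in s & t, forall x y, nadj x y} (anti s t).
Proof.
apply: (iffP allP) => [h x y xs yt|h x xs]; first by move/allP: (h x xs); apply.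
by apply/allP => y yt; apply: h.
Qed.

Lemma att_nth x0 x t : att x t -> forall j, j < size t ->
  (x != nth x0 t j) && ((x -- nth x0 t j) == (j == 0)).
Proof.
case: t => [|y t] //= /andP[xy /allP h] [|j] /=; first by rewrite xy adj_neq.
rewrite ltnS => lj; move: (h (nth x0 t j)); rewrite mem_nth // /nadj.
by case/(_ isT)/andP => -> /negbTE ->.
Qed.

Lemma link_nthP x0 s t :
  reflect (forall i j, i < size s -> j < size t ->
     (nth x0 s i != nth x0 t j) &&
     ((nth x0 s i -- nth x0 t j) == (i == (size s).-1) && (j == 0))) (link s t).
Proof.
apply: (iffP idP).
  elim: s => [|x s IH] //=; case: s IH => [_ h [|i] j //= _ lj|y s IH].
    exact: att_nth.
  case/andP => /allP h hl [|i] j /= li lj; last by apply: IH.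
  by move: (h (nth x0 t j)); rewrite mem_nth // /nadj; case/(_ isT)/andP=> -> /negbTE ->.
elim: s => [|x s IH] //= h; case: s IH h => [_|y s IH] h.
  case: t h => [|z t] //= h; move: (h 0 0 isT isT) => /= /andP[_ /eqP ->] /=.
  apply/(all_nthP x0) => j lj; move: (h 0 j.+1 isT lj) => /=.
  by rewrite /nadj => /andP[-> /eqP ->].
apply/andP; split.
  apply/(all_nthP x0) => j lj; move: (h 0 j isT lj) => /=.
  by rewrite /nadj => /andP[-> /eqP ->].
by apply: IH => i j li lj; apply: (h i.+1 j).
Qed.

Lemma link0 s : link s [::].
Proof. by elim: s => [|a [|b l] IH]. Qed.

Lemma link_rev s t : link (rev t) (rev s) = link s t.
Proof.
have H s1 t1 : link s1 t1 -> link (rev t1) (rev s1).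
  case: s1 => [|x s1 /link_nthP h].
    by rewrite link0.
  apply/(link_nthP x) => i j; rewrite !size_rev => li lj; rewrite !nth_rev //.
  have /andP[n1 /eqP e1] := h x (size (x :: s1) - j.+1) (size t1 - i.+1)
    ltac:(lia) ltac:(lia).
  by rewrite eq_sym n1 /= adj_sym e1; apply/eqP; lia.
by apply/idP/idP => /H; rewrite ?revK.
Qed.

Lemma link_catl s1 s2 t : 0 < size s2 -> link (s1 ++ s2) t = anti s1 t && link s2 t.
Proof.
move=> n2; elim: s1 => [|x s1 IH] //=; rewrite -andbA -IH.
by case: s1 {IH} => [|//] /=; case: s2 n2.
Qed.

Lemma link_catr s t1 t2 : 0 < size t1 -> link s (t1 ++ t2) = link s t1 && anti s t2.
Proof.
move=> n1; rewrite -link_rev rev_cat link_catl ?size_rev // link_rev andbC.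
congr andb; rewrite anti_sym; apply/antiP/antiP => h x y;
  by [move=> xs yt; apply: h; rewrite ?mem_rev|
      rewrite ?mem_rev => xs yt; apply: h].
Qed.

Lemma ipath_cat s t : ipath (s ++ t) = [&& ipath s, ipath t & link s t].
Proof.
elim: s => [|x s IH]; first by rewrite /= andbT.
rewrite [LHS]/= IH [ipath (x :: s)]/=.
case: s {IH} => [|y s] /=; first by rewrite !andbT andbC.
rewrite all_cat; case: (x -- y) => //=; case: (all _ s) => //=.
case: (all _ t) => /=; last by rewrite !andbF.
by case: (att y s) => //=; case: (ipath s) => //=.
Qed.

Lemma ipath_nthP x0 s :
  reflect (forall i j, i < j < size s ->
     (nth x0 s i != nth x0 s j) && ((nth x0 s i -- nth x0 s j) == (j == i.+1)))
  (ipath s).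
Proof.
apply: (iffP idP).
  elim: s => [_ i j /andP[]|x s IH /= /andP[ha hp] [|i] [|j] //= lj] //.
    exact: att_nth.
  exact: IH.
elim: s => [|x s IH] //= h; apply/andP; split; last first.
  by apply: IH => i j lj; apply: (h i.+1 j.+1).
case: s h {IH} => [|y s] //= h; move: (h 0 1 isT) => /= /andP[_ /eqP ->] /=.
apply/(all_nthP x0) => j lj; move: (h 0 j.+2 lj) => /=.
by rewrite /nadj => /andP[-> /eqP ->].
Qed.

Lemma ipath_uniq s : ipath s -> uniq s.
Proof.
case: s => [|x s] // /ipath_nthP h; apply/(uniqP x) => i j; rewrite !inE => li lj.
apply: contra_eq => /eqP ne; case: (ltngtP i j) => // lt.
  by have /andP[] := h x i j ltac:(simpl in *; lia).
by have /andP[] := h x j i ltac:(simpl in *; lia); rewrite eq_sym.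
Qed.

(** Long paths are carried as functions on an index range rather than as lists: subpaths are
    subranges, lengths are differences handed to [lia], and values outside the range are
    arbitrary. *)
Definition ipf f m n : Prop := forall i j, m <= i -> i < j -> j <= n ->
  (f i != f j) && ((f i -- f j) == (j == i.+1)).

Lemma ipf_adj f m n i j : ipf f m n -> m <= i <= n -> m <= j <= n ->
  (i == j.+1) || (j == i.+1) -> f i -- f j.
Proof.
move=> h li lj; case: (ltngtP i j) => [lt|gt|->]; last by lia.
  by case/andP: (h i j ltac:(lia) ltac:(lia) ltac:(lia)) => _ /eqP -> ?; lia.
by case/andP: (h j i ltac:(lia) ltac:(lia) ltac:(lia)) => _; rewrite adj_sym => /eqP -> ?; lia.
Qed.

Lemma ipf_nadj f m n i j : ipf f m n -> m <= i <= n -> m <= j <= n ->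
  (i.+1 < j) || (j.+1 < i) -> nadj (f i) (f j).
Proof.
move=> h li lj; case: (ltngtP i j) => [lt|gt|->]; last by lia.
  move=> ?; case/andP: (h i j ltac:(lia) ltac:(lia) ltac:(lia)) => ne /eqP e.
  by rewrite /nadj ne e; lia.
move=> ?; case/andP: (h j i ltac:(lia) ltac:(lia) ltac:(lia)) => ne /eqP e.
by rewrite nadj_sym /nadj ne e; lia.
Qed.

Lemma ipf_neq f m n i j : ipf f m n -> m <= i <= n -> m <= j <= n ->
  i != j -> f i != f j.
Proof.
move=> h li lj; case: (ltngtP i j) => [lt|gt|->] // _.
  by case/andP: (h i j ltac:(lia) ltac:(lia) ltac:(lia)).
by rewrite eq_sym; case/andP: (h j i ltac:(lia) ltac:(lia) ltac:(lia)).
Qed.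

Lemma ipf_sub f m n m' n' : ipf f m n -> m <= m' -> n' <= n -> ipf f m' n'.
Proof. by move=> h l1 l2 i j a b c; apply: h; lia. Qed.

Lemma ipath_ipf x0 s : ipath s -> ipf (nth x0 s) 0 (size s).-1.
Proof. by move/(ipath_nthP x0) => h i j _ lt le; apply: h; lia. Qed.

Lemma ipf_rev f n : ipf f 0 n -> ipf (fun i => f (n - i)) 0 n.
Proof.
move=> h i j _ lt le; have /andP[n1 /eqP e1] := h (n - j) (n - i) ltac:(lia) ltac:(lia) ltac:(lia).
by rewrite eq_sym n1 /= adj_sym e1; apply/eqP; lia.
Qed.

Lemma ipath_seg f m n i j :
  ipf f m n -> m <= i <= n -> m <= j <= n -> ipath (seg f i j).
Proof.
move=> h li lj; apply/(ipath_nthP (f 0)) => k l; rewrite size_seg => lt.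
rewrite !nth_seg; try lia; case: leqP => le.
  have /andP[n1 /eqP e1] := h (i + k) (i + l) ltac:(lia) ltac:(lia) ltac:(lia).
  by rewrite n1 /= e1; apply/eqP; lia.
have /andP[n1 /eqP e1] := h (i - l) (i - k) ltac:(lia) ltac:(lia) ltac:(lia).
by rewrite eq_sym n1 /= adj_sym e1; apply/eqP; lia.
Qed.

Lemma anti_ss f i j g k l :
  (forall p q, minn i j <= p <= maxn i j -> minn k l <= q <= maxn k l ->
     nadj (f p) (g q)) -> anti (seg f i j) (seg g k l).
Proof. by move=> h; apply: all_seg => p hp; apply: all_seg => q hq; apply: h. Qed.

Lemma anti_1s x g k l :
  (forall q, minn k l <= q <= maxn k l -> nadj x (g q)) -> anti [:: x] (seg g k l).
Proof. by move=> h; rewrite /anti /= andbT; apply: all_seg. Qed.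

Lemma anti_s1 x g k l :
  (forall q, minn k l <= q <= maxn k l -> nadj (g q) x) -> anti (seg g k l) [:: x].
Proof. by move=> h; rewrite /anti; apply: all_seg => p hp /=; rewrite h. Qed.

Lemma anti_11 x y : nadj x y -> anti [:: x] [:: y].
Proof. by rewrite /anti /= => ->. Qed.

Lemma link_ss f i j g k l : f j -- g k ->
  (forall p q, minn i j <= p <= maxn i j -> minn k l <= q <= maxn k l ->
     (p != j) || (q != k) -> nadj (f p) (g q)) -> link (seg f i j) (seg g k l).
Proof.
move=> e h; apply/(link_nthP (f 0)) => p q; rewrite !size_seg => lp lq.
rewrite !nth_seg; try lia.
have [/andP[/eqP ep /eqP ->]|ne] := boolP ((p == i - j + (j - i)) && (q == 0)).
  have -> : (if i <= j then f (i + p) else f (i - p)) = f j.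
    by case: ifP => ?; congr f; lia.
  rewrite addn0 subn0 if_same e adj_neq // ep eqxx andbT.
  by apply/eqP; rewrite addn1 eqxx.
rewrite addn1 /= (negbTE ne).
case: (leqP i j) => lij; case: (leqP k l) => lkl.
- have /andP[-> /negbTE -> //] : nadj (f (i + p)) (g (k + q)) by apply: h; lia.
- have /andP[-> /negbTE -> //] : nadj (f (i + p)) (g (k - q)) by apply: h; lia.
- have /andP[-> /negbTE -> //] : nadj (f (i - p)) (g (k + q)) by apply: h; lia.
- have /andP[-> /negbTE -> //] : nadj (f (i - p)) (g (k - q)) by apply: h; lia.
Qed.

Lemma link_1s x g k l : x -- g k ->
  (forall q, minn k l <= q <= maxn k l -> q != k -> nadj x (g q)) ->
  link [:: x] (seg g k l).
Proof.
move=> e h; rewrite -(seg_xx (fun=> x) 0); apply: link_ss => // p q hp hq.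
by have -> : p = 0 by [lia]; rewrite eqxx /=; apply: h.
Qed.

Lemma link_s1 x g k l : g l -- x ->
  (forall q, minn k l <= q <= maxn k l -> q != l -> nadj (g q) x) ->
  link (seg g k l) [:: x].
Proof.
move=> e h; rewrite -(seg_xx (fun=> x) 0); apply: link_ss => // p q hp hq.
by have -> : q = 0 by [lia]; rewrite eqxx orbF; apply: h.
Qed.

Lemma link_11 x y : x -- y -> link [:: x] [:: y].
Proof. by rewrite /= => ->. Qed.

Lemma ipath_catI s t : ipath s -> ipath t -> link s t -> ipath (s ++ t).
Proof. by rewrite ipath_cat => -> -> ->. Qed.
Lemma link_catlI s1 s2 t : 0 < size s2 -> anti s1 t -> link s2 t -> link (s1 ++ s2) t.
Proof. by move=> n; rewrite link_catl // => -> ->. Qed.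
Lemma link_catrI s t1 t2 : 0 < size t1 -> link s t1 -> anti s t2 -> link s (t1 ++ t2).
Proof. by move=> n; rewrite link_catr // => -> ->. Qed.
Lemma anti_catlI s1 s2 t : anti s1 t -> anti s2 t -> anti (s1 ++ s2) t.
Proof. by rewrite anti_catl => -> ->. Qed.
Lemma anti_catrI s t1 t2 : anti s t1 -> anti s t2 -> anti s (t1 ++ t2).
Proof. by rewrite anti_catr => -> ->. Qed.

(* A cyclically ordered list of at least four vertices, without chord. *)
Definition ihole s : Prop := 4 <= size s /\
  forall x0 i j, i < j < size s -> (nth x0 s i != nth x0 s j) &&
   ((nth x0 s i -- nth x0 s j) == (j == i.+1) || (i == 0) && (j == (size s).-1)).

(** A hole cut into only two paths would have two edges between them, which [link] cannot express.
    With three nonempty pieces each closing edge is the unique edge between two of them. *)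
Lemma ihole_catI s t1 t2 : 0 < size s -> 0 < size t1 -> 0 < size t2 ->
  ipath s -> ipath (t1 ++ t2) -> link s t1 -> link t2 s ->
  4 <= size (s ++ t1 ++ t2) -> ihole (s ++ t1 ++ t2).
Proof.
move=> ns n1 n2 ps; rewrite ipath_cat => /and3P[p1 p2 h12] h1 h2 sz; split=> // x0 i j.
move: sz; rewrite !size_cat => sz lt; rewrite !nth_cat.
have S p q : p < size s -> q < size s -> p < q -> _ :=
  fun a b c => ipath_nthP x0 s ps p q (introT andP (conj c b)).
have T1 p q : p < size t1 -> q < size t1 -> p < q -> _ :=
  fun a b c => ipath_nthP x0 t1 p1 p q (introT andP (conj c b)).
have T2 p q : p < size t2 -> q < size t2 -> p < q -> _ :=
  fun a b c => ipath_nthP x0 t2 p2 p q (introT andP (conj c b)).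
move/(link_nthP x0): h1 => h1; move/(link_nthP x0): h2 => h2.
move/(link_nthP x0): h12 => h12.
case: (ltnP i (size s)) => li; case: (ltnP j (size s)) => lj.
- by case/andP: (S i j ltac:(lia) ltac:(lia) ltac:(lia)) => -> /eqP ->; apply/eqP; lia.
- case: (ltnP (j - size s) (size t1)) => lj'.
    by case/andP: (h1 i (j - size s) ltac:(lia) ltac:(lia)) => -> /eqP ->; apply/eqP; lia.
  case/andP: (h2 (j - size s - size t1) i ltac:(lia) ltac:(lia)).
  by rewrite eq_sym adj_sym => -> /eqP ->; apply/eqP; lia.
- by lia.
case: (ltnP (i - size s) (size t1)) => li'; case: (ltnP (j - size s) (size t1)) => lj'.
- by case/andP: (T1 (i - size s) (j - size s) ltac:(lia) ltac:(lia) ltac:(lia)) => -> /eqP ->; apply/eqP; lia.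
- case/andP: (h12 (i - size s) (j - size s - size t1) ltac:(lia) ltac:(lia)).
  by move=> -> /eqP ->; apply/eqP; lia.
- by lia.
by case/andP: (T2 (i - size s - size t1) (j - size s - size t1) ltac:(lia) ltac:(lia) ltac:(lia)) => -> /eqP ->; apply/eqP; lia.
Qed.
End InducedPaths.

Ltac nonempty := by rewrite ?seg_neq0 // ?size_cat ?size_seg /=; range_lia.

(** [geo] checks the induced paths, holes and prisms of the proof. [geo1] reduces [ipath], [link]
    and [anti] of concatenated segments to single pairs of vertices, and [geo_leaf] closes each pair
    with some hypothesis of the context about [nadj], [adj] or [ipf]. Hence proofs first collect
    such pointwise facts with explicit ranges. *)
Ltac geo1 := lazymatch goal with
  | |- context [seg _ ?i ?i] => rewrite seg_xx
  | |- context [rev [:: ?a]] => change (rev [:: a]) with [:: a]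
  | |- context [rev (seg _ _ _)] => rewrite rev_seg
  | |- context [rev (_ ++ _)] => rewrite rev_cat
  | |- is_true (ipath (_ ++ _)) => apply: ipath_catI
  | |- is_true (ipath [:: _]) => reflexivity
  | |- is_true (link (_ ++ _) _) => apply: link_catlI; [nonempty| |]
  | |- is_true (link _ (_ ++ _)) => apply: link_catrI; [nonempty| |]
  | |- is_true (anti (_ ++ _) _) => apply: anti_catlI
  | |- is_true (anti _ (_ ++ _)) => apply: anti_catrI
  | |- is_true (anti (seg _ _ _) (seg _ _ _)) => apply: anti_ss => ? ? ? ?
  | |- is_true (anti [:: _] (seg _ _ _)) => apply: anti_1s => ? ?
  | |- is_true (anti (seg _ _ _) [:: _]) => apply: anti_s1 => ? ?
  | |- is_true (anti [:: _] [:: _]) => apply: anti_11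
  | |- is_true (link (seg _ _ _) (seg _ _ _)) => apply: link_ss => [|? ? ? ? ?]
  | |- is_true (link [:: _] (seg _ _ _)) => apply: link_1s => [|? ? ?]
  | |- is_true (link (seg _ _ _) [:: _]) => apply: link_s1 => [|? ? ?]
  | |- is_true (link [:: _] [:: _]) => apply: link_11
  end.

Ltac geo_leaf := lazymatch goal with
  | |- is_true (ipath (seg ?f _ _)) =>
      match goal with H : ipf f _ _ |- _ => apply: (ipath_seg H); range_lia end
  | |- is_true (nadj ?a ?b) => first
     [ assumption | rewrite nadj_sym; assumption
     | match goal with
       | H : context[nadj] |- _ => solve [apply: H; range_lia | rewrite nadj_sym; apply: H; range_lia]
       | H : ipf ?f _ _ |- is_true (nadj (?f _) (?f _)) => apply: (ipf_nadj H); range_lia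
       end ]
  | |- is_true (_ -- _) => first
     [ assumption | rewrite adj_sym; assumption
     | match goal with
       | H : context[adj] |- _ => solve [apply: H; range_lia | rewrite adj_sym; apply: H; range_lia]
       | H : ipf ?f _ _ |- is_true (?f _ -- ?f _) => apply: (ipf_adj H); range_lia
       end ]
  end.

Ltac geo := repeat geo1; try geo_leaf.

(** * Holes, antiholes and prisms as lists *)

Section Lists.

Lemma ihole_uniq (G : sgraph) (s : seq G) : ihole s -> uniq s.
Proof.
case: s => [|x s] // [_ h]; apply/(uniqP x) => i j; rewrite !inE => li lj.
apply: contra_eq => /eqP ne; case: (ltngtP i j) => // lt.
  by have /andP[] := h x i j ltac:(simpl in *; lia).
by have /andP[] := h x j i ltac:(simpl in *; lia); rewrite eq_sym.
Qed.

Lemma next_nth_uniq (G : sgraph) (x0 : G) (c : seq G) i : uniq c -> i < size c ->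
  next c (nth x0 c i) = nth x0 c (if i.+1 < size c then i.+1 else 0).
Proof.
move=> u li; rewrite next_nth mem_nth // index_uniq //.
case: c u li => [|y c] //= u li; case: ltnP => l /=.
  by apply: set_nth_default; lia.
by rewrite nth_default.
Qed.

Lemma iholeP (G : sgraph) (c : seq G) :
  ihole c <-> chordless_cycle c /\ 4 <= size c.
Proof.
split=> [hc|[[_ /andP[/= cy u] ch] sz]].
  have u := ihole_uniq hc; case: hc => sz h; split=> //.
  have [x0 x0c] : exists x, x \in c by case: c sz {h u} => // x c; exists x; rewrite inE eqxx.
  split; first by slia.
    rewrite /ucycle u andbT; apply: cycle_from_next => // x /(nthP x0) [i li' <-]; have li : i < size c := li'.
    rewrite next_nth_uniq //; case: ltnP => l.
      by case/andP: (h x0 i i.+1 ltac:(slia)) => _ /eqP ->; rewrite eqxx.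
    case/andP: (h x0 0 i ltac:(slia)) => _; rewrite adj_sym => /eqP ->.
    by apply/orP; right; slia.
  move=> v w /(nthP x0) [i li' <-] /(nthP x0) [j lj' <-].
  have li : i < size c := li'; have lj : j < size c := lj'; clear li' lj'.
  rewrite /cycle_edge !next_nth_uniq // !(nth_uniq x0) //; try by case: ifP => ?; slia.
  case: (ltngtP i j) => [lt|gt|->]; last by rewrite adj_irrefl.
    by case/andP: (h x0 i j ltac:(slia)) => _ /eqP ->; case: (ltnP i.+1) => ?; case: (ltnP j.+1) => ?; slia.
  case/andP: (h x0 j i ltac:(slia)) => _; rewrite adj_sym => /eqP ->.
  by case: (ltnP i.+1) => ?; case: (ltnP j.+1) => ?; slia.
split=> // x0 i j lt; have li : i < size c by lia.
have lj : j < size c by lia.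
rewrite nth_uniq //.
apply/andP; split; first by slia.
have := ch (nth x0 c i) (nth x0 c j).
rewrite !mem_nth /cycle_edge ?next_nth_uniq //; try slia.
move/(_ isT isT); rewrite !(nth_uniq x0) //; try by case: ifP => ?; slia.
case: (boolP (_ -- _)) => [_ /(_ isT)|na _].
  by move=> h; apply/eqP/esym; move: h; case: (ltnP i.+1) => ?; case: (ltnP j.+1) => ?; slia.
apply/eqP/esym/negP => h.
have nx k : k < size c -> nth x0 c k -- next c (nth x0 c k).
  by move=> lk; apply: (next_cycle cy); rewrite mem_nth.
move/negP: na; apply; case/orP: h => [/eqP ej|/andP[/eqP ei /eqP ej]]; subst.
  by have := nx i li; rewrite next_nth_uniq // lj.
have lc : (size c).-1 < size c by lia.
have := nx (size c).-1 lc; rewrite next_nth_uniq // prednK; last by lia.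
by rewrite ltnn adj_sym.
Qed.

Section Transport.
Variables (H G : sgraph) (h : H -> G).
Hypotheses (h_inj : injective h) (h_adj : forall u v, h u -- h v = u -- v).

Lemma ihole_map s : ihole (map h s) <-> ihole s.
Proof.
have key : 0 < size s -> exists y : H, true by case: s => // y; exists y.
rewrite /ihole size_map; split=> -[sz hs]; split=> // x0 i j lt;
  have [y _] := key (ltnW (ltnW (ltnW sz))).
  have := hs (h x0) i j lt; rewrite !(nth_map x0); try lia.
  by rewrite h_adj (inj_eq h_inj).
have := hs y i j lt; rewrite !(nth_map y); try lia.
by rewrite h_adj (inj_eq h_inj).
Qed.

Lemma ipath_map s : ipath (map h s) = ipath s.
Proof.
have E x t : all (nadj (h x)) (map h t) = all (nadj x) t.
  by rewrite all_map; apply: eq_all => y; rewrite /= /nadj h_adj (inj_eq h_inj).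
elim: s => //= x s ->; congr andb; case: s => //= y s.
by rewrite h_adj E.
Qed.
End Transport.

Lemma lift_seq (G : sgraph) (S : {set G}) (s : seq G) : {subset s <= S} ->
  exists s' : seq (induced S), map val s' = s.
Proof.
elim: s => [|x s IH] h; first by exists [::].
have [s' <-] : exists s' : seq (induced S), map val s' = s.
  by apply: IH => y ys; apply: h; rewrite inE ys orbT.
have xS : x \in S by apply: h; rewrite inE eqxx.
by exists (exist _ x xS :: s').
Qed.

Lemma card_cover (T : finType) (s : seq T) : uniq s -> (forall v, v \in s) ->
  #|T| = size s.
Proof. by move=> u h; rewrite -(card_uniqP u); apply: eq_card => x; rewrite h. Qed.

Lemma lift_cover (G : sgraph) (s : seq G) (s' : seq (induced [set x in s])) :
  map val s' = s -> forall v, v \in s'.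
Proof.
by move=> e v; rewrite -(mem_map val_inj) e; case: v => /= v; rewrite inE.
Qed.

Lemma contains_odd_holeP (G : sgraph) :
  contains G is_odd_hole <-> exists2 s : seq G, ihole s & odd (size s).
Proof.
split=> [[S [[c [cc sz cov]] od]]|[s hs od]].
  have hc : ihole c by apply/iholeP.
  exists (map val c); first by apply/(@ihole_map (induced S) G val val_inj (fun _ _ => erefl)).
  by rewrite size_map -(card_cover (ihole_uniq hc) cov).
have [s' e] : exists s' : seq (induced [set x in s]), map val s' = s.
  by apply: lift_seq => x; rewrite inE.
have hs' : ihole s'.
  by apply/(@ihole_map (induced [set x in s]) G val val_inj (fun _ _ => erefl)); rewrite e.
exists [set x in s]; split.
  by move/iholeP: (hs') => [cc sz]; exists s'; split=> //; apply: lift_cover.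
by rewrite (card_cover (ihole_uniq hs') (lift_cover e)) -(size_map val) e.
Qed.

Lemma contains_antiholeP (G : sgraph) : contains G is_long_antihole <->
  exists2 s : seq (compl G), ihole s & 5 <= size s.
Proof.
have va (S : {set G}) (u v : compl (induced S)) :
    (val u : compl G) -- (val v : compl G) = u -- v.
  by rewrite /= /compl_adj (inj_eq val_inj).
split=> [[S [[c [cc sz cov]] od]]|[s hs sz]].
  have hc : ihole c by apply/iholeP.
  exists (map val c); first by apply/(@ihole_map (compl (induced S)) (compl G) val val_inj (va S)).
  by rewrite size_map -(card_cover (ihole_uniq hc) cov).
have [s' e] : exists s' : seq (induced [set x in s : seq G]), map val s' = s.
  by apply: lift_seq => x; rewrite inE.
have hs' : @ihole (compl (induced [set x in s : seq G])) s'.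
  by apply/(@ihole_map (compl (induced [set x in s : seq G])) (compl G) val val_inj (va _)); rewrite e.
exists [set x in s : seq G]; split.
  by move/iholeP: (hs') => [cc sz']; exists s'; split=> //; apply: lift_cover.
by rewrite (card_cover (ihole_uniq hs') (lift_cover e)) -(size_map val) e.
Qed.
End Lists.

Section PrismLists.

Definition plink (G : sgraph) (s t : seq G) : Prop :=
  forall x0 i j, i < size s -> j < size t -> (nth x0 s i != nth x0 t j) &&
   ((nth x0 s i -- nth x0 t j) ==
      (i == 0) && (j == 0) || (i == (size s).-1) && (j == (size t).-1)).

Definition iprism (G : sgraph) (p1 p2 p3 : seq G) : Prop :=
  [/\ [/\ 1 < size p1, 1 < size p2 & 1 < size p3],
      [/\ ipath p1, ipath p2 & ipath p3]
    & [/\ plink p1 p2, plink p1 p3 & plink p2 p3]].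

(** The edge clause of [is_prism] under a name, so that permuting the three paths can be used to cut
    down the cases. *)
Definition prism_edge (T : eqType) (a1 a2 a3 : T) (p1 p2 p3 : seq T) (u v : T) :=
  [|| path_edge (a1 :: p1) u v, path_edge (a2 :: p2) u v, path_edge (a3 :: p3) u v,
      triangle_edge a1 a2 a3 u v
    | triangle_edge (last a1 p1) (last a2 p2) (last a3 p3) u v].

Lemma prism_edge12 (T : eqType) (a1 a2 a3 : T) p1 p2 p3 u v :
  prism_edge a1 a2 a3 p1 p2 p3 u v = prism_edge a2 a1 a3 p2 p1 p3 u v.
Proof.
have E (a b c : T) : triangle_edge a b c u v = triangle_edge b a c u v.
  by rewrite /triangle_edge !inE (orbCA (u == a)) (orbCA (v == a)).
by rewrite /prism_edge (E a1) (E (last a1 p1)) orbCA.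
Qed.

Lemma prism_edge23 (T : eqType) (a1 a2 a3 : T) p1 p2 p3 u v :
  prism_edge a1 a2 a3 p1 p2 p3 u v = prism_edge a1 a3 a2 p1 p3 p2 u v.
Proof.
have E (a b c : T) : triangle_edge a b c u v = triangle_edge a c b u v.
  by rewrite /triangle_edge !inE (orbC (u == b)) (orbC (v == b)).
by rewrite /prism_edge (E a1) (E (last a1 p1)); congr orb; rewrite orbCA.
Qed.

Lemma prism_edgeC (T : eqType) (a1 a2 a3 : T) p1 p2 p3 u v :
  prism_edge a1 a2 a3 p1 p2 p3 u v = prism_edge a1 a2 a3 p1 p2 p3 v u.
Proof.
rewrite /prism_edge /path_edge /triangle_edge !(orbC (infix [:: u; v] _)) (eq_sym u).
by congr [|| _, _, _, _ | _]; congr andb; rewrite andbC.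
Qed.

Lemma infix2P (T : eqType) (x0 : T) (s : seq T) u v :
  reflect (exists i, [/\ i.+1 < size s, nth x0 s i = u & nth x0 s i.+1 = v])
          (infix [:: u; v] s).
Proof.
apply: (iffP (@infixP T [:: u; v] s)) => [[s1 [s2 ->]]|[i [li <- <-]]].
  exists (size s1); rewrite !size_cat !nth_cat ltnn subnn /=.
  have -> : (size s1).+1 < size s1 = false by lia.
  by rewrite subSn // subnn; split=> //; lia.
exists (take i s), (drop i.+2 s).
rewrite -[LHS](cat_take_drop i) (drop_nth x0) ?(drop_nth x0 (n := i.+1)) //.
by rewrite ltnW.
Qed.

Lemma path_edge_nth (T : eqType) (x0 : T) (s : seq T) i j : uniq s ->
  i < size s -> j < size s ->
  path_edge s (nth x0 s i) (nth x0 s j) = (j == i.+1) || (i == j.+1).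
Proof.
move=> us li lj; rewrite /path_edge.
have E k l : k < size s -> l < size s -> infix [:: nth x0 s k; nth x0 s l] s = (l == k.+1).
  move=> lk ll; apply/(infix2P x0)/eqP => [[m [lm /eqP e1 /eqP e2]]|e].
    by move: e1 e2; rewrite !nth_uniq //; lia.
  by exists k; rewrite -e.
by rewrite !E.
Qed.

Lemma path_edge_out (T : eqType) (s : seq T) u v :
  (u \notin s) || (v \notin s) -> path_edge s u v = false.
Proof.
move=> h; apply/negP; rewrite /path_edge.
have E a b : infix [:: a; b] s -> (a \in s) && (b \in s).
  by move/(infix2P a) => [i [li <- <-]]; rewrite !mem_nth //; lia.
by case/orP => /E /andP[e1 e2]; move: h; rewrite e1 e2.
Qed.

Section Edges.
Variables (T : eqType) (a1 a2 a3 : T) (p1 p2 p3 : seq T).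
Hypothesis u123 : uniq ((a1 :: p1) ++ (a2 :: p2) ++ (a3 :: p3)).

Lemma prism_edge_same x0 i j : i < j <= size p1 ->
  prism_edge a1 a2 a3 p1 p2 p3 (nth x0 (a1 :: p1) i) (nth x0 (a1 :: p1) j)
    = (j == i.+1).
Proof.
move=> lt; have [u1 d] : uniq (a1 :: p1) /\
    forall x, x \in a1 :: p1 -> (x \notin a2 :: p2) && (x \notin a3 :: p3).
  move: u123; rewrite cat_uniq => /and3P[u1 /hasPn d _]; split=> // x xp.
  rewrite -negb_or -mem_cat; apply/negP => /d; move/negP; exact.
set u := nth _ _ i; set v := nth _ _ j.
have up : u \in a1 :: p1 by apply: mem_nth; simpl; lia.
have vp : v \in a1 :: p1 by apply: mem_nth; simpl; lia.
have /andP[u2 u3] := d _ up.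
rewrite /prism_edge path_edge_nth //=; try lia.
rewrite !(@path_edge_out _ (_ :: _)) ?u2 ?u3 //.
have F b1 b2 b3 : b1 \in a1 :: p1 -> b2 \in a2 :: p2 -> b3 \in a3 :: p3 ->
    triangle_edge b1 b2 b3 u v = false.
  move=> h1 h2 h3; rewrite /triangle_edge !inE.
  have N (x b : T) (q : seq T) : b \in q -> x \notin q -> (x == b) = false.
    by move=> bq; apply: contraNF => /eqP ->.
  have /andP[v2 v3] := d _ vp.
  rewrite (N u b2 _ h2) // (N u b3 _ h3) // (N v b2 _ h2) // (N v b3 _ h3) // !orbF.
  by apply/negP => /and3P[/eqP ne /eqP eu /eqP ev]; apply: ne; rewrite eu.
rewrite !F ?mem_last ?inE ?eqxx //; lia.
Qed.

Lemma prism_edge_diff x0 i j : i <= size p1 -> j <= size p2 ->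
  (nth x0 (a1 :: p1) i != nth x0 (a2 :: p2) j) &&
  (prism_edge a1 a2 a3 p1 p2 p3 (nth x0 (a1 :: p1) i) (nth x0 (a2 :: p2) j)
    == (i == 0) && (j == 0) || (i == size p1) && (j == size p2)).
Proof.
move=> li lj.
have N (x b : T) (q : seq T) : b \in q -> x \notin q -> (x == b) = false.
  by move=> bq; apply: contraNF => /eqP ->.
move: u123; rewrite cat_uniq => /and3P[u1 /hasPn d1].
rewrite cat_uniq => /and3P[u2 /hasPn d2 u3].
set u := nth _ _ i; set v := nth _ _ j.
have up : u \in a1 :: p1 by apply: mem_nth; simpl; lia.
have vp : v \in a2 :: p2 by apply: mem_nth; simpl; lia.
have v1 : v \notin a1 :: p1 by apply: d1; rewrite mem_cat vp.
have v3 : v \notin a3 :: p3 by apply/negP => /d2; rewrite vp.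
have u2' : u \notin a2 :: p2.
  by apply/negP => h; have := d1 u; rewrite mem_cat h up => /(_ isT).
have u3' : u \notin a3 :: p3.
  by apply/negP => h; have := d1 u; rewrite mem_cat h up orbT => /(_ isT).
rewrite (N u v _ vp) //= /prism_edge.
rewrite !path_edge_out ?v1 ?u2' ?u3' ?orbT //=.
have F b1 b2 b3 : b1 \in a1 :: p1 -> b2 \in a2 :: p2 -> b3 \in a3 :: p3 ->
    triangle_edge b1 b2 b3 u v = (u == b1) && (v == b2).
  move=> h1 h2 h3; rewrite /triangle_edge !inE (N u v _ vp) //=.
  rewrite (N u b2 _ h2) // (N u b3 _ h3) // (N v b1 _ h1) // (N v b3 _ h3) // !orbF.
  by [].
rewrite !F ?mem_last ?inE ?eqxx //.
have E (a : T) (p : seq T) k : uniq (a :: p) -> k <= size p ->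
    (nth x0 (a :: p) k == a) = (k == 0) /\
    (nth x0 (a :: p) k == last a p) = (k == size p).
  move=> up' lk; split; first by rewrite -{2}[a]/(nth x0 (a :: p) 0) nth_uniq //=; lia.
  have -> : last a p = nth x0 (a :: p) (size p) by rewrite -[size p]/(size (a :: p)).-1 nth_last.
  by rewrite nth_uniq //=; lia.
have [-> ->] := E a1 p1 i u1 li; have [-> ->] := E a2 p2 j u2 lj.
by rewrite eqxx.
Qed.
End Edges.
End PrismLists.

Section PrismTransport.

Lemma uniq_catAC (T : eqType) (s t r : seq T) : uniq (s ++ t ++ r) = uniq (s ++ r ++ t).
Proof. by apply: perm_uniq; rewrite perm_cat2l perm_catC. Qed.

Lemma plink_map (H G : sgraph) (h : H -> G) (s t : seq H) : injective h ->
  (forall u v, h u -- h v = u -- v) -> plink (map h s) (map h t) <-> plink s t.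
Proof.
move=> h_inj h_adj; split=> hs x0 i j li lj.
  have := hs (h x0) i j; rewrite !size_map => /(_ li lj).
  by rewrite !(nth_map x0) // h_adj (inj_eq h_inj).
move: li lj; rewrite !size_map => li lj.
have [y _] : exists y : H, true by case: s li {hs lj} => // y; exists y.
by have := hs y i j li lj; rewrite !(nth_map y) // h_adj (inj_eq h_inj).
Qed.

Lemma iprism_map (H G : sgraph) (h : H -> G) (p1 p2 p3 : seq H) : injective h ->
  (forall u v, h u -- h v = u -- v) ->
  iprism (map h p1) (map h p2) (map h p3) <-> iprism p1 p2 p3.
Proof.
move=> hi ha; rewrite /iprism !size_map !(ipath_map hi ha).
by split=> -[sz ip [l12 l13 l23]]; split=> //; split; move: l12 l13 l23;
  rewrite ?plink_map.
Qed.

(** Pairs inside the first path and pairs between the first two are computed; the other positions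
    follow by permuting the paths and exchanging the two vertices. *)
Lemma iprism_edge (G : sgraph) (a1 a2 a3 : G) p1 p2 p3 :
  iprism (a1 :: p1) (a2 :: p2) (a3 :: p3) <->
  [/\ [/\ p1 != [::], p2 != [::] & p3 != [::]],
      uniq ((a1 :: p1) ++ (a2 :: p2) ++ (a3 :: p3))
    & {in (a1 :: p1) ++ (a2 :: p2) ++ (a3 :: p3) &,
       forall u v, u -- v = prism_edge a1 a2 a3 p1 p2 p3 u v}].
Proof.
have ne p : (p != [::]) = (1 < size (a1 :: p)) by case: p.
split.
  case=> [[s1 s2 s3] [i1 i2 i3] [l12 l13 l23]].
  have U : uniq ((a1 :: p1) ++ (a2 :: p2) ++ (a3 :: p3)).
    have D (s t : seq G) : plink s t -> ~~ has [in s] t.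
      move=> l; apply/hasPn => x; apply: contraL => xs; apply/negP => xt.
      have ls : index x s < size s by rewrite index_mem.
      have lt : index x t < size t by rewrite index_mem.
      by case/andP: (l x _ _ ls lt); rewrite !nth_index // eqxx.
    rewrite !cat_uniq (ipath_uniq i1) (ipath_uniq i2) (ipath_uniq i3) has_cat.
    by rewrite negb_or (D _ _ l12) (D _ _ l13) (D _ _ l23).
  split=> //; first by rewrite !ne.
  pose Q q1 q2 q3 (u v : G) := u -- v = prism_edge (head a1 q1) (head a1 q2) (head a1 q3)
    (behead q1) (behead q2) (behead q3) u v.
  have same q1 q2 q3 : ipath q1 -> 0 < size q1 -> 0 < size q2 -> 0 < size q3 ->
      uniq (q1 ++ q2 ++ q3) -> {in q1 &, forall u v, Q q1 q2 q3 u v}.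
    case: q1 q2 q3 => [|b1 q1] [|b2 q2] [|b3 q3] // ip _ _ _ uq u v.
    move=> /(nthP a1) [i li <-] /(nthP a1) [j lj <-]; rewrite /Q /=.
    have li' : i <= size q1 := li; have lj' : j <= size q1 := lj.
    case: (ltngtP i j) => [lt|gt|->].
    - rewrite (prism_edge_same uq) ?lt //.
      by case/andP: (ipath_nthP a1 _ ip i j (introT andP (conj lt lj))) => _ /eqP.
    - rewrite prism_edgeC adj_sym (prism_edge_same uq) ?gt //.
      by case/andP: (ipath_nthP a1 _ ip j i (introT andP (conj gt li))) => _ /eqP.
    move: uq; rewrite cat_uniq => /and3P[u1 /hasPn d _].
    have hn k : k \in (b2 :: q2) ++ (b3 :: q3) -> (nth a1 (b1 :: q1) j == k) = false.
      by move=> /d; apply: contraNF => /eqP <-; apply: mem_nth.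
    rewrite adj_irrefl /prism_edge /triangle_edge eqxx path_edge_nth // !orbF.
    have -> : (j == j.+1) = false by rewrite ltn_eqF.
    rewrite !path_edge_out //; apply/orP; left; apply/negP => h.
      by have := hn (nth a1 (b1 :: q1) j); rewrite eqxx mem_cat h orbT => /(_ isT).
    by have := hn (nth a1 (b1 :: q1) j); rewrite eqxx mem_cat h => /(_ isT).
  have diff q1 q2 q3 : plink q1 q2 -> 0 < size q1 -> 0 < size q2 -> 0 < size q3 ->
      uniq (q1 ++ q2 ++ q3) -> {in q1 & q2, forall u v, Q q1 q2 q3 u v}.
    case: q1 q2 q3 => [|b1 q1] [|b2 q2] [|b3 q3] // pl _ _ _ uq u v.
    move=> /(nthP a1) [i li <-] /(nthP a1) [j lj <-]; rewrite /Q /=.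
    case/andP: (pl a1 i j li lj) => _ /eqP ->.
    have /andP[_ /eqP ->] := prism_edge_diff uq a1 li lj.
    by [].
  have QC q1 q2 q3 u v : Q q1 q2 q3 u v -> Q q1 q2 q3 v u.
    by rewrite /Q adj_sym prism_edgeC.
  have Q12 q1 q2 q3 u v : Q q1 q2 q3 u v -> Q q2 q1 q3 u v.
    by rewrite /Q prism_edge12.
  have Q23 q1 q2 q3 u v : Q q1 q2 q3 u v -> Q q1 q3 q2 u v.
    by rewrite /Q prism_edge23.
  have U12 : uniq ((a2 :: p2) ++ (a1 :: p1) ++ (a3 :: p3)) by rewrite uniq_catCA.
  have U13 : uniq ((a1 :: p1) ++ (a3 :: p3) ++ (a2 :: p2)) by rewrite uniq_catAC.
  have U31 : uniq ((a3 :: p3) ++ (a1 :: p1) ++ (a2 :: p2)) by rewrite uniq_catCA.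
  have U23 : uniq ((a2 :: p2) ++ (a3 :: p3) ++ (a1 :: p1)) by rewrite uniq_catAC.
  move=> u v; rewrite !mem_cat => /or3P[]hu /or3P[]hv;
    rewrite -[LHS]/(u -- v) -/(Q (a1 :: p1) (a2 :: p2) (a3 :: p3) u v).
  - exact: same.
  - exact: diff.
  - by apply: Q23; apply: diff.
  - by apply: QC; apply: diff.
  - by apply: Q12; apply: same.
  - by apply: Q12; apply: Q23; apply: diff.
  - by apply: QC; apply: Q23; apply: diff.
  - by apply: QC; apply: Q12; apply: Q23; apply: diff.
  by apply: Q23; apply: Q12; apply: same.
case=> n123 U E.
have U12 : uniq ((a2 :: p2) ++ (a1 :: p1) ++ (a3 :: p3)) by rewrite uniq_catCA.
have U13 : uniq ((a1 :: p1) ++ (a3 :: p3) ++ (a2 :: p2)) by rewrite uniq_catAC.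
have U31 : uniq ((a3 :: p3) ++ (a1 :: p1) ++ (a2 :: p2)) by rewrite uniq_catCA.
have U23 : uniq ((a2 :: p2) ++ (a3 :: p3) ++ (a1 :: p1)) by rewrite uniq_catAC.
have M x : [|| x \in a1 :: p1, x \in a2 :: p2 | x \in a3 :: p3] ->
  x \in (a1 :: p1) ++ (a2 :: p2) ++ (a3 :: p3) by rewrite !mem_cat.
have ip (b1 b2 b3 : G) (q1 q2 q3 : seq G) : uniq ((b1 :: q1) ++ (b2 :: q2) ++ (b3 :: q3)) ->
  {in b1 :: q1 &, forall u v, u -- v = prism_edge b1 b2 b3 q1 q2 q3 u v} ->
  ipath (b1 :: q1).
  move=> uq e; apply/(ipath_nthP a1) => i j lt.
  have /andP[lij lj] := lt; have li := ltn_trans lij lj.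
  rewrite e ?mem_nth // (prism_edge_same uq) ?lij // eqxx andbT.
  by rewrite nth_uniq ?ltn_eqF //; move: uq; rewrite cat_uniq => /and3P[].
have pl (b1 b2 b3 : G) (q1 q2 q3 : seq G) : uniq ((b1 :: q1) ++ (b2 :: q2) ++ (b3 :: q3)) ->
  {in b1 :: q1 & b2 :: q2, forall u v, u -- v = prism_edge b1 b2 b3 q1 q2 q3 u v} ->
  plink (b1 :: q1) (b2 :: q2).
  move=> uq e x0 i j li lj; rewrite e ?mem_nth //.
  exact: prism_edge_diff.
split; first by move: n123; rewrite !ne.
  split.
  - by apply: ip U _ => u v hu hv; apply: E; apply: M; rewrite ?hu ?hv.
  - apply: ip U12 _ => u v hu hv; rewrite -prism_edge12; apply: E; apply: M;
      by rewrite ?hu ?hv ?orbT.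
  - apply: ip U31 _ => u v hu hv; rewrite -prism_edge12 -prism_edge23; apply: E;
      apply: M; by rewrite ?hu ?hv ?orbT.
split.
- by apply: pl U _ => u v hu hv; apply: E; apply: M; rewrite ?hu ?hv ?orbT.
- apply: pl U13 _ => u v hu hv; rewrite -prism_edge23; apply: E; apply: M;
    by rewrite ?hu ?hv ?orbT.
- apply: pl U23 _ => u v hu hv; rewrite -prism_edge23 -prism_edge12; apply: E; apply: M;
    by rewrite ?hu ?hv ?orbT.
Qed.

Lemma contains_prismP (G : sgraph) : contains G is_prism <->
  exists p1 p2 p3 : seq G, iprism p1 p2 p3.
Proof.
split=> [[S [a1 [a2 [a3 [p1 [p2 [p3 [n123 U cov E]]]]]]]]|[p1 [p2 [p3 hp]]]].
  exists (map val (a1 :: p1)), (map val (a2 :: p2)), (map val (a3 :: p3)).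
  apply/(@iprism_map (induced S) G val _ _ _ val_inj (fun _ _ => erefl)).
  by apply/iprism_edge; split=> // u v _ _; apply: E.
have [r1 e1] : exists s' : seq (induced [set x in p1 ++ p2 ++ p3]), map val s' = p1.
  by apply: lift_seq => x xp; rewrite inE mem_cat xp.
have [r2 e2] : exists s' : seq (induced [set x in p1 ++ p2 ++ p3]), map val s' = p2.
  by apply: lift_seq => x xp; rewrite inE !mem_cat xp orbT.
have [r3 e3] : exists s' : seq (induced [set x in p1 ++ p2 ++ p3]), map val s' = p3.
  by apply: lift_seq => x xp; rewrite inE !mem_cat xp !orbT.
have hr : iprism r1 r2 r3.
  apply/(@iprism_map (induced [set x in p1 ++ p2 ++ p3]) G val _ _ _ val_inj (fun _ _ => erefl)).
  by rewrite e1 e2 e3.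
exists [set x in p1 ++ p2 ++ p3].
have cov v : v \in r1 ++ r2 ++ r3.
  rewrite -(mem_map val_inj) !map_cat e1 e2 e3.
  by case: v => /= v; rewrite inE.
move: hr cov; case: r1 {e1} => [|a1 q1]; first by case=> -[].
case: r2 {e2} => [|a2 q2]; first by case=> -[].
case: r3 {e3} => [|a3 q3]; first by case=> -[].
move=> /iprism_edge [n123 U E] cov.
by exists a1, a2, a3, q1, q2, q3; split=> // u v; apply: E.
Qed.
End PrismTransport.

Section ClassA.
Variable G : sgraph.

Lemma class_A_lists : class_A G <->
  [/\ forall s : seq G, ihole s -> ~~ odd (size s),
      forall s : seq (compl G), ihole s -> size s <= 4
    & forall p1 p2 p3 : seq G, ~ iprism p1 p2 p3].
Proof.
split=> -[h1 h2 h3]; split.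
- by move=> s hs; apply/negP => o; apply/h1/contains_odd_holeP; exists s.
- by move=> s hs; rewrite leqNgt; apply/negP => o; apply/h2/contains_antiholeP; exists s.
- by move=> p1 p2 p3 h; apply/h3/contains_prismP; exists p1, p2, p3.
- by move=> /contains_odd_holeP[s /h1 /negP].
- by move=> /contains_antiholeP[s /h2]; rewrite leqNgt => /negP.
by move=> /contains_prismP[p1 [p2 [p3 /h3]]].
Qed.
End ClassA.

Lemma class_A_induced (G : sgraph) (S : {set G}) : class_A G -> class_A (induced S).
Proof.
move=> /class_A_lists[h1 h2 h3]; apply/class_A_lists; split.
- move=> s /(@ihole_map (induced S) G val val_inj (fun _ _ => erefl)) /h1.
  by rewrite size_map.
- move=> s; have va (u v : compl (induced S)) :
      (val u : compl G) -- (val v : compl G) = u -- v.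
    by rewrite /= /compl_adj (inj_eq val_inj).
  by move/(@ihole_map (compl (induced S)) (compl G) val val_inj va)/h2; rewrite size_map.
move=> p1 p2 p3 /(@iprism_map (induced S) G val _ _ _ val_inj (fun _ _ => erefl)).
exact: h3.
Qed.

(** * Co-connected sets and their complete vertices *)

Section Walks.
Variable G : sgraph.

Lemma split_last (T : Type) (a : pred T) (s : seq T) : has a s ->
  exists s1 z s2, [/\ s = s1 ++ z :: s2, a z & ~~ has a s2].
Proof.
elim: s => //= x s IH; case: (boolP (has a s)) => [/IH [s1 [z [s2 [-> az ns]]]] _|ns].
  by exists (x :: s1), z, s2.
by rewrite orbF => ax; exists [::], x, s.
Qed.

(** Induction from the end: if [x] already lies on the induced path built from its successor, start
    there; otherwise jump from [x] to its last neighbour on that path. *)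
Lemma walk_ipath (x : G) p : path adj x p ->
  exists q, [/\ ipath (x :: q), last x q = last x p & {subset q <= p}].
Proof.
elim: p x => [|y p IH] x /=; first by exists [::].
case/andP=> xy /IH [q [iq lq sq]].
have sub : {subset y :: q <= y :: p}.
  by move=> z; rewrite !inE => /orP[->//|/sq ->]; rewrite orbT.
have [xin|xout] := boolP (x \in y :: q).
  have {}lq : last x (y :: q) = last y p by [].
  case/splitPr: xin iq lq sub => q1 q2 iq lq sub.
  exists q2; split; first by move: iq; rewrite ipath_cat => /and3P[].
    by rewrite -lq last_cat.
  by move=> z zq; apply: sub; rewrite mem_cat inE zq !orbT.
have [|s1 [z [s2 [e xz ns]]]] := @split_last _ (adj x) (y :: q).
  by rewrite /= xy.
exists (z :: s2); split.
- move: iq; rewrite e ipath_cat => /and3P[_ i2 _].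
  change (att x (z :: s2) && ipath (z :: s2)); rewrite i2 andbT /= xz /=.
  apply/allP => w ws; rewrite /nadj; apply/andP; split.
    by apply: contraNneq xout => ->; rewrite e mem_cat inE ws !orbT.
  by apply: contraNN ns => xw; apply/hasP; exists w.
- by rewrite -lq /= -[last y q]/(last x (y :: q)) e last_cat.
by move=> w ws; apply: sub; rewrite e mem_cat ws orbT.
Qed.
End Walks.

Section CoConnected.
Variable G : sgraph.
Implicit Types (T S : {set G}) (x y b : G).

(** Connectedness of the complement on [T], in cut form: every nonempty proper part has a nonedge
    leaving it. This is directly the step that grows a co-connected set by one vertex. *)
Definition coconn T : Prop := T != set0 /\
  forall S, S \proper T -> S != set0 -> exists s t, [/\ s \in S, t \in T :\: S & nadj s t].

Definition Kc T : pred G := fun x => [forall t in T, x -- t].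

Lemma KcP T x : reflect (forall t, t \in T -> x -- t) (Kc T x).
Proof. by apply: (iffP forall_inP) => h t; apply: h. Qed.

Lemma Kc_notin T x : Kc T x -> x \notin T.
Proof. by move/KcP => h; apply/negP => /h; rewrite adj_irrefl. Qed.

Lemma Kc_sub T S x : S \subset T -> Kc T x -> Kc S x.
Proof. by move/subsetP => h /KcP k; apply/KcP => t /h; apply: k. Qed.

Lemma Kc_setU1 T y x : Kc (y |: T) x = (x -- y) && Kc T x.
Proof.
apply/KcP/andP => [h|[xy /KcP h] t].
  by split; [apply: h; rewrite !inE eqxx|apply/KcP => t tT; apply: h; rewrite inE tT orbT].
by rewrite !inE => /orP[/eqP ->|/h].
Qed.

Lemma Kc_setD1 T b x : b \in T -> Kc T x = (x -- b) && Kc (T :\ b) x.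
Proof. by move=> bT; rewrite -Kc_setU1 setD1K. Qed.

Lemma coconn1 x : coconn [set x].
Proof.
split; first by apply/set0Pn; exists x; rewrite inE.
by move=> S; rewrite properEcard cards1 => /andP[_]; rewrite ltnS leqn0 cards_eq0 => ->.
Qed.

Lemma coconnU1 T y : coconn T -> (exists2 t, t \in T & nadj t y) -> coconn (y |: T).
Proof.
move=> [T0 h] [t tT ty].
have [yT|yT] := boolP (y \in T); first by rewrite (setUidPr _) ?sub1set.
split; first by apply/set0Pn; exists y; rewrite !inE eqxx.
move=> S /properP[sS [z zT zS]] S0.
have key (R : {set G}) : R \subset T -> R != set0 -> R != T ->
    exists s t0, [/\ s \in R, t0 \in T :\: R & nadj s t0].
  by move=> sR R0 RT; apply: h => //; rewrite properEneq RT.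
have [yS|yS] := boolP (y \in S).
  have [S1|S1] := eqVneq (S :&: T) set0.
    have tS : t \notin S by apply/negP => tS; have := in_set0 t; rewrite -S1 inE tS tT.
    by exists y, t; split; rewrite ?inE ?tT ?tS ?orbT // nadj_sym.
  have [|s [t0 [sR t0R st]]] := key (S :&: T) (subsetIr _ _) S1.
    apply: contraNneq zS => e; move: zT; rewrite !inE => /orP[/eqP -> //|].
    by rewrite -{1}e inE => /andP[].
  exists s, t0; move: sR t0R; rewrite !inE => /andP[-> sT] /andP[].
  by case: (t0 \in S) => //=; case: (t0 \in T) => // _ _; rewrite orbT.
have sST : S \subset T.
  apply/subsetP => w wS; move/subsetP/(_ w wS): sS; rewrite !inE => /orP[/eqP e|//].
  by move: yS; rewrite -e wS.
have [e|ne] := eqVneq S T.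
  by exists t, y; rewrite e; split=> //; rewrite !inE eqxx yT.
have [s [t0 [sS0 t0S st]]] := key _ sST S0 ne.
by exists s, t0; split=> //; move: t0S; rewrite !inE => /andP[-> ->]; rewrite orbT.
Qed.

(** Grow a co-connected subset from [[set x]], one vertex at a time, until a single vertex of [T] is
    left out; that vertex is [b]. *)
Lemma coconn_noncut T x : coconn T -> x \in T -> 1 < #|T| ->
  exists b, [/\ b \in T, b != x & coconn (T :\ b)].
Proof.
move=> cT xT T1.
pose good n := exists S : {set G}, [/\ coconn S, x \in S, S \proper T & #|S| = n].
have good1 : good 1.
  exists [set x]; split; rewrite ?cards1 ?inE //; first exact: coconn1.
  by rewrite properEcard cards1 T1 sub1set xT.
suff [S [cS xS pS eS]] : good #|T|.-1.
  have [b bT bS] : exists2 b, b \in T & b \notin S by case/properP: pS.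
  have e : T :\ b = S.
    apply/eqP; rewrite eq_sym eqEcard; apply/andP; split.
      apply/subsetP => w wS; rewrite !inE (subsetP (proper_sub pS)) // andbT.
      by apply: contraNneq bS => <-.
    by rewrite eS; have := cardsD1 b T; rewrite bT; nlia.
  by exists b; rewrite e; split=> //; apply: contraNneq bS => ->.
have step n : n.+1 < #|T| -> good n -> good n.+1.
  move=> ln [S [cS xS pS eS]].
  have [s [t [sS tS st]]] := cT.2 S pS (cS.1).
  move: tS; rewrite !inE => /andP[tS tT].
  exists (t |: S); split.
  - by apply: coconnU1 => //; exists s.
  - by rewrite inE xS orbT.
  - rewrite properEcard cardsU1 tS add1n eS ln andbT.
    by apply/subsetP => w; rewrite !inE => /orP[/eqP ->//|/(subsetP (proper_sub pS))].
  by rewrite cardsU1 tS eS.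
have all_good n : 0 < n -> n < #|T| -> good n.
  by elim: n => // -[|n] IH _ ln //; apply: step => //; apply: IH => //; nlia.
by apply: all_good; nlia.
Qed.

Lemma coconn_two T : coconn T -> 1 < #|T| -> exists b b',
  [/\ b \in T, b' \in T, b != b', coconn (T :\ b) & coconn (T :\ b')].
Proof.
move=> cT T1; have [x xT] := set0Pn _ cT.1.
have [b [bT _ cb]] := coconn_noncut cT xT T1.
have [b' [b'T ne cb']] := coconn_noncut cT bT T1.
by exists b, b'; split=> //; rewrite eq_sym.
Qed.

Lemma coconn_nadj T b : coconn T -> b \in T -> 1 < #|T| -> exists2 t, t \in T :\ b & nadj b t.
Proof.
move=> cT bT T1; have [||s [t [sb tb st]]] := cT.2 [set b].
- by rewrite properEcard cards1 T1 sub1set bT.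
- by apply/set0Pn; exists b; rewrite inE.
by move: sb st; rewrite inE => /eqP -> bt; exists t => //; move: tb; rewrite !inE.
Qed.

(** If [b'] could not be reached from [b] by nonedges inside [T], the reachable part would be a cut
    that no nonedge leaves. The walk is then shortened to an induced path of the complement. *)
Lemma coconn_antipath T b b' : coconn T -> b \in T -> b' \in T -> b != b' ->
  exists q : seq (compl G),
    [/\ ipath ((b : compl G) :: q), last b q = b' & {subset b :: q <= T}].
Proof.
move=> cT bT b'T ne.
pose e (u v : G) := [&& u \in T, v \in T & nadj u v].
have [cn|ncn] := boolP (connect e b b').
  have [p pe lp] := connectP cn.
  have pa : @path (compl G) adj b p.
    by apply: sub_path pe => u v /and3P[].
  have pT : {subset b :: p <= T}.
    move: pe {cn lp pa}; elim: p b bT {ne} => [|y p IH] x xT /= => [_ z|/andP[/and3P[_ yT _] /IH h] z].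
      by rewrite inE => /eqP ->.
    by rewrite inE => /orP[/eqP ->//|]; apply: h.
  have [q [iq lq sq]] := walk_ipath pa.
  exists q; split=> //; first by rewrite lq lp.
  move=> z; rewrite inE => /orP[/eqP ->//|/sq zp].
  by apply: pT; rewrite inE zp orbT.
have [||s [t [sS tS st]]] := cT.2 [set v in T | connect e b v].
- apply/properP; split; first by apply/subsetP => z; rewrite inE => /andP[].
  by exists b' => //; rewrite inE (negbTE ncn) andbF.
- by apply/set0Pn; exists b; rewrite inE bT connect0.
move: sS tS; rewrite !inE => /andP[sT cs] /andP[nc tT]; case/negP: nc; rewrite tT.
by apply: connect_trans cs _; apply: connect1; rewrite /e sT tT.
Qed.
End CoConnected.

(** * Holes, prisms and antiholes as sources of contradiction *)

Section Class.
Variables (G : sgraph) (hG : class_A G).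
Implicit Types (T S : {set G}) (x y b p q : G).

Lemma hole_even (s t1 t2 : seq G) : 0 < size s -> 0 < size t1 -> 0 < size t2 ->
  4 <= size (s ++ t1 ++ t2) -> ipath s -> ipath (t1 ++ t2) -> link s t1 -> link t2 s ->
  odd (size (s ++ t1 ++ t2)) = false.
Proof.
move=> n1 n2 n3 sz i1 i2 l1 l2; have [h _ _] := (class_A_lists G).1 hG.
by apply/negbTE/h/ihole_catI.
Qed.

Lemma plinkI (s1 s2 t1 t2 : seq G) : 0 < size s1 -> 0 < size s2 -> 0 < size t1 ->
  0 < size t2 -> link (rev s1) t1 -> anti s1 t2 -> anti s2 t1 -> link s2 (rev t2) ->
  plink (s1 ++ s2) (t1 ++ t2).
Proof.
move=> n1 n2 m1 m2 /link_nthP h1 /antiP h12 /antiP h21 /link_nthP h2 x0 i j.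
rewrite !size_cat => li lj; rewrite !nth_cat.
have N (u v : G) : nadj u v -> (u != v) && ((u -- v) == false).
  by case/andP=> -> /negbTE ->.
case: (ltnP i (size s1)) => ci; case: (ltnP j (size t1)) => cj.
- have Mi : size s1 - i.+1 < size s1 by nlia.
  have := h1 x0 (size s1 - i.+1) j; rewrite size_rev nth_rev //.
  have -> : size s1 - (size s1 - i.+1).+1 = i by nlia.
  move=> /(_ Mi cj) /andP[-> /eqP ->]; apply/eqP; nlia.
- have Mt : j - size t1 < size t2 by nlia.
  have /andP[-> /eqP ->] := N _ _ (h12 _ _ (mem_nth x0 ci) (mem_nth x0 Mt)).
  by apply/eqP; nlia.
- have Ms : i - size s1 < size s2 by nlia.
  have /andP[-> /eqP ->] := N _ _ (h21 _ _ (mem_nth x0 Ms) (mem_nth x0 cj)).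
  by apply/eqP; nlia.
have := h2 x0 (i - size s1) (size t2 - (j - size t1).+1); rewrite size_rev nth_rev; last by nlia.
have -> : size t2 - (size t2 - (j - size t1).+1).+1 = j - size t1 by nlia.
have Mj : size t2 - (j - size t1).+1 < size t2 by nlia.
by move=> /(_ ltac:(nlia) Mj) /andP[-> /eqP ->]; apply/eqP; nlia.
Qed.

(** Each of the three paths is cut into two nonempty pieces, so that every triangle edge is the only
    edge between two pieces: the first pieces carry one triangle at their heads, the second pieces
    the other at their lasts. *)
Lemma no_prism (s1 s2 t1 t2 r1 r2 : seq G) :
  0 < size s1 -> 0 < size s2 -> 0 < size t1 -> 0 < size t2 -> 0 < size r1 -> 0 < size r2 ->
  ipath (s1 ++ s2) -> ipath (t1 ++ t2) -> ipath (r1 ++ r2) ->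
  link (rev s1) t1 -> anti s1 t2 -> anti s2 t1 -> link s2 (rev t2) ->
  link (rev s1) r1 -> anti s1 r2 -> anti s2 r1 -> link s2 (rev r2) ->
  link (rev t1) r1 -> anti t1 r2 -> anti t2 r1 -> link t2 (rev r2) -> False.
Proof.
move=> *; have [_ _ h] := (class_A_lists G).1 hG.
apply: (h (s1 ++ s2) (t1 ++ t2) (r1 ++ r2)); split.
- by rewrite !size_cat; split; nlia.
- by split.
by split; apply: plinkI.
Qed.

Lemma no_antihole (s : seq (compl G)) : ihole s -> size s <= 4.
Proof. by have [_ h _] := (class_A_lists G).1 hG => /h. Qed.

Lemma nadj_compl (x y : compl G) : nadj x y = ((x : G) -- y).
Proof.
rewrite /nadj /= /compl_adj; case: eqVneq => [->|//] /=; first by rewrite adj_irrefl.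
by rewrite negbK.
Qed.

Section Antiholes.
Variables (T : {set G}) (b b' p q : G).
Hypotheses (cT : coconn T) (bT : b \in T) (b'T : b' \in T) (bb' : b != b').
Hypotheses (pb : nadj p b) (qb' : nadj q b') (Kp : Kc (T :\ b) p) (Kq : Kc (T :\ b') q).

Lemma antipath_ends : exists r : seq (compl G), [/\ 1 < size r /\ ipath r,
  link [:: p : compl G] r, link r [:: q : compl G], (size r == 2) ==> nadj b b'
  & {subset r <= T}].
Proof.
have [r [ir lr sr]] := coconn_antipath cT bT b'T bb'.
exists ((b : compl G) :: r).
have s1 : 1 < size ((b : compl G) :: r).
  by case: r lr {ir sr} => //= e; move: bb'; rewrite e eqxx.
have un := ipath_uniq ir.
split=> //.
- rewrite /= -[compl_adj p b]/(nadj p b) pb /=; apply/allP => z zr.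
  rewrite nadj_compl; apply: (KcP _ _ Kp); rewrite !inE sr ?inE ?zr ?orbT // andbT.
  by move: un; rewrite /= => /andP[h _]; apply: contraNneq h => <-.
- rewrite -link_rev; case/lastP: r lr s1 un {ir} sr => [|r z] // lr _ un sr.
  have ez : z = b' by rewrite last_rcons in lr.
  rewrite -rcons_cons rev_rcons /= -[compl_adj q z]/(nadj q z) ez qb' /=.
  apply/allP => w; rewrite mem_rev => wr; rewrite nadj_compl; apply: (KcP _ _ Kq).
  rewrite !inE (sr w); last first.
    by move: wr; rewrite !inE mem_rcons inE => /orP[->//|->]; rewrite !orbT.
  rewrite andbT; apply: contraTneq wr => ->; rewrite -ez.
  by move: un; rewrite -rcons_cons rcons_uniq => /andP[].
apply/implyP => /eqP [e]; case: r e lr ir {s1 un sr} => // c [|//] _ /= <-.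
by rewrite andbT => /andP[].
Qed.

(** When [p] and [q] are nonadjacent, [p, r, q] closes to an antihole by itself. Its length is at
    most four, so [r] consists of [b] and [b'] only. *)
Lemma antihole1 : nadj p q -> nadj b b'.
Proof.
move=> pq; have [r [[s1 ir] l1 l2 /implyP h2 sr]] := antipath_ends; apply: h2.
have : ihole ([:: p : compl G] ++ r ++ [:: q : compl G]) -> size r == 2.
  by move/no_antihole; move: s1; rewrite !size_cat /=; nlia.
have [//|n2] := boolP (size r == 2); apply.
apply: ihole_catI => //; [by nlia|by apply: ipath_catI| |].
  by rewrite /= /compl_adj eq_sym (andP pq).1 adj_sym (andP pq).2.
by move: s1; rewrite !size_cat /=; nlia.
Qed.

(** One complete vertex missing both [p] and [q] closes the antihole, whose length is at least
    five. *)
Lemma antihole2 y : p -- q -> Kc T y -> nadj y p -> nadj y q -> False.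
Proof.
move=> pq Ky yp yq; have [r [[s1 ir] l1 l2 _ sr]] := antipath_ends.
suff /no_antihole : ihole ([:: y : compl G] ++ [:: p : compl G] ++ r ++ [:: q : compl G]).
  by move: s1; rewrite !size_cat /=; nlia.
have ay : anti [:: y : compl G] r.
  apply/antiP => u v; rewrite inE => /eqP -> vr; rewrite nadj_compl.
  by apply: (KcP _ _ Ky); apply: sr.
apply: ihole_catI => //.
- by move: s1; rewrite size_cat /=; nlia.
- apply: ipath_catI => //; first by apply: ipath_catI.
  apply: link_catrI => //; first by nlia.
  by rewrite /anti /= nadj_compl pq.
- by rewrite /= andbT.
- by apply: link_catlI => //; [rewrite anti_sym|by rewrite /= -[compl_adj q y]/(nadj q y) nadj_sym yq].
by move: s1; rewrite !size_cat /=; nlia.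
Qed.

(** The antihole is closed by two complete vertices, in the order [q, y, y', p]. *)
Lemma antihole3 y y' : p -- q -> Kc T y -> Kc T y' -> nadj y q -> nadj y y' -> nadj y' p ->
  y -- p -> y' -- q -> False.
Proof.
move=> pq Ky Ky' yq yy' yp' yp y'q; have [r [[s1 ir] l1 l2 _ sr]] := antipath_ends.
suff /no_antihole : ihole ([:: y : compl G; y' : compl G] ++ [:: p : compl G] ++ r ++ [:: q : compl G]).
  by move: s1; rewrite !size_cat /=; nlia.
have ay z : Kc T z -> anti r [:: z : compl G].
  move=> Kz; rewrite anti_sym; apply/antiP => u v; rewrite inE => /eqP -> vr.
  by rewrite nadj_compl; apply: (KcP _ _ Kz); apply: sr.
apply: ihole_catI => //.
- by move: s1; rewrite size_cat /=; nlia.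
- by rewrite /= !andbT.
- apply: ipath_catI => //; first by apply: ipath_catI.
  apply: link_catrI => //; first by nlia.
  by rewrite /anti /= nadj_compl pq.
- by rewrite /= -[compl_adj y' p]/(nadj y' p) yp' nadj_compl yp.
- apply: link_catlI => //.
    by rewrite (anti_catr r [:: y : compl G] [:: y']) !ay.
  by rewrite /= nadj_compl andbT (@adj_sym G q) y'q -[compl_adj q y]/(nadj q y) nadj_sym yq.
by move: s1; rewrite !size_cat /=; nlia.
Qed.
End Antiholes.
End Class.

Arguments seg {T} f i j : simpl never.
Arguments ipath {G} s : simpl never.
Arguments link {G} s t : simpl never.
Arguments att {G} x s : simpl never.
Arguments anti {G} s t : simpl never.

(** * Parity of complete edges *)

Section MinMax.

Lemma first_index (p : pred nat) i j : i <= j -> p j ->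
  exists k, [/\ i <= k <= j, p k & forall l, i <= l < k -> ~~ p l].
Proof.
move=> ij pj; have ex : exists k, (i <= k) && p k by exists j; rewrite ij.
case: (ex_minnP ex) => k /andP[ik pk] mn; exists k; split=> //.
  by rewrite ik mn // ij.
move=> l /andP[il lk]; apply/negP => pl; have := mn l; rewrite il pl => /(_ isT).
by rewrite leqNgt lk.
Qed.

Lemma last_index (p : pred nat) i j : i <= j -> p i ->
  exists k, [/\ i <= k <= j, p k & forall l, k < l <= j -> ~~ p l].
Proof.
move=> ij pi; have [k [hk pk nk]] := @first_index (fun l => p (i + j - l)) i j ij
  ltac:(by rewrite /= addnK).
exists (i + j - k); split=> //; first by lia.
move=> l hl; have := nk (i + j - l) ltac:(lia).
by have -> : i + j - (i + j - l) = l by lia.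
Qed.

Lemma next_index (p : pred nat) i j : i < j -> p j ->
  exists k, [/\ i < k <= j, p k & forall l, i < l < k -> ~~ p l].
Proof. by move=> ij pj; have [k [hk pk nk]] := first_index ij pj; exists k. Qed.
End MinMax.

Section Parity.
Variable G : sgraph.
Implicit Types (K : pred G) (f : nat -> G) (s : seq G).

(** The conclusion of the Roussel-Rubio lemma, for an arbitrary predicate. The condition [i.+1 < j]
    excludes the path with one edge. *)
Definition pari K : Prop := forall f i j, ipf f i j -> i.+1 < j ->
  K (f i) -> K (f j) -> (forall k, i < k < j -> ~~ K (f k)) -> odd (j - i) = false.

Definition Kend K (x y : G) : pred G := fun e => K e ==> (e == x) || (e == y).

(** Sizes count vertices: an even number of edges is an odd size, and the excluded size 2 is the
    path with one edge. *)
Lemma pari_list K s x y : pari K -> 0 < size s -> head x s = x -> last x s = y ->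
  ipath s -> K x -> K y -> all (Kend K x y) s -> size s != 2 -> odd (size s).
Proof.
move=> hK; case: s => // z s _ /= ez; subst z => ly ip Kx Ky /andP[_ /allP ha] n2.
case: s ly ip ha n2 => [|z s] // ly ip ha n2.
have /= hp := ipath_ipf x ip; have := hK _ _ _ hp.
have e2 : nth x (x :: z :: s) (size s).+1 = y by rewrite -ly (last_nth x).
rewrite e2 subn0 => /(_ _ Kx Ky) h; suff : odd (size s).+1 = false by move=> /= ->.
apply: h => [|k hk]; first by move: n2 => /=; lia.
apply/negP => Kk; have kin : nth x (x :: z :: s) k \in z :: s.
  by case: k hk {Kk} => // k hk; apply: (@mem_nth _ x (z :: s)); move: hk => /=; lia.
have u := ipath_uniq ip; have /= := ha _ kin; rewrite /Kend Kk /=.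
have lk : k <= (size s).+1 by move: hk => /=; nlia.
have E l : l <= (size s).+1 -> (nth x (x :: z :: s) k == nth x (x :: z :: s) l) = (k == l).
  by move=> hl; apply: nth_uniq.
by have := E 0 isT; have := E (size s).+1 (leqnn _); rewrite e2 /= => -> ->; move: hk => /=; nlia.
Qed.

Lemma Kend_l K x y : Kend K x y x. Proof. by rewrite /Kend eqxx implybT. Qed.
Lemma Kend_r K x y : Kend K x y y. Proof. by rewrite /Kend eqxx orbT implybT. Qed.
Lemma Kend_n K x y z : ~~ K z -> Kend K x y z. Proof. by rewrite /Kend => /negbTE ->. Qed.

Definition kedg K f i j := count (fun k => K (f k) && K (f k.+1)) (iota i (j - i)).

Lemma kedg_cat K f i j k : i <= j -> j <= k -> kedg K f i k = kedg K f i j + kedg K f j k.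
Proof.
move=> ij jk; rewrite /kedg -count_cat; congr count.
by have -> : k - i = (j - i) + (k - j) by [lia]; rewrite iotaD; congr (_ ++ iota _ _); lia.
Qed.

Lemma kedg0 K f i j : (forall k, i <= k < j -> ~~ (K (f k) && K (f k.+1))) ->
  kedg K f i j = 0.
Proof.
move=> h; apply/eqP; rewrite -leqn0 leqNgt -has_count; apply/hasPn => k.
by rewrite mem_iota => hk; apply: h; lia.
Qed.

Lemma kedg_ex K f i j : 0 < kedg K f i j -> exists k, [/\ i <= k < j, K (f k) & K (f k.+1)].
Proof.
rewrite -has_count => /hasP [k]; rewrite mem_iota => hk /andP[k1 k2].
by exists k; split=> //; lia.
Qed.

(** Cut the path at its vertices in [K]. A piece is either one edge, counted by [kedg], or has even
    length and contains no counted edge. *)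
Lemma pari_kedg K f i j : pari K -> ipf f i j -> i <= j -> K (f i) -> K (f j) ->
  odd (kedg K f i j) = odd (j - i).
Proof.
move=> hK; have [n] := ubnP (j - i); elim: n i => // n IH i ln hf ij Ki Kj.
have [e|ne] := eqVneq i j; first by rewrite e /kedg subnn.
have [k [hk Kk nk]] := @next_index (fun k => K (f k)) i j ltac:(lia) Kj.
rewrite (@kedg_cat _ _ i k j); [|nlia|nlia].
have hkj : ipf f k j by apply: (ipf_sub hf); nlia.
rewrite oddD (IH k ltac:(nlia) hkj ltac:(nlia) Kk Kj).
have -> : kedg K f i k = (k == i.+1).
  have [ek|nek] := eqVneq k i.+1.
    by rewrite ek /kedg subSnn /= -ek Ki Kk.
  apply: kedg0 => l hl; apply/negP => /andP[Kl' Kl].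
  have [el|nel] := eqVneq l.+1 k; first by have := nk l ltac:(nlia); rewrite Kl'.
  by have := nk l.+1 ltac:(nlia); rewrite Kl.
have [ek|nek] := eqVneq k i.+1; first by rewrite -[odd true]/true addTb; nlia.
have hik : ipf f i k by apply: (ipf_sub hf); nlia.
by have := hK f i k hik ltac:(nlia) Ki Kk nk; rewrite -[odd false]/false addFb; nlia.
Qed.

Lemma kedg_ext K f x y u v : pari K -> ipf f x y -> x <= u -> u <= v -> v <= y ->
  K (f u) -> K (f v) -> (forall k, x <= k < u -> ~~ K (f k)) ->
  (forall k, v < k <= y -> ~~ K (f k)) -> odd (kedg K f x y) = odd (v - u).
Proof.
move=> hK hf xu uv vy Ku Kv nu nv.
rewrite (@kedg_cat _ _ x u y); [|nlia|nlia].
rewrite (@kedg_cat _ _ u v y); [|nlia|nlia].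
rewrite (@kedg0 _ _ x u) ?(@kedg0 _ _ v y) ?addn0 ?add0n.
- by apply: pari_kedg => //; apply: (ipf_sub hf).
- by move=> k hk; rewrite (negbTE (nv k.+1 _)) ?andbF //; nlia.
by move=> k hk; rewrite (negbTE (nu k _)) //; nlia.
Qed.

(** The count of edges in [K] is additive over the intervals between consecutive indices satisfying
    [Q], so an odd total comes from an odd interval. *)
Lemma split_odd (Q : pred nat) K f i j : i < j -> Q i -> Q j -> odd (kedg K f i j) ->
  exists l r, [/\ i <= l /\ r <= j, l < r, Q l /\ Q r,
    forall k, l < k < r -> ~~ Q k & odd (kedg K f l r)].
Proof.
have [n] := ubnP (j - i); elim: n i => // n IH i ln ij Qi Qj od.
have [k [hk Qk nk]] := next_index ij Qj.
have [ok|nok] := boolP (odd (kedg K f i k)).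
  by exists i, k; split=> //; try split; nlia.
have [e|ne] := eqVneq k j; first by move: nok; rewrite e od.
have odk : odd (kedg K f k j).
  by move: od; rewrite (@kedg_cat _ _ i k j) ?oddD ?(negbTE nok) //; nlia.
have [l [r [[h1 h2] h3 h4 h5 h6]]] := IH k ltac:(nlia) ltac:(nlia) Qk Qj odk.
by exists l, r; split=> //; try split; nlia.
Qed.
End Parity.

(** * The Roussel-Rubio lemma *)

Section RousselRubio.
Variables (G : sgraph) (hG : class_A G).
Implicit Types (T : {set G}) (x y b : G) (f : nat -> G).

Lemma nadjI x y : x != y -> ~~ x -- y -> nadj x y.
Proof. by rewrite /nadj => -> ->. Qed.

Lemma ends_notin b f i j k : ipf f i j -> i.+2 < j -> b -- f i -> b -- f j ->
  i <= k <= j -> b != f k.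
Proof.
move=> hf ij bi bj hk; apply: contraTneq bi => e.
have [ek|nk] := eqVneq k i; first by rewrite e ek adj_irrefl.
have [ek|nk'] := eqVneq k i.+1.
  by case/andP: (ipf_nadj hf (i := j) (j := k) ltac:(nlia) ltac:(nlia) ltac:(nlia)); rewrite adj_sym -e bj.
by case/andP: (ipf_nadj hf (i := k) (j := i) ltac:(nlia) ltac:(nlia) ltac:(nlia)); rewrite -e.
Qed.

Lemma pari_shift (K : pred G) : (forall f m, ipf f 0 m -> 1 < m -> K (f 0) -> K (f m) ->
  (forall k, 0 < k < m -> ~~ K (f k)) -> odd m = false) -> pari K.
Proof.
move=> h f i j hf ij Ki Kj nK; apply: (h (fun k => f (i + k))).
- move=> a b _ ab bj; have := hf (i + a) (i + b) ltac:(nlia) ltac:(nlia) ltac:(nlia).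
  by move=> /andP[-> /eqP ->]; apply/eqP; lia.
- by nlia.
- by rewrite addn0.
- by rewrite subnKC //; nlia.
by move=> k hk; apply: nK; nlia.
Qed.

(** The case of a one-vertex [T]: [t] closes the path to a hole, which has to be even. *)
Lemma pari1 t : pari (fun x => x -- t).
Proof.
apply: pari_shift => f m hf m1 t0 tm nt.
have [->//|m2] := eqVneq m 2.
have nadjt k : 0 < k < m -> nadj t (f k).
  move=> hk; apply: nadjI; last by rewrite adj_sym nt.
  by apply: (ends_notin hf); rewrite 1?adj_sym //; nlia.
have := @hole_even G hG [:: t] (seg f 0 0) (seg f 1 m).
rewrite !size_cat !size_seg => /(_ isT isT ltac:(nlia) ltac:(simpl; nlia) isT).
suff h : ipath (seg f 0 0 ++ seg f 1 m) /\ link [:: t] (seg f 0 0) /\ link (seg f 1 m) [:: t].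
  by case: h => h1 [h2 h3] /(_ h1 h2 h3); simpl; nlia.
by split; [|split]; geo.
Qed.

Section Noncut.
Variables (T : {set G}) (b : G) (f : nat -> G) (m : nat).
Hypotheses (bT : b \in T) (KU : pari (Kc (T :\ b))).
Hypotheses (hf : ipf f 0 m) (om : odd m) (m3 : 3 <= m) (K0 : Kc T (f 0)) (Km : Kc T (f m)).
Hypothesis (nK : forall k, 0 < k < m -> ~~ Kc T (f k)).
Hypothesis (bU : exists2 t, t \in T :\ b & nadj b t).

Let b0 : b -- f 0. Proof. by rewrite adj_sym; apply: (KcP _ _ K0). Qed.
Let bm : b -- f m. Proof. by rewrite adj_sym; apply: (KcP _ _ Km). Qed.
Let KU0 : Kc (T :\ b) (f 0). Proof. by apply: Kc_sub K0; rewrite subsetDl. Qed.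
Let KUm : Kc (T :\ b) (f m). Proof. by apply: Kc_sub Km; rewrite subsetDl. Qed.

Let nKUb : ~~ Kc (T :\ b) b.
Proof.
case: bU => t tU /andP[_ nbt]; apply/negP => /KcP /(_ t tU) h.
by rewrite h in nbt.
Qed.

Let nb k : k <= m -> ~~ b -- f k -> nadj b (f k).
Proof. by move=> km h; apply: nadjI => //; apply: (ends_notin hf). Qed.

Let nb_KU k : 0 < k < m -> b -- f k -> ~~ Kc (T :\ b) (f k).
Proof.
move=> hk bk; apply: contraNN (nK hk) => h.
by rewrite (Kc_setD1 _ bT) adj_sym bk.
Qed.

(** [f j] is the first vertex from [f l] on that is complete to [T :\ b], and [b] is not. So
    [f 0, b, f l, ..., f j] is an induced path to which the parity for [T :\ b] applies. For [l = 1]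
    it has the chord from [f 0] to [f 1]; starting at [f m] instead avoids this, provided that [f j]
    is not next to [f m]. *)
Lemma noncut_left l j : l <= j -> j <= m -> b -- f l -> (forall k, l < k <= j -> nadj b (f k)) ->
  Kc (T :\ b) (f j) -> (forall k, l <= k < j -> ~~ Kc (T :\ b) (f k)) ->
  (l == 1) ==> (j.+1 < m) -> odd (j - l) = false.
Proof.
move=> lj jm bl nbk Kj nKk h1.
have [->|lj'] := eqVneq j l; first by rewrite subnn.
have l0 : l != 0 by apply/eqP => e; have := nKk 0 ltac:(nlia); rewrite KU0.
have Ks : all (Kend (Kc (T :\ b)) (f (if l == 1 then m else 0)) (f j)) (seg f l j).
  apply: all_seg => k hk; have [->|nk] := eqVneq k j; first exact: Kend_r.
  by apply/Kend_n/nKk; nlia.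
have [e|l1] := eqVneq l 1; last first.
  have := @pari_list _ _ ([:: f 0] ++ [:: b] ++ seg f l j) (f 0) (f j) KU.
  rewrite !last_cat last_seg /= (Kend_l _ _ _) (Kend_n _ _ nKUb) => /(_ isT erefl erefl).
  have ip : ipath ([:: f 0] ++ [:: b] ++ seg f l j) by geo.
  move: Ks; rewrite (negbTE l1) => Ks.
  by move=> /(_ ip KU0 Kj Ks); rewrite size_seg; nlia.
subst l; move: Ks; rewrite eqxx => Ks; have jm' : j.+1 < m by [].
have := @pari_list _ _ ([:: f m] ++ [:: b] ++ seg f 1 j) (f m) (f j) KU.
rewrite !last_cat last_seg /= (Kend_l _ _ _) (Kend_n _ _ nKUb) => /(_ isT erefl erefl).
have ip : ipath ([:: f m] ++ [:: b] ++ seg f 1 j) by geo.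
by move=> /(_ ip KUm Kj Ks); rewrite size_seg; nlia.
Qed.
End Noncut.

(** The path has an odd number of edges complete to [T :\ b], hence so has some interval between
    consecutive neighbours [f l], [f r] of [b]. This interval is even because [b] closes it to a
    hole, while the distance between its first and last [T :\ b]-complete vertices [f j1] and [f j2]
    is odd. So one of the two outer pieces is odd, and [noncut_left] allows this only in its
    exceptional case, which is the conclusion. *)
Lemma noncut_main T b f m : b \in T -> pari (Kc (T :\ b)) -> ipf f 0 m -> odd m -> 3 <= m ->
  Kc T (f 0) -> Kc T (f m) -> (forall k, 0 < k < m -> ~~ Kc T (f k)) ->
  (exists2 t, t \in T :\ b & nadj b t) ->
  [/\ b -- f 1, forall k, 1 < k < m -> nadj b (f k) & Kc (T :\ b) (f m.-1)] \/
  [/\ b -- f m.-1, forall k, 0 < k < m.-1 -> nadj b (f k) & Kc (T :\ b) (f 1)].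
Proof.
move=> bT KU hf om m3 K0 Km nK bU.
have b0 : b -- f 0 by rewrite adj_sym; apply: (KcP _ _ K0).
have bm : b -- f m by rewrite adj_sym; apply: (KcP _ _ Km).
have KU0 : Kc (T :\ b) (f 0) by apply: Kc_sub K0; rewrite subsetDl.
have KUm : Kc (T :\ b) (f m) by apply: Kc_sub Km; rewrite subsetDl.
have nb k : k <= m -> ~~ b -- f k -> nadj b (f k).
  by move=> km h; apply: nadjI => //; apply: (ends_notin hf).
have nb_KU k : 0 < k < m -> b -- f k -> ~~ Kc (T :\ b) (f k).
  move=> hk bk; apply: contraNN (nK k hk) => h.
  by rewrite (Kc_setD1 _ bT) adj_sym bk.
have od : odd (kedg (Kc (T :\ b)) f 0 m).
  by rewrite pari_kedg // subn0.
have [l [r [[_ rm] lr [bl br] nlr odlr]]] :=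
  @split_odd _ (fun k => b -- f k) _ f 0 m ltac:(nlia) b0 bm od.
have [k [hk Kk Kk']] := kedg_ex (odd_gt0 odlr).
have nlr' q : l < q < r -> nadj b (f q) by move=> hq; apply: nb; [nlia|apply: nlr].
have r2 : l.+1 < r.
  rewrite ltnNge; apply/negP => rl; have ek : k = l by nlia.
  have er : k.+1 = r by nlia.
  have [l0|l0] := eqVneq l 0.
    by have := nb_KU r ltac:(nlia) br; rewrite -er Kk'.
  by have := nb_KU l ltac:(nlia) bl; rewrite -ek Kk.
have [j1 [h1 K1 n1]] := @first_index (fun q => Kc (T :\ b) (f q)) l k ltac:(nlia) Kk.
have [j2 [h2 K2 n2]] := @last_index (fun q => Kc (T :\ b) (f q)) k.+1 r ltac:(nlia) Kk'.
have hlr : ipf f l r by apply: (ipf_sub hf); nlia.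
have e21 : odd (j2 - j1).
  rewrite -(@kedg_ext _ (Kc (T :\ b)) f l r) //; try nlia.
have ev : odd (r - l) = false.
  have := @hole_even G hG [:: b] (seg f l l) (seg f l.+1 r).
  rewrite !size_cat !size_seg => /(_ isT ltac:(nlia) ltac:(nlia) ltac:(simpl; nlia) isT).
  suff h : ipath (seg f l l ++ seg f l.+1 r) /\ link [:: b] (seg f l l) /\
           link (seg f l.+1 r) [:: b].
    by case: h => p1 [p2 p3] /(_ p1 p2 p3) /=; nlia.
  by split; [|split]; geo.
have L : (l == 1) ==> (j1.+1 < m) -> odd (j1 - l) = false.
  apply: (@noncut_left T b f m) => //; try nlia.
  by move=> q hq; apply: nlr'; nlia.
have R : (m - r == 1) ==> ((m - j2).+1 < m) -> odd (m - j2 - (m - r)) = false.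
  have hf' : ipf (fun q => f (m - q)) 0 m by apply: ipf_rev.
  have e1 : m - (m - r) = r by nlia.
  have e2 : m - (m - j2) = j2 by nlia.
  apply: (@noncut_left T b (fun q => f (m - q)) m) => //=; rewrite ?subn0 ?subnn ?e1 ?e2 //;
    try nlia.
  - by move=> q hq; apply: nlr'; nlia.
  by move=> q hq; apply: n2; nlia.
have [l1|l1] := boolP ((l == 1) ==> (j1.+1 < m)); last first.
  left; have el : l = 1 by move: l1; case: (eqVneq l 1).
  have ej : m.-1 = j1 by move: l1; rewrite el eqxx /=; nlia.
  split; [by rewrite -el| |by rewrite ej].
  by move=> q hq; apply: nlr'; nlia.
have [r1|r1] := boolP ((m - r == 1) ==> ((m - j2).+1 < m)); last first.
  right; have el : m - r = 1 by move: r1; case: (eqVneq (m - r) 1).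
  have ej : j2 = 1 by move: r1; rewrite el eqxx /=; nlia.
  have er : m.-1 = r by nlia.
  split; [by rewrite er| |by rewrite -ej].
  by move=> q hq; apply: nlr'; nlia.
by have := L l1; have := R r1; nlia.
Qed.

(** Induction on the size of [T], with two vertices [b], [b'] whose removal keeps [T] co-connected.
    If [noncut_main] puts both on the same side, one end vertex of the inner path is complete to
    [T :\ b] and yet misses [b']. If it puts them on opposite sides, [key] finds an antihole or a
    prism. *)
Theorem roussel_rubio T : coconn T -> pari (Kc T).
Proof.
have [n] := ubnP #|T|; elim: n T => // n IH T ln cT.
have [T1|T1] := leqP #|T| 1.
  have [t tT] := set0Pn _ cT.1.
  have eT : T = [set t].
    by apply/eqP; rewrite eq_sym eqEcard sub1set tT cards1.
  move=> f i j hf ij Ki Kj nK; apply: (pari1 (t := t) hf ij).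
  - by apply: (KcP _ _ Ki).
  - by apply: (KcP _ _ Kj).
  move=> k hk; apply: contraNN (nK k hk) => h; apply/KcP => s.
  by rewrite eT inE => /eqP ->.
have [b [b' [bT b'T bb' cb cb']]] := coconn_two cT T1.
have sz c : c \in T -> #|T :\ c| < n by move=> cT'; have := cardsD1 c T; rewrite cT'; nlia.
have Pb := IH _ (sz b bT) cb; have Pb' := IH _ (sz b' b'T) cb'.
have bU := coconn_nadj cT bT T1; have b'U := coconn_nadj cT b'T T1.
apply: pari_shift => f m hf m1 K0 Km nK.
apply/negbTE/negP => om; have m3 : 3 <= m by nlia.
have key c c' : c \in T -> c' \in T -> c != c' -> c -- f 1 ->
    (forall k, 1 < k < m -> nadj c (f k)) -> Kc (T :\ c) (f m.-1) ->
    c' -- f m.-1 -> (forall k, 0 < k < m.-1 -> nadj c' (f k)) -> Kc (T :\ c') (f 1) -> False.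
  move=> cT' c'T cc' c1 nc Kc1 c'm nc' Kc'.
  have pc : nadj (f m.-1) c by rewrite nadj_sym; apply: nc; nlia.
  have qc' : nadj (f 1) c' by rewrite nadj_sym; apply: nc'; nlia.
  (* For [m = 3] the vertices [f 1] and [f 2] are adjacent and the two ends of the path close the
     antihole. Otherwise [c] and [c'] are nonadjacent, and the prism has triangles [c, f 0, f 1] and
     [f m, c', f m.-1]. *)
  have [e|m4] := eqVneq m 3.
    subst m; apply: (@antihole3 G hG T c c' (f 2) (f 1) cT cT' c'T cc' pc qc' Kc1 Kc' (f 3) (f 0)) => //;
    by geo_leaf.
  have pq : nadj (f m.-1) (f 1) by apply: (ipf_nadj hf); nlia.
  have ncc := antihole1 hG cT cT' c'T cc' pc qc' Kc1 Kc' pq.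
  have c0 : c -- f 0 by rewrite adj_sym; apply: (KcP _ _ K0).
  have cm : c -- f m by rewrite adj_sym; apply: (KcP _ _ Km).
  have c'0 : c' -- f 0 by rewrite adj_sym; apply: (KcP _ _ K0).
  have c'm' : c' -- f m by rewrite adj_sym; apply: (KcP _ _ Km).
  by apply: (@no_prism G hG [:: c] [:: f m] [:: f 0] [:: c'] (seg f 1 2) (seg f 3 m.-1)) => //;
    rewrite ?seg_neq0 //; geo.
have M c : c \in T -> pari (Kc (T :\ c)) -> (exists2 t, t \in T :\ c & nadj c t) -> _ :=
  fun h1 h2 h3 => noncut_main h1 h2 hf om m3 K0 Km nK h3.
have nn (x y : G) : x -- y -> nadj x y -> False by move=> h /andP[_]; rewrite h.
have [[x1 x2 x3]|[x1 x2 x3]] := M b bT Pb bU; have [[y1 y2 y3]|[y1 y2 y3]] := M b' b'T Pb' b'U.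
- have := KcP _ _ x3 b'; rewrite !inE b'T eq_sym bb' => /(_ isT).
  by rewrite adj_sym => e; apply: (nn _ _ e); apply: y2; nlia.
- exact: (key b b').
- by apply: (key b' b) => //; rewrite eq_sym.
have := KcP _ _ x3 b'; rewrite !inE b'T eq_sym bb' => /(_ isT).
by rewrite adj_sym => e; apply: (nn _ _ e); apply: y2; nlia.
Qed.
End RousselRubio.

(** * Hats *)

Section Hats.
Variables (G : sgraph) (hG : class_A G).
Implicit Types (T : {set G}) (x y b t : G) (f : nat -> G).

(** The antihole is closed by three complete vertices, in the order [q, y', z, y, p]. It serves
    holes with four vertices, in which no complete vertex of the hole misses both [p] and [q]. *)
Lemma antihole4 T b b' p q y y' z : coconn T -> b \in T -> b' \in T -> b != b' ->
  nadj p b -> nadj q b' -> Kc (T :\ b) p -> Kc (T :\ b') q ->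
  p -- q -> Kc T y -> Kc T y' -> Kc T z -> nadj y p -> y -- q -> nadj y' q -> y' -- p ->
  y -- y' -> nadj z y -> nadj z y' -> z -- p -> z -- q -> False.
Proof.
move=> cT bT b'T bb' pb qb' Kp Kq pq Ky Ky' Kz yp yq y'q y'p yy' zy zy' zp zq.
have [r [[s1 ir] l1 l2 _ sr]] := antipath_ends cT bT b'T bb' pb qb' Kp Kq.
suff /(no_antihole hG) : ihole ([:: z : compl G] ++
    [:: y : compl G] ++ [:: p : compl G] ++ r ++ [:: q : compl G] ++ [:: y' : compl G]).
  by move: s1; rewrite !size_cat /=; nlia.
have ay w : Kc T w -> anti r [:: w : compl G].
  move=> Kw; rewrite anti_sym; apply/antiP => u v; rewrite inE => /eqP -> vr.
  by rewrite nadj_compl; apply: (KcP _ _ Kw); apply: sr.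
have A (u v : G) : u -- v -> anti [:: u : compl G] [:: v : compl G].
  by move=> uv; apply: anti_11; rewrite nadj_compl.
have L (u v : G) : nadj u v -> link [:: u : compl G] [:: v : compl G].
  by move=> uv; apply: link_11.
have ne : 0 < size r by nlia.
apply: ihole_catI => //.
- do ![apply: ipath_catI => // | apply: link_catrI => // | apply: anti_catrI | apply: A => //
      | apply: L => // | rewrite anti_sym; apply: ay => // | apply: ay => //
      | rewrite adj_sym; done].
  + by rewrite nadj_sym.
- by apply: L.
- do ![apply: link_catlI => //; first by rewrite ?size_cat /=; nlia].
  + by apply: A; rewrite adj_sym.
  apply: link_catlI => //; first by apply: ay.
  apply: link_catlI => //; first by apply: A; rewrite adj_sym.
  by apply: L; rewrite nadj_sym.
by move: s1; rewrite !size_cat /=; nlia.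
Qed.

(* The hole is listed so that the distinguished edge joins its two ends. *)
Definition hpf (C : nat -> G) m : Prop := forall i j, i < j -> j <= m ->
  (C i != C j) && ((C i -- C j) == (j == i.+1) || (i == 0) && (j == m)).

Lemma ihole_hpf x0 (s : seq G) : ihole s -> hpf (nth x0 s) (size s).-1.
Proof. by case=> sz h i j ij jm; apply: h; nlia. Qed.

Section HolePath.
Variables (C : nat -> G) (m : nat).
Hypotheses (hC : hpf C m) (m3 : 3 <= m).

Lemma hpf_ipf i j : (0 < i) || (j < m) -> j <= m -> ipf C i j.
Proof.
move=> h jm k l ik kl lj; have /andP[-> /eqP ->] := hC kl (leq_trans lj jm).
by apply/eqP; lia.
Qed.

Lemma hpf_nadj i j : i.+1 < j -> j <= m -> (i != 0) || (j != m) -> nadj (C i) (C j).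
Proof.
move=> ij jm h; have /andP[ne /eqP e] := hC (ltnW ij) jm.
by apply: nadjI => //; rewrite e; nlia.
Qed.

Lemma hpf_adj i : i < m -> C i -- C i.+1.
Proof. by move=> im; have /andP[_ /eqP ->] := hC (ltnSn i) im; rewrite eqxx. Qed.

Lemma hpf_ends : C 0 -- C m.
Proof.
by have /andP[_ /eqP ->] := hC (i := 0) (j := m) ltac:(nlia) (leqnn m); rewrite !eqxx orbT.
Qed.

Lemma hpf_even : odd m.
Proof.
have := @hole_even G hG (seg C 0 0) (seg C 1 1) (seg C 2 m).
rewrite !size_cat !size_seg => /(_ ltac:(nlia) ltac:(nlia) ltac:(nlia) ltac:(nlia)).
have h1 := @hpf_nadj; have h2 := @hpf_adj; have h3 := hpf_ends.
have i1 := @hpf_ipf 0 1 ltac:(nlia) ltac:(nlia); have i2 := @hpf_ipf 1 m ltac:(nlia) ltac:(nlia).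
suff h : ipath (seg C 0 0) /\ ipath (seg C 1 1 ++ seg C 2 m) /\
    link (seg C 0 0) (seg C 1 1) /\ link (seg C 2 m) (seg C 0 0).
  by case: h => p1 [p2 [p3 p4]] /(_ p1 p2 p3 p4); nlia.
by split; [|split; [|split]]; geo.
Qed.

Lemma hpf_notin t k : t -- C 0 -> t -- C m -> k <= m -> t != C k.
Proof.
move=> t0 tm km; apply: contraTneq t0 => e; rewrite e.
have [->|k0] := eqVneq k 0; first by rewrite adj_irrefl.
have [ek|km'] := eqVneq k m.
  by move: tm; rewrite e ek adj_irrefl.
have [ek|k1] := eqVneq k 1.
  have /andP[_ h] := @hpf_nadj k m ltac:(nlia) (leqnn m) ltac:(nlia).
  by rewrite -e tm in h.
by have /andP[_] := @hpf_nadj 0 k ltac:(nlia) ltac:(nlia) ltac:(nlia); rewrite adj_sym.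
Qed.
End HolePath.

(* A vertex adjacent to both ends of one edge of a hole and to no other vertex of it
   cannot be linked to the rest of the hole away from that edge: a pyramid, hence an
   odd hole, or a prism would appear. *)
Lemma hat_obstructed C m t x p : hpf C m -> 3 <= m -> t -- C 0 -> t -- C m ->
  (forall i, 0 < i < m -> nadj t (C i)) -> path adj x p -> t -- x ->
  {in x :: p, forall z, nadj z (C 0) && nadj z (C m)} ->
  (exists2 i, 0 < i < m & last x p -- C i) -> False.
Proof.
move=> hC m3 t0 tm nt xp tx hp [i0 hi0 li0].
have om := hpf_even hC m3.
have [q [iq lq sq]] := walk_ipath xp.
pose f := nth x (x :: q); pose n := size q.
have hf : ipf f 0 n by apply: (ipath_ipf x iq).
have fin k : k <= n -> f k \in x :: p.
  move=> kn; have : f k \in x :: q by apply: mem_nth.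
  by rewrite !inE => /orP[->//|/sq ->]; rewrite orbT.
have fn0 k : k <= n -> nadj (f k) (C 0) by move=> /fin/hp/andP[].
have fnm k : k <= n -> nadj (f k) (C m) by move=> /fin/hp/andP[].
pose touch k := [exists i : 'I_m, (0 < i) && (f k -- C i)].
have touchP k i : 0 < i < m -> f k -- C i -> touch k.
  by move=> /andP[i0' im] h; apply/existsP; exists (Ordinal im); rewrite /= i0'.
have tn : touch n by apply: (touchP n i0) => //; rewrite /f /n -[size q]/(size (x :: q)).-1 nth_last /= lq.
(* Trim the path: [f e] is its first vertex that sees the inner part of the hole, and [f s] the last
   one up to [f e] adjacent to [t]. Then [t, f s, ..., f e] has no edge to the hole except from its
   two ends. *)
have [e [he te ne]] := first_index (leq0n n) tn.
have [s [hs ts ns]] := @last_index (fun k => t -- f k) 0 e (leq0n e) tx.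
have fC k i : s <= k < e -> i <= m -> nadj (f k) (C i).
  move=> hk im; have [->|i0'] := eqVneq i 0; first by apply: fn0; nlia.
  have [->|im'] := eqVneq i m; first by apply: fnm; nlia.
  have hi : 0 < i < m by nlia.
  apply: nadjI; last first.
    by apply/negP => /(touchP _ _ hi) h; have := ne k ltac:(nlia); rewrite h.
  apply/eqP => ek; have [es|es] := eqVneq k s.
    by have /andP[_] := nt i hi; rewrite -ek es ts.
  have : touch k.-1.
    apply: (touchP _ i) => //; rewrite -ek.
    by apply: (ipf_adj hf); nlia.
  by apply/negP; apply: ne; nlia.
have nts k : s < k <= e -> nadj t (f k).
  move=> hk; apply: nadjI; last exact: ns.
  apply/eqP => ek; have /andP[_] := fn0 k ltac:(nlia).
  by rewrite -ek t0.
have feC i : i <= m -> ~~ f e -- C i -> nadj (f e) (C i).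
  move=> im h; apply: nadjI => //; apply: contraNneq h => ek.
  have [i0'|i0'] := eqVneq i 0.
    by have /andP[] := fn0 e ltac:(nlia); rewrite ek i0' eqxx.
  have [im'|im'] := eqVneq i m.
    by have /andP[] := fnm e ltac:(nlia); rewrite ek im' eqxx.
  exfalso; have hi : 0 < i < m by nlia.
  have [es|es] := eqVneq e s.
    by have /andP[_] := nt i hi; rewrite -ek es ts.
  have : touch e.-1.
    apply: (touchP _ i) => //; rewrite -ek.
    by apply: (ipf_adj hf); nlia.
  by apply/negP; apply: ne; nlia.
have /existsP [[i im] /= /andP[i0' fi]] := te.
have [l1 [h1 f1 n1]] := @first_index (fun k => f e -- C k) 1 i ltac:(nlia) fi.
have [l2 [h2 f2 n2]] := @last_index (fun k => f e -- C k) i m.-1 ltac:(nlia) fi.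
have g1 k : k < l1 -> nadj (f e) (C k).
  move=> kl; have [->|k0] := eqVneq k 0; first by apply: fn0; nlia.
  by apply: feC; [nlia|apply: n1; nlia].
have g2 k : l2 < k <= m -> nadj (f e) (C k).
  move=> kl; have [->|k0] := eqVneq k m; first by apply: fnm; nlia.
  by apply: feC; [nlia|apply: n2; nlia].
have hse : ipf f s e by apply: (ipf_sub hf); nlia.
have c1 := hpf_nadj hC m3; have c2 := hpf_adj hC; have c3 := hpf_ends hC m3.
have i1 := @hpf_ipf _ _ hC m3 0 l1 ltac:(nlia) ltac:(nlia).
have i2 := @hpf_ipf _ _ hC m3 l2 m ltac:(nlia) ltac:(nlia).
have fle k : s <= k <= e -> k != e -> nadj (f k) (C 0) by move=> *; apply: fn0; nlia.
have gen1 q' r : s <= q' <= e -> r <= l1 -> (q' != e) || (r != l1) -> nadj (f q') (C r).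
  move=> hq hr hh; have [eq|nq] := eqVneq q' e; first by rewrite eq; apply: g1; nlia.
  by apply: fC; nlia.
have gen2 q' r : s <= q' <= e -> l2 <= r <= m -> (q' != e) || (r != l2) -> nadj (f q') (C r).
  move=> hq hr hh; have [eq|nq] := eqVneq q' e; first by rewrite eq; apply: g2; nlia.
  by apply: fC; nlia.
have A : odd (e - s + l1) = true.
  have := @hole_even G hG [:: t] (seg f s e) (seg C l1 0).
  rewrite !size_cat !size_seg => /(_ isT ltac:(nlia) ltac:(nlia) ltac:(simpl; nlia) isT).
  suff h : ipath (seg f s e ++ seg C l1 0) /\ link [:: t] (seg f s e) /\
      link (seg C l1 0) [:: t].
    by case: h => p1 [p2 p3] /(_ p1 p2 p3) /=; nlia.
  by split; [|split]; geo.
have B : odd (e - s + (m - l2)) = true.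
  have := @hole_even G hG [:: t] (seg f s e) (seg C l2 m).
  rewrite !size_cat !size_seg => /(_ isT ltac:(nlia) ltac:(nlia) ltac:(simpl; nlia) isT).
  suff h : ipath (seg f s e ++ seg C l2 m) /\ link [:: t] (seg f s e) /\
      link (seg C l2 m) [:: t].
    by case: h => p1 [p2 p3] /(_ p1 p2 p3) /=; nlia.
  by split; [|split]; geo.
(* [A] and [B] make [l1 + (m - l2)] even. With one neighbour, [l1 = l2], this contradicts [m] odd;
   two consecutive neighbours give a prism; otherwise [f e] closes a hole with the part of [C] from
   [l1] down to 0 and from [m] down to [l2], of the wrong parity. *)
have [e12|n12] := eqVneq l1 l2; first by nlia.
have [e12|n12'] := eqVneq l2 l1.+1.
  have c12 : C l1 -- C l2 by rewrite e12; apply: c2; nlia.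
  by apply: (@no_prism G hG [:: t] (seg f s e) (seg C 0 0) (seg C 1 l1)
    (seg C m m) (seg C m.-1 l2)); rewrite ?seg_neq0 //; geo.
have D : odd (l1 + (m - l2)) = true.
  have := @hole_even G hG [:: f e] (seg C l1 0) (seg C m l2).
  rewrite !size_cat !size_seg => /(_ isT ltac:(nlia) ltac:(nlia) ltac:(simpl; nlia) isT).
  suff h : ipath (seg C l1 0 ++ seg C m l2) /\ link [:: f e] (seg C l1 0) /\
      link (seg C m l2) [:: f e].
    by case: h => p1 [p2 p3] /(_ p1 p2 p3) /=; nlia.
  by split; [|split]; geo.
nlia.
Qed.

(* If [x] sees exactly one edge of the hole then the antihole on [x], four vertices of a
   4-hole and an antipath of [T] replaces the parity argument used when [x] sees none. *)
Lemma hat_exists T C m x : coconn T -> hpf C m -> 3 <= m -> Kc T (C 0) -> Kc T (C m) ->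
  (forall i, 0 < i < m -> ~~ Kc T (C i)) -> Kc T x ->
  (forall i, i <= m -> nadj x (C i)) \/
  (exists s, [/\ 0 < s, s.+1 < m, x -- C s, x -- C s.+1
     & forall i, i <= m -> i != s -> i != s.+1 -> nadj x (C i)]) ->
  exists2 t, t \in T & forall i, 0 < i < m -> nadj t (C i).
Proof.
move=> cT0 hC m3 K00 Km0 nK0 Kx0 hx.
have om := hpf_even hC m3.
have c1 := hpf_nadj hC m3; have c2 := hpf_adj hC; have c3 := hpf_ends hC m3.
have ci := hpf_ipf hC m3.
have [n] := ubnP #|T|; elim: n T cT0 K00 Km0 nK0 Kx0 => // n IH T cT K0 Km nK Kx ln.
have [T1|T1] := leqP #|T| 1.
  have [t tT] := set0Pn _ cT.1.
  have eT : T = [set t] by apply/eqP; rewrite eq_sym eqEcard sub1set tT cards1.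
  exists t => // i hi; rewrite nadj_sym; apply: nadjI.
    rewrite eq_sym; apply: (hpf_notin hC m3); try nlia; rewrite adj_sym.
      exact: (KcP _ _ K0).
    exact: (KcP _ _ Km).
  by apply: contraNN (nK i hi) => h; apply/KcP => t'; rewrite eT inE => /eqP ->.
have [b [b' [bT b'T bb' cb cb']]] := coconn_two cT T1.
have step c : c \in T -> coconn (T :\ c) ->
    (exists2 t, t \in T & forall i, 0 < i < m -> nadj t (C i)) \/
    (exists s, [/\ 0 < s, s.+1 < m, x -- C s, x -- C s.+1 &
      [/\ forall i, i <= m -> i != s -> i != s.+1 -> nadj x (C i) &
         Kc (T :\ c) (C s) \/ Kc (T :\ c) (C s.+1)]]).
  move=> cinT cc; set U := T :\ c in cc *.
  have sU : U \subset T by rewrite subsetDl.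
  have [U0 Um Ux] : [/\ Kc U (C 0), Kc U (C m) & Kc U x] by split; apply: (Kc_sub sU).
  have HU := roussel_rubio hG cc.
  have [nint|] := boolP [forall i : 'I_m, (0 < i) ==> ~~ Kc U (C i)].
    have lU : #|U| < n by have := cardsD1 c T; rewrite cinT -/U; nlia.
    have nKU i : 0 < i < m -> ~~ Kc U (C i).
      by move=> /andP[i0 im]; move/forallP/(_ (Ordinal im)): nint => /=; rewrite i0.
    left; have [t tU ht] := IH U cc U0 Um nKU Ux lU.
    by exists t => //; apply: (subsetP sU).
  rewrite negb_forall => /existsP [[j jm] /=]; rewrite negb_imply negbK => /andP[j0 Kj].
  have [cint|] := boolP [forall i : 'I_m, (0 < i) ==> ~~ c -- C i].
    left; exists c => // i /andP[i0 im]; apply: nadjI.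
      apply: (hpf_notin hC m3); last by nlia.
        by rewrite adj_sym; exact: (KcP _ _ K0).
      by rewrite adj_sym; exact: (KcP _ _ Km).
    by move/forallP/(_ (Ordinal im)): cint => /=; rewrite i0.
  rewrite negb_forall => /existsP [[i im] /=]; rewrite negb_imply negbK => /andP[i0 cCi].
  right.
  have nUc : ~~ Kc U c.
    have [t tU /andP[_ h]] := coconn_nadj cT cinT T1.
    by apply: contraNN h => /KcP; apply.
  (* The whole range from 0 to [m] is not an induced path, because its ends are adjacent. The parity
     is therefore added up over the two parts cut at the [U]-complete inner vertex [C j]. *)
  have odU : odd (kedg (Kc U) C 0 m).
    rewrite (@kedg_cat _ _ _ 0 j m) ?oddD; try nlia.
    rewrite (pari_kedg HU) ?(pari_kedg HU) //; try nlia; first last.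
    - by apply: ci; nlia.
    - by apply: ci; nlia.
  have c0 : c -- C 0 by rewrite adj_sym; exact: (KcP _ _ K0).
  have cm : c -- C m by rewrite adj_sym; exact: (KcP _ _ Km).
  have cK k : 0 < k < m -> c -- C k -> ~~ Kc U (C k).
    move=> hk ck; apply: contraNN (nK k hk) => h.
    by rewrite (Kc_setD1 _ cinT) adj_sym ck.
  case: hx => [hx|[s [s0 sm xs xs' nx]]].
    exfalso.
    (* Since [x] misses the hole, [x, c, C l, ..., C j1] and [x, c, C r, ..., C j2] are induced
       paths with only their ends [U]-complete, so both outer pieces of the interval are even. The
       interval itself is even by the hole through [c], but its part from [j1] to [j2] is odd. *)
    have [l [r [[_ rm] lr [cl cr] nlr odlr]]] :=
      @split_odd _ (fun k => c -- C k) _ C 0 m ltac:(nlia) c0 cm odU.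
    have nfull : 0 < l \/ r < m.
      have [l0|] := posnP l; last by left.
      right; rewrite ltn_neqAle rm andbT; apply/eqP => e.
      by have := nlr i ltac:(nlia); rewrite cCi.
    have hlr : ipf C l r by apply: ci; nlia.
    have [k [hk Kk Kk']] := kedg_ex (odd_gt0 odlr).
    have nlr' q : l < q < r -> nadj c (C q).
      move=> hq; apply: nadjI; last exact: nlr.
      by apply: (hpf_notin hC m3) => //; nlia.
    have r2 : l.+1 < r.
      rewrite ltnNge; apply/negP => rl; have ek : k = l by nlia.
      have er : k.+1 = r by nlia.
      have [l0|l0] := eqVneq l 0.
        by have := cK r ltac:(nlia) cr; rewrite -er Kk'.
      by have := cK l ltac:(nlia) cl; rewrite -ek Kk.
    have [j1 [h1 K1 n1]] := @first_index (fun q => Kc U (C q)) l k ltac:(nlia) Kk.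
    have [j2 [h2 K2 n2]] := @last_index (fun q => Kc U (C q)) k.+1 r ltac:(nlia) Kk'.
    have e21 : odd (j2 - j1).
      by rewrite -(@kedg_ext _ (Kc U) C l r) //; nlia.
    have ev : odd (r - l) = false.
      have := @hole_even G hG [:: c] (seg C l l) (seg C l.+1 r).
      rewrite !size_cat !size_seg => /(_ isT ltac:(nlia) ltac:(nlia) ltac:(simpl; nlia) isT).
      suff h : ipath (seg C l l ++ seg C l.+1 r) /\ link [:: c] (seg C l l) /\
               link (seg C l.+1 r) [:: c].
        by case: h => p1 [p2 p3] /(_ p1 p2 p3) /=; nlia.
      by split; [|split]; geo.
    have xc : x -- c by exact: (KcP _ _ Kx).
    have L : odd (j1 - l) = false.
      have [->|lj] := eqVneq j1 l; first by rewrite subnn.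
      have := @pari_list _ _ ([:: x] ++ [:: c] ++ seg C l j1) x (C j1) HU.
      rewrite !last_cat last_seg /= (Kend_l _ _ _) (Kend_n _ _ nUc) => /(_ isT erefl erefl).
      have ip : ipath ([:: x] ++ [:: c] ++ seg C l j1) by geo.
      have Ks : all (Kend (Kc U) x (C j1)) (seg C l j1).
        apply: all_seg => q hq; have [->|nq] := eqVneq q j1; first exact: Kend_r.
        by apply/Kend_n/n1; nlia.
      by move=> /(_ ip Ux K1 Ks); rewrite size_seg; nlia.
    have R : odd (r - j2) = false.
      have [->|lj] := eqVneq j2 r; first by rewrite subnn.
      have := @pari_list _ _ ([:: x] ++ [:: c] ++ seg C r j2) x (C j2) HU.
      rewrite !last_cat last_seg /= (Kend_l _ _ _) (Kend_n _ _ nUc) => /(_ isT erefl erefl).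
      have ip : ipath ([:: x] ++ [:: c] ++ seg C r j2) by geo.
      have Ks : all (Kend (Kc U) x (C j2)) (seg C r j2).
        apply: all_seg => q hq; have [->|nq] := eqVneq q j2; first exact: Kend_r.
        by apply/Kend_n/n2; nlia.
      by move=> /(_ ip Ux K2 Ks); rewrite size_seg; nlia.
    by nlia.
  exists s; split=> //; split=> //.
  have [Ks|nKs] := boolP (Kc U (C s)); first by left.
  have [Ks'|nKs'] := boolP (Kc U (C s.+1)); first by right.
  exfalso.
  (* If neither end of the edge seen by [x] is [U]-complete, the induced paths from [x] through
     these ends to the nearest [U]-complete vertices make [s - j1] and [j2 - s.+1] odd. As [m] is
     odd, the number of [U]-complete edges, all before [j1] or after [j2], would be even. *)
  have [j1 [h1 K1 n1]] := @last_index (fun q => Kc U (C q)) 0 s (leq0n s) U0.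
  have [j2 [h2 K2 n2]] := @first_index (fun q => Kc U (C q)) s.+1 m ltac:(nlia) Um.
  have [js js'] : j1 != s /\ j2 != s.+1.
    by split; [apply: contraNneq nKs => <-|apply: contraNneq nKs' => <-].
  have L : odd (s - j1).
    have := @pari_list _ _ ([:: x] ++ seg C s j1) x (C j1) HU.
    rewrite !last_cat last_seg /= (Kend_l _ _ _) => /(_ isT erefl erefl).
    have i1 : ipf C j1 s by apply: ci; nlia.
    have ip : ipath ([:: x] ++ seg C s j1) by geo.
    have Ka : all (Kend (Kc U) x (C j1)) (seg C s j1).
      apply: all_seg => q hq; have [->|nq] := eqVneq q j1; first exact: Kend_r.
      by apply/Kend_n/n1; nlia.
    by move=> /(_ ip Ux K1 Ka); rewrite size_seg; nlia.
  have R : odd (j2 - s.+1).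
    have := @pari_list _ _ ([:: x] ++ seg C s.+1 j2) x (C j2) HU.
    rewrite !last_cat last_seg /= (Kend_l _ _ _) => /(_ isT erefl erefl).
    have i1 : ipf C s.+1 j2 by apply: ci; nlia.
    have ip : ipath ([:: x] ++ seg C s.+1 j2) by geo.
    have Ka : all (Kend (Kc U) x (C j2)) (seg C s.+1 j2).
      apply: all_seg => q hq; have [->|nq] := eqVneq q j2; first exact: Kend_r.
      by apply/Kend_n/n2; nlia.
    by move=> /(_ ip Ux K2 Ka); rewrite size_seg; nlia.
  move: odU; rewrite (@kedg_cat _ _ _ 0 j1 m); try nlia.
  rewrite (@kedg_cat _ _ _ j1 j2 m); try nlia.
  rewrite (@kedg0 _ _ _ j1 j2); last first.
    move=> q hq; apply/negP => /andP[k1 k2].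
    have [e|ne] := eqVneq q j1; first by have := n1 q.+1 ltac:(nlia); rewrite k2.
    have [qs|qs] := leqP q s; first by have := n1 q ltac:(nlia); rewrite k1.
    by have := n2 q ltac:(nlia); rewrite k1.
  rewrite add0n oddD (pari_kedg HU) ?(pari_kedg HU) //; try nlia.
  - by apply: ci; nlia.
  by apply: ci; nlia.
(* In the remaining case both removals concern the one edge seen by [x]. One end of it is complete
   to [T :\ b] and the other to [T :\ b'], because a vertex complete to both sets is complete to
   [T]; this is the configuration of the antihole lemmas. *)
have [//|[s [s0 sm xs xs' [nx Ks]]]] := step b bT cb.
have [//|[s' [s0' sm' ys ys' [ny Ks']]]] := step b' b'T cb'.
exfalso.
have es : s' = s.
  apply/eqP/negPn/negP => ne.
  have nn y : x -- y -> nadj x y -> False by move=> h /andP[_]; rewrite h.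
  have [e|ne'] := eqVneq s s'.+1; last first.
    by apply: (nn _ xs); apply: ny => //; nlia.
  by apply: (nn _ xs'); apply: ny; nlia.
subst s'.
have both k : 0 < k < m -> Kc (T :\ b) (C k) -> Kc (T :\ b') (C k) -> False.
  move=> hk k1 k2; have := nK k hk; rewrite (Kc_setD1 _ bT) k1 andbT.
  by rewrite (KcP _ _ k2) // !inE bT bb'.
have nad k c : c \in T -> 0 < k < m -> Kc (T :\ c) (C k) -> nadj (C k) c.
  move=> cinT hk kc; have h : ~~ C k -- c.
    by have := nK k hk; rewrite (Kc_setD1 _ cinT) kc andbT.
  rewrite nadj_sym; apply: nadjI; last by rewrite adj_sym.
  apply: (hpf_notin hC m3); last by nlia.
    by rewrite adj_sym; exact: (KcP _ _ K0).
  by rewrite adj_sym; exact: (KcP _ _ Km).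
have key c c' : c \in T -> c' \in T -> c != c' -> Kc (T :\ c) (C s) ->
    Kc (T :\ c') (C s.+1) -> False.
  move=> cinT c'T cc' k1 k2.
  have n1 := nad s c cinT ltac:(nlia) k1; have n2 := nad s.+1 c' c'T ltac:(nlia) k2.
  have cs := c2 s ltac:(nlia).
  have [s1|s1] := leqP 2 s.
    by apply: (antihole2 hG cT cinT c'T cc' n1 n2 k1 k2 cs K0); apply: c1; nlia.
  have [s2|s2] := leqP s.+3 m.
    by apply: (antihole2 hG cT cinT c'T cc' n1 n2 k1 k2 cs Km); rewrite nadj_sym; apply: c1; nlia.
  have e1 : s = 1 by nlia. have e2 : m = 3 by nlia. subst s m.
  apply: (antihole4 cT cinT c'T cc' n1 n2 k1 k2 cs Km K0 Kx).
  - by rewrite nadj_sym; apply: c1.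
  - by rewrite adj_sym; apply: c2.
  - by apply: c1.
  - by apply: c2.
  - by rewrite adj_sym.
  - by apply: nx.
  - by apply: nx.
  - by [].
  by [].
have [Kb|Kb] := Ks; have [Kb'|Kb'] := Ks'.
- by apply: (both s) => //; nlia.
- exact: (key b b').
- by apply: (key b' b) => //; rewrite eq_sym.
by apply: (both s.+1) => //; nlia.
Qed.

(** [hat_exists] gives a vertex [t] of [T] that sees only the complete edge of the hole. As [x] is
    complete, it is adjacent to [t], and the path from [x] contradicts [hat_obstructed]. *)
Lemma hole_two_complete T C m x p : coconn T -> hpf C m -> 3 <= m -> Kc T (C 0) -> Kc T (C m) ->
  (forall i, 0 < i < m -> ~~ Kc T (C i)) -> Kc T x -> (forall i, i <= m -> nadj x (C i)) ->
  path adj x p -> {in p, forall z, nadj z (C 0) && nadj z (C m)} ->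
  (exists2 i, 0 < i < m & last x p -- C i) -> False.
Proof.
move=> cT hC m3 K0 Km nK Kx nx xp hp hl.
have [t tT ht] := hat_exists cT hC m3 K0 Km nK Kx (or_introl nx).
apply: (hat_obstructed hC m3 _ _ ht xp _ _ hl).
- by rewrite adj_sym; exact: (KcP _ _ K0).
- by rewrite adj_sym; exact: (KcP _ _ Km).
- by rewrite adj_sym; exact: (KcP _ _ Kx).
by move=> z; rewrite inE => /orP[/eqP ->|/hp //]; rewrite !nx.
Qed.
End Hats.

Section ListForms.
Variables (G : sgraph) (hG : class_A G).
Implicit Types (T : {set G}) (x y b t u v : G) (s : seq G).

Lemma nth_uniqG x0 s i j : uniq s -> i < size s -> j < size s ->
  (nth x0 s i == nth x0 s j) = (i == j).
Proof. by move=> us li lj; apply: nth_uniq. Qed.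

Lemma mem_nthG x0 s i : i < size s -> nth x0 s i \in s.
Proof. exact: mem_nth. Qed.

Lemma ihole_end s u v : ihole s -> head u s = u -> last u s = v ->
  [/\ hpf (nth u s) (size s).-1, 3 <= (size s).-1, nth u s 0 = u & nth u s (size s).-1 = v].
Proof.
move=> hs hu hv; split; [exact: ihole_hpf| |by rewrite nth0|by rewrite nth_last].
by case: hs => sz _; nlia.
Qed.

Lemma ihole_inner s u v i : ihole s -> head u s = u -> last u s = v ->
  0 < i < (size s).-1 -> [/\ nth u s i \in s, nth u s i != u & nth u s i != v].
Proof.
move=> hs hu hv hi; have [h1 h2 h3 h4] := ihole_end hs hu hv.
have li : i < size s by nlia.
have U := ihole_uniq hs; have ls : (size s).-1 < size s by nlia.
split; first exact: mem_nth.
  by rewrite -{2}h3 nth_uniqG //; nlia.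
by rewrite -h4 nth_uniqG //; nlia.
Qed.

Lemma has_inner s u v z : ihole s -> head u s = u -> last u s = v ->
  nadj z u -> nadj z v -> has (adj z) s -> exists2 i, 0 < i < (size s).-1 & z -- nth u s i.
Proof.
move=> hs hu hv /andP[_ nu] /andP[_ nv] /(has_nthP u) [i li zi].
have [h1 h2 h3 h4] := ihole_end hs hu hv.
exists i => //; have [e|i0] := eqVneq i 0; first by move: nu; rewrite -{1}h3 -e zi.
have [e|im] := eqVneq i (size s).-1; first by move: nv; rewrite -h4 -e zi.
by have li' : i < size s := li; nlia.
Qed.

Lemma hat_obstructed_list s t u v x p : ihole s -> head u s = u -> last u s = v ->
  t -- u -> t -- v -> all (fun e => [|| e == u, e == v | nadj t e]) s ->
  path adj x p -> t -- x -> {in x :: p, forall z, nadj z u && nadj z v} ->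
  has (adj (last x p)) s -> False.
Proof.
move=> hs hu hv tu tv /allP ha xp tx hp hl.
have [h1 h2 h3 h4] := ihole_end hs hu hv.
apply: (hat_obstructed hG h1 h2 _ _ _ xp tx); rewrite ?h3 ?h4 //.
  move=> i hi; have [hin n1 n2] := ihole_inner hs hu hv hi.
  by have := ha _ hin; rewrite (negbTE n1) (negbTE n2).
have /andP[z1 z2] := hp _ (mem_last x p).
exact: (has_inner hs hu hv z1 z2 hl).
Qed.

Lemma hole_two_complete_list T s u v x p : coconn T -> ihole s -> head u s = u ->
  last u s = v -> Kc T u -> Kc T v -> all (Kend (Kc T) u v) s -> Kc T x ->
  all (nadj x) s -> path adj x p -> {in p, forall z, nadj z u && nadj z v} ->
  has (adj (last x p)) s -> False.
Proof.
move=> cT hs hu hv Ku Kv /allP ha Kx /allP hx xp hp hl.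
have [h1 h2 h3 h4] := ihole_end hs hu hv.
have us : u \in s by rewrite -{1}h3 mem_nthG //; case: hs => *; nlia.
have vs : v \in s by rewrite -h4 mem_nthG //; case: hs => *; nlia.
apply: (hole_two_complete hG cT h1 h2 _ _ _ Kx _ xp); rewrite ?h3 ?h4 //.
- move=> i hi; have [hin n1 n2] := ihole_inner hs hu hv hi.
  by have := ha _ hin; rewrite /Kend (negbTE n1) (negbTE n2) implybF.
- by move=> i hi; apply: hx; apply: mem_nthG; case: hs => *; nlia.
have [z1 z2] : nadj (last x p) u /\ nadj (last x p) v.
  have := mem_last x p; rewrite inE => /orP[/eqP ->|/hp /andP[]//].
  by split; apply: hx.
exact: (has_inner hs hu hv z1 z2 hl).
Qed.

(** The hole is cut at the edge seen by [x], from the last of [s1] to the first of [s2]. Both parts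
    have at least two vertices, which keeps this edge disjoint from the edge between [u] and [v]. *)
Lemma hat_exists_list T s1 s2 u v x : coconn T -> ihole (s1 ++ s2) ->
  1 < size s1 -> 1 < size s2 -> head u s1 = u -> last u s2 = v ->
  Kc T u -> Kc T v -> all (Kend (Kc T) u v) (s1 ++ s2) -> Kc T x ->
  link s1 [:: x] -> link [:: x] s2 ->
  exists2 t, t \in T & all (fun e => [|| e == u, e == v | nadj t e]) (s1 ++ s2).
Proof.
move=> cT hs l1 l2 hu hv Ku Kv /allP ha Kx k1 k2.
have hu' : head u (s1 ++ s2) = u by case: s1 l1 hu {hs ha k1}.
have hv' : last u (s1 ++ s2) = v by rewrite last_cat; case: s2 l2 hv {hs hu' ha k2}.
have [h1 h2 h3 h4] := ihole_end hs hu' hv'.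
have szs : size (s1 ++ s2) = size s1 + size s2 by rewrite size_cat.
have K0 : Kc T (nth u (s1 ++ s2) 0) by rewrite h3.
have Km : Kc T (nth u (s1 ++ s2) (size (s1 ++ s2)).-1) by rewrite h4.
have nKi i : 0 < i < (size (s1 ++ s2)).-1 -> ~~ Kc T (nth u (s1 ++ s2) i).
  move=> hi; have [hin n1 n2] := ihole_inner hs hu' hv' hi.
  by have := ha _ hin; rewrite /Kend (negbTE n1) (negbTE n2) implybF.
have e1 : (size s1).-1.+1 = size s1 by nlia.
have k1' i : i < size s1 -> (nth u s1 i != x) && ((nth u s1 i -- x) == (i == (size s1).-1)).
  by move=> li; have := link_nthP u _ _ k1 i 0 li isT => /=; rewrite andbT.
have k2' i : i < size s2 -> (x != nth u s2 i) && ((x -- nth u s2 i) == (i == 0)).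
  by move=> li; have := link_nthP u _ _ k2 0 i isT li => /=.
have hx : exists q, [/\ 0 < q, q.+1 < (size (s1 ++ s2)).-1, x -- nth u (s1 ++ s2) q,
    x -- nth u (s1 ++ s2) q.+1
  & forall i, i <= (size (s1 ++ s2)).-1 -> i != q -> i != q.+1 -> nadj x (nth u (s1 ++ s2) i)].
  exists (size s1).-1; rewrite e1; split; try nlia.
  - rewrite nth_cat; have -> : (size s1).-1 < size s1 by nlia.
    have /andP[_ /eqP h] := k1' (size s1).-1 ltac:(nlia).
    by rewrite adj_sym h eqxx.
  - rewrite nth_cat ltnn subnn.
    by have /andP[_ /eqP ->] := k2' 0 ltac:(nlia).
  move=> i li n1 n2; rewrite nth_cat; case: ltnP => c.
    have /andP[ne /eqP e] := k1' i c; rewrite nadj_sym; apply: nadjI => //.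
    by rewrite e.
  have c' : i - size s1 < size s2 by nlia.
  have /andP[ne /eqP e] := k2' _ c'; apply: nadjI => //.
  by rewrite e; nlia.
have [t tT ht] := hat_exists hG cT h1 h2 K0 Km nKi Kx (or_intror hx).
exists t => //; apply/(all_nthP u) => i li.
have [->|i0] := eqVneq i 0; first by rewrite h3 eqxx.
have [->|im] := eqVneq i (size (s1 ++ s2)).-1; first by rewrite h4 eqxx orbT.
by rewrite ht ?orbT //; have li' : i < size (s1 ++ s2) := li; nlia.
Qed.
End ListForms.

(** * Frames *)

Section Frame.
Variable G : sgraph.

(* [z 1, ..., z n] is the interior of a shortest outer path of [T]; [A] and [B] are the
   complete vertices that see only its first, respectively its last, vertex. *)
Record frame (T : {set G}) (z : nat -> G) (n : nat) (A B : pred G) : Prop := Frame {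
  fr_cc : coconn T;
  fr_z : ipf z 1 n;
  fr_odd : odd n;
  fr_n : 3 <= n;
  fr_nK : forall i, 1 <= i <= n -> ~~ Kc T (z i);
  fr_AK : forall a, A a -> Kc T a;
  fr_A1 : forall a, A a -> a -- z 1;
  fr_Az : forall a i, A a -> 1 < i <= n -> nadj a (z i);
  fr_BK : forall b, B b -> Kc T b;
  fr_Bn : forall b, B b -> b -- z n;
  fr_Bz : forall b i, B b -> 1 <= i < n -> nadj b (z i);
  fr_AA : forall a a', A a -> A a' -> a != a' -> a -- a';
  fr_BB : forall b b', B b -> B b' -> b != b' -> b -- b';
  fr_AB : forall a b, A a -> B b -> nadj a b;
  fr_D : forall v, Kc T v -> ~~ A v -> ~~ B v ->
    (forall i, 1 <= i <= n -> nadj v (z i)) \/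
    (forall a, A a -> v -- a) /\ (forall b, B b -> v -- b) }.

Lemma frame_rev T z n A B : frame T z n A B -> frame T (fun i => z (n.+1 - i)) n B A.
Proof.
case=> cc hz od n3 nK AK A1 Az BK Bn Bz AA BB AB D; split=> //.
- move=> i j i1 ij jn; have := hz (n.+1 - j) (n.+1 - i) ltac:(nlia) ltac:(nlia) ltac:(nlia).
  by rewrite eq_sym adj_sym => /andP[-> /eqP ->]; apply/eqP; lia.
- by move=> i hi; apply: nK; nlia.
- by move=> b /Bn; rewrite subn1.
- by move=> b i Bb hi; apply: Bz => //; nlia.
- by move=> a /A1; rewrite subSnn.
- by move=> a i Aa hi; apply: Az => //; nlia.
- by move=> b a Bb Aa; rewrite nadj_sym; apply: AB.
move=> v Kv nB nA; have [h|[h1 h2]] := D v Kv nA nB; last by right.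
by left=> i hi; apply: h; nlia.
Qed.
End Frame.

Section SegHelpers.
Variable G : sgraph.
Implicit Types (f : nat -> G) (s : seq G).

Lemma head_segcat x f i j s : head x (seg f i j ++ s) = f i.
Proof. by case e: (seg f i j) (seg_neq0 f i j) (head_seg x f i j) => [|y t]. Qed.

Lemma has_seg (p : pred G) f i j k : minn i j <= k <= maxn i j -> p (f k) -> has p (seg f i j).
Proof. by move=> hk pk; apply/hasP; exists (f k) => //; apply/mem_segP; exists k. Qed.

Lemma ipath_path x s : ipath (x :: s) -> path adj x s.
Proof.
elim: s x => //= y s IH x; rewrite -[ipath _]/(att x (y :: s) && ipath (y :: s)).
by case/andP => /andP[-> _] /IH.
Qed.

Lemma in_seg (P : G -> Prop) f i j :
  (forall k, minn i j <= k <= maxn i j -> P (f k)) -> {in seg f i j, forall w, P w}.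
Proof. by move=> h w /mem_segP [k hk ->]; apply: h. Qed.

Lemma neq_adj (x y w : G) : x -- y -> nadj x w -> y != w.
Proof. by move=> xy /andP[_ nxw]; apply: contraNneq nxw => <-. Qed.
End SegHelpers.

(** * Complete edges between consecutive vertices that see the path [z] *)

Section Intervals.
Variables (G : sgraph) (hG : class_A G).
Implicit Types (T : {set G}) (z f : nat -> G) (A B : pred G).

(** Lying on the path counts as touching it, since [nadj] also requires distinct vertices. *)
Definition touch z n (v : G) : bool := [exists i : 'I_n.+1, (0 < i) && ~~ nadj v (z i)].

Lemma touchN z n v : ~~ touch z n v -> forall i, 1 <= i <= n -> nadj v (z i).
Proof.
rewrite negb_exists => /forallP h i /andP[i1 ilt]; move: (h (inord i)).
by rewrite inordK ?ltnS // i1 /= negbK.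
Qed.

Lemma touchI z n v i : 1 <= i <= n -> ~~ nadj v (z i) -> touch z n v.
Proof.
move=> /andP[i1 ilt] h; apply/existsP; exists (inord i).
by rewrite inordK ?ltnS // i1.
Qed.

Lemma touch_rev z n v : touch (fun i => z (n.+1 - i)) n v = touch z n v.
Proof.
apply/idP/idP; apply: contraTT => /touchN h.
  rewrite negb_exists; apply/forallP => -[i ilt] /=; rewrite negb_and negbK -leqNgt leqn0.
  by case: eqVneq => //= i0; apply: h; nlia.
rewrite negb_exists; apply/forallP => -[i ilt] /=; rewrite negb_and negbK -leqNgt leqn0.
case: eqVneq => //= i0; have -> : z i = z (n.+1 - (n.+1 - i)) by congr z; nlia.
by apply: h; nlia.
Qed.

(** Let [z k] be the first neighbour of [f y]. For [v >= 2] the hole [f 0, ..., f y, z k, ..., z 1]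
    and the induced path [f 0, z 1, ..., z k, f y, ..., f v] with complete ends force [v] to be
    even. For [v = 1] that path has a chord, and the rest of the proof excludes this case. *)
Lemma interval_left T z n A B f r y v : frame T z n A B -> ipf f 0 r -> A (f 0) -> B (f r) ->
  (forall k, 0 < k < r -> Kc T (f k) -> ~~ touch z n (f k)) ->
  0 < y < r -> touch z n (f y) -> (forall k, 0 < k < y -> ~~ touch z n (f k)) ->
  v <= y -> Kc T (f v) -> (forall k, v < k <= y -> ~~ Kc T (f k)) -> odd v = false.
Proof.
move=> fr hf Aa Bb hD hy ty ny vy Kv nKv.
have [-> //|v0] := eqVneq v 0.
have vy' : v < y.
  rewrite ltn_neqAle vy andbT; apply: contraTneq ty => e.
  by apply: hD => //; rewrite -e.
have nz k i : 0 < k < y -> 1 <= i <= n -> nadj (f k) (z i).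
  by move=> hk hi; apply: (touchN (ny k hk)).
have n3 := fr_n fr; have on := fr_odd fr; have hz := fr_z fr.
have K0 := fr_AK fr Aa; have Kb := fr_BK fr Bb.
have az1 := fr_A1 fr Aa; have bzn := fr_Bn fr Bb.
have az i : 1 < i <= n -> nadj (f 0) (z i) by apply: (fr_Az fr).
have bz i : 1 <= i < n -> nadj (f r) (z i) by apply: (fr_Bz fr).
have HK := roussel_rubio hG (fr_cc fr).
have nKz := fr_nK fr.
have fyz i : 1 <= i <= n -> f y != z i.
  move=> hi; apply: (neq_adj (x := f y.-1)); last by apply: nz; nlia.
  by apply: (ipf_adj hf); nlia.
have /existsP [[i ilt] /= /andP[i0 fyi]] := ty.
have fyi' : f y -- z i.
  by move: fyi; rewrite /nadj fyz ?negbK //=; nlia.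
have [k [hk fk nk]] := @first_index (fun j => f y -- z j) 1 i i0 fyi'.
have wz j : 1 <= j < k -> nadj (f y) (z j).
  by move=> hj; apply: nadjI; [apply: fyz; nlia|apply: nk; nlia].
have fz p q : 0 < p <= y -> 1 <= q <= k -> (p != y) || (q != k) -> nadj (f p) (z q).
  move=> hp hq; have [->|py] := eqVneq p y => /= h; first by apply: wz; nlia.
  by apply: nz; nlia.
have hole1 : odd (y + k) = true.
  have := @hole_even G hG (seg f 0 0) (seg f 1 y) (seg z k 1).
  rewrite !size_cat !size_seg => /(_ ltac:(nlia) ltac:(nlia) ltac:(nlia) ltac:(nlia)).
  suff h : ipath (seg f 0 0) /\ ipath (seg f 1 y ++ seg z k 1) /\
      link (seg f 0 0) (seg f 1 y) /\ link (seg z k 1) (seg f 0 0).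
    by case: h => p0 [p1 [p2 p3]] /(_ p0 p1 p2 p3); nlia.
  by split; [|split; [|split]]; geo.
have [v2|v1] := ltnP 1 v.
  have := @pari_list _ _ ([:: f 0] ++ seg z 1 k ++ seg f y v) (f 0) (f v) HK.
  rewrite !last_cat last_seg /= (Kend_l _ _ _) => /(_ isT erefl erefl).
  have ip : ipath ([:: f 0] ++ seg z 1 k ++ seg f y v) by geo.
  have Ks : all (Kend (Kc T) (f 0) (f v)) (seg z 1 k ++ seg f y v).
    rewrite all_cat; apply/andP; split; apply: all_seg => q hq.
      by apply/Kend_n/nKz; range_lia.
    have [->|nq] := eqVneq q v; first exact: Kend_r.
    by apply/Kend_n/nKv; range_lia.
  by move=> /(_ ip K0 Kv Ks); rewrite size_cat !size_seg; nlia.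
have ev : v = 1 by nlia.
(* Now [f 1] and [f 0] are the only complete vertices of the hole [s], and they are adjacent. The
   vertex [f r] is complete and is linked to the hole along [z n, ..., z k.+1]; only [k = n] and
   [y.+1 = r] escape this argument and are treated by parity. *)
subst v; exfalso.
pose s := seg f 1 y ++ seg z k 1 ++ seg f 0 0.
have hs : ihole s.
  by apply: ihole_catI; rewrite ?seg_neq0 // ?size_cat ?size_seg; try nlia; geo.
have hhs : head (f 1) s = f 1 by rewrite /s head_segcat.
have hls : last (f 1) s = f 0 by rewrite /s !last_cat last_seg.
have Ks : all (Kend (Kc T) (f 1) (f 0)) s.
  rewrite !all_cat; apply/and3P; split; apply: all_seg => q hq.
  - have [->|nq] := eqVneq q 1; first exact: Kend_l.
    by apply/Kend_n/nKv; range_lia.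
  - by apply/Kend_n/nKz; range_lia.
  have -> : q = 0 by nlia. exact: Kend_r.
have y1 : y.+1 < r -> k = n -> odd y.
  move=> yr kn.
  have := @pari_list _ _ ([:: f r] ++ [:: z n] ++ seg f y 1) (f r) (f 1) HK.
  rewrite !last_cat last_seg /= (Kend_l _ _ _) => /(_ isT erefl erefl).
  have fyn : f y -- z n by rewrite -kn.
  have ip : ipath ([:: f r] ++ [:: z n] ++ seg f y 1) by geo.
  have Ks' : all (Kend (Kc T) (f r) (f 1)) (z n :: seg f y 1).
    apply/andP; split; first by apply/Kend_n/nKz; range_lia.
    apply: all_seg => q hq; have [->|nq] := eqVneq q 1; first exact: Kend_r.
    by apply/Kend_n/nKv; range_lia.
  by move=> /(_ ip Kb Kv Ks'); rewrite size_seg; nlia.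
have y2 : y.+1 = r -> odd y = false.
  move=> yr; have := @pari_list _ _ (seg f 1 r) (f 1) (f r) HK.
  have i1 : ipath (seg f 1 r) by geo_leaf.
  rewrite head_seg last_seg seg_neq0 => /(_ isT erefl erefl i1 Kv Kb).
  have -> : all (Kend (Kc T) (f 1) (f r)) (seg f 1 r).
    apply: all_seg => q hq; have [->|nq] := eqVneq q 1; first exact: Kend_l.
    have [->|nq'] := eqVneq q r; first exact: Kend_r.
    by apply/Kend_n/nKv; range_lia.
  by rewrite size_seg => /(_ isT); nlia.
have [yr|yr] := eqVneq y.+1 r; last first.
  have yr' : y.+1 < r by nlia.
  have [kn|kn] := eqVneq k n; first by have := y1 yr' kn; nlia.
  apply: (hole_two_complete_list hG (fr_cc fr) hs hhs hls Kv K0 Ks Kb (p := seg z n k.+1)).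
  - by rewrite !all_cat; apply/and3P; split; apply: all_seg => q hq; geo_leaf.
  - apply: ipath_path; change (ipath ([:: f r] ++ seg z n k.+1)).
    by geo.
  - by apply: in_seg => q hq; apply/andP; split; geo_leaf.
  rewrite last_seg !has_cat; apply/orP; right; apply/orP; left.
  by apply: (has_seg (k := k)); [nlia|geo_leaf].
have ey := y2 yr.
have fyr : f y -- f r by rewrite -yr; geo_leaf.
have [kn|kn] := eqVneq k n; last first.
  have := @pari_list _ _ ([:: f 0] ++ seg z 1 k ++ [:: f y] ++ [:: f r]) (f 0) (f r) HK.
  rewrite !last_cat /= (Kend_l _ _ _) => /(_ isT erefl erefl).
  have ip : ipath ([:: f 0] ++ seg z 1 k ++ [:: f y] ++ [:: f r]) by geo.
  have Ks' : all (Kend (Kc T) (f 0) (f r)) (seg z 1 k ++ [:: f y; f r]).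
    rewrite all_cat /= Kend_r andbT; apply/andP; split.
      by apply: all_seg => q hq; apply/Kend_n/nKz; range_lia.
    by rewrite andbT; apply/Kend_n/nKv; range_lia.
  by move=> /(_ ip K0 Kb Ks'); rewrite size_cat size_seg /=; nlia.
have fyn : f y -- z n by rewrite -kn.
(* Here [f r] sees exactly the edge of the hole between [f y] and [z n]. The vertex [t] of the hat
   lemma then gives a prism with triangles [t, f 1, f 0] and [f r, f y, z n]. *)
have s12 : s = seg f 1 y ++ (seg z n 1 ++ seg f 0 0) by rewrite /s kn.
move: Ks hs; rewrite s12 => Ks hs.
have g1 : 1 < size (seg f 1 y) by rewrite size_seg; nlia.
have g2 : 1 < size (seg z n 1 ++ seg f 0 0) by rewrite size_cat !size_seg; nlia.
have g3 : last (f 1) (seg z n 1 ++ seg f 0 0) = f 0 by rewrite last_cat last_seg.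
have g4 : link (seg f 1 y) [:: f r] by geo.
have g5 : link [:: f r] (seg z n 1 ++ seg f 0 0) by geo.
have [t tT ht] := hat_exists_list hG (fr_cc fr) hs g1 g2 (head_seg (f 1) f 1 y) g3 Kv K0 Ks Kb g4 g5.
have tf w : Kc T w -> t -- w by move=> /KcP h; rewrite adj_sym h.
have t0 := tf _ K0; have t1 := tf _ Kv; have tr := tf _ Kb.
move: ht; rewrite !all_cat => /and3P[/allP h1 /allP h2 _].
have tfn q : 1 < q <= y -> nadj t (f q).
  move=> hq; have := h1 (f q); have -> : f q \in seg f 1 y by apply/mem_segP; exists q => //; nlia.
  move=> /(_ isT); rewrite (negbTE (ipf_neq hf (i := q) (j := 1) ltac:(nlia) ltac:(nlia) ltac:(nlia))).
  by rewrite (negbTE (ipf_neq hf (i := q) (j := 0) ltac:(nlia) ltac:(nlia) ltac:(nlia))).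
have tzn q : 1 <= q <= n -> nadj t (z q).
  move=> hq; have := h2 (z q); have -> : z q \in seg z n 1 by apply/mem_segP; exists q => //; nlia.
  have ne u : Kc T u -> (z q == u) = false by move=> Ku; apply: contraNF (nKz q hq) => /eqP ->.
  by rewrite !ne // => /(_ isT).
by apply: (@no_prism G hG [:: t] [:: f r] (seg f 1 1) (seg f 2 y) [:: f 0] (seg z 1 n));
  rewrite ?seg_neq0 //; geo.
Qed.
End Intervals.

Section Middle.
Variables (G : sgraph) (hG : class_A G).
Variables (T : {set G}) (z f : nat -> G) (n x y u v : nat) (A B : pred G) (a : G).
Hypotheses (fr : frame T z n A B) (hf : ipf f x y) (Aa : A a).
Hypothesis af : forall k, x < k <= y -> nadj a (f k).
Hypotheses (xu : x < u) (uv : u < v) (vy : v < y).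
Hypotheses (tx : touch z n (f x)) (ty : touch z n (f y)).
Hypothesis nt : forall k, x < k < y -> ~~ touch z n (f k).
Hypotheses (Ku : Kc T (f u)) (Kv : Kc T (f v)).
Hypothesis nKu : forall k, x <= k < u -> ~~ Kc T (f k).
Hypothesis nKv : forall k, v < k <= y -> ~~ Kc T (f k).
Hypothesis od : odd (v - u).

Let n3 := fr_n fr.
Let on := fr_odd fr.
Let hz := fr_z fr.
Let K0 := fr_AK fr Aa.
Let az1 := fr_A1 fr Aa.
Let HK := roussel_rubio hG (fr_cc fr).
Let nKz := fr_nK fr.
Let az i : 1 < i <= n -> nadj a (z i). Proof. exact: (fr_Az fr). Qed.
Let nz k i : x < k < y -> 1 <= i <= n -> nadj (f k) (z i).
Proof. by move=> hk; apply/touchN/nt. Qed.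

Let fxz i : 1 <= i <= n -> f x != z i.
Proof.
move=> hi; apply: (neq_adj (x := f x.+1)); last by apply: nz; nlia.
by apply: (ipf_adj hf); nlia.
Qed.

Let fyz i : 1 <= i <= n -> f y != z i.
Proof.
move=> hi; apply: (neq_adj (x := f y.-1)); last by apply: nz; nlia.
by apply: (ipf_adj hf); nlia.
Qed.

(* [z p] and [z q] are neighbours of [f x] and [f y], with no such neighbour in between. *)
Definition near p q : Prop := [/\ 1 <= p <= n, 1 <= q <= n, f x -- z p, f y -- z q &
  forall i, minn p q <= i <= maxn p q ->
    (i != p -> nadj (f x) (z i)) /\ (i != q -> nadj (f y) (z i))].

Let near_nadj p q : near p q ->
  (forall k i, x <= k < y -> minn p q <= i <= maxn p q -> (k != x) || (i != p) -> nadj (f k) (z i)) /\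
  (forall k i, x < k <= y -> minn p q <= i <= maxn p q -> (k != y) || (i != q) -> nadj (f k) (z i)).
Proof.
case=> hp hq xp yq h; split=> k i hk hi.
  have [->|kx] := eqVneq k x => /= hh; first by have [+ _] := h i hi; apply; nlia.
  by apply: nz; nlia.
have [->|kx] := eqVneq k y => /= hh; first by have [_ +] := h i hi; apply; nlia.
by apply: nz; nlia.
Qed.

(** A near pair closes [f x, ..., f y] to a hole through [z q, ..., z p]. *)
Lemma near_even p q : near p q -> odd (y - x + ((p - q) + (q - p))) = false.
Proof.
move=> N; have [h1 h2] := near_nadj N; case: N => hp hq xp yq _.
have h1x i : minn p q <= i <= maxn p q -> i != p -> nadj (f x) (z i).
  by move=> hi ip; apply: h1; nlia.
have := @hole_even G hG [:: f x] (seg f x.+1 y) (seg z q p).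
rewrite !size_cat !size_seg => /(_ isT ltac:(nlia) ltac:(nlia) ltac:(simpl; nlia) isT).
suff h : ipath (seg f x.+1 y ++ seg z q p) /\ link [:: f x] (seg f x.+1 y) /\
    link (seg z q p) [:: f x].
  by case: h => [p1 [p2 p3]] /(_ p1 p2 p3) /=; nlia.
by split; [|split]; geo.
Qed.

(** If [f u] and [f v] were nonadjacent, the way around the hole through [z] would be an induced
    path with only its ends complete. It has the parity of [v - u], which is odd. *)
Lemma near_edge p q : near p q -> v = u.+1.
Proof.
move=> N; have ev := near_even N; have [h1 h2] := near_nadj N; case: N => hp hq xp yq _.
apply/eqP/negPn/negP => ne; have uv2 : u.+1 < v by nlia.
have := @pari_list _ _ (seg f u x ++ seg z p q ++ seg f y v) (f u) (f v) HK.
have ip : ipath (seg f u x ++ seg z p q ++ seg f y v) by geo.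
rewrite head_segcat !last_cat last_seg => /(_ _ erefl erefl ip Ku Kv).
rewrite !size_cat !size_seg => /(_ ltac:(range_lia)).
have -> : all (Kend (Kc T) (f u) (f v)) (seg f u x ++ seg z p q ++ seg f y v).
  rewrite !all_cat; apply/and3P; split; apply: all_seg => i hi.
  - have [->|ni] := eqVneq i u; first exact: Kend_l.
    by apply/Kend_n/nKu; range_lia.
  - by apply/Kend_n/nKz; range_lia.
  have [->|ni] := eqVneq i v; first exact: Kend_r.
  by apply/Kend_n/nKv; range_lia.
by move=> /(_ isT); nlia.
Qed.

(** The hole of the near pair has just the two complete vertices [f u] and [f v], which are
    adjacent. The complete vertex [a] misses it and is linked to it along [z 1, z 2, ...], up to the
    smaller of [p] and [q]. *)
Lemma near_a p q : near p q -> nadj a (f x) -> 1 < p -> 1 < q -> False.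
Proof.
move=> N ax p1 q1; have ev := near_edge N; have [h1 h2] := near_nadj N.
case: N => hp hq xp yq _.
pose s := seg f v y ++ seg z q p ++ seg f x u.
have afx k : x <= k <= y -> nadj a (f k).
  by have [->|kx] := eqVneq k x => // hk; apply: af; nlia.
have fuv : f u -- f v by rewrite ev; geo_leaf.
have hs : ihole s.
  by apply: ihole_catI; rewrite ?seg_neq0 // ?size_cat ?size_seg; try nlia; geo.
have hhs : head (f v) s = f v by rewrite /s head_segcat.
have hls : last (f v) s = f u by rewrite /s !last_cat last_seg.
have Ks : all (Kend (Kc T) (f v) (f u)) s.
  rewrite !all_cat; apply/and3P; split; apply: all_seg => i hi.
  - have [->|ni] := eqVneq i v; first exact: Kend_l.
    by apply/Kend_n/nKv; range_lia.
  - by apply/Kend_n/nKz; range_lia.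
  have [->|ni] := eqVneq i u; first exact: Kend_r.
  by apply/Kend_n/nKu; range_lia.
apply: (hole_two_complete_list hG (fr_cc fr) hs hhs hls Kv Ku Ks K0 (p := seg z 1 (minn p q).-1)).
- by rewrite !all_cat; apply/and3P; split; apply: all_seg => i hi; geo_leaf.
- apply: ipath_path; change (ipath ([:: a] ++ seg z 1 (minn p q).-1)).
  by geo.
- by apply: in_seg => i hi; apply/andP; split; geo_leaf.
rewrite last_seg !has_cat; apply/orP; right; apply/orP; left.
by apply: (has_seg (k := minn p q)); [nlia|geo_leaf].
Qed.

(** Starting from the first neighbours [z i] of [f x] and [z k] of [f y], keep the later one and
    advance the earlier one to the last neighbour that does not pass it. *)
Lemma near_start : exists i k p q, [/\ near p q, 1 <= i <= n /\ 1 <= k <= n,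
  f x -- z i /\ (forall j, 1 <= j < i -> nadj (f x) (z j)),
  f y -- z k /\ (forall j, 1 <= j < k -> nadj (f y) (z j))
  & (q = k /\ i <= p <= k) \/ (p = i /\ k <= q <= i)].
Proof.
have ex w : touch z n w -> (forall i, 1 <= i <= n -> w != z i) ->
    exists i, [/\ 1 <= i <= n, w -- z i & forall j, 1 <= j < i -> nadj w (z j)].
  move=> /existsP [[i ilt] /= /andP[i0 wi]] nw.
  have wi' : w -- z i by move: wi; rewrite /nadj nw ?negbK //=; nlia.
  have [k [hk fk nk]] := @first_index (fun j => w -- z j) 1 i i0 wi'.
  exists k; split=> //; first by nlia.
  by move=> j hj; apply: nadjI; [apply: nw; nlia|apply: nk; nlia].
have [i [hi xi ni]] := ex _ tx fxz; have [k [hk yk nk]] := ex _ ty fyz.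
have [ik|ki] := leqP i k.
  have [p [hp xp np]] := @last_index (fun j => f x -- z j) i k ik xi.
  exists i, k, p, k; split=> //; last by left.
  split=> //; try nlia.
  move=> j hj; split=> jn; last by apply: nk; nlia.
  by apply: nadjI; [apply: fxz; nlia|apply: np; nlia].
have [q [hq yq nq]] := @last_index (fun j => f y -- z j) k i (ltnW ki) yk.
exists i, k, i, q; split=> //; last by right.
split=> //; try nlia.
move=> j hj; split=> jn; first by apply: ni; nlia.
by apply: nadjI; [apply: fyz; nlia|apply: nq; nlia].
Qed.

Lemma first_x i : 1 <= i <= n -> f x -- z i -> (forall j, 1 <= j < i -> nadj (f x) (z j)) ->
  nadj a (f x) -> odd (i + (u - x)).
Proof.
move=> hi xi ni ax.
have afx k : x <= k <= y -> nadj a (f k).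
  by have [->|kx] := eqVneq k x => // hk; apply: af; nlia.
have := @pari_list _ _ ([:: a] ++ seg z 1 i ++ seg f x u) a (f u) HK.
have fz p q : x <= p < y -> 1 <= q <= i -> (p != x) || (q != i) -> nadj (f p) (z q).
  move=> hp hq; have [->|py] := eqVneq p x => /= h; first by apply: ni; nlia.
  by apply: nz; nlia.
have ip : ipath ([:: a] ++ seg z 1 i ++ seg f x u) by geo.
rewrite !last_cat last_seg /= (Kend_l _ _ _) => /(_ isT erefl erefl ip K0 Ku).
rewrite size_cat !size_seg.
have -> : all (Kend (Kc T) a (f u)) (seg z 1 i ++ seg f x u).
  rewrite !all_cat; apply/andP; split; apply: all_seg => j hj.
    by apply/Kend_n/nKz; range_lia.
  have [->|nj] := eqVneq j u; first exact: Kend_r.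
  by apply/Kend_n/nKu; range_lia.
by move=> /(_ isT); nlia.
Qed.

Lemma first_y k : 1 <= k <= n -> f y -- z k -> (forall j, 1 <= j < k -> nadj (f y) (z j)) ->
  odd (k + (y - v)).
Proof.
move=> hk yk nk.
have := @pari_list _ _ ([:: a] ++ seg z 1 k ++ seg f y v) a (f v) HK.
have fz p q : x < p <= y -> 1 <= q <= k -> (p != y) || (q != k) -> nadj (f p) (z q).
  move=> hp hq; have [->|py] := eqVneq p y => /= h; first by apply: nk; nlia.
  by apply: nz; nlia.
have ip : ipath ([:: a] ++ seg z 1 k ++ seg f y v) by geo.
rewrite !last_cat last_seg /= (Kend_l _ _ _) => /(_ isT erefl erefl ip K0 Kv).
rewrite size_cat !size_seg.
have -> : all (Kend (Kc T) a (f v)) (seg z 1 k ++ seg f y v).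
  rewrite !all_cat; apply/andP; split; apply: all_seg => j hj.
    by apply/Kend_n/nKz; range_lia.
  have [->|nj] := eqVneq j v; first exact: Kend_r.
  by apply/Kend_n/nKv; range_lia.
by move=> /(_ isT); nlia.
Qed.

Lemma middle_adj : ~~ nadj a (f x).
Proof.
apply/negP => x1.
have [i [k [p [q [N [hi hk] [xi ni] [yk nk] hpq]]]]] := near_start.
have ev := near_edge N; have e1 := near_even N.
have ei := first_x hi xi ni x1; have ek := first_y hk yk nk.
(* The parities exclude that [p = i] and [q = k] hold together. So one of them has advanced, and
   both [p] and [q] exceed 1, as [near_a] requires. *)
by apply: (near_a N x1); case: hpq => [[? ?]|[? ?]]; nlia.
Qed.
End Middle.

Section Interval.
Variables (G : sgraph) (hG : class_A G).
Implicit Types (T : {set G}) (z f : nat -> G) (A B : pred G).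

(** By [middle_adj], applied from both ends of the path, a counterexample has [f x] next to [f 0]
    and [f y] next to [f r]. The remaining parities are then explicit. *)
Lemma interval_mid T z n A B f r x y u v : frame T z n A B -> ipf f 0 r -> A (f 0) -> B (f r) ->
  (forall k, 0 < k < r -> Kc T (f k) -> ~~ touch z n (f k)) ->
  0 < x -> x < u -> u < v -> v < y -> y < r -> touch z n (f x) -> touch z n (f y) ->
  (forall k, x < k < y -> ~~ touch z n (f k)) -> Kc T (f u) -> Kc T (f v) ->
  (forall k, x <= k < u -> ~~ Kc T (f k)) -> (forall k, v < k <= y -> ~~ Kc T (f k)) ->
  odd (v - u) = false.
Proof.
move=> fr hf Aa Bb hD x0 xu uv vy yr tx ty nt Ku Kv nKu nKv.
apply/negbTE/negP => od.
have fr' := frame_rev fr; have hf' := ipf_rev hf.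
have hfxy : ipf f x y by apply: (ipf_sub hf); nlia.
have hfyx : ipf (fun i => f (r - i)) (r - y) (r - x) by apply: (ipf_sub hf'); nlia.
have af k : x < k <= y -> nadj (f 0) (f k) by move=> hk; apply: (ipf_nadj hf); nlia.
have af' k : r - y < k <= r - x -> nadj (f (r - 0)) (f (r - k)).
  by move=> hk; apply: (ipf_nadj hf); nlia.
have x1 : x = 1.
  apply/eqP/negPn/negP => xn1; have := middle_adj hG fr hfxy Aa af xu uv vy tx ty nt Ku Kv nKu nKv od.
  by rewrite (ipf_nadj hf) //; nlia.
have E k : k <= r -> r - (r - k) = k by nlia.
have ntr k : r - y < k < r - x -> ~~ touch (fun i => z (n.+1 - i)) n (f (r - k)).
  by move=> hk; rewrite touch_rev; apply: nt; nlia.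
have nKr k : r - u < k <= r - x -> ~~ Kc T (f (r - k)) by move=> hk; apply: nKu; nlia.
have Eu : f (r - (r - u)) = f u by congr f; nlia.
have Ev : f (r - (r - v)) = f v by congr f; nlia.
have Ex : f (r - (r - x)) = f x by congr f; nlia.
have Ey : f (r - (r - y)) = f y by congr f; nlia.
have od' : odd (r - u - (r - v)) by nlia.
have Br : B (f (r - 0)) by rewrite subn0.
have y1 : r - y = 1.
  apply/eqP/negPn/negP => yn1.
  have : nadj (f (r - 0)) (f (r - (r - y))) by apply: (ipf_nadj hf); nlia.
  apply/negP; apply: (@middle_adj G hG T _ (fun i => f (r - i)) n (r - y) (r - x) (r - v) (r - u) B A (f (r - 0)) fr' hfyx);
    rewrite ?Eu ?Ev ?Ex ?Ey ?touch_rev //; try nlia.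
  by move=> k hk; apply: nKv; nlia.
have [i [k [p [q [N [hi hk] [xi ni] [yk nk] hpq]]]]] := near_start fr hfxy xu uv vy tx ty nt od.
have ev := near_edge hG fr hfxy xu uv vy nt Ku Kv nKu nKv od N.
have ne := near_even hG fr hfxy xu uv vy nt od.
have HK := roussel_rubio hG (fr_cc fr).
have nKz := fr_nK fr.
have nz k' i' : x < k' < y -> 1 <= i' <= n -> nadj (f k') (z i').
  by move=> hk'; apply/touchN/nt.
have n3 := fr_n fr; have on := fr_odd fr; have hz := fr_z fr.
have K0 := fr_AK fr Aa; have Kb := fr_BK fr Bb.
have bz j : 1 <= j < n -> nadj (f r) (z j) by apply: (fr_Bz fr).
have eu : odd u = false.
  have := @pari_list _ _ (seg f 0 u) (f 0) (f u) HK (seg_neq0 _ _ _) (head_seg _ _ _ _) (last_seg _ _ _ _).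
  have ip : ipath (seg f 0 u) by geo_leaf.
  have -> : all (Kend (Kc T) (f 0) (f u)) (seg f 0 u).
    apply: all_seg => j hj; have [->|nj] := eqVneq j 0; first exact: Kend_l.
    have [->|nj'] := eqVneq j u; first exact: Kend_r.
    by apply/Kend_n/nKu; range_lia.
  by move=> /(_ ip K0 Ku isT); rewrite size_seg; nlia.
have erv : odd (r - v) = false.
  have := @pari_list _ _ (seg f v r) (f v) (f r) HK (seg_neq0 _ _ _) (head_seg _ _ _ _) (last_seg _ _ _ _).
  have ip : ipath (seg f v r) by geo_leaf.
  have -> : all (Kend (Kc T) (f v) (f r)) (seg f v r).
    apply: all_seg => j hj; have [->|nj] := eqVneq j v; first exact: Kend_l.
    have [->|nj'] := eqVneq j r; first exact: Kend_r.
    by apply/Kend_n/nKv; range_lia.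
  by move=> /(_ ip Kv Kb isT); rewrite size_seg; nlia.
have ek := first_y hG fr hfxy Aa af xu uv vy nt Kv nKv od hk yk nk.
have fxz j : 1 <= j <= n -> f x != z j.
  move=> hj; apply: (neq_adj (x := f x.+1)); last by apply: nz; nlia.
  by apply: (ipf_adj hf); nlia.
have [I [hI xI nI]] := @last_index (fun j => f x -- z j) i n ltac:(nlia) xi.
have nI' j : I < j <= n -> nadj (f x) (z j).
  by move=> hj; apply: nadjI; [apply: fxz; nlia|apply: nI; nlia].
have eI : odd (n.+1 - I + (r - x - (r - u))).
  apply: (@first_y G hG T (fun i => z (n.+1 - i)) (fun i => f (r - i)) n (r - y) (r - x) (r - v) (r - u) B A (f (r - 0)) fr' hfyx);
    rewrite ?Eu ?Ev ?Ex ?Ey ?touch_rev //; try nlia.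
    by have -> : n.+1 - (n.+1 - I) = I by nlia.
  by move=> j hj; apply: nI'; nlia.
(* Otherwise [I] and [k] are a near pair, and [eI] and [ek] contradict [near_even]. The parity of
   [I] also gives [I < n], so the near pair [p], [q] stays below [n]. *)
have kI : k < I.
  rewrite ltnNge; apply/negP => Ik.
  have NI : near z f n x y I k.
    split=> //; try range_lia.
    move=> j hj; split=> jn; first by apply: nI'; range_lia.
    by apply: nk; range_lia.
  clear hpq; by have := ne _ _ NI; nlia.
have e1 := ne _ _ N.
case: N => hp hq xp yq hN.
have [pn qn] : p < n /\ q < n.
  have In : I < n by clear hpq e1; nlia.
  by clear e1 ek eI od' on eu erv; case: hpq => [[? ?]|[? ?]]; split; nlia.
clear hpq.
have fz1 a b : x <= a < y -> minn p q <= b <= maxn p q -> (a != x) || (b != p) -> nadj (f a) (z b).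
  move=> ha hb; have [->|ax] := eqVneq a x => /= hh; first by have [+ _] := hN b hb; apply; nlia.
  by apply: nz; range_lia.
have fz2 b : minn p q <= b <= maxn p q -> b != q -> nadj (f y) (z b).
  by move=> hb bq; have [_ +] := hN b hb; apply.
have fyr : f y -- f r by have -> : r = y.+1 by [nlia]; apply: (ipf_adj hf); nlia.
(* As [p] and [q] are below [n], the vertex [f r] sees none of the [z] used here, and the path is
   induced with only its ends complete. With [u] and [r - v] even, [v = u.+1] and [y.+1 = r], its
   parity contradicts [near_even]. *)
have := @pari_list _ _ (seg f u x ++ seg z p q ++ [:: f y] ++ [:: f r]) (f u) (f r) HK.
have ip : ipath (seg f u x ++ seg z p q ++ [:: f y] ++ [:: f r]) by geo.
rewrite head_segcat !last_cat /= => /(_ _ erefl erefl ip Ku Kb).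
rewrite !size_cat !size_seg => /(_ ltac:(range_lia)).
have -> : all (Kend (Kc T) (f u) (f r)) (seg f u x ++ seg z p q ++ [:: f y; f r]).
  rewrite !all_cat /= Kend_r !andbT; apply/and3P; split.
  - apply: all_seg => j hj; have [->|nj] := eqVneq j u; first exact: Kend_l.
    by apply/Kend_n/nKu; range_lia.
  - by apply: all_seg => j hj; apply/Kend_n/nKz; range_lia.
  by apply/Kend_n/nKv; range_lia.
by move=> /(_ isT) /=; nlia.
Qed.
End Interval.

(** * Paths between [A] and [B] that meet them only in their ends *)

Section GoodPaths.
Variables (G : sgraph) (hG : class_A G) (T : {set G}) (z : nat -> G) (n : nat) (A B : pred G).
Hypothesis fr : frame T z n A B.
Implicit Types (f : nat -> G) (s : seq G).

Lemma touch_A a : A a -> touch z n a.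
Proof.
move=> Aa; have n3 := fr_n fr; apply: (touchI (i := 1)); first by range_lia.
by rewrite /nadj (fr_A1 fr Aa) andbF.
Qed.

Lemma touch_B b : B b -> touch z n b.
Proof.
move=> Bb; have n3 := fr_n fr; apply: (touchI (i := n)); first by range_lia.
by rewrite /nadj (fr_Bn fr Bb) andbF.
Qed.

(** If one end of the interval is an end of the path, this is [interval_left], possibly reversed. If
    both are, the path and [z] form a hole and [n] is odd. If none is, the ends touch [z] and so are
    not complete, which leaves [u] and [v] strictly inside. *)
Lemma interval_even f r x y u v : ipf f 0 r -> A (f 0) -> B (f r) ->
  (forall k, 0 < k < r -> Kc T (f k) -> ~~ touch z n (f k)) ->
  x < y -> y <= r -> touch z n (f x) -> touch z n (f y) ->
  (forall k, x < k < y -> ~~ touch z n (f k)) -> x <= u -> u <= v -> v <= y ->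
  Kc T (f u) -> Kc T (f v) ->
  (forall k, x <= k < u -> ~~ Kc T (f k)) -> (forall k, v < k <= y -> ~~ Kc T (f k)) ->
  odd (v - u) = false.
Proof.
move=> hf Aa Bb hD xy yr tx ty nt xu uv vy Ku Kv nKu nKv.
have K0 := fr_AK fr Aa; have Kb := fr_BK fr Bb.
have [x0|x0] := posnP x.
  subst x; have u0 : u = 0.
    by apply/eqP; rewrite -leqn0 leqNgt; apply/negP => h; have := nKu 0 ltac:(range_lia); rewrite K0.
  subst u; rewrite subn0; have [yr'|yr'] := eqVneq y r; last first.
    by apply: (interval_left hG fr hf Aa Bb hD _ ty nt vy Kv nKv); range_lia.
  subst y; have ev : v = r.
    apply/eqP; rewrite eqn_leq vy leqNgt; apply/negP => h.
    by have := nKv r ltac:(range_lia); rewrite Kb.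
  subst v; have nz k i : 0 < k < r -> 1 <= i <= n -> nadj (f k) (z i).
    by move=> hk; apply/touchN/nt.
  have n3 := fr_n fr; have on := fr_odd fr; have hz := fr_z fr.
  have az1 := fr_A1 fr Aa; have bzn := fr_Bn fr Bb.
  have az i : 1 < i <= n -> nadj (f 0) (z i) by apply: (fr_Az fr).
  have bz i : 1 <= i < n -> nadj (f r) (z i) by apply: (fr_Bz fr).
  have ab : nadj (f 0) (f r) by apply: (fr_AB fr).
  have r1 : 1 < r.
    rewrite ltnNge; apply/negP => r1; have er : r = 1 by range_lia.
    by have /andP[_] := ab; rewrite er (ipf_adj hf (i := 0) (j := 1)) //; range_lia.
  have fz p q : 0 < p <= r -> 1 <= q <= n -> (p != r) || (q != n) -> nadj (f p) (z q).
    move=> hp hq; have [->|py] := eqVneq p r => /= h; first by apply: bz; range_lia.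
    by apply: nz; range_lia.
  have := @hole_even G hG [:: f 0] (seg f 1 r) (seg z n 1).
  rewrite !size_cat !size_seg => /(_ isT ltac:(range_lia) ltac:(range_lia) ltac:(simpl; range_lia) isT).
  suff h : ipath (seg f 1 r ++ seg z n 1) /\ link [:: f 0] (seg f 1 r) /\
      link (seg z n 1) [:: f 0].
    by case: h => [p1 [p2 p3]] /(_ p1 p2 p3) /=; nlia.
  by split; [|split]; geo.
have [yr'|yr'] := eqVneq y r.
  subst y; have ev : v = r.
    apply/eqP; rewrite eqn_leq vy leqNgt; apply/negP => h.
    by have := nKv r ltac:(range_lia); rewrite Kb.
  subst v; have fr' := frame_rev fr; have hf' := ipf_rev hf.
  have Ex : f (r - (r - x)) = f x by congr f; range_lia.
  have Eu : f (r - (r - u)) = f u by congr f; range_lia.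
  apply: (@interval_left G hG T _ n B A (fun i => f (r - i)) r (r - x) (r - u) fr' hf');
    rewrite ?Ex ?Eu ?subn0 ?subnn ?touch_rev //; try range_lia.
  - by move=> k hk; rewrite touch_rev; apply: hD; range_lia.
  - by move=> k hk; rewrite touch_rev; apply: nt; range_lia.
  by move=> k hk; apply: nKu; range_lia.
have [->|uv'] := eqVneq u v; first by rewrite subnn.
have nKt k : 0 < k < r -> touch z n (f k) -> ~~ Kc T (f k).
  by move=> hk; apply: contraTN => /(hD k hk).
have xu' : x != u by apply: contraTneq Ku => <-; apply: nKt => //; range_lia.
have vy' : v != y by apply: contraTneq Kv => ->; apply: nKt => //; range_lia.
by apply: (interval_mid hG fr hf Aa Bb hD _ _ _ _ _ tx ty nt Ku Kv nKu nKv); range_lia.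
Qed.

Lemma interval_kedg f r x y : ipf f 0 r -> A (f 0) -> B (f r) ->
  (forall k, 0 < k < r -> Kc T (f k) -> ~~ touch z n (f k)) ->
  x < y -> y <= r -> touch z n (f x) -> touch z n (f y) ->
  (forall k, x < k < y -> ~~ touch z n (f k)) -> odd (kedg (Kc T) f x y) = false.
Proof.
move=> hf Aa Bb hD xy yr tx ty nt; apply/negbTE/negP => od.
have [k [hk Kk Kk']] := kedg_ex (odd_gt0 od).
have [u [hu Ku nu]] := @first_index (fun q => Kc T (f q)) x k ltac:(range_lia) Kk.
have [v [hv Kv nv]] := @last_index (fun q => Kc T (f q)) k.+1 y ltac:(range_lia) Kk'.
have HK := roussel_rubio hG (fr_cc fr).
have hxy : ipf f x y by apply: (ipf_sub hf); range_lia.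
have e := @kedg_ext _ (Kc T) f x y u v HK hxy ltac:(range_lia) ltac:(range_lia) ltac:(range_lia)
  Ku Kv nu nv.
have := interval_even hf Aa Bb hD xy yr tx ty nt _ _ _ Ku Kv nu nv.
by rewrite -e od => /(_ ltac:(range_lia) ltac:(range_lia) ltac:(range_lia)).
Qed.

(** A complete inner vertex that touches [z] would by [fr_D] be adjacent to both ends, which is
    impossible on an induced path with at least three edges. Testing [f 1] and [f r.-1] is enough
    because [A] and [B] are cliques. *)
Lemma inner_untouched f r : ipf f 0 r -> 3 <= r -> A (f 0) -> B (f r) -> ~~ A (f 1) ->
  ~~ B (f r.-1) -> forall k, 0 < k < r -> Kc T (f k) -> ~~ touch z n (f k).
Proof.
move=> hf r3 Aa Bb nA nB k hk Kk.
have nAk : ~~ A (f k).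
  have [->//|k1] := eqVneq k 1; apply/negP => Ak.
  have /andP[] := ipf_nadj hf (i := 0) (j := k) ltac:(range_lia) ltac:(range_lia) ltac:(range_lia).
  by move=> /(fr_AA fr Aa Ak) ->.
have nBk : ~~ B (f k).
  have [->//|k1] := eqVneq k r.-1; apply/negP => Bk.
  have /andP[] := ipf_nadj hf (i := r) (j := k) ltac:(range_lia) ltac:(range_lia) ltac:(range_lia).
  by move=> /(fr_BB fr Bb Bk) ->.
have [h|[h1 h2]] := fr_D fr Kk nAk nBk.
  rewrite negb_exists; apply/forallP => -[i ilt] /=; rewrite negb_and negbK -leqNgt leqn0.
  by case: eqVneq => //= i0; apply: h; range_lia.
have k1 : k = 1.
  apply/eqP/negPn/negP => k1.
  have /andP[_] := ipf_nadj hf (i := k) (j := 0) ltac:(range_lia) ltac:(range_lia) ltac:(range_lia).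
  by rewrite h1.
have /andP[_] := ipf_nadj hf (i := k) (j := r) ltac:(range_lia) ltac:(range_lia) ltac:(range_lia).
by rewrite h2.
Qed.

(** Both ends touch [z], so the path is a union of intervals between consecutive touching vertices,
    each with an even number of complete edges; and this number has the parity of the length. *)
Lemma good_even f r : ipf f 0 r -> A (f 0) -> B (f r) -> ~~ A (f 1) -> ~~ B (f r.-1) ->
  odd r = false.
Proof.
move=> hf Aa Bb nA nB; apply/negbTE/negP => od.
have ab : nadj (f 0) (f r) by apply: (fr_AB fr).
have [r3|r3] := leqP 3 r; last first.
  have er : r = 1 by nlia.
  by have /andP[_] := ab; rewrite er (ipf_adj hf (i := 0) (j := 1)) //; range_lia.
have hD := inner_untouched hf r3 Aa Bb nA nB.
have HK := roussel_rubio hG (fr_cc fr).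
have ok : odd (kedg (Kc T) f 0 r).
  by rewrite (pari_kedg HK hf) ?subn0 //; [apply: (fr_AK fr)|apply: (fr_BK fr)].
have [l [m [[_ mr] lm [tl tm] nlm]]] :=
  @split_odd _ (fun k => touch z n (f k)) _ f 0 r ltac:(range_lia) (touch_A Aa) (touch_B Bb) ok.
by rewrite (interval_kedg hf Aa Bb hD lm mr tl tm nlm).
Qed.

Definition Gend (a b e : G) : bool := (A e ==> (e == a)) && (B e ==> (e == b)).

Lemma good_even_list s a b : ipath s -> 0 < size s -> head a s = a -> last a s = b -> A a -> B b ->
  all (Gend a b) s -> odd (size s).
Proof.
move=> ip s0 ha hb Aa Bb /allP hs.
have nab : a != b by have /andP[] := fr_AB fr Aa Bb.
have s1 : 1 < size s.
  case: s ip s0 ha hb hs => [|x [|y s]] //= _ _ -> e _; by rewrite e eqxx in nab.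
have hf := ipath_ipf a ip; set f := nth a s in hf.
have f0 : f 0 = a by rewrite /f nth0.
have fl : f (size s).-1 = b by rewrite /f nth_last.
have Ain k : k < size s -> k != 0 -> ~~ A (f k).
  move=> lk k0; apply/negP => Ak; have := hs _ (mem_nthG a lk); rewrite /Gend -/(f k) Ak /=.
  by rewrite -f0 (negbTE (ipf_neq hf _ _ k0)) //; range_lia.
have Bin k : k < size s -> k != (size s).-1 -> ~~ B (f k).
  move=> lk k0; apply/negP => Ak; have := hs _ (mem_nthG a lk); rewrite /Gend -/(f k) Ak /=.
  by rewrite -fl (negbTE (ipf_neq hf _ _ k0)) ?andbF //; range_lia.
have := @good_even f (size s).-1 hf; rewrite f0 fl => /(_ Aa Bb).
have [s2|s2] := leqP (size s) 2.
  have es : size s = 2 by range_lia.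
  have /andP[_] := fr_AB fr Aa Bb.
  by rewrite -f0 -fl (ipf_adj hf (i := 0) (j := (size s).-1)) //; range_lia.
by rewrite Ain ?Bin //; range_lia.
Qed.
End GoodPaths.

(** * Two good paths joined only at their starts and at their ends *)

Section Rungs.
Variables (G : sgraph) (hG : class_A G).
Implicit Types (T : {set G}) (f g z : nat -> G) (A B : pred G).

Record goodp A B f p : Prop := Goodp {
  gd_ipf : ipf f 0 p;
  gd_A : A (f 0);
  gd_B : B (f p);
  gd_nA : forall k, 0 < k <= p -> ~~ A (f k);
  gd_nB : forall k, k < p -> ~~ B (f k) }.

Lemma goodp_rev A B f p : goodp A B f p -> goodp B A (fun i => f (p - i)) p.
Proof.
case=> h a b nA nB; split.
- exact: ipf_rev.
- by rewrite subn0.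
- by rewrite subnn.
- by move=> k hk; apply: nB; range_lia.
by move=> k hk; apply: nA; range_lia.
Qed.

Lemma Gend_n A B a b e : ~~ A e -> ~~ B e -> Gend A B a b e.
Proof. by rewrite /Gend => /negbTE -> /negbTE ->. Qed.

Lemma goodp_Gend A B f p x y k : goodp A B f p -> k <= p -> (k == 0) ==> (f k == x) ->
  (k == p) ==> (f k == y) -> Gend A B x y (f k).
Proof.
case=> h a b nA nB kp h0 hp; rewrite /Gend; apply/andP; split; apply/implyP => Ak.
  have [k0|k0] := eqVneq k 0; first by move: h0; rewrite k0.
  by have := nA k ltac:(range_lia); rewrite Ak.
have [k0|k0] := eqVneq k p; first by move: hp; rewrite k0 eqxx.
by have := nB k ltac:(range_lia); rewrite Ak.
Qed.

Lemma frame_zG T z n A B x y i : frame T z n A B -> 1 <= i <= n -> Gend A B x y (z i).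
Proof.
move=> fr hi; have nK := fr_nK fr hi; apply: Gend_n; apply: contra nK.
  exact: (fr_AK fr).
exact: (fr_BK fr).
Qed.

Lemma goodp_even T z n A B f p : frame T z n A B -> goodp A B f p -> odd p = false.
Proof.
move=> fr [h a b nA nB]; have [->//|p0] := posnP p.
by apply: (good_even hG fr h a b); [apply: nA|apply: nB]; range_lia.
Qed.

(** [z m] is the first vertex of [z] that sees the inside of one of the paths, and [m < n] keeps it
    away from [f p] and [g q]. With [f y] its last neighbour on [f], the good path
    [g 0, z 1, ..., z m, f y, ..., f p] clashes with a hole through [f p] and [g q]: the one that
    [z m] closes if it also sees the inside of [g], and otherwise the one that returns along all of
    [g]. *)
Lemma rungs_half T z n A B f p g q m y0 : frame T z n A B -> goodp A B f p -> goodp A B g q ->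
  f 0 -- g 0 -> f p -- g q ->
  (forall k l, k <= p -> l <= q -> (k != 0) || (l != 0) -> (k != p) || (l != q) -> nadj (f k) (g l)) ->
  1 <= m < n ->
  (forall i k, 1 <= i < m -> 0 < k < p -> nadj (z i) (f k)) ->
  (forall i l, 1 <= i < m -> 0 < l < q -> nadj (z i) (g l)) ->
  0 < y0 < p -> z m -- f y0 -> False.
Proof.
move=> fr gf gg fg0 fgp cross hm zf zg hy0 zy0.
have [hf Af Bf nAf nBf] := gf; have [hgi Ag Bg nAg nBg] := gg.
have n3 := fr_n fr; have on := fr_odd fr; have hz := fr_z fr.
have ep := goodp_even fr gf; have eq := goodp_even fr gg.
have p2 : 1 < p by range_lia.
have q2 : 1 < q.
  rewrite ltnNge; apply/negP => q1; have q0 : q = 0 by nlia.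
  by have := nBg; have := nAg; move: Bg; rewrite q0 => Bg0; have := fr_AB fr Ag Bg0; rewrite /nadj eqxx.
have f0z i : 1 < i <= n -> nadj (f 0) (z i) by apply: (fr_Az fr).
have fpz i : 1 <= i < n -> nadj (f p) (z i) by apply: (fr_Bz fr).
have g0z i : 1 < i <= n -> nadj (g 0) (z i) by apply: (fr_Az fr).
have gqz i : 1 <= i < n -> nadj (g q) (z i) by apply: (fr_Bz fr).
have f0z1 := fr_A1 fr Af; have g0z1 := fr_A1 fr Ag.
have zmf k : 0 < k < p -> z m != f k.
  move=> hk; have [e|m1] := eqVneq m 1.
    by rewrite e; apply: (neq_adj (x := g 0)) => //; rewrite nadj_sym; apply: cross; range_lia.
  apply: (neq_adj (x := z m.-1)); last by apply: zf; range_lia.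
  by apply: (ipf_adj hz); range_lia.
have zmg k : 0 < k < q -> z m != g k.
  move=> hk; have [e|m1] := eqVneq m 1.
    by rewrite e; apply: (neq_adj (x := f 0)) => //; apply: cross; range_lia.
  apply: (neq_adj (x := z m.-1)); last by apply: zg; range_lia.
  by apply: (ipf_adj hz); range_lia.
have [y [hy zy ny]] := @last_index (fun k => z m -- f k) y0 p.-1 ltac:(range_lia) zy0.
have zfy i k : 1 <= i <= m -> y <= k <= p -> (i != m) || (k != y) -> nadj (z i) (f k).
  move=> hi hk h; have [->|kp] := eqVneq k p; first by rewrite nadj_sym; apply: fpz; range_lia.
  have [e|im] := eqVneq i m; last by apply: zf; range_lia.
  by rewrite e; apply: nadjI; [apply: zmf; range_lia|apply: ny; range_lia].
have P1 : odd (m + (p - y)).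
  have := @good_even_list G hG T z n A B fr ([:: g 0] ++ seg z 1 m ++ seg f y p) (g 0) (f p).
  rewrite !last_cat last_seg /= => h; have {h} := h _ isT erefl erefl Ag Bf.
  have ip : ipath ([:: g 0] ++ seg z 1 m ++ seg f y p) by geo.
  rewrite size_cat !size_seg => /(_ ip) h; have {h} := h _.
  have -> : [&& Gend A B (g 0) (f p) (g 0) & all (Gend A B (g 0) (f p)) (seg z 1 m ++ seg f y p)].
    rewrite all_cat; apply/and3P; split.
    - by apply: (goodp_Gend gg) => //=; rewrite ?eqxx //; apply/implyP; range_lia.
    - by apply: all_seg => i hi; apply: (frame_zG _ _ fr); range_lia.
    apply: all_seg => i hi; apply: (goodp_Gend gf); first by range_lia.
      by apply/implyP; range_lia.
    by apply/implyP => /eqP ->.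
  by move=> /(_ isT); nlia.
have [has_g|no_g] := boolP [exists l : 'I_q, (0 < l) && (z m -- g l)].
  have /existsP [[l lq] /= /andP[l0 zl]] := has_g.
  have [w [hw zw nw]] := @last_index (fun k => z m -- g k) l q.-1 ltac:(range_lia) zl.
  have zgw i k : 1 <= i <= m -> w <= k <= q -> (i != m) || (k != w) -> nadj (z i) (g k).
    move=> hi hk h; have [->|kp] := eqVneq k q; first by rewrite nadj_sym; apply: gqz; range_lia.
    have [e|im] := eqVneq i m; last by apply: zg; range_lia.
    by rewrite e; apply: nadjI; [apply: zmg; range_lia|apply: nw; range_lia].
  have P2 : odd (m + (q - w)).
    have := @good_even_list G hG T z n A B fr ([:: f 0] ++ seg z 1 m ++ seg g w q) (f 0) (g q).
    rewrite !last_cat last_seg /= => h; have {h} := h _ isT erefl erefl Af Bg.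
    have ip : ipath ([:: f 0] ++ seg z 1 m ++ seg g w q) by geo.
    rewrite size_cat !size_seg => /(_ ip) h; have {h} := h _.
    have -> : [&& Gend A B (f 0) (g q) (f 0) & all (Gend A B (f 0) (g q)) (seg z 1 m ++ seg g w q)].
      rewrite all_cat; apply/and3P; split.
      - by apply: (goodp_Gend gf) => //=; rewrite ?eqxx //; apply/implyP; range_lia.
      - by apply: all_seg => i hi; apply: (frame_zG _ _ fr); range_lia.
      apply: all_seg => i hi; apply: (goodp_Gend gg); first by range_lia.
        by apply/implyP; range_lia.
      by apply/implyP => /eqP ->.
    by move=> /(_ isT); nlia.
  have zfm k : y <= k <= p -> k != y -> nadj (z m) (f k) by move=> *; apply: zfy; range_lia.
  have zgm k : w <= k <= q -> k != w -> nadj (z m) (g k) by move=> *; apply: zgw; range_lia.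
  have := @hole_even G hG [:: z m] (seg f y p) (seg g q w).
  rewrite !size_cat !size_seg => /(_ isT ltac:(range_lia) ltac:(range_lia) ltac:(simpl; range_lia) isT).
  suff h : ipath (seg f y p ++ seg g q w) /\ link [:: z m] (seg f y p) /\
      link (seg g q w) [:: z m].
    by case: h => [p1 [p3 p4]] /(_ p1 p3 p4) /=; nlia.
  by split; [|split]; geo.
have zmgl l : 0 < l < q -> nadj (z m) (g l).
  move=> hl; apply: nadjI; first exact: zmg.
  apply: contraNN no_g => h; apply/existsP; exists (Ordinal (ltac:(range_lia) : l < q)).
  by rewrite /= h andbT; range_lia.
have zgl i l : 1 <= i <= m -> 0 < l <= q -> nadj (z i) (g l).
  move=> hi hl; have [->|lq] := eqVneq l q; first by rewrite nadj_sym; apply: gqz; range_lia.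
  have [->|im] := eqVneq i m; first by apply: zmgl; range_lia.
  by apply: zg; range_lia.
have := @hole_even G hG [:: g 0] (seg z 1 m) (seg f y p ++ seg g q 1).
rewrite !size_cat !size_seg => /(_ isT ltac:(range_lia) ltac:(range_lia) ltac:(simpl; range_lia) isT).
suff h : ipath (seg z 1 m ++ seg f y p ++ seg g q 1) /\ link [:: g 0] (seg z 1 m) /\
    link (seg f y p ++ seg g q 1) [:: g 0].
  by case: h => [p1 [p3 p4]] /(_ p1 p3 p4) /=; nlia.
by split; [|split]; geo.
Qed.

Definition rung_touch f p g q (v : G) : bool :=
  [exists k : 'I_p, (0 < k) && ~~ nadj v (f k)] || [exists l : 'I_q, (0 < l) && ~~ nadj v (g l)].

Lemma rung_touchN f p g q v : ~~ rung_touch f p g q v ->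
  (forall k, 0 < k < p -> nadj v (f k)) /\ (forall l, 0 < l < q -> nadj v (g l)).
Proof.
rewrite negb_or !negb_exists => /andP[/forallP h1 /forallP h2]; split=> k /andP[k0 kp].
  by have := h1 (Ordinal kp); rewrite /= k0 negbK.
by have := h2 (Ordinal kp); rewrite /= k0 negbK.
Qed.

Lemma rungs_first T z n A B f p g q m : frame T z n A B -> goodp A B f p -> goodp A B g q ->
  f 0 -- g 0 -> f p -- g q ->
  (forall k l, k <= p -> l <= q -> (k != 0) || (l != 0) -> (k != p) || (l != q) -> nadj (f k) (g l)) ->
  1 <= m < n -> rung_touch f p g q (z m) ->
  (forall i, 1 <= i < m -> ~~ rung_touch f p g q (z i)) -> False.
Proof.
move=> fr gf gg fg0 fgp cross hm tm nm.
have [hf Af Bf nAf nBf] := gf; have [hgi Ag Bg nAg nBg] := gg.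
have n3 := fr_n fr; have hz := fr_z fr.
have ep := goodp_even fr gf; have eq := goodp_even fr gg.
have cross' k l : k <= q -> l <= p -> (k != 0) || (l != 0) -> (k != q) || (l != p) -> nadj (g k) (f l).
  by move=> *; rewrite nadj_sym; apply: cross; range_lia.
have zf i k : 1 <= i < m -> 0 < k < p -> nadj (z i) (f k) by move=> /nm/rung_touchN[h _]; apply: h.
have zg i l : 1 <= i < m -> 0 < l < q -> nadj (z i) (g l) by move=> /nm/rung_touchN[_ h]; apply: h.
case/orP: tm => /existsP [[k kp] /= /andP[k0 nk]].
  apply: (rungs_half fr gf gg fg0 fgp cross hm zf zg (y0 := k)); first by range_lia.
  move: nk; rewrite /nadj negb_and !negbK => /orP[/eqP e|//]; exfalso.
  have [m1|m1] := eqVneq m 1.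
    have := fr_A1 fr Ag; rewrite -m1 e; have /andP[_] := cross' 0 k ltac:(range_lia) ltac:(range_lia) ltac:(range_lia) ltac:(range_lia).
    by move/negbTE ->.
  have /andP[_] := zf m.-1 k ltac:(range_lia) ltac:(range_lia).
  by rewrite -e (ipf_adj hz) //; range_lia.
have fg0' : g 0 -- f 0 by rewrite adj_sym.
have fgp' : g q -- f p by rewrite adj_sym.
apply: (rungs_half fr gg gf fg0' fgp' cross' hm zg zf (y0 := k)); first by range_lia.
move: nk; rewrite /nadj negb_and !negbK => /orP[/eqP e|//]; exfalso.
have [m1|m1] := eqVneq m 1.
  have := fr_A1 fr Af; rewrite -m1 e; have /andP[_] := cross 0 k ltac:(range_lia) ltac:(range_lia) ltac:(range_lia) ltac:(range_lia).
  by move/negbTE ->.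
have /andP[_] := zg m.-1 k ltac:(range_lia) ltac:(range_lia).
by rewrite -e (ipf_adj hz) //; range_lia.
Qed.

(** If some [z i] sees the inside of a path, take the first one; when [z n] does, reversing the
    frame makes it the first with index 1. If none does, [z 1, ..., z n] and the two paths form a
    prism. *)
Lemma rungs T z n A B f p g q : frame T z n A B -> goodp A B f p -> goodp A B g q ->
  f 0 -- g 0 -> f p -- g q ->
  (forall k l, k <= p -> l <= q -> (k != 0) || (l != 0) -> (k != p) || (l != q) -> nadj (f k) (g l)) ->
  False.
Proof.
move=> fr gf gg fg0 fgp cross.
have [hf Af Bf nAf nBf] := gf; have [hgi Ag Bg nAg nBg] := gg.
have n3 := fr_n fr; have on := fr_odd fr; have hz := fr_z fr.
have ep := goodp_even fr gf; have eq := goodp_even fr gg.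
have nAB x : A x -> B x -> False by move=> a b; have := fr_AB fr a b; rewrite /nadj eqxx.
have p2 : 1 < p.
  rewrite ltnNge; apply/negP => p1; have p0 : p = 0 by nlia.
  by move: Bf; rewrite p0; apply: nAB.
have q2 : 1 < q.
  rewrite ltnNge; apply/negP => p1; have p0 : q = 0 by nlia.
  by move: Bg; rewrite p0; apply: nAB.
have [tn|ntn] := boolP (rung_touch f p g q (z n)).
  have fr' := frame_rev fr; have gf' := goodp_rev gf; have gg' := goodp_rev gg.
  apply: (@rungs_first T (fun i => z (n.+1 - i)) n B A (fun k => f (p - k)) p
      (fun k => g (q - k)) q 1 fr' gf' gg'); rewrite ?subn0 ?subnn ?subn1 //.
  - by move=> k l kp lq h1 h2; apply: cross; range_lia.
  - by range_lia.
  - move: tn; rewrite /rung_touch => /orP[]/existsP[[k kp] /= /andP[k0 nk]]; apply/orP.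
      left; apply/existsP; exists (Ordinal (ltac:(range_lia) : p - k < p)) => /=.
      by have -> : p - (p - k) = k by [range_lia]; rewrite nk andbT; range_lia.
    right; apply/existsP; exists (Ordinal (ltac:(range_lia) : q - k < q)) => /=.
    by have -> : q - (q - k) = k by [range_lia]; rewrite nk andbT; range_lia.
  by move=> i; range_lia.
have [h|nt] := boolP [exists i : 'I_n, (0 < i) && rung_touch f p g q (z i)].
  have /existsP [[i ilt] /= /andP[i0 ti]] := h.
  have [m [hm tm nm]] := @first_index (fun i => rung_touch f p g q (z i)) 1 i i0 ti.
  by apply: (rungs_first fr gf gg fg0 fgp cross (m := m)) => //; range_lia.
have tN i : 1 <= i <= n -> (forall k, 0 < k < p -> nadj (z i) (f k)) /\
                       (forall l, 0 < l < q -> nadj (z i) (g l)).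
  move=> hi; apply: rung_touchN; have [->//|ni] := eqVneq i n.
  apply: contraNN nt => h; apply/existsP; exists (Ordinal (ltac:(range_lia) : i < n)).
  by rewrite /= h andbT; range_lia.
have zf i k : 1 <= i <= n -> 0 < k < p -> nadj (z i) (f k) by move=> /tN[h _]; apply: h.
have zg i l : 1 <= i <= n -> 0 < l < q -> nadj (z i) (g l) by move=> /tN[_ h]; apply: h.
have f0z i : 1 < i <= n -> nadj (f 0) (z i) by apply: (fr_Az fr).
have fpz i : 1 <= i < n -> nadj (f p) (z i) by apply: (fr_Bz fr).
have g0z i : 1 < i <= n -> nadj (g 0) (z i) by apply: (fr_Az fr).
have gqz i : 1 <= i < n -> nadj (g q) (z i) by apply: (fr_Bz fr).
have f0z1 := fr_A1 fr Af; have g0z1 := fr_A1 fr Ag.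
have fpzn := fr_Bn fr Bf; have gqzn := fr_Bn fr Bg.
have z1f k : 0 < k <= p -> nadj (z 1) (f k).
  by move=> hk; have [->|kp] := eqVneq k p; [rewrite nadj_sym; apply: fpz|apply: zf]; range_lia.
have z1g k : 0 < k <= q -> nadj (z 1) (g k).
  by move=> hk; have [->|kp] := eqVneq k q; [rewrite nadj_sym; apply: gqz|apply: zg]; range_lia.
have zif i k : 1 < i <= n -> k <= p -> (i != n) || (k != p) -> nadj (z i) (f k).
  move=> hi hk h; have [->|k0] := eqVneq k 0; first by rewrite nadj_sym; apply: f0z.
  have [e|kp] := eqVneq k p; last by apply: zf; range_lia.
  by rewrite e nadj_sym; apply: fpz; range_lia.
have zig i k : 1 < i <= n -> k <= q -> (i != n) || (k != q) -> nadj (z i) (g k).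
  move=> hi hk h; have [->|k0] := eqVneq k 0; first by rewrite nadj_sym; apply: g0z.
  have [e|kp] := eqVneq k q; last by apply: zg; range_lia.
  by rewrite e nadj_sym; apply: gqz; range_lia.
have f0g k : 0 < k <= q -> nadj (f 0) (g k) by move=> hk; apply: cross; range_lia.
have g0f k : 0 < k <= p -> nadj (f k) (g 0) by move=> hk; apply: cross; range_lia.
by apply: (@no_prism G hG [:: z 1] (seg z 2 n) [:: f 0] (seg f 1 p) [:: g 0] (seg g 1 q));
  rewrite ?seg_neq0 //; geo.
Qed.
End Rungs.

(** * Two good paths whose next contact is a triangle *)

Section Tripods.
Variables (G : sgraph) (hG : class_A G).

Lemma path_cons_ipath (x : G) s : ipath s -> 0 < size s -> x -- head x s -> path adj x s.
Proof. by case: s => //= y s ip _ ->; apply: ipath_path. Qed.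

Variables (T : {set G}) (z f g : nat -> G) (n p q c j : nat) (A B : pred G).
Hypotheses (fr : frame T z n A B) (gf : goodp A B f p) (gg : goodp A B g q).
Hypotheses (fg0 : f 0 -- g 0) (hc : 1 <= c < p) (hj : 1 <= j < q).
Hypothesis g0f : forall k, 0 < k <= p -> nadj (g 0) (f k).
Hypothesis f0g : forall l, 0 < l <= q -> nadj (f 0) (g l).
Hypothesis fg : forall k l, k < c -> 0 < l <= q -> nadj (f k) (g l).
Hypotheses (cj : f c -- g j) (cj' : f c -- g j.+1).
Hypothesis cg : forall l, 0 < l <= q -> l != j -> l != j.+1 -> nadj (f c) (g l).
Hypothesis ecj : odd c = odd j.

Let hf := gd_ipf gf.
Let hg := gd_ipf gg.
Let n3 := fr_n fr.
Let on := fr_odd fr.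
Let hz := fr_z fr.
Let HK := roussel_rubio hG (fr_cc fr).
Let Kf0 := fr_AK fr (gd_A gf).
Let Kg0 := fr_AK fr (gd_A gg).
Let Kgq := fr_BK fr (gd_B gg).
Let gqz i : 1 <= i < n -> nadj (g q) (z i). Proof. exact: (fr_Bz fr (gd_B gg)). Qed.
Let f0z i : 1 < i <= n -> nadj (f 0) (z i). Proof. exact: (fr_Az fr (gd_A gf)). Qed.
Let g0z i : 1 < i <= n -> nadj (g 0) (z i). Proof. exact: (fr_Az fr (gd_A gg)). Qed.

Let fgc k l : k <= c -> 0 < l <= j -> (k != c) || (l != j) -> nadj (f k) (g l).
Proof.
move=> kc hl h; have [e|nk] := eqVneq k c; last by apply: fg; range_lia.
by rewrite e; apply: cg; range_lia.
Qed.

Let fgc' k l : k <= c -> j < l <= q -> (k != c) || (l != j.+1) -> nadj (f k) (g l).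
Proof.
move=> kc hl h; have [e|nk] := eqVneq k c; last by apply: fg; range_lia.
by rewrite e; apply: cg; range_lia.
Qed.

Let hole_c : ihole (seg f 0 c ++ seg g j 1 ++ seg g 0 0).
Proof.
by apply: ihole_catI; rewrite ?seg_neq0 // ?size_cat ?size_seg; try range_lia; geo.
Qed.

(** From each vertex of the triangle [f c, g j, g j.+1] walk along its path to the nearest complete
    vertex: [f u], [g v], [g w]. If at most one triangle vertex is complete, the three connections
    through the triangle all have even length, while the parities of these lengths cannot all agree.
    The connection from [f u] to [g v] fails only for [u = v = 0]; then [f 0] and [g 0] are the only
    complete vertices of a hole, which [g w] contradicts directly or through a prism. *)
Lemma tripod_T : [|| Kc T (f c) && Kc T (g j), Kc T (f c) && Kc T (g j.+1)
   | Kc T (g j) && Kc T (g j.+1)].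
Proof.
apply/negPn/negP; rewrite !negb_or !negb_and => /and3P[h1 h2 h3].
have [u [hu Ku nu]] := @last_index (fun k => Kc T (f k)) 0 c (leq0n c) Kf0.
have [v [hv Kv nv]] := @last_index (fun k => Kc T (g k)) 0 j (leq0n j) Kg0.
have [w [hw Kw nw]] := @first_index (fun k => Kc T (g k)) j.+1 q ltac:(range_lia) Kgq.
have E1 : odd (c - u + (w - j.+1)).
  have := @pari_list _ _ (seg f u c ++ seg g j.+1 w) (f u) (g w) HK.
  rewrite head_segcat last_cat last_seg size_cat !size_seg.
  have ip : ipath (seg f u c ++ seg g j.+1 w) by geo.
  move=> /(_ ltac:(range_lia) erefl erefl ip Ku Kw).
  have -> : all (Kend (Kc T) (f u) (g w)) (seg f u c ++ seg g j.+1 w).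
    rewrite all_cat; apply/andP; split; apply: all_seg => k hk.
      have [->|nk] := eqVneq k u; first exact: Kend_l.
      by apply/Kend_n/nu; range_lia.
    have [->|nk] := eqVneq k w; first exact: Kend_r.
    by apply/Kend_n/nw; range_lia.
  have [e|ne] := boolP ((u == c) && (w == j.+1)).
    by case/andP: e => /eqP eu /eqP ew; move: h2; rewrite -{1}eu -ew Ku Kw.
  by move=> /(_ isT); nlia.
have E2 : odd (j - v + (w - j.+1)).
  have := @pari_list _ _ (seg g v w) (g v) (g w) HK (seg_neq0 _ _ _) (head_seg _ _ _ _) (last_seg _ _ _ _).
  have ip : ipath (seg g v w) by geo_leaf.
  have -> : all (Kend (Kc T) (g v) (g w)) (seg g v w).
    apply: all_seg => k hk.
    have [->|nk] := eqVneq k v; first exact: Kend_l.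
    have [->|nk'] := eqVneq k w; first exact: Kend_r.
    by have [kj|kj] := leqP k j; apply/Kend_n; [apply: nv|apply: nw]; range_lia.
  rewrite size_seg => /(_ ip Kv Kw isT).
  have [e|ne] := boolP ((v == j) && (w == j.+1)).
    by case/andP: e => /eqP eu /eqP ew; move: h3; rewrite -{1}eu -ew Kv Kw.
  by nlia.
have [uv0|uv0] := boolP ((u == 0) && (v == 0)); last first.
  have := @pari_list _ _ (seg f u c ++ seg g j v) (f u) (g v) HK.
  rewrite head_segcat last_cat last_seg size_cat !size_seg.
  have ip : ipath (seg f u c ++ seg g j v).
    have fgz k l : u <= k <= c -> v <= l <= j -> (k != c) || (l != j) -> nadj (f k) (g l).
      move=> hk hl h; have [l0|l0] := posnP l; last by apply: fgc; range_lia.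
      rewrite l0 nadj_sym; apply: g0f; have [k0|k0] := posnP k; last by range_lia.
      by move: uv0; rewrite k0 l0 in hk hl; range_lia.
    by geo.
  move=> /(_ ltac:(range_lia) erefl erefl ip Ku Kv).
  have -> : all (Kend (Kc T) (f u) (g v)) (seg f u c ++ seg g j v).
    rewrite all_cat; apply/andP; split; apply: all_seg => k hk.
      have [->|nk] := eqVneq k u; first exact: Kend_l.
      by apply/Kend_n/nu; range_lia.
    have [->|nk] := eqVneq k v; first exact: Kend_r.
    by apply/Kend_n/nv; range_lia.
  have [e|ne] := boolP ((u == c) && (v == j)).
    by case/andP: e => /eqP eu /eqP ew; move: h1; rewrite -{1}eu -ew Ku Kv.
  by move=> /(_ isT); nlia.
case/andP: uv0 => /eqP eu /eqP ev; subst u v.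
pose s := seg f 0 c ++ seg g j 1 ++ seg g 0 0.
have hs : ihole s := hole_c.
have hhs : head (f 0) s = f 0 by rewrite /s head_segcat.
have hls : last (f 0) s = g 0 by rewrite /s !last_cat last_seg.
have Ks : all (Kend (Kc T) (f 0) (g 0)) s.
  rewrite !all_cat; apply/and3P; split; apply: all_seg => k hk.
  - have [->|nk] := eqVneq k 0; first exact: Kend_l.
    by apply/Kend_n/nu; range_lia.
  - by apply/Kend_n/nv; range_lia.
  have -> : k = 0 by range_lia. exact: Kend_r.
have [ew|ew] := eqVneq w j.+1; last first.
  apply: (hole_two_complete_list hG (fr_cc fr) hs hhs hls Kf0 Kg0 Ks Kw (p := seg g w.-1 j.+1)).
  - by rewrite !all_cat; apply/and3P; split; apply: all_seg => k hk; geo_leaf.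
  - apply: ipath_path; change (ipath ([:: g w] ++ seg g w.-1 j.+1)).
    by geo.
  - by apply: in_seg => k hk; apply/andP; split; geo_leaf.
  rewrite last_seg !has_cat; apply/orP; right; apply/orP; left.
  by apply: (has_seg (k := j)); [range_lia|geo_leaf].
have g1 : 1 < size (seg f 0 c) by rewrite size_seg; range_lia.
have g2 : 1 < size (seg g j 1 ++ seg g 0 0) by rewrite size_cat !size_seg; range_lia.
have g3 : last (f 0) (seg g j 1 ++ seg g 0 0) = g 0 by rewrite last_cat last_seg.
rewrite ew in Kw.
have g4 : link (seg f 0 c) [:: g j.+1] by geo.
have g5 : link [:: g j.+1] (seg g j 1 ++ seg g 0 0) by geo.
have [t tT ht] := hat_exists_list hG (fr_cc fr) hs g1 g2 (head_seg (f 0) f 0 c) g3 Kf0 Kg0 Ks Kw g4 g5.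
have tf x : Kc T x -> t -- x by move=> /KcP h; rewrite adj_sym h.
have t0 := tf _ Kf0; have t1 := tf _ Kg0; have tw := tf _ Kw.
move: ht; rewrite !all_cat => /and3P[/allP k1 /allP k2 _].
have tfn k : 0 < k <= c -> nadj t (f k).
  move=> hk; have := k1 (f k); have -> : f k \in seg f 0 c by apply/mem_segP; exists k => //; range_lia.
  have ng : f k != g 0 by have /andP[] := g0f (k := k) ltac:(range_lia); rewrite eq_sym.
  by move=> /(_ isT); rewrite (negbTE ng) (negbTE (ipf_neq hf (i := k) (j := 0) ltac:(range_lia) ltac:(range_lia) ltac:(range_lia))).
have tgn k : 0 < k <= j -> nadj t (g k).
  move=> hk; have := k2 (g k); have -> : g k \in seg g j 1 by apply/mem_segP; exists k => //; range_lia.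
  have ng : g k != f 0 by have /andP[] := f0g (l := k) ltac:(range_lia); rewrite eq_sym.
  by move=> /(_ isT); rewrite (negbTE ng) (negbTE (ipf_neq hg (i := k) (j := 0) ltac:(range_lia) ltac:(range_lia) ltac:(range_lia))).
have fcw k : k <= c -> k != c -> nadj (f k) (g j.+1) by move=> *; apply: fgc'; range_lia.
by apply: (@no_prism G hG [:: t] [:: g j.+1] (seg f 0 0) (seg f 1 c) (seg g 0 0) (seg g 1 j));
  rewrite ?seg_neq0 //; geo.
Qed.

(** Such a complete vertex misses [f 0] or [g 0], both in [A], so [fr_D] does not let it see [z]
    unless it is in [B], and then it sees only [z n]. *)
Let Kz1 v : Kc T v -> (exists k, [/\ 0 < k < p & v = f k]) \/ (exists l, [/\ 0 < l <= q & v = g l]) ->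
  nadj v (z 1).
Proof.
have cA v' a : Kc T v' -> ~~ A v' -> ~~ B v' -> A a -> nadj v' a -> nadj v' (z 1).
  move=> Kv nA nB Aa /andP[_ na]; have [h|[h _]] := fr_D fr Kv nA nB; first by apply: h; range_lia.
  by rewrite h in na.
move=> Kv [[k [hk e]]|[l [hl e]]]; subst v.
  apply: (cA _ (g 0) Kv); [apply: (gd_nA gf)|apply: (gd_nB gf)|exact: (gd_A gg)|]; try range_lia.
  by rewrite nadj_sym; apply: g0f; range_lia.
have [->|lq] := eqVneq l q; first by apply: gqz; range_lia.
apply: (cA _ (f 0) Kv); [apply: (gd_nA gg)|apply: (gd_nB gg)|exact: (gd_A gf)|]; try range_lia.
by rewrite nadj_sym; apply: f0g; range_lia.
Qed.

(** Two vertices of the triangle are complete and hence missed by [z 1], while [z 1] sees the starts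
    [f 0] and [g 0]. The ways from [z 1] to the triangle then form a pyramid with apex [z 1], or
    good paths through [z 1] have the wrong parity. *)
Lemma tripod_contra : False.
Proof.
have z1f0 : z 1 -- f 0 by rewrite adj_sym; apply: (fr_A1 fr (gd_A gf)).
have z1g0 : z 1 -- g 0 by rewrite adj_sym; apply: (fr_A1 fr (gd_A gg)).
have gqzn : g q -- z n by apply: (fr_Bn fr (gd_B gg)).
have eq := goodp_even hG fr gg.
have z1nf k : 0 < k <= p -> z 1 != f k.
  by move=> hk; apply: (neq_adj (x := g 0)); [rewrite adj_sym|apply: g0f].
have z1ng l : 0 < l <= q -> z 1 != g l.
  by move=> hk; apply: (neq_adj (x := f 0)); [rewrite adj_sym|apply: f0g].
have notwo : ~~ [|| (z 1 -- f c) && (z 1 -- g j), (z 1 -- f c) && (z 1 -- g j.+1)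
   | (z 1 -- g j) && (z 1 -- g j.+1)].
  have nK v : nadj v (z 1) -> (z 1 -- v) = false.
    by rewrite nadj_sym => /andP[_ /negbTE].
  have N1 : Kc T (f c) -> (z 1 -- f c) = false.
    by move=> h; apply/nK/Kz1 => //; left; exists c; split=> //; range_lia.
  have N2 : Kc T (g j) -> (z 1 -- g j) = false.
    by move=> h; apply/nK/Kz1 => //; right; exists j; split=> //; range_lia.
  have N3 : Kc T (g j.+1) -> (z 1 -- g j.+1) = false.
    by move=> h; apply/nK/Kz1 => //; right; exists j.+1; split=> //; range_lia.
  by case/or3P: tripod_T => /andP[h1 h2]; rewrite ?(N1 h1) ?(N1 h2) ?(N2 h1) ?(N2 h2) ?(N3 h2) ?andbF.
have [m1 [hm1 f1 nf1]] := @last_index (fun k => z 1 -- f k) 0 c (leq0n c) z1f0.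
have [m2 [hm2 f2 nf2]] := @last_index (fun k => z 1 -- g k) 0 j (leq0n j) z1g0.
have zf k : m1 < k <= c -> nadj (z 1) (f k).
  by move=> hk; apply: nadjI; [apply: z1nf; range_lia|apply: nf1].
have zg k : m2 < k <= j -> nadj (z 1) (g k).
  by move=> hk; apply: nadjI; [apply: z1ng; range_lia|apply: nf2].
(* Otherwise [z 1] sees just the edge from [f 0] to [g 0] of the hole, and
   [z 2, ..., z n, g q, ..., g j.+1] links it to [f c] away from that edge. *)
have nhat : ~~ ((m1 == 0) && (m2 == 0)).
  apply/negP => /andP[/eqP e1 /eqP e2].
  have hs := hole_c.
  apply: (@hat_obstructed_list _ hG _ (z 1) (f 0) (g 0) (z 2) (seg z 3 n ++ seg g q j.+1) hs);
    rewrite ?head_segcat ?last_cat ?last_seg //.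
  - rewrite !all_cat; apply/and3P; split; apply: all_seg => k hk.
    + have [->|k0] := eqVneq k 0; first by rewrite eqxx.
      by rewrite zf ?orbT //; range_lia.
    + by rewrite zg ?orbT //; range_lia.
    by have -> : k = 0 by [range_lia]; rewrite eqxx orbT.
  - rewrite cat_path last_seg; apply/andP; split; apply: path_cons_ipath; rewrite ?seg_neq0 //;
      rewrite ?head_seg; by [geo_leaf|rewrite adj_sym].
  - by geo_leaf.
  - move=> x; rewrite inE mem_cat => /or3P[/eqP ->|/mem_segP[k hk ->]|/mem_segP[k hk ->]];
    apply/andP; split; geo_leaf.
  rewrite !has_cat; apply/orP; left; apply: (has_seg (k := c)); first by range_lia.
  by rewrite adj_sym.
have E12 : odd (m1 + m2).
  have := @hole_even G hG [:: z 1] (seg f m1 c) (seg g j m2).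
  rewrite !size_cat !size_seg => /(_ isT ltac:(range_lia) ltac:(range_lia) _ isT).
  have [e|ne] := boolP ((m1 == c) && (m2 == j)).
    by case/andP: e => /eqP e1 /eqP e2; move: notwo; rewrite -{1}e1 -{1}e2 f1 f2.
  have fgz k l : m1 <= k <= c -> m2 <= l <= j -> (k != c) || (l != j) -> nadj (f k) (g l).
    move=> hk hl h; have [l0|l0] := posnP l; last by apply: fgc; range_lia.
    rewrite l0 nadj_sym; apply: g0f; have [k0|k0] := posnP k; last by range_lia.
    by rewrite k0 l0 in hk hl; range_lia.
  suff h : ipath (seg f m1 c ++ seg g j m2) /\ link [:: z 1] (seg f m1 c) /\
      link (seg g j m2) [:: z 1].
    by case: h => [p1 [p3 p4]] /(_ ltac:(simpl; range_lia) p1 p3 p4) /=; nlia.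
  by split; [|split]; geo.
(* If [z 1] sees [g] beyond [g j], there is a third way from the triangle to [z 1], and the three
   holes formed by two of the ways have incompatible parities. *)
have [has_t|no_t] := boolP [exists l : 'I_q.+1, (j < l) && (z 1 -- g l)].
  have /existsP [[l lq] /= /andP[l0 zl]] := has_t.
  have [m3 [hm3 f3 nf3]] := @first_index (fun k => z 1 -- g k) j.+1 l l0 zl.
  have zg' k : j < k < m3 -> nadj (z 1) (g k).
    by move=> hk; apply: nadjI; [apply: z1ng; range_lia|apply: nf3; range_lia].
  have E13 : odd (m1 + m3) = false.
    have := @hole_even G hG [:: z 1] (seg f m1 c) (seg g j.+1 m3).
    rewrite !size_cat !size_seg => /(_ isT ltac:(range_lia) ltac:(range_lia) _ isT).
    have [e|ne] := boolP ((m1 == c) && (m3 == j.+1)).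
      by case/andP: e => /eqP e1 /eqP e2; move: notwo; rewrite -{2}e1 -{1}e2 f1 f3 orbT.
    suff h : ipath (seg f m1 c ++ seg g j.+1 m3) /\ link [:: z 1] (seg f m1 c) /\
        link (seg g j.+1 m3) [:: z 1].
      by case: h => [p1 [p3 p4]] /(_ ltac:(simpl; range_lia) p1 p3 p4) /=; nlia.
    by split; [|split]; geo.
  have E23 : odd (m2 + m3) = false.
    have := @hole_even G hG [:: z 1] (seg g m2 m2) (seg g m2.+1 m3).
    rewrite !size_cat !size_seg => /(_ isT ltac:(range_lia) ltac:(range_lia) _ isT).
    have [e|ne] := boolP ((m2 == j) && (m3 == j.+1)).
      case/andP: e => /eqP e1 /eqP e2; move: notwo.
      have -> : z 1 -- g j by rewrite -e1.
      have -> : z 1 -- g j.+1 by rewrite -e2.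
      by rewrite !orbT.
    have zgm k : m2.+1 <= k <= m3 -> k != m3 -> nadj (z 1) (g k).
      by move=> hk km; have [kj|kj] := leqP k j; [apply: zg|apply: zg']; range_lia.
    suff h : ipath (seg g m2 m2 ++ seg g m2.+1 m3) /\ link [:: z 1] (seg g m2 m2) /\
        link (seg g m2.+1 m3) [:: z 1].
      by case: h => [p1 [p3 p4]] /(_ ltac:(simpl; range_lia) p1 p3 p4) /=; nlia.
    by split; [|split]; geo.
  by nlia.
have zt k : j < k <= q -> nadj (z 1) (g k).
  move=> hk; apply: nadjI; first by apply: z1ng; range_lia.
  apply: contraNN no_t => h; apply/existsP; exists (Ordinal (ltac:(range_lia) : k < q.+1)).
  by rewrite /= h andbT; range_lia.
have z1G x y : Gend A B x y (z 1) by apply: (frame_zG _ _ fr); range_lia.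
(* Without a third way, good paths ending in [g q] that start at [g 0] or [f 0] and continue with
   [z 1] make [m1] and [m2] even, against [E12]. *)
have EE1 : odd m1 = false.
  have [->//|m10] := eqVneq m1 0.
  have := @good_even_list G hG T z n A B fr ([:: g 0] ++ [:: z 1] ++ seg f m1 c ++ seg g j.+1 q) (g 0) (g q).
  rewrite !last_cat last_seg /= => h; have {h} := h _ isT erefl erefl (gd_A gg) (gd_B gg).
  have ip : ipath ([:: g 0] ++ [:: z 1] ++ seg f m1 c ++ seg g j.+1 q) by geo.
  rewrite size_cat !size_seg => /(_ ip) h; have {h} := h _.
  have -> : [&& Gend A B (g 0) (g q) (g 0), Gend A B (g 0) (g q) (z 1)
      & all (Gend A B (g 0) (g q)) (seg f m1 c ++ seg g j.+1 q)].
    rewrite z1G all_cat; apply/and4P; split=> //.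
    - by apply: (goodp_Gend gg) => //=; rewrite ?eqxx //; apply/implyP; range_lia.
    - apply: all_seg => i hi; apply: (goodp_Gend gf); first by range_lia.
        by apply/implyP; range_lia.
      by apply/implyP; range_lia.
    apply: all_seg => i hi; apply: (goodp_Gend gg); first by range_lia.
      by apply/implyP; range_lia.
    by apply/implyP => /eqP ->.
  by move=> /(_ isT); nlia.
have EE2 : odd m2 = false.
  have [->//|m20] := eqVneq m2 0.
  have zgm k : m2 < k <= q -> nadj (z 1) (g k).
    by move=> hk; have [kj|kj] := leqP k j; [apply: zg|apply: zt]; range_lia.
  have := @good_even_list G hG T z n A B fr ([:: f 0] ++ [:: z 1] ++ seg g m2 q) (f 0) (g q).
  rewrite !last_cat last_seg /= => h; have {h} := h _ isT erefl erefl (gd_A gf) (gd_B gg).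
  have ip : ipath ([:: f 0] ++ [:: z 1] ++ seg g m2 q) by geo.
  rewrite !size_seg => /(_ ip) h; have {h} := h _.
  have -> : [&& Gend A B (f 0) (g q) (f 0), Gend A B (f 0) (g q) (z 1)
      & all (Gend A B (f 0) (g q)) (seg g m2 q)].
    rewrite z1G; apply/and3P; split=> //.
      by apply: (goodp_Gend gf) => //=; rewrite ?eqxx //; apply/implyP; range_lia.
    apply: all_seg => i hi; apply: (goodp_Gend gg); first by range_lia.
      by apply/implyP; range_lia.
    by apply/implyP => /eqP ->.
  by move=> /(_ isT); nlia.
by nlia.
Qed.
End Tripods.

Section Crossing.
Variables (G : sgraph) (hG : class_A G).

(** Let [f c] be the first vertex of [f] after its start that touches [g] after its start, with
    first and last neighbours [g i] and [g I]. If [c = p], parity forces [i = q] and [rungs]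
    applies. Otherwise the hole gives [c + i] even and the good path through [g I] gives [c + I]
    odd, and a good path along [g] that detours through [f c] leaves only [I = i.+1], a triangle. *)
Lemma good_cross (T : {set G}) z n A B f p g q : frame T z n A B -> goodp A B f p -> goodp A B g q ->
  f 0 -- g 0 -> (forall k, 0 < k <= p -> nadj (g 0) (f k)) ->
  (forall l, 0 < l <= q -> nadj (f 0) (g l)) -> False.
Proof.
move=> fr gf gg fg0 g0f f0g.
have [hf Af Bf nAf nBf] := gf; have [hg Ag Bg nAg nBg] := gg.
have ep := goodp_even hG fr gf; have eq := goodp_even hG fr gg.
have nAB x : A x -> B x -> False by move=> a b; have := fr_AB fr a b; rewrite /nadj eqxx.
have p2 : 1 < p.
  rewrite ltnNge; apply/negP => p1; have p0 : p = 0 by nlia.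
  by move: Bf; rewrite p0; apply: nAB.
have q2 : 1 < q.
  rewrite ltnNge; apply/negP => p1; have p0 : q = 0 by nlia.
  by move: Bg; rewrite p0; apply: nAB.
pose tc k := [exists l : 'I_q.+1, (0 < l) && ~~ nadj (f k) (g l)].
have tcN k : ~~ tc k -> forall l, 0 < l <= q -> nadj (f k) (g l).
  rewrite negb_exists => /forallP h l /andP[l0 lq].
  by have := h (Ordinal (ltac:(range_lia) : l < q.+1)); rewrite /= l0 negbK.
have tp : tc p.
  apply/existsP; exists ord_max; rewrite /= (ltnW q2) /nadj.
  by have [//|ne] := eqVneq (f p) (g q); rewrite (fr_BB fr Bf Bg ne).
have [c [hc tcc nc]] := @first_index tc 1 p ltac:(range_lia) tp.
have fg k l : k < c -> 0 < l <= q -> nadj (f k) (g l).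
  move=> kc hl; have [->|k0] := posnP k; first exact: f0g.
  by apply: tcN => //; apply: nc; range_lia.
have fcn l : 0 < l <= q -> f c != g l.
  move=> hl; apply: (neq_adj (x := f c.-1)); last by apply: fg; range_lia.
  by apply: (ipf_adj hf); range_lia.
have /existsP [[l lq] /= /andP[l0 fl]] := tcc.
have fl' : f c -- g l by move: fl; rewrite /nadj fcn ?negbK //=; range_lia.
have [i [hi fi ni]] := @first_index (fun l => f c -- g l) 1 l l0 fl'.
have [I [hI fI nI]] := @last_index (fun l => f c -- g l) l q ltac:(range_lia) fl'.
have gi k : 0 < k < i -> nadj (f c) (g k).
  by move=> hk; apply: nadjI; [apply: fcn; range_lia|apply: ni; range_lia].
have gI k : I < k <= q -> nadj (f c) (g k).
  by move=> hk; apply: nadjI; [apply: fcn; range_lia|apply: nI; range_lia].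
have fgi k m : k <= c -> 0 < m <= i -> (k != c) || (m != i) -> nadj (f k) (g m).
  move=> hk hm h; have [e|kc] := eqVneq k c; last by apply: fg; range_lia.
  by rewrite e; apply: gi; range_lia.
have E1 : odd (c + i) = false.
  have := @hole_even G hG [:: g 0] (seg f 0 c) (seg g i 1).
  rewrite !size_cat !size_seg => /(_ isT ltac:(range_lia) ltac:(range_lia) ltac:(simpl; range_lia) isT).
  suff h : ipath (seg f 0 c ++ seg g i 1) /\ link [:: g 0] (seg f 0 c) /\
      link (seg g i 1) [:: g 0].
    by case: h => [p1 [p3 p4]] /(_ p1 p3 p4) /=; nlia.
  by split; [|split]; geo.
have nBc : c < p -> ~~ B (f c) by apply: nBf.
have nAc : ~~ A (f c) by apply: nAf; range_lia.
have [cp|cp] := eqVneq c p.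
  have iq : i = q.
    apply/eqP/negPn/negP => iq.
    have gpi m : m <= i -> m != i -> nadj (g m) (f c).
      move=> hm mi; have [->|m0] := posnP m; first by apply: g0f; range_lia.
      by rewrite nadj_sym; apply: gi; range_lia.
    have := @good_even_list G hG T z n A B fr (seg g 0 i ++ [:: f c]) (g 0) (f c).
    rewrite head_segcat last_cat size_cat !size_seg => h.
    have Bc : B (f c) by rewrite cp.
    have ip : ipath (seg g 0 i ++ [:: f c]) by geo.
    have := h ip ltac:(range_lia) erefl erefl Ag Bc.
    have -> : all (Gend A B (g 0) (f c)) (seg g 0 i ++ [:: f c]).
      rewrite all_cat; apply/andP; split.
        apply: all_seg => k hk; apply: (goodp_Gend gg); first by range_lia.
          by apply/implyP => /eqP ->.
        by apply/implyP; range_lia.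
      rewrite /= andbT cp; apply: (goodp_Gend gf) => //; apply/implyP; first by range_lia.
      by rewrite eqxx.
    by move=> /(_ isT) /=; nlia.
  apply: (rungs hG fr gf gg fg0); first by rewrite -cp -{1}iq.
  move=> k m kp mq h1 h2; have [m0|m0] := posnP m.
    by rewrite m0 nadj_sym; apply: g0f; range_lia.
  by apply: fgi; range_lia.
have cp' : c < p by range_lia.
have fgI k m : k <= c -> I <= m <= q -> (k != c) || (m != I) -> nadj (f k) (g m).
  move=> hk hm h; have [e|kc] := eqVneq k c; last by apply: fg; range_lia.
  by rewrite e; apply: gI; range_lia.
have E2 : odd (c + I).
  have := @good_even_list G hG T z n A B fr (seg f 0 c ++ seg g I q) (f 0) (g q).
  rewrite head_segcat last_cat last_seg size_cat !size_seg => h.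
  have ip : ipath (seg f 0 c ++ seg g I q) by geo.
  have := h ip ltac:(range_lia) erefl erefl Af Bg.
  have -> : all (Gend A B (f 0) (g q)) (seg f 0 c ++ seg g I q).
    rewrite all_cat; apply/andP; split; apply: all_seg => k hk.
      apply: (goodp_Gend gf); first by range_lia.
        by apply/implyP => /eqP ->.
      by apply/implyP; range_lia.
    apply: (goodp_Gend gg); first by range_lia.
      by apply/implyP; range_lia.
    by apply/implyP => /eqP ->.
  by move=> /(_ isT); nlia.
have iI : I = i.+1.
  apply/eqP/negPn/negP => ne; have iI : i.+1 < I by nlia.
  have gpi m : m <= i -> m != i -> nadj (g m) (f c).
    move=> hm mi; have [->|m0] := posnP m; first by apply: g0f; range_lia.
    by rewrite nadj_sym; apply: gi; range_lia.
  have := @good_even_list G hG T z n A B fr (seg g 0 i ++ [:: f c] ++ seg g I q) (g 0) (g q).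
  rewrite head_segcat !last_cat last_seg !size_cat !size_seg => h.
  have ip : ipath (seg g 0 i ++ [:: f c] ++ seg g I q) by geo.
  have := h ip ltac:(simpl; range_lia) erefl erefl Ag Bg.
  have -> : all (Gend A B (g 0) (g q)) (seg g 0 i ++ [:: f c] ++ seg g I q).
    rewrite !all_cat; apply/and3P; split.
    - apply: all_seg => k hk; apply: (goodp_Gend gg); first by range_lia.
        by apply/implyP => /eqP ->.
      by apply/implyP; range_lia.
    - by rewrite /= andbT; apply: Gend_n => //; apply: nBc.
    apply: all_seg => k hk; apply: (goodp_Gend gg); first by range_lia.
      by apply/implyP; range_lia.
    by apply/implyP => /eqP ->.
  by move=> /(_ isT) /=; nlia.
apply: (@tripod_contra G hG T z f g n p q c i A B fr gf gg fg0) => //; try range_lia.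
- by rewrite -iI.
- move=> m hm m1 m2; have [mi|mi] := ltnP m i; first by apply: gi; range_lia.
  by apply: gI; range_lia.
by nlia.
Qed.
End Crossing.

(** * Maximal pairs *)

Section Maximal.
Variables (U : finType) (R : U -> U -> Prop).
Hypothesis Rtr : forall x y w, R x y -> R y w -> R x w.
Hypothesis Rir : forall x, ~ R x x.

Lemma exists_maximal (P : U -> Prop) x0 : P x0 ->
  exists2 x, P x & forall y, P y -> ~ R x y.
Proof.
move=> Px0; suff [x [Px _ hx]] : exists x, [/\ P x, true & forall y, y \in enum U -> P y -> ~ R x y].
  by exists x => // y Py; apply: hx => //; rewrite mem_enum.
elim: (enum U) => [|w s [x [Px _ hx]]]; first by exists x0.
have [[Pw Rxw]|h] := classic (P w /\ R x w).
  exists w; split=> // y; rewrite inE => /orP[/eqP -> _|ys Py Rwy]; first exact: Rir.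
  exact: (hx y ys Py (Rtr Rxw Rwy)).
exists x; split=> // y; rewrite inE => /orP[/eqP -> Pw Rxw|]; last exact: hx.
by apply: h.
Qed.
End Maximal.

Section Order.
Variables (G : sgraph) (hG : class_A G).
Implicit Types (f g : nat -> G) (A B : pred G).

Definition prepend (a : G) f k : nat -> G := fun i => if i is j.+1 then f (k + j) else a.

Lemma ipf_prepend a f k p : ipf f k p -> k <= p -> a -- f k -> (forall l, k < l <= p -> nadj a (f l)) ->
  ipf (prepend a f k) 0 (p - k).+1.
Proof.
move=> hf kp ak na [|i] [|j] //= _ ij jp; last first.
  have /andP[-> /eqP ->] := hf (k + i) (k + j) ltac:(range_lia) ltac:(range_lia) ltac:(range_lia).
  by apply/eqP; lia.
have [->|j0] := posnP j; first by rewrite addn0 ak adj_neq.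
by have /andP[-> /negbTE ->] := na (k + j) ltac:(range_lia); case: j j0 {ij jp}.
Qed.

Lemma goodpI T z n A B f r : frame T z n A B -> ipf f 0 r -> A (f 0) -> B (f r) ->
  ~~ A (f 1) -> ~~ B (f r.-1) -> goodp A B f r.
Proof.
move=> fr hf Aa Bb nA nB; split=> // k hk.
  have [->//|k1] := eqVneq k 1; apply/negP => Ak.
  have /andP[] := ipf_nadj hf (i := 0) (j := k) ltac:(range_lia) ltac:(range_lia) ltac:(range_lia).
  by move=> /(fr_AA fr Aa Ak) ->.
have [->//|k1] := eqVneq k r.-1; apply/negP => Bk.
have /andP[] := ipf_nadj hf (i := r) (j := k) ltac:(range_lia) ltac:(range_lia) ltac:(range_lia).
by move=> /(fr_BB fr Bb Bk) ->.
Qed.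

(* Equivalently, some odd induced path from [a] to [B] has [a'] as its second vertex. *)
Definition below A B (a a' : G) : Prop := [/\ A a, A a', a != a' &
  exists f p, [/\ goodp A B f p, f 0 = a' & forall k, 0 < k <= p -> nadj a (f k)]].

Lemma below_asym T z n A B a a' : frame T z n A B -> below A B a a' -> below A B a' a -> False.
Proof.
move=> fr [Aa Aa' ne [f [p [gf f0 nf]]]] [_ _ _ [g [q [gg g0 ng]]]].
apply: (good_cross hG fr gf gg); rewrite ?f0 ?g0 //.
by apply: (fr_AA fr) => //; rewrite eq_sym.
Qed.

(** The witness of the second relation also serves for [a], unless [a] sees it after its start. In
    that case [a] followed by the witness from its last neighbour [f k] on is a good path that shows
    [below A B a' a], against asymmetry. *)
Lemma below_trans T z n A B a a' a'' : frame T z n A B -> below A B a a' -> below A B a' a'' ->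
  below A B a a''.
Proof.
move=> fr ab bc; have [Aa Aa' ne [g [q [gg g0 ng]]]] := ab.
have [_ Aa'' ne' [f [p [gf f0 nf]]]] := bc.
have ne2 : a != a''.
  by apply/eqP => e; rewrite -e in bc; apply: (below_asym fr ab bc).
split=> //; exists f, p; split=> // k0 hk0.
apply: contraT => nk0.
have [k [hk nk hk']] := @last_index (fun k => ~~ nadj a (f k)) k0 p ltac:(range_lia) nk0.
have nAk := gd_nA gf (k := k) ltac:(range_lia).
have ak : a -- f k.
  have : a != f k by apply: contraNneq nAk => <-.
  by move=> e; move: nk; rewrite /= /nadj e /= !negbK.
exfalso; apply: (below_asym fr ab); split=> //; first by rewrite eq_sym.
have na l : k < l <= p -> nadj a (f l) by move=> hl; apply/negPn/hk'; range_lia.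
exists (prepend a f k), (p - k).+1; split=> //.
  split=> //=.
  - by apply: ipf_prepend => //; [apply: (ipf_sub (gd_ipf gf))|]; range_lia.
  - by have -> : k + (p - k) = p by [range_lia]; apply: (gd_B gf).
  - by case=> //= l hl; apply: (gd_nA gf); range_lia.
  case=> [_|l hl] /=; last by apply: (gd_nB gf); range_lia.
  by apply/negP => Ba; have := fr_AB fr Aa Ba; rewrite /nadj eqxx.
by case=> //= l hl; apply: nf; range_lia.
Qed.

(** If [f 1] were in [A], the rest of the path would witness that [f 0] is below [f 1]. It is
    stopped one vertex earlier when [f r.-1] is already in [B]. *)
Lemma maximal_noA T z n A B f r : frame T z n A B ->
  (forall a', A a' -> ~ below A B (f 0) a') -> ipf f 0 r -> A (f 0) -> B (f r) -> ~~ A (f 1).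
Proof.
move=> fr mx hf Aa Bb; apply/negP => A1.
have nAB x : A x -> B x -> False by move=> a b; have := fr_AB fr a b; rewrite /nadj eqxx.
have r2 : 1 < r.
  rewrite ltnNge; apply/negP => r1; have [r0|r0] := posnP r.
    by move: Bb; rewrite r0; apply: nAB.
  by have r1' : r = 1 by [range_lia]; move: Bb; rewrite r1'; apply: nAB.
have nA k : 1 < k <= r -> ~~ A (f k).
  move=> hk; apply/negP => Ak.
  have /andP[] := ipf_nadj hf (i := 0) (j := k) ltac:(range_lia) ltac:(range_lia) ltac:(range_lia).
  by move=> /(fr_AA fr Aa Ak) ->.
have nBk k : k.+1 < r -> ~~ B (f k).
  move=> hk; apply/negP => Bk.
  have /andP[] := ipf_nadj hf (i := r) (j := k) ltac:(range_lia) ltac:(range_lia) ltac:(range_lia).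
  by move=> /(fr_BB fr Bb Bk) ->.
have key s : 1 < s <= r -> B (f s) -> (forall k, k < s -> ~~ B (f k)) -> False.
  move=> hs Bs nBs; apply: (mx _ A1); split=> //; first by apply: (ipf_neq hf); range_lia.
  exists (fun i => f i.+1), s.-1; split=> //; last by move=> k hk; apply: (ipf_nadj hf); range_lia.
  split=> //.
  - move=> i j _ ij js; have := hf i.+1 j.+1 ltac:(range_lia) ltac:(range_lia) ltac:(range_lia).
    by rewrite eqSS.
  - by rewrite prednK //; range_lia.
  - by move=> k hk; apply: nA; range_lia.
  by move=> k hk; apply: nBs; range_lia.
have [B1|nB1] := boolP (B (f r.-1)).
  have r3 : 2 < r.
    rewrite ltnNge; apply/negP => r3; have er : r.-1 = 1 by range_lia.
    by move: B1; rewrite er; apply: nAB.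
  by apply: (key r.-1) => //; [range_lia|move=> k hk; apply: nBk; range_lia].
apply: (key r) => //; first by range_lia.
move=> k hk; have [->//|kr] := eqVneq k r.-1.
by apply: nBk; range_lia.
Qed.

Lemma maximal_goodp T z n A B a b : frame T z n A B -> A a -> B b ->
  (forall a', A a' -> ~ below A B a a') -> (forall b', B b' -> ~ below B A b b') ->
  forall f r, ipf f 0 r -> f 0 = a -> f r = b -> goodp A B f r.
Proof.
move=> fr Aa Bb mA mB f r hf f0 fr'; apply: (goodpI fr) => //; rewrite ?f0 ?fr' //.
  by apply: (maximal_noA fr _ hf); rewrite ?f0 ?fr'.
have := @maximal_noA T _ n B A (fun i => f (r - i)) r (frame_rev fr).
rewrite subn0 subnn fr' f0 subn1 => h.
by apply: h => //; apply: ipf_rev.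
Qed.

Lemma exists_maximal_pair T z n A B a0 b0 : frame T z n A B -> A a0 -> B b0 ->
  exists a b, [/\ A a, B b & forall f r, ipf f 0 r -> f 0 = a -> f r = b -> goodp A B f r].
Proof.
move=> fr Aa0 Bb0; have fr' := frame_rev fr.
have irr A' B' x : ~ below A' B' x x by case=> _ _; rewrite eqxx.
have [a Aa ma] := @exists_maximal G (below A B) (fun x y w => @below_trans T z n A B x y w fr)
  (irr A B) (fun x => A x) a0 Aa0.
have [b Bb mb] := @exists_maximal G (below B A) (fun x y w => @below_trans T _ n B A x y w fr')
  (irr B A) (fun x => B x) b0 Bb0.
by exists a, b; split=> // f r; apply: (maximal_goodp fr Aa Bb ma mb).
Qed.
End Order.

Section Fork.
Variables (G : sgraph) (hG : class_A G) (T : {set G}) (z : nat -> G) (n : nat) (A B : pred G).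
Hypothesis fr : frame T z n A B.

(* Comparing the parities of the complete edges of [g] and [h] up to their next vertices that see
   [z] yields a hole through [h x.+1] and [g x.+1] with exactly two complete vertices, adjacent. *)
Lemma fork_contra g h r r' x : ipf g 0 r -> ipf h 0 r' -> A (g 0) -> B (g r) -> B (h r') ->
  (forall k, 0 < k < r -> Kc T (g k) -> ~~ touch z n (g k)) ->
  (forall k, 0 < k < r' -> Kc T (h k) -> ~~ touch z n (h k)) ->
  0 < x -> x.+2 < r -> x.+1 < r' -> (forall k, k <= x -> h k = g k) ->
  Kc T (g x) -> Kc T (g x.+1) -> ~~ Kc T (h x.+1) -> touch z n (h x.+1) ->
  h x.+1 -- g x.+1 -> (forall k, x.+1 < k <= r -> nadj (h x.+1) (g k)) -> False.
Proof.
move=> hg hh Aa Bg Bh Dg Dh x0 xr2 xr' E Kx Kx1 nKd td dc nd.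
have HK := roussel_rubio hG (fr_cc fr).
have xr : x.+1 < r := ltnW xr2.
have [w [hw tw nw]] := @last_index (fun k => touch z n (g k)) 0 x (ltnW x0) (touch_A fr Aa).
have wx : w < x.
  have ne : w != x by apply: contraTneq tw => ->; apply: Dg => //; range_lia.
  by range_lia.
have [y [hy ty ny]] := @next_index (fun k => touch z n (g k)) x.+1 r xr (touch_B fr Bg).
have tx1 : ~~ touch z n (g x.+1) by apply: Dg => //; range_lia.
have nt k : w < k < y -> ~~ touch z n (g k).
  move=> hk; have [->//|kx] := eqVneq k x.+1.
  by have [kx'|kx'] := leqP k x; [apply: nw|apply: ny]; range_lia.
(* Up to [x] the paths agree and [h x.+1] is not complete, so [h] between [w] and [x.+1] has the
   same complete edges as [g] between [w] and [x]: an even number. The complete edge from [g x] to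
   [g x.+1] then leaves an odd number of them between [x.+1] and [y]. *)
have e1 : odd (kedg (Kc T) h w x.+1) = false.
  apply: (interval_kedg hG fr hh) => //; rewrite ?E //; try by range_lia.
  by move=> k hk; rewrite E; [apply: nw|]; range_lia.
have e2 : odd (kedg (Kc T) g w y) = false.
  by apply: (interval_kedg hG fr hg) => //; range_lia.
have e3 : kedg (Kc T) h w x.+1 = kedg (Kc T) g w x.
  rewrite (@kedg_cat _ _ _ w x x.+1); [|range_lia|range_lia].
  rewrite [X in _ + X]kedg0 ?addn0; last first.
    by move=> k hk; have -> : k = x by [range_lia]; rewrite (negbTE nKd) andbF.
  by apply: eq_in_count => k; rewrite mem_iota => hk; rewrite !E //; range_lia.
have e4 : odd (kedg (Kc T) g x.+1 y).
  move: e2; rewrite (@kedg_cat _ _ _ w x y); [|range_lia|range_lia].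
  rewrite (@kedg_cat _ _ _ x x.+1 y); [|range_lia|range_lia].
  rewrite oddD -e3 e1 oddD /kedg subSnn /= Kx Kx1 /=.
  by case: (odd _).
have [v [hv Kv nv]] := @last_index (fun k => Kc T (g k)) x.+1 y ltac:(range_lia) Kx1.
have od : odd (v - x.+1).
  have <- : odd (kedg (Kc T) g x.+1 y) = odd (v - x.+1); last by [].
  have hgy : ipf g x.+1 y by apply: (ipf_sub hg); range_lia.
  have nk k : x < k < x.+1 -> ~~ Kc T (g k) by move=> hk; exfalso; range_lia.
  by apply: (kedg_ext HK hgy (leqnn _) _ _ Kx1 Kv nk nv); range_lia.
have xv : x.+1 < v by move: od hv; clear; lia.
(* The path [h x.+1, g x.+1, ..., g r], kept at the indices of [g]. By [middle_adj] its start would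
   be adjacent to [g 0 = h 0], but [h] is induced and [x] is positive. *)
pose f k := if k == x then h x.+1 else g k.
have fx : f x = h x.+1 by rewrite /f eqxx.
have fE k : x < k -> f k = g k by rewrite /f => hk; case: eqP => // e; range_lia.
have hf : ipf f x r.
  move=> i j xi ij jr; rewrite (fE j); last by range_lia.
  have [ei|ni] := eqVneq i x; last by rewrite fE; [apply: hg|]; range_lia.
  subst i; rewrite fx; have [ej|nj] := eqVneq j x.+1.
    by subst j; rewrite dc adj_neq.
  by have /andP[-> /negbTE ->] := nd j ltac:(range_lia).
have nz k i : x < k < y -> 1 <= i <= n -> nadj (f k) (z i).
  by move=> hk; rewrite fE; [apply/touchN/nt|]; range_lia.
have Ku : Kc T (f x.+1) by rewrite fE.
have vy : v < y.
  have [vy|yv] := ltnP v y; first by [].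
  have ev : v = y by range_lia.
  have yr : y = r.
    by apply/eqP/negPn/negP => ne; have := Dg y ltac:(range_lia); rewrite -ev Kv ev ty => /(_ isT).
  clear e1 e2 e4 nv; subst v y; have n3 := fr_n fr; have hz := fr_z fr; have nKz := fr_nK fr.
  have Bf : B (f r) by rewrite fE //; range_lia.
  have bz i : 1 <= i < n -> nadj (f r) (z i) by apply: (fr_Bz fr).
  have bzn := fr_Bn fr Bf; have Kr := fr_BK fr Bf.
  have fxz i : 1 <= i <= n -> f x != z i.
    move=> hi; apply: (neq_adj (x := f x.+1)); last by apply: nz; range_lia.
    by apply: (ipf_adj hf); range_lia.
  have [j hj xj] : exists2 j, 1 <= j <= n & f x -- z j.
    move: td; rewrite -fx => /existsP [[j jlt] /= /andP[j0 xj]]; exists j; first by range_lia.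
    by move: xj; rewrite /nadj fxz ?negbK //=; range_lia.
  have [i [hi xi ni]] := @last_index (fun j => f x -- z j) j n ltac:(range_lia) xj.
  have ni' k : i < k <= n -> nadj (f x) (z k).
    by move=> hk; apply: nadjI; [apply: fxz|apply: ni]; range_lia.
  have fz p q : x < p <= r -> i <= q <= n -> (p != r) || (q != n) -> nadj (f p) (z q).
    move=> hp hq; have [->|py] := eqVneq p r => /= hh'; first by apply: bz; range_lia.
    by apply: nz; range_lia.
  have := @hole_even G hG [:: f x] (seg f x.+1 r) (seg z n i).
  rewrite !size_cat !size_seg => /(_ isT ltac:(range_lia) ltac:(range_lia) ltac:(simpl; range_lia) isT).
  suff hl : ipath (seg f x.+1 r ++ seg z n i) /\ link [:: f x] (seg f x.+1 r) /\
      link (seg z n i) [:: f x].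
    case: hl => [p1 [p2 p3]] /(_ p1 p2 p3) /= ho.
    have := @pari_list _ _ ([:: f x.+1] ++ [:: f x] ++ seg z i n ++ [:: f r]) (f x.+1) (f r) HK.
    have ip : ipath ([:: f x.+1] ++ [:: f x] ++ seg z i n ++ [:: f r]) by geo.
    rewrite /= !last_cat /= Kend_l => /(_ isT erefl erefl ip Ku Kr).
    rewrite !size_cat !size_seg /= all_cat /= Kend_r andbT Kend_n /=; last by rewrite fx.
    have -> : all (Kend (Kc T) (f x.+1) (f r)) (seg z i n).
      by apply: all_seg => k hk; apply/Kend_n/nKz; range_lia.
    by move=> /(_ isT ltac:(range_lia)); nlia.
  by split; [|split]; geo.
have Kv' : Kc T (f v) by rewrite fE //; range_lia.
have hfy : ipf f x y by apply: (ipf_sub hf); range_lia.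
have af k : x < k <= y -> nadj (g 0) (f k).
  by move=> hk; rewrite fE; [apply: (ipf_nadj hg)|]; range_lia.
have tfx : touch z n (f x) by rewrite fx.
have tfy : touch z n (f y) by rewrite fE //; range_lia.
have ntf k : x < k < y -> ~~ touch z n (f k).
  by move=> hk; rewrite fE; [apply: nt|]; range_lia.
have nku k : x <= k < x.+1 -> ~~ Kc T (f k).
  by move=> hk; have -> : k = x by [range_lia]; rewrite fx.
have nkv k : v < k <= y -> ~~ Kc T (f k) by move=> hk; rewrite fE; [apply: nv|]; range_lia.
have := middle_adj hG fr hfy Aa af (ltnSn x) xv vy tfx tfy ntf Ku Kv' nku nkv od.
by rewrite fx -E // (ipf_nadj hh) //; range_lia.
Qed.
End Fork.

(** * Snakes *)

Section Snakes.
Variables (G : sgraph).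
Implicit Types (f g : nat -> G).

(* The paths are [a = f1 0, ..., a' = f1 n1], [b = f2 0, ..., b' = f2 n2], and from [c = f3 0] to
   [c' = f3 n3] and from [d = f4 0] to [d' = f4 n4]. *)
Record snakef f1 n1 f2 n2 f3 n3 f4 n4 : Prop := Snakef {
  sn_1 : ipf f1 0 n1;
  sn_2 : ipf f2 0 n2;
  sn_3 : ipf f3 0 n3;
  sn_4 : ipf f4 0 n4;
  sn_3pos : 0 < n3;
  sn_4pos : 0 < n4;
  sn_12 : forall i j, i <= n1 -> j <= n2 -> nadj (f1 i) (f2 j);
  sn_13 : forall i j, i <= n1 -> j <= n3 -> (i != n1) || (j != 0) -> nadj (f1 i) (f3 j);
  sn_13e : f1 n1 -- f3 0;
  sn_14 : forall i j, i <= n1 -> j <= n4 -> (i != n1) || (j != 0) -> nadj (f1 i) (f4 j);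
  sn_14e : f1 n1 -- f4 0;
  sn_23 : forall i j, i <= n2 -> j <= n3 -> (i != n2) || (j != n3) -> nadj (f2 i) (f3 j);
  sn_23e : f2 n2 -- f3 n3;
  sn_24 : forall i j, i <= n2 -> j <= n4 -> (i != n2) || (j != n4) -> nadj (f2 i) (f4 j);
  sn_24e : f2 n2 -- f4 n4;
  sn_34 : forall i j, i <= n3 -> j <= n4 -> (i != 0) || (j != 0) -> (i != n3) || (j != n4) ->
    nadj (f3 i) (f4 j);
  sn_34c : f3 0 -- f4 0;
  sn_34c' : f3 n3 -- f4 n4 }.

Lemma snake_swap f1 n1 f2 n2 f3 n3 f4 n4 :
  snakef f1 n1 f2 n2 f3 n3 f4 n4 -> snakef f1 n1 f2 n2 f4 n4 f3 n3.
Proof.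
case=> *; split=> //; try by rewrite adj_sym.
by move=> i j hi hj h h'; rewrite nadj_sym; match goal with H : forall i j, _ -> _ -> _ -> _ -> _ |- _ => by apply: H; rewrite // orbC end.
Qed.

Lemma snake_flip f1 n1 f2 n2 f3 n3 f4 n4 : snakef f1 n1 f2 n2 f3 n3 f4 n4 ->
  snakef f2 n2 f1 n1 (fun i => f3 (n3 - i)) n3 (fun i => f4 (n4 - i)) n4.
Proof.
case=> h1 h2 h3 h4 p3 p4 h12 h13 h13e h14 h14e h23 h23e h24 h24e h34 hc hc'.
split; rewrite ?subn0 ?subnn //; try exact: ipf_rev.
- by move=> i j hi hj; rewrite nadj_sym; apply: h12.
- by move=> i j hi hj h; apply: h23; range_lia.
- by move=> i j hi hj h; apply: h24; range_lia.
- by move=> i j hi hj h; apply: h13; range_lia.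
- by move=> i j hi hj h; apply: h14; range_lia.
by move=> i j hi hj h h'; apply: h34; range_lia.
Qed.

Lemma snake_hole f1 n1 f2 n2 f3 n3 f4 n4 : snakef f1 n1 f2 n2 f3 n3 f4 n4 ->
  ihole (seg f3 0 n3 ++ seg f4 n4 1 ++ seg f4 0 0).
Proof.
case=> h1 h2 h3 h4 p3 p4 h12 h13 h13e h14 h14e h23 h23e h24 h24e h34 hc hc'.
by apply: ihole_catI; rewrite ?size_cat ?size_seg //=; try range_lia; geo.
Qed.

Section Classify.
Hypothesis hG : class_A G.
Variables (K : pred G) (HK : pari K).

Lemma snake_parity f1 n1 f2 n2 f3 n3 f4 n4 : snakef f1 n1 f2 n2 f3 n3 f4 n4 ->
  odd n3 = odd n4.
Proof.
move/snake_hole => h; have := ((class_A_lists G).1 hG) => -[+ _ _].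
by move=> /(_ _ h); rewrite !size_cat !size_seg; lia.
Qed.

(** Take the last vertex of [K] on the first path and the first ones on the third and fourth. The
    three connections through the triangle [a', c, d] cannot all have even length, and the one from
    [c] to [d] is not a single edge, so [a'] with exactly one of [c], [d] is a single edge in [K].
    If the fourth path has no vertex of [K], it is itself used as a connection to the other
    triangle. *)
Lemma snake_left f1 n1 f2 n2 f3 n3 f4 n4 : snakef f1 n1 f2 n2 f3 n3 f4 n4 ->
  K (f1 0) -> K (f2 0) -> ~~ (K (f3 0) && K (f4 0)) -> ~~ (K (f3 n3) && K (f4 n4)) ->
  (exists2 k, k <= n3 & K (f3 k)) -> K (f1 n1) /\ K (f3 0) (+) K (f4 0).
Proof.
move=> sn Ka Kb nl nr [k0 hk0 Kk0]; have par := snake_parity sn.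
case: (sn) => h1 h2 h3 h4 p3 p4 h12 h13 h13e h14 h14e h23 h23e h24 h24e h34 hc hc'.
have [p [hp Kp np]] := @last_index (fun k => K (f1 k)) 0 n1 isT Ka.
have [q [hq Kq nq]] := @last_index (fun k => K (f2 k)) 0 n2 isT Kb.
have [u [hu Ku nu]] := @first_index (fun k => K (f3 k)) 0 k0 isT Kk0.
have E1 : all (Kend K (f1 p) (f3 u)) (seg f1 p n1).
  apply: all_seg => i hi; have [->|ni] := eqVneq i p; first exact: Kend_l.
  by apply/Kend_n/np; range_lia.
have E3 x : all (Kend K x (f3 u)) (seg f3 0 u).
  apply: all_seg => i hi; have [->|ni] := eqVneq i u; first exact: Kend_r.
  by apply/Kend_n/nu; range_lia.
have e13 : (p == n1) && (u == 0) \/ odd (n1 - p + u).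
  have := @pari_list _ _ (seg f1 p n1 ++ seg f3 0 u) (f1 p) (f3 u) HK.
  have ip : ipath (seg f1 p n1 ++ seg f3 0 u) by geo.
  rewrite head_segcat last_cat last_seg !size_cat !size_seg all_cat E1 E3.
  by move=> /(_ ltac:(range_lia) erefl erefl ip Kp Ku isT); nlia.
have [[v [hv Kv nv]]|no4] : (exists v, [/\ v <= n4, K (f4 v) & forall k, k < v -> ~~ K (f4 k)])
    \/ forall k, k <= n4 -> ~~ K (f4 k).
- have [/existsP [[k klt] /= Kk]|/existsPn h] := boolP [exists k : 'I_n4.+1, K (f4 k)].
    have [v [hv Kv nv]] := @first_index (fun k => K (f4 k)) 0 k isT Kk.
    by left; exists v; split=> //; range_lia.
  by right=> k hk; apply: (h (Ordinal (_ : k < n4.+1))).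
- have E4 x : all (Kend K x (f4 v)) (seg f4 0 v).
    apply: all_seg => i hi; have [->|ni] := eqVneq i v; first exact: Kend_r.
    by apply/Kend_n/nv; range_lia.
  have E1' : all (Kend K (f1 p) (f4 v)) (seg f1 p n1).
    apply: all_seg => i hi; have [->|ni] := eqVneq i p; first exact: Kend_l.
    by apply/Kend_n/np; range_lia.
  have e14 : (p == n1) && (v == 0) \/ odd (n1 - p + v).
    have := @pari_list _ _ (seg f1 p n1 ++ seg f4 0 v) (f1 p) (f4 v) HK.
    have ip : ipath (seg f1 p n1 ++ seg f4 0 v) by geo.
    rewrite head_segcat last_cat last_seg !size_cat !size_seg all_cat E1' E4.
    by move=> /(_ ltac:(range_lia) erefl erefl ip Kp Kv isT); nlia.
  have uv0 : ~~ ((u == 0) && (v == 0)).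
    by apply: contra nl => /andP[/eqP eu /eqP ev]; rewrite -{1}eu -ev Ku Kv.
  have uv1 : ~~ ((u == n3) && (v == n4)).
    by apply: contra nr => /andP[/eqP eu /eqP ev]; rewrite -{1}eu -ev Ku Kv.
  have e34 : odd (u + v).
    have := @pari_list _ _ (seg f3 u 0 ++ seg f4 0 v) (f3 u) (f4 v) HK.
    have ip : ipath (seg f3 u 0 ++ seg f4 0 v) by geo.
    have E3' : all (Kend K (f3 u) (f4 v)) (seg f3 u 0).
      apply: all_seg => i hi; have [->|ni] := eqVneq i u; first exact: Kend_l.
      by apply/Kend_n/nu; range_lia.
    rewrite head_segcat last_cat last_seg !size_cat !size_seg all_cat E3' E4.
    by move=> /(_ ltac:(range_lia) erefl erefl ip Ku Kv isT); nlia.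
  have [[ep [eu ov]]|[ep [ev ou]]] : p = n1 /\ u = 0 /\ 0 < v \/ p = n1 /\ v = 0 /\ 0 < u.
  - move: e13 e14 e34; clear; lia.
  - by rewrite -ep -{1}eu Kp Ku (negbTE (nv 0 ov)).
  by rewrite -ep -{2}ev Kp Kv (negbTE (nu 0 ou)).
have [un|un] := eqVneq u n3.
  subst n3.
  have ip : ipath (seg f1 p n1 ++ seg f4 0 n4 ++ [:: f3 u]) by geo.
  have := @pari_list _ _ (seg f1 p n1 ++ seg f4 0 n4 ++ [:: f3 u]) (f1 p) (f3 u) HK.
  have -> : all (Kend K (f1 p) (f3 u)) (seg f1 p n1 ++ seg f4 0 n4 ++ [:: f3 u]).
    rewrite !all_cat E1 andTb; apply/andP; split; last by rewrite /= Kend_r.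
    by apply: all_seg => i hi; apply/Kend_n/no4; range_lia.
  rewrite head_segcat !last_cat !size_cat !size_seg.
  by move=> /(_ ltac:(range_lia) erefl erefl ip Kp Ku isT) /=; nlia.
have [[ep eu]|ou] : p = n1 /\ u = 0 \/ odd (n1 - p + u) by move: e13; clear; lia.
  by rewrite -ep -{1}eu Kp Ku (negbTE (no4 0 _)).
have E2 x : all (Kend K x (f2 q)) (seg f2 n2 q).
  apply: all_seg => i hi; have [->|ni] := eqVneq i q; first exact: Kend_r.
  by apply/Kend_n/nq; range_lia.
have E4 x y : all (Kend K x y) (seg f4 0 n4).
  by apply: all_seg => i hi; apply/Kend_n/no4; range_lia.
have := @pari_list _ _ (seg f1 p n1 ++ seg f4 0 n4 ++ seg f2 n2 q) (f1 p) (f2 q) HK.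
have ip : ipath (seg f1 p n1 ++ seg f4 0 n4 ++ seg f2 n2 q) by geo.
have -> : all (Kend K (f1 p) (f2 q)) (seg f1 p n1 ++ seg f4 0 n4 ++ seg f2 n2 q).
  rewrite !all_cat E2 E4 !andbT; apply: all_seg => i hi.
  have [->|ni] := eqVneq i p; first exact: Kend_l.
  by apply/Kend_n/np; range_lia.
rewrite head_segcat !last_cat last_seg !size_cat !size_seg.
move=> /(_ ltac:(range_lia) erefl erefl ip Kp Kq isT ltac:(range_lia)) o1.
have := @pari_list _ _ (seg f3 u 0 ++ seg f4 0 n4 ++ seg f2 n2 q) (f3 u) (f2 q) HK.
have ip' : ipath (seg f3 u 0 ++ seg f4 0 n4 ++ seg f2 n2 q) by geo.
have -> : all (Kend K (f3 u) (f2 q)) (seg f3 u 0 ++ seg f4 0 n4 ++ seg f2 n2 q).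
  rewrite !all_cat E2 E4 !andbT; apply: all_seg => i hi.
  have [->|ni] := eqVneq i u; first exact: Kend_l.
  by apply/Kend_n/nu; range_lia.
rewrite head_segcat !last_cat last_seg !size_cat !size_seg.
move=> /(_ ltac:(range_lia) erefl erefl ip' Ku Kq isT ltac:(range_lia)) o2.
by exfalso; move: ou o1 o2 hp hq hu; clear; lia.
Qed.
End Classify.
End Snakes.

Section Special.
Variables (G : sgraph) (hG : class_A G).
Implicit Types (f g z : nat -> G) (T U : {set G}) (A B : pred G).

Lemma snake_classify (K : pred G) f1 n1 f2 n2 f3 n3 f4 n4 : pari K ->
  snakef f1 n1 f2 n2 f3 n3 f4 n4 -> K (f1 0) -> K (f2 0) ->
  ~~ (K (f3 0) && K (f4 0)) -> ~~ (K (f3 n3) && K (f4 n4)) ->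
  (exists2 k, k <= n3 & K (f3 k)) \/ (exists2 k, k <= n4 & K (f4 k)) ->
  [/\ K (f1 n1), K (f3 0) (+) K (f4 0), K (f2 n2) & K (f3 n3) (+) K (f4 n4)].
Proof.
move=> HK.
have H m1 m2 m3 m4 g1 g2 g3 g4 : snakef g1 m1 g2 m2 g3 m3 g4 m4 -> K (g1 0) -> K (g2 0) ->
    ~~ (K (g3 0) && K (g4 0)) -> ~~ (K (g3 m3) && K (g4 m4)) -> (exists2 k, k <= m3 & K (g3 k)) ->
    [/\ K (g1 m1), K (g3 0) (+) K (g4 0), K (g2 m2) & K (g3 m3) (+) K (g4 m4)].
  move=> sn Ka Kb nl nr [k hk Kk]; have [h1 h2] := snake_left hG HK sn Ka Kb nl nr (ex_intro2 _ _ k hk Kk).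
  have := snake_left hG HK (snake_flip sn) Kb Ka; rewrite !subn0 !subnn => /(_ nr nl) [|//].
  by exists (m3 - k); [exact: leq_subr|rewrite subKn].
move=> sn Ka Kb nl nr [|ex]; first exact: H sn Ka Kb nl nr.
rewrite addbC [K (f3 n3) (+) _]addbC; apply: (H _ _ _ _ _ _ _ _ (snake_swap sn) Ka Kb _ _ ex).
  by rewrite andbC.
by rewrite andbC.
Qed.

(** In the hole formed by the third and fourth paths, [a'] sees only the edge from [c] to [d]. Going
    back to [a], along [y] and [w] to [b], and on to [b'] links it to [c'] away from [c] and [d],
    which [hat_obstructed_list] forbids. *)
Lemma snake_link f1 n1 f2 n2 f3 n3 f4 n4 y w : snakef f1 n1 f2 n2 f3 n3 f4 n4 ->
  f1 0 -- y -> path adj y w -> {in y :: w, forall v, nadj v (f3 0) && nadj v (f4 0)} ->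
  last y w -- f2 0 -> False.
Proof.
move=> sn fy pw nw lw; have hs := snake_hole sn.
case: sn => h1 h2 h3 h4 p3 p4 h12 h13 h13e h14 h14e h23 h23e h24 h24e h34 hc hc'.
set s := seg f3 0 n3 ++ _ in hs.
have hd : head (f3 0) s = f3 0 by rewrite /s head_segcat.
have ls : last (f3 0) s = f4 0 by rewrite /s !last_cat last_seg.
have as1 : all (fun e => [|| e == f3 0, e == f4 0 | nadj (f1 n1) e]) s.
  rewrite !all_cat; apply/and3P; split; apply: all_seg => k hk.
  - by have [->|nk] := eqVneq k 0; rewrite ?eqxx // h13 ?orbT //; range_lia.
  - by rewrite h14 ?orbT //; range_lia.
  by have -> : k = 0 by [range_lia]; rewrite eqxx orbT.
have p2 : path adj y (w ++ seg f2 0 n2).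
  rewrite cat_path pw; apply: path_cons_ipath; rewrite ?seg_neq0 ?head_seg //.
  by apply: (ipath_seg h2); range_lia.
have l2 : has (adj (last y (w ++ seg f2 0 n2))) s.
  by rewrite last_cat last_seg has_cat (has_seg (k := n3)) //; range_lia.
have n2' : {in y :: (w ++ seg f2 0 n2), forall v, nadj v (f3 0) && nadj v (f4 0)}.
  move=> v; rewrite -cat_cons mem_cat => /orP[/nw//|/mem_segP [k hk ->]].
  by rewrite h23 ?h24 //; range_lia.
have [e|n10] := posnP n1.
  by apply: (hat_obstructed_list hG hs hd ls h13e h14e as1 p2 _ n2' l2); rewrite e.
have p1 : path adj (f1 n1.-1) (seg f1 n1.-1.-1 0 ++ (y :: (w ++ seg f2 0 n2))) \/ n1 = 1.
  have [->|n11] := eqVneq n1 1; [by right|left].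
  rewrite cat_path /= last_seg fy p2 !andbT; apply: path_cons_ipath; rewrite ?seg_neq0 ?head_seg //.
    by apply: (ipath_seg h1); range_lia.
  by apply: (ipf_adj h1); range_lia.
have ad : f1 n1 -- f1 n1.-1 by apply: (ipf_adj h1); range_lia.
have nf1 k : k < n1 -> nadj (f1 k) (f3 0) && nadj (f1 k) (f4 0).
  by move=> hk; rewrite h13 ?h14 //; range_lia.
case: p1 => [p1|e].
  apply: (hat_obstructed_list hG hs hd ls h13e h14e as1 p1 ad _ _).
    move=> v; rewrite inE mem_cat => /or3P[/eqP ->|/mem_segP [k hk ->]|/n2' //]; apply: nf1; range_lia.
  by rewrite last_cat.
apply: (hat_obstructed_list hG hs hd ls h13e h14e as1 (x := f1 0) (p := y :: (w ++ seg f2 0 n2)) _ _ _ l2).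
- by rewrite /= fy.
- by move: ad; rewrite e.
by move=> v; rewrite inE => /orP[/eqP ->|/n2' //]; apply: nf1; range_lia.
Qed.

Lemma snake_dominated f1 n1 f2 n2 f3 n3 f4 n4 t : snakef f1 n1 f2 n2 f3 n3 f4 n4 ->
  f1 0 -- t -> f2 0 -- t -> (t -- f3 0) || (t -- f4 0).
Proof.
move=> sn at_ bt; apply/negPn; rewrite negb_or; apply/negP => /andP[t3 t4].
have p3 := sn_3pos sn; have p4 := sn_4pos sn.
apply: (snake_link (y := t) (w := [::]) sn) => //=; last by rewrite adj_sym.
move=> v; rewrite inE => /eqP ->; rewrite !nadjI //.
  by apply: (neq_adj bt); apply: (sn_24 sn); range_lia.
by apply: (neq_adj bt); apply: (sn_23 sn); range_lia.
Qed.

(** Induction on the size of [T]. A single vertex [t] is handled by [snake_dominated]. Otherwise the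
    induction hypothesis and [snake_classify] for [T :\ t] show that one of [c], [d] is complete to
    [T :\ t] and misses [t]; two choices of [t] give the configuration of [antihole2], with [b] as
    the complete vertex that misses [c] and [d]. *)
Lemma snake_no_complete f1 n1 f2 n2 f3 n3 f4 n4 T : snakef f1 n1 f2 n2 f3 n3 f4 n4 ->
  coconn T -> Kc T (f1 0) -> Kc T (f2 0) ->
  (forall k, k <= n3 -> ~~ Kc T (f3 k)) -> (forall k, k <= n4 -> ~~ Kc T (f4 k)) -> False.
Proof.
move=> sn; have p3 := sn_3pos sn; have p4 := sn_4pos sn.
have [m] := ubnP #|T|; elim: m T => // m IH T Tm cT Ka Kb N3 N4.
have dom t : t \in T -> (t -- f3 0) || (t -- f4 0).
  by move=> tT; apply: (snake_dominated sn); [apply: (KcP _ _ Ka)|apply: (KcP _ _ Kb)].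
have dom' t : t \in T -> (t -- f3 n3) || (t -- f4 n4).
  move=> tT; have := @snake_dominated _ _ _ _ _ _ _ _ t (snake_flip sn).
  by rewrite !subn0; apply; [apply: (KcP _ _ Kb)|apply: (KcP _ _ Ka)].
have [T1|T1] := leqP #|T| 1.
  have /cards1P [t eT] : #|T| == 1 by rewrite eqn_leq T1 card_gt0 (cT.1).
  have tT : t \in T by rewrite eT set11.
  have Kt v : t -- v -> Kc T v.
    by move=> tv; apply/KcP => t'; rewrite eT => /set1P ->; rewrite adj_sym.
  by case/orP: (dom t tT) => /Kt; apply/negP; [apply: N3|apply: N4].
have [b [b' [bT b'T bb' cb cb']]] := coconn_two cT T1.
(* Each of [T :\ b] and [T :\ b'] picks one of [c], [d]; they pick different ones. *)
have key t : t \in T -> coconn (T :\ t) -> exists v, [/\ v \in [:: f3 0; f4 0], Kc (T :\ t) v & nadj v t].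
  move=> tT ct; have Ka' : Kc (T :\ t) (f1 0) by apply: Kc_sub Ka; rewrite subsetDl.
  have Kb' : Kc (T :\ t) (f2 0) by apply: Kc_sub Kb; rewrite subsetDl.
  have nt v : Kc (T :\ t) v -> ~~ Kc T v -> ~~ v -- t by move=> Kv; rewrite (Kc_setD1 _ tT) Kv andbT.
  have nl : ~~ (Kc (T :\ t) (f3 0) && Kc (T :\ t) (f4 0)).
    apply/negP => /andP[k3 k4]; have := dom t tT; rewrite !(adj_sym t).
    by rewrite (negbTE (nt _ k3 (N3 0 isT))) (negbTE (nt _ k4 (N4 0 isT))).
  have nr : ~~ (Kc (T :\ t) (f3 n3) && Kc (T :\ t) (f4 n4)).
    apply/negP => /andP[k3 k4]; have := dom' t tT; rewrite !(adj_sym t).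
    by rewrite (negbTE (nt _ k3 (N3 _ (leqnn _)))) (negbTE (nt _ k4 (N4 _ (leqnn _)))).
  have ex : (exists2 k, k <= n3 & Kc (T :\ t) (f3 k)) \/ (exists2 k, k <= n4 & Kc (T :\ t) (f4 k)).
    have [/existsP [[k klt] /= Kk]|/existsPn h3] := boolP [exists k : 'I_n3.+1, Kc (T :\ t) (f3 k)].
      by left; exists k.
    have [/existsP [[k klt] /= Kk]|/existsPn h4] := boolP [exists k : 'I_n4.+1, Kc (T :\ t) (f4 k)].
      by right; exists k.
    exfalso; apply: (IH (T :\ t)) => //.
    - by move: Tm; rewrite (cardsD1 t T) tT.
    - by move=> k hk; apply: (h3 (Ordinal (_ : k < n3.+1))).
    by move=> k hk; apply: (h4 (Ordinal (_ : k < n4.+1))).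
  have [_ h _ _] := snake_classify (roussel_rubio hG ct) sn Ka' Kb' nl nr ex.
  have bt : f2 0 -- t by apply: (KcP _ _ Kb).
  have [k3|k3] := boolP (Kc (T :\ t) (f3 0)).
    exists (f3 0); split=> //; first by rewrite inE eqxx.
    rewrite nadj_sym; apply: nadjI; last by rewrite adj_sym; apply: nt (N3 0 isT).
    by apply: (neq_adj bt); apply: (sn_23 sn); range_lia.
  have k4 : Kc (T :\ t) (f4 0) by move: h; rewrite (negbTE k3).
  exists (f4 0); split=> //; first by rewrite !inE eqxx orbT.
  rewrite nadj_sym; apply: nadjI; last by rewrite adj_sym; apply: nt (N4 0 isT).
  by apply: (neq_adj bt); apply: (sn_24 sn); range_lia.
have [p [hp Kp pb]] := key b bT cb; have [q [hq Kq qb']] := key b' b'T cb'.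
have nK v : v \in [:: f3 0; f4 0] -> ~~ Kc T v.
  by rewrite !inE => /orP[] /eqP ->; [apply: N3|apply: N4].
have pq : p != q.
  apply/eqP => e; subst q; have := nK p hp; rewrite (Kc_setD1 _ bT) Kp andbT.
  by rewrite (KcP _ _ Kq) // !inE bb'.
have pq' : p -- q.
  move: hp hq pq; rewrite !inE => /orP[] /eqP -> /orP[] /eqP ->; rewrite ?eqxx // => _;
    by rewrite ?(sn_34c sn) // adj_sym (sn_34c sn).
have nb v : v \in [:: f3 0; f4 0] -> nadj (f2 0) v.
  by rewrite !inE => /orP[] /eqP ->; [apply: (sn_23 sn)|apply: (sn_24 sn)]; range_lia.
exact: (antihole2 hG cT bT b'T bb' pb qb' Kp Kq pq' Kb (nb _ hp) (nb _ hq)).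
Qed.
End Special.

Section SpecialPair.
Variables (G : sgraph) (hG : class_A G).
Implicit Types (f g z : nat -> G) (T U : {set G}) (A B : pred G).

(** The induced path from [a] to [b] along the first, third and second paths; [snake_swap] gives the
    one along the fourth. *)
Lemma snake_path f1 n1 f2 n2 f3 n3 f4 n4 : snakef f1 n1 f2 n2 f3 n3 f4 n4 ->
  exists g, [/\ ipf g 0 (n1 + n3 + n2).+2, forall k, k <= n1 -> g k = f1 k,
    forall k, k <= n3 -> g (n1.+1 + k) = f3 k & forall k, k <= n2 -> g ((n1 + n3).+2 + k) = f2 (n2 - k)].
Proof.
case=> h1 h2 h3 h4 p3 p4 h12 h13 h13e h14 h14e h23 h23e h24 h24e h34 hc hc'.
pose s := seg f1 0 n1 ++ seg f3 0 n3 ++ seg f2 n2 0.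
have ip : ipath s by rewrite /s; geo.
have := ipath_ipf (f1 0) ip; rewrite /s !size_cat !size_seg => hg.
exists (nth (f1 0) s); split.
- by have -> : (n1 + n3 + n2).+2 = (0 - n1 + (n1 - 0) + 1 + (0 - n3 + (n3 - 0) + 1 + (n2 - 0 + (0 - n2) + 1))).-1 by lia.
- by move=> k hk; rewrite /s nth_cat size_seg ifT ?nth_seg ?leq0n //; lia.
- move=> k hk; rewrite /s nth_cat size_seg ifF ?nth_cat ?size_seg ?ifT; try lia.
  by rewrite nth_seg; [rewrite leq0n; congr f3; lia|lia].
move=> k hk; rewrite /s nth_cat size_seg ifF ?nth_cat ?size_seg ?ifF; try lia.
rewrite nth_seg; last by lia.
have [e|n20] := posnP n2; first by rewrite e leqnn; congr f2; lia.
by rewrite leqNgt n20 /=; congr f2; lia.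
Qed.

(** This is what the choice of the maximal pair contributes to the exclusion of snakes, in a form
    stable under reversing the frame. *)
Definition inner_untouched_on T z n a b := forall f r, ipf f 0 r -> f 0 = a -> f r = b -> 3 <= r ->
  forall k, 0 < k < r -> Kc T (f k) -> ~~ touch z n (f k).

Lemma inner_untouched_on_rev T z n a b : inner_untouched_on T z n a b ->
  inner_untouched_on T (fun i => z (n.+1 - i)) n b a.
Proof.
move=> h f r hf f0 fr r3 k hk Kk; rewrite touch_rev.
have := h (fun i => f (r - i)) r (ipf_rev hf).
rewrite subn0 subnn => /(_ fr f0 r3 (r - k) ltac:(range_lia)).
by rewrite subKn; [apply|range_lia].
Qed.

(** If neither [c] nor [d] touches [z], then [z 1, ..., z n] joins [a] to [b] away from both,
    against [snake_link]. *)
Lemma frame_link T z n A B f1 n1 f2 n2 f3 n3 f4 n4 : frame T z n A B ->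
  snakef f1 n1 f2 n2 f3 n3 f4 n4 -> A (f1 0) -> B (f2 0) ->
  touch z n (f3 0) || touch z n (f4 0).
Proof.
move=> fr sn Aa Bb; apply/negPn; rewrite negb_or; apply/negP => /andP[t3 t4].
have n3' := fr_n fr; have hz := fr_z fr.
have lz : z n -- f2 0 by rewrite adj_sym (fr_Bn fr Bb).
have hp : path adj (z 1) (seg z 2 n).
  by apply: path_cons_ipath; rewrite ?head_seg ?seg_neq0 //; [apply: (ipath_seg hz)|apply: (ipf_adj hz)]; range_lia.
apply: (snake_link hG (w := seg z 2 n) sn (fr_A1 fr Aa) hp); last by rewrite last_seg.
have nz i : 1 <= i <= n -> nadj (z i) (f3 0) && nadj (z i) (f4 0).
  by move=> hi; rewrite !(nadj_sym (z i)) (touchN t3) // (touchN t4).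
move=> v; rewrite inE => /orP[/eqP ->|/mem_segP [i hi ->]]; apply: nz; range_lia.
Qed.

(** The two paths from [a] to [b], through [c] and through [d], agree up to [a'] and fork there.
    Properness enters here: [0 < n1] makes [a'] an inner vertex, as [fork_contra] needs. *)
Lemma special_fork T z n A B f1 n1 f2 n2 f3 n3 f4 n4 : frame T z n A B ->
  snakef f1 n1 f2 n2 f3 n3 f4 n4 -> A (f1 0) -> B (f2 0) ->
  inner_untouched_on T z n (f1 0) (f2 0) -> 0 < n1 ->
  Kc T (f1 n1) -> Kc T (f3 0) -> ~~ Kc T (f4 0) -> False.
Proof.
move=> fr sn Aa Bb un n10 Ka' Kc3 nK4.
have [g [hg g1 g3 g2]] := snake_path sn.
have [h [hh h1 h4 h2]] := snake_path (snake_swap sn).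
have p3 := sn_3pos sn; have p4 := sn_4pos sn.
have eg : g (n1 + n3 + n2).+2 = f2 0.
  by rewrite -[X in f2 X](subnn n2) -g2 //; congr g; lia.
have eh : h (n1 + n4 + n2).+2 = f2 0.
  by rewrite -[X in f2 X](subnn n2) -h2 //; congr h; lia.
have g0 : g 0 = f1 0 := g1 0 isT.
have h0 : h 0 = f1 0 := h1 0 isT.
have ec : g n1.+1 = f3 0 by rewrite -g3 // addn0.
have ed : h n1.+1 = f4 0 by rewrite -h4 // addn0.
have Dg := un _ _ hg g0 eg ltac:(range_lia); have Dh := un _ _ hh h0 eh ltac:(range_lia).
have kr : 0 < n1.+1 < (n1 + n3 + n2).+2 by range_lia.
have nt3 : ~~ touch z n (f3 0) by rewrite -ec; apply: Dg kr _; rewrite ec.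
have td : touch z n (h n1.+1) by have := frame_link fr sn Aa Bb; rewrite (negbTE nt3) ed.
have Ag : A (g 0) by rewrite g0.
have Bg : B (g (n1 + n3 + n2).+2) by rewrite eg.
have Bh : B (h (n1 + n4 + n2).+2) by rewrite eh.
have E k : k <= n1 -> h k = g k by move=> hk; rewrite g1 ?h1.
apply: (fork_contra hG fr hg hh Ag Bg Bh Dg Dh n10 _ _ E _ _ _ td); rewrite ?ec ?ed ?g1 //; try by range_lia.
  by rewrite adj_sym (sn_34c sn).
move=> k hk; rewrite nadj_sym.
have [k3|k3] := leqP k (n1.+1 + n3).
  have -> : k = n1.+1 + (k - n1.+1) by range_lia.
  by rewrite g3; [apply: (sn_34 sn)|]; range_lia.
have -> : k = (n1 + n3).+2 + (k - (n1 + n3).+2) by range_lia.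
by rewrite g2; [apply: (sn_24 sn)|]; range_lia.
Qed.

Lemma frame_no_snake T z n A B f1 n1 f2 n2 f3 n3 f4 n4 : frame T z n A B ->
  snakef f1 n1 f2 n2 f3 n3 f4 n4 -> A (f1 0) -> B (f2 0) ->
  inner_untouched_on T z n (f1 0) (f2 0) -> 0 < n1 \/ 0 < n2 -> False.
Proof.
move=> fr sn Aa Bb un n12; have Ka := fr_AK fr Aa; have Kb := fr_BK fr Bb.
(* If [c] and [d] were both complete, each would be an inner vertex of an induced path from [a] to
   [b] and so touch no vertex of the outer path, against [frame_link]. *)
have half m1 m2 m3 m4 g1 g2 g3 g4 z' A' B' : frame T z' n A' B' ->
    snakef g1 m1 g2 m2 g3 m3 g4 m4 -> A' (g1 0) -> B' (g2 0) ->
    inner_untouched_on T z' n (g1 0) (g2 0) -> ~~ (Kc T (g3 0) && Kc T (g4 0)).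
  move=> fr' sn' Aa' Bb' un'; apply/negP => /andP[k3 k4].
  have [g [hg e1 e3 e2]] := snake_path sn'; have [h [hh e1' e4 e2']] := snake_path (snake_swap sn').
  have eg : g (m1 + m3 + m2).+2 = g2 0 by rewrite -[X in g2 X](subnn m2) -e2 //; congr g; lia.
  have eh : h (m1 + m4 + m2).+2 = g2 0 by rewrite -[X in g2 X](subnn m2) -e2' //; congr h; lia.
  have p3 := sn_3pos sn'; have p4 := sn_4pos sn'.
  have := frame_link fr' sn' Aa' Bb'.
  have /negbTE -> : ~~ touch z' n (g3 0).
    rewrite -e3 // addn0; apply: (un' _ _ hg (e1 0 isT) eg); rewrite ?ltnS //; try lia.
    by rewrite -[m1.+1]addn0 e3.
  have /negbTE -> // : ~~ touch z' n (g4 0).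
  rewrite -e4 // addn0; apply: (un' _ _ hh (e1' 0 isT) eh); rewrite ?ltnS //; try lia.
  by rewrite -[m1.+1]addn0 e4.
have nl := half _ _ _ _ _ _ _ _ _ _ _ fr sn Aa Bb un.
have fr' := frame_rev fr; have un' := inner_untouched_on_rev un; have sn' := snake_flip sn.
have nr : ~~ (Kc T (f3 n3) && Kc T (f4 n4)).
  by have := half _ _ _ _ _ _ _ _ _ _ _ fr' sn' Bb Aa un'; rewrite !subn0.
have ex : (exists2 k, k <= n3 & Kc T (f3 k)) \/ (exists2 k, k <= n4 & Kc T (f4 k)).
  have [/existsP [[k klt] /= Kk]|/existsPn h3] := boolP [exists k : 'I_n3.+1, Kc T (f3 k)].
    by left; exists k.
  have [/existsP [[k klt] /= Kk]|/existsPn h4] := boolP [exists k : 'I_n4.+1, Kc T (f4 k)].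
    by right; exists k.
  exfalso; apply: (snake_no_complete hG sn (fr_cc fr) Ka Kb).
    by move=> k hk; apply: (h3 (Ordinal (_ : k < n3.+1))).
  by move=> k hk; apply: (h4 (Ordinal (_ : k < n4.+1))).
have [Ka' x34 Kb' x34'] := snake_classify hG (roussel_rubio hG (fr_cc fr)) sn Ka Kb nl nr ex.
case: n12 => [n10|n20].
  have [k3|k3] := boolP (Kc T (f3 0)).
    by apply: (special_fork fr sn Aa Bb un n10 Ka' k3); move: x34; rewrite k3.
  have k4 : Kc T (f4 0) by move: x34; rewrite (negbTE k3).
  exact: (special_fork fr (snake_swap sn) Aa Bb un n10 Ka' k4 k3).
have [k3|k3] := boolP (Kc T (f3 n3)).
  apply: (special_fork fr' sn' Bb Aa un' n20 Kb'); rewrite subn0 //.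
  by move: x34'; rewrite k3.
have k4 : Kc T (f4 n4) by move: x34'; rewrite (negbTE k3).
by apply: (special_fork fr' (snake_swap sn') Bb Aa un' n20 Kb'); rewrite subn0.
Qed.

Theorem frame_special T z n A B a0 b0 : frame T z n A B -> A a0 -> B b0 -> exists a b, [/\ A a, B b,
    (forall f r, ipf f 0 r -> f 0 = a -> f r = b -> odd r = false)
  & forall f1 n1 f2 n2 f3 n3 f4 n4, f1 0 = a -> f2 0 = b -> 0 < n1 \/ 0 < n2 ->
      snakef f1 n1 f2 n2 f3 n3 f4 n4 -> False].
Proof.
move=> fr Aa0 Bb0; have [a [b [Aa Bb good]]] := exists_maximal_pair hG fr Aa0 Bb0.
exists a, b; split=> // [f r hf f0 fr'|f1 n1 f2 n2 f3 n3 f4 n4 e1 e2 n12 sn].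
  exact: (goodp_even hG fr (good f r hf f0 fr')).
apply: (frame_no_snake fr sn _ _ _ n12); rewrite ?e1 ?e2 //.
move=> f r hf f0 fr' r3; have gp := good f r hf f0 fr'.
apply: (inner_untouched fr hf r3); [exact: gd_A gp|exact: gd_B gp|apply: (gd_nA gp)|apply: (gd_nB gp)];
  range_lia.
Qed.
End SpecialPair.

(** * Existence of frames *)

Section FrameExists.
Variables (G : sgraph) (hG : class_A G).
Implicit Types (z : nat -> G) (T : {set G}) (x y v : G).

Definition interesting T := coconn T /\ exists x y, [/\ Kc T x, Kc T y & nadj x y].

Definition outer T x w y : bool := [&& Kc T x, Kc T y, nadj x y, path adj x (rcons w y)
  & all (fun v => (v \notin T) && ~~ Kc T v) w].

Lemma interesting_maximal T0 : interesting T0 -> exists2 T, interesting T &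
  forall T', interesting T' -> ~ (T \proper T').
Proof.
apply: (@exists_maximal {set G} (fun T T' => T \proper T')) => [S1 S2 S3|S].
  exact: proper_trans.
by rewrite properxx.
Qed.

(** Turning a shortest walk into an induced path uses only its own vertices, so the result is again
    an outer path and, by minimality, has the same length. *)
Lemma outer_shortest T x w y : outer T x w y -> exists z n,
  [/\ ipf z 0 n.+1, outer T (z 0) (seg z 1 n) (z n.+1), 0 < n
    & forall x' w' y', outer T x' w' y' -> n <= size w'].
Proof.
move=> ow.
pose P n := [exists x, exists y, exists w : n.-tuple G, outer T x w y].
have PI x' w' y' : outer T x' w' y' -> P (size w').
  by move=> h; apply/existsP; exists x'; apply/existsP; exists y'; apply/existsP; exists (in_tuple w').
have ex : exists n, P n by exists (size w); apply: PI ow.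
case: (ex_minnP ex) => n /existsP [a /existsP [b /existsP [s os]]] mn.
have [Ka Kb nab pab sout] : [/\ Kc T a, Kc T b, nadj a b, path adj a (rcons s b)
   & all (fun v => (v \notin T) && ~~ Kc T v) s] by case/and5P: os.
have [q [iq lq sq]] := walk_ipath pab; rewrite last_rcons in lq.
case/lastP: q iq lq sq => [_ /= e|q b'].
  by move: nab; rewrite /nadj e eqxx.
rewrite last_rcons => iq e sq; subst b'.
have uq : uniq (rcons q b) by have := ipath_uniq iq; rewrite cons_uniq => /andP[].
have qs : {subset q <= s}.
  move=> v vq; have := sq v; rewrite !mem_rcons !inE vq orbT => /(_ isT) /orP[/eqP e|//].
  by move: uq; rewrite rcons_uniq -e vq.
have oq : outer T a q b.
  rewrite /outer Ka Kb nab ipath_path //=; apply/allP => v /qs; exact: (allP sout).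
have sz : size q = n.
  apply/eqP; rewrite eqn_leq (mn _ (PI _ _ _ oq)) andbT -[X in _ <= X](size_tuple s).
  by apply: uniq_leq_size => //; move: uq; rewrite rcons_uniq => /andP[].
have n0 : 0 < n.
  rewrite -sz lt0n size_eq0; apply/eqP => e; move: oq; rewrite e /outer => /and5P[_ _ /andP[_ nab'] /= /andP[ab _] _].
  by rewrite ab in nab'.
pose z := nth a (a :: rcons q b).
have hz : ipf z 0 n.+1 by have := ipath_ipf a iq; rewrite /= size_rcons sz.
have eb : z n.+1 = b by rewrite /z /= nth_rcons sz ltnn eqxx.
have es : seg z 1 n = q.
  apply: (@eq_from_nth _ a); rewrite size_seg ?sz; first by move: n0; clear; lia.
  move=> k hk; rewrite nth_seg; last by lia.
  by rewrite n0 /z /= nth_rcons sz ifT //; lia.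
exists z, n; split=> //; first by rewrite es eb.
by move=> x' w' y' /PI; apply: mn.
Qed.

Lemma frame_exists T x w y : interesting T -> (forall T', interesting T' -> ~ (T \proper T')) ->
  outer T x w y -> exists z n A B, [/\ frame T z n A B, A (z 0) & B (z n.+1)].
Proof.
move=> [cT _] mT /outer_shortest [z [n [hz /and5P [Ka Kb nab _ sout] n0 mn]]].
have zo i : 1 <= i <= n -> (z i \notin T) && ~~ Kc T (z i).
  by move=> hi; apply: (allP sout); apply/mem_segP; exists i => //; range_lia.
have nT i : 1 <= i <= n -> z i \notin T by move/zo/andP => [].
have nK i : 1 <= i <= n -> ~~ Kc T (z i) by move/zo/andP => [].
have HK := roussel_rubio hG cT.
have on : odd n.
  have := HK z 0 n.+1 hz ltac:(range_lia) Ka Kb.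
  by rewrite subn0 /= => /(_ _)/negbFE; apply=> k hk; apply: nK; range_lia.
(* Two nonadjacent complete neighbours of [z i] would make [z i |: T] a larger interesting set. *)
have cl i u v : 1 <= i <= n -> Kc T u -> Kc T v -> u -- z i -> v -- z i -> u != v -> u -- v.
  move=> hi Ku Kv ui vi uv; apply/negPn/negP => nuv.
  apply: (mT (z i |: T)).
    split; last by exists u, v; rewrite !Kc_setU1 ui vi Ku Kv /nadj uv nuv.
    apply: coconnU1 => //; have := nK i hi; rewrite negb_forall_in => /exists_inP [t tT ti].
    exists t => //; rewrite nadj_sym; apply: nadjI ti.
    by apply: contraNneq (nT i hi) => ->.
  by rewrite properUr // sub1set; apply: nT.
have n3 : 3 <= n.
  rewrite ltnNge; apply/negP => n2; have n1 : n = 1 by move: on n0 n2; clear; lia.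
  subst n; have := @cl 1 (z 0) (z 2) isT Ka Kb.
  rewrite (ipf_adj hz (i := 0) (j := 1)) // (ipf_adj hz (i := 2) (j := 1)) //.
  by case/andP: nab => -> /negbTE -> /(_ isT isT isT).
have adjz u i : 1 <= i <= n -> Kc T u -> ~~ nadj u (z i) -> u -- z i.
  move=> hi Ku; rewrite /nadj negb_and !negbK => /orP[/eqP e|//].
  by move: (nK i hi); rewrite -e Ku.
(* The stretch of [z] between neighbours of two nonadjacent complete vertices is again an outer
   path, so by minimality it is all of [z]: the indices are 1 and [n]. *)
have short u v i j : Kc T u -> Kc T v -> 1 <= i <= n -> 1 <= j <= n -> u -- z i -> v -- z j ->
    nadj u v -> n <= (i - j) + (j - i) + 1.
  move=> Ku Kv hi hj ui vj uv; rewrite -(size_seg z i j); apply: (mn u _ v).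
  rewrite /outer Ku Kv uv rcons_path path_cons_ipath ?head_seg ?seg_neq0 ?last_seg //=; last first.
    by apply: (ipath_seg hz); range_lia.
  by rewrite adj_sym vj /=; apply: all_seg => k hk; apply: zo; range_lia.
pose A : pred G := fun v => [&& Kc T v, v -- z 1 & all (fun i => nadj v (z i)) (iota 2 n.-1)].
pose B : pred G := fun v => [&& Kc T v, v -- z n & all (fun i => nadj v (z i)) (iota 1 n.-1)].
have AI v : Kc T v -> v -- z 1 -> (forall i, 1 < i <= n -> nadj v (z i)) -> A v.
  by move=> Kv v1 nv; rewrite /A Kv v1 /=; apply/allP => i; rewrite mem_iota => hi; apply: nv; range_lia.
have BI v : Kc T v -> v -- z n -> (forall i, 1 <= i < n -> nadj v (z i)) -> B v.
  by move=> Kv v1 nv; rewrite /B Kv v1 /=; apply/allP => i; rewrite mem_iota => hi; apply: nv; range_lia.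
have AE v : A v -> [/\ Kc T v, v -- z 1 & forall i, 1 < i <= n -> nadj v (z i)].
  case/and3P => -> -> /allP h; split=> // i hi; apply: h; rewrite mem_iota; range_lia.
have BE v : B v -> [/\ Kc T v, v -- z n & forall i, 1 <= i < n -> nadj v (z i)].
  case/and3P => -> -> /allP h; split=> // i hi; apply: h; rewrite mem_iota; range_lia.
have hz1 : ipf z 1 n by apply: (ipf_sub hz); range_lia.
exists z, n, A, B; split; last 2 first.
- by apply: AI => // [|i hi]; [apply: (ipf_adj hz)|apply: (ipf_nadj hz)]; range_lia.
- by apply: BI => // [|i hi]; [apply: (ipf_adj hz)|apply: (ipf_nadj hz)]; range_lia.
split=> //.
- by move=> a /AE [].
- by move=> a /AE [].
- by move=> a i /AE [_ _]; apply.
- by move=> b /BE [].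
- by move=> b /BE [].
- by move=> b i /BE [_ _]; apply.
- by move=> a a' /AE [Kx x1 _] /AE [Ky y1 _]; apply: (cl 1).
- by move=> b b' /BE [Kx x1 _] /BE [Ky y1 _]; apply: (cl n) => //; range_lia.
- move=> a b /AE [Kx x1 nx] /BE [Ky y1 ny].
  have ne : a != b.
    apply/eqP => e; subst b; have := ny 1 ltac:(range_lia); rewrite /nadj x1 andbF //.
  apply: nadjI ne _; apply/negP => ab.
  (* An edge between [a] and [b] would close [z] to a hole with [n + 2] vertices, an odd number. *)
  have := @hole_even G hG [:: a] (seg z 1 n) [:: b].
  rewrite !size_cat !size_seg => /(_ isT ltac:(range_lia) isT ltac:(simpl; range_lia) isT).
  suff h : ipath (seg z 1 n ++ [:: b]) /\ link [:: a] (seg z 1 n) /\ link [:: b] [:: a].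
    by case: h => [p1 [p2 p3]] /(_ p1 p2 p3) /=; move: on; clear; lia.
  by split; [|split]; geo.
move=> v Kv nA nB.
have [/existsP [[i ilt] /= /andP[i0 nvi]]|/existsPn h] :=
    boolP [exists i : 'I_n.+1, (0 < i) && ~~ nadj v (z i)]; last first.
  left=> i hi; have := h (Ordinal (_ : i < n.+1)) => /=.
  by case/andP: (hi) => hi1 hi2; rewrite hi1 => /(_ hi2) /negPn.
(* If [v] misses some vertex of [A], then by [short] every [z j] seen by [v] is [z n], which puts
   [v] in [B]. The other side is symmetric. *)
right; have vi := adjz v i ltac:(range_lia) Kv nvi.
split=> u hu.
  have [Ku u1 nu] := AE u hu; apply/negPn/negP => nvu.
  have uv : nadj u v.
    by rewrite nadj_sym; apply: nadjI nvu; apply: contraNneq nA => ->.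
  case/negP: nB; apply: BI => //.
    have := short u v 1 i Ku Kv ltac:(range_lia) ltac:(range_lia) u1 vi uv.
    by move=> hi; have -> : n = i by range_lia.
  move=> j hj; apply/negPn/negP => /adjz vj.
  have := short u v 1 j Ku Kv ltac:(range_lia) ltac:(range_lia) u1 (vj ltac:(range_lia) Kv) uv.
  by range_lia.
have [Ku u1 nu] := BE u hu; apply/negPn/negP => nvu.
have uv : nadj u v.
  by rewrite nadj_sym; apply: nadjI nvu; apply: contraNneq nB => ->.
case/negP: nA; apply: AI => //.
  have := short u v n i Ku Kv ltac:(range_lia) ltac:(range_lia) u1 vi uv.
  by move=> hi; have <- : i = 1 by range_lia.
move=> j hj; apply/negPn/negP => /adjz vj.
have := short u v n j Ku Kv ltac:(range_lia) ltac:(range_lia) u1 (vj ltac:(range_lia) Kv) uv.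
by range_lia.
Qed.
End FrameExists.

(** * Special even pairs *)

Section SnakeEdges.
Variables (T : eqType) (a b c d : T) (s1 s2 s3 s4 : seq T).

Definition snake_edge (u v : T) : bool :=
  [|| path_edge (a :: s1) u v, path_edge (b :: s2) u v, path_edge (c :: s3) u v,
      path_edge (d :: s4) u v, triangle_edge (last a s1) c d u v
    | triangle_edge (last b s2) (last c s3) (last d s4) u v].

Lemma path_edgeC (s : seq T) u v : path_edge s u v = path_edge s v u.
Proof. by rewrite /path_edge orbC. Qed.

Lemma triangle_edgeC (x y w u v : T) : triangle_edge x y w u v = triangle_edge x y w v u.
Proof. by rewrite /triangle_edge eq_sym [X in _ && X]andbC. Qed.

Lemma snake_edgeC u v : snake_edge u v = snake_edge v u.
Proof.
rewrite /snake_edge !(path_edgeC _ u v) !(triangle_edgeC _ _ _ u v).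
by [].
Qed.

Hypothesis us : uniq ((a :: s1) ++ (b :: s2) ++ (c :: s3) ++ (d :: s4)).
Let f1 := nth a (a :: s1).
Let f2 := nth b (b :: s2).
Let f3 := nth c (c :: s3).
Let f4 := nth d (d :: s4).

Let disj (x : T) : [/\ x \in a :: s1 -> [&& x \notin b :: s2, x \notin c :: s3 & x \notin d :: s4],
  x \in b :: s2 -> [&& x \notin a :: s1, x \notin c :: s3 & x \notin d :: s4],
  x \in c :: s3 -> [&& x \notin a :: s1, x \notin b :: s2 & x \notin d :: s4]
  & x \in d :: s4 -> [&& x \notin a :: s1, x \notin b :: s2 & x \notin c :: s3]].
Proof.
(* The occurrences of [x] in the four parts of a duplicate-free list add up to at most one, which
   turns disjointness into arithmetic. *)
have := count_uniq_mem x us; rewrite !mem_cat !count_cat -!has_pred1 !has_count.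
by split; lia.
Qed.

Let uq : [/\ uniq (a :: s1), uniq (b :: s2), uniq (c :: s3) & uniq (d :: s4)].
Proof. by have := us; rewrite !cat_uniq => /and3P[-> _ /and3P[-> _ /and3P[-> _ ->]]]. Qed.

Let neqO (x y : T) (s : seq T) : x \notin s -> y \in s -> (x == y) = false.
Proof. by move=> ns ys; apply/negbTE/eqP => e; move: ns; rewrite e ys. Qed.

Let tri1 k : k <= size s1 -> [/\ f1 k \in a :: s1, (f1 k \in [:: last a s1; c; d]) = (k == size s1)
  & (f1 k \in [:: last b s2; last c s3; last d s4]) = false].
Proof.
move=> hk; have m : f1 k \in a :: s1 by apply: mem_nth.
have [/(_ m)/and3P[n2 n3 n4] _ _ _] := disj (f1 k); have [u _ _ _] := uq.
split=> //; rewrite !inE ?(neqO n2 (mem_last _ _)) ?(neqO n3 (mem_last _ _)) ?(neqO n4 (mem_last _ _))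
  ?(neqO n3 (mem_head _ _)) ?(neqO n4 (mem_head _ _)) ?orbF //.
by rewrite [last a s1](last_nth a) nth_uniq.
Qed.

Let tri2 k : k <= size s2 -> [/\ f2 k \in b :: s2, (f2 k \in [:: last a s1; c; d]) = false
  & (f2 k \in [:: last b s2; last c s3; last d s4]) = (k == size s2)].
Proof.
move=> hk; have m : f2 k \in b :: s2 by apply: mem_nth.
have [_ /(_ m)/and3P[n1 n3 n4] _ _] := disj (f2 k); have [_ u _ _] := uq.
split=> //; rewrite !inE ?(neqO n1 (mem_last _ _)) ?(neqO n3 (mem_last _ _)) ?(neqO n4 (mem_last _ _))
  ?(neqO n3 (mem_head _ _)) ?(neqO n4 (mem_head _ _)) ?orbF //.
by rewrite [last b s2](last_nth b) nth_uniq.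
Qed.

Let tri3 k : k <= size s3 -> [/\ f3 k \in c :: s3, (f3 k \in [:: last a s1; c; d]) = (k == 0)
  & (f3 k \in [:: last b s2; last c s3; last d s4]) = (k == size s3)].
Proof.
move=> hk; have m : f3 k \in c :: s3 by apply: mem_nth.
have [_ _ /(_ m)/and3P[n1 n2 n4] _] := disj (f3 k); have [_ _ u _] := uq.
split=> //; rewrite !inE ?(neqO n1 (mem_last _ _)) ?(neqO n2 (mem_last _ _)) ?(neqO n4 (mem_last _ _))
  ?(neqO n4 (mem_head _ _)) ?orbF /=.
  by rewrite -[X in _ == X]/(nth c (c :: s3) 0) nth_uniq.
by rewrite [last c s3](last_nth c) nth_uniq.
Qed.

Let tri4 k : k <= size s4 -> [/\ f4 k \in d :: s4, (f4 k \in [:: last a s1; c; d]) = (k == 0)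
  & (f4 k \in [:: last b s2; last c s3; last d s4]) = (k == size s4)].
Proof.
move=> hk; have m : f4 k \in d :: s4 by apply: mem_nth.
have [_ _ _ /(_ m)/and3P[n1 n2 n3]] := disj (f4 k); have [_ _ _ u] := uq.
split=> //; rewrite !inE ?(neqO n1 (mem_last _ _)) ?(neqO n2 (mem_last _ _)) ?(neqO n3 (mem_last _ _))
  ?(neqO n3 (mem_head _ _)) ?orbF /=.
  by rewrite -[X in _ == X]/(nth d (d :: s4) 0) nth_uniq.
by rewrite [last d s4](last_nth d) nth_uniq.
Qed.

Let out (s : seq T) u v : (u \notin s) || (v \notin s) -> path_edge s u v = false.
Proof. exact: path_edge_out. Qed.

Let nots x : [/\ x \in a :: s1 -> [/\ x \notin b :: s2, x \notin c :: s3 & x \notin d :: s4],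
  x \in b :: s2 -> [/\ x \notin a :: s1, x \notin c :: s3 & x \notin d :: s4],
  x \in c :: s3 -> [/\ x \notin a :: s1, x \notin b :: s2 & x \notin d :: s4]
  & x \in d :: s4 -> [/\ x \notin a :: s1, x \notin b :: s2 & x \notin c :: s3]].
Proof. by have [h1 h2 h3 h4] := disj x; split=> [/h1|/h2|/h3|/h4] /and3P. Qed.

Lemma snake_edge11 k l : k < l <= size s1 -> (f1 k != f1 l) && (snake_edge (f1 k) (f1 l) == (l == k.+1)).
Proof.
case/andP=> kl l1; have k1 : k <= size s1 by apply: ltnW; apply: leq_trans l1.
have [m e e'] := tri1 k1; have [m' ee ee'] := tri1 l1; have [u _ _ _] := uq.
have [/(_ m)[x2 x3 x4] _ _ _] := nots (f1 k).
rewrite /snake_edge (@out (b :: s2) (f1 k)) ?x2 // (@out (c :: s3) (f1 k)) ?x3 // (@out (d :: s4) (f1 k)) ?x4 // /triangle_edge e e' ee ee'.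
rewrite (path_edge_nth _ u (k1 : k < size (a :: s1)) (l1 : l < size (a :: s1))) nth_uniq //.
by move: kl l1 k1; clear; lia.
Qed.

Lemma snake_edge22 k l : k < l <= size s2 -> (f2 k != f2 l) && (snake_edge (f2 k) (f2 l) == (l == k.+1)).
Proof.
case/andP=> kl l1; have k1 : k <= size s2 by apply: ltnW; apply: leq_trans l1.
have [m e e'] := tri2 k1; have [m' ee ee'] := tri2 l1; have [_ u _ _] := uq.
have [_ /(_ m)[x2 x3 x4] _ _] := nots (f2 k).
rewrite /snake_edge (@out (a :: s1) (f2 k)) ?x2 // (@out (c :: s3) (f2 k)) ?x3 // (@out (d :: s4) (f2 k)) ?x4 // /triangle_edge e e' ee ee'.
rewrite (path_edge_nth _ u (k1 : k < size (b :: s2)) (l1 : l < size (b :: s2))) nth_uniq //.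
by move: kl l1 k1; clear; lia.
Qed.

Lemma snake_edge33 k l : k < l <= size s3 -> (f3 k != f3 l) && (snake_edge (f3 k) (f3 l) == (l == k.+1)).
Proof.
case/andP=> kl l1; have k1 : k <= size s3 by apply: ltnW; apply: leq_trans l1.
have [m e e'] := tri3 k1; have [m' ee ee'] := tri3 l1; have [_ _ u _] := uq.
have [_ _ /(_ m)[x2 x3 x4] _] := nots (f3 k).
rewrite /snake_edge (@out (a :: s1) (f3 k)) ?x2 // (@out (b :: s2) (f3 k)) ?x3 // (@out (d :: s4) (f3 k)) ?x4 // /triangle_edge e e' ee ee'.
rewrite (path_edge_nth _ u (k1 : k < size (c :: s3)) (l1 : l < size (c :: s3))) nth_uniq //.
by move: kl l1 k1; clear; lia.
Qed.

Lemma snake_edge44 k l : k < l <= size s4 -> (f4 k != f4 l) && (snake_edge (f4 k) (f4 l) == (l == k.+1)).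
Proof.
case/andP=> kl l1; have k1 : k <= size s4 by apply: ltnW; apply: leq_trans l1.
have [m e e'] := tri4 k1; have [m' ee ee'] := tri4 l1; have [_ _ _ u] := uq.
have [_ _ _ /(_ m)[x2 x3 x4]] := nots (f4 k).
rewrite /snake_edge (@out (a :: s1) (f4 k)) ?x2 // (@out (b :: s2) (f4 k)) ?x3 // (@out (c :: s3) (f4 k)) ?x4 // /triangle_edge e e' ee ee'.
rewrite (path_edge_nth _ u (k1 : k < size (d :: s4)) (l1 : l < size (d :: s4))) nth_uniq //.
by move: kl l1 k1; clear; lia.
Qed.

Lemma snake_edge12 k l : k <= size s1 -> l <= size s2 ->
  (f1 k != f2 l) && (snake_edge (f1 k) (f2 l) == false).
Proof.
move=> k1 l1; have [m e e'] := tri1 k1; have [m' ee ee'] := tri2 l1.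
have [/(_ m)[x2 x3 x4] _ _ _] := nots (f1 k); have [_ /(_ m')[y2 y3 y4] _ _] := nots (f2 l).
rewrite /snake_edge (@out (b :: s2) (f1 k)) ?x2 // (@out (c :: s3) (f1 k)) ?x3 // (@out (d :: s4) (f1 k)) ?x4 // (@out (a :: s1) (f1 k)) ?y2 ?orbT // /triangle_edge e e' ee ee'.
by rewrite (neqO x2 m'); move: k1 l1; clear; lia.
Qed.

Lemma snake_edge13 k l : k <= size s1 -> l <= size s3 ->
  (f1 k != f3 l) && (snake_edge (f1 k) (f3 l) == (k == size s1) && (l == 0)).
Proof.
move=> k1 l1; have [m e e'] := tri1 k1; have [m' ee ee'] := tri3 l1.
have [/(_ m)[x2 x3 x4] _ _ _] := nots (f1 k); have [_ _ /(_ m')[y2 y3 y4] _] := nots (f3 l).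
rewrite /snake_edge (@out (b :: s2) (f1 k)) ?x2 // (@out (c :: s3) (f1 k)) ?x3 // (@out (d :: s4) (f1 k)) ?x4 // (@out (a :: s1) (f1 k)) ?y2 ?orbT // /triangle_edge e e' ee ee'.
by rewrite (neqO x3 m'); move: k1 l1; clear; lia.
Qed.

Lemma snake_edge14 k l : k <= size s1 -> l <= size s4 ->
  (f1 k != f4 l) && (snake_edge (f1 k) (f4 l) == (k == size s1) && (l == 0)).
Proof.
move=> k1 l1; have [m e e'] := tri1 k1; have [m' ee ee'] := tri4 l1.
have [/(_ m)[x2 x3 x4] _ _ _] := nots (f1 k); have [_ _ _ /(_ m')[y2 y3 y4]] := nots (f4 l).
rewrite /snake_edge (@out (b :: s2) (f1 k)) ?x2 // (@out (c :: s3) (f1 k)) ?x3 // (@out (d :: s4) (f1 k)) ?x4 // (@out (a :: s1) (f1 k)) ?y2 ?orbT // /triangle_edge e e' ee ee'.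
by rewrite (neqO x4 m'); move: k1 l1; clear; lia.
Qed.

Lemma snake_edge23 k l : k <= size s2 -> l <= size s3 ->
  (f2 k != f3 l) && (snake_edge (f2 k) (f3 l) == (k == size s2) && (l == size s3)).
Proof.
move=> k1 l1; have [m e e'] := tri2 k1; have [m' ee ee'] := tri3 l1.
have [_ /(_ m)[x2 x3 x4] _ _] := nots (f2 k); have [_ _ /(_ m')[y2 y3 y4] _] := nots (f3 l).
rewrite /snake_edge (@out (a :: s1) (f2 k)) ?x2 // (@out (c :: s3) (f2 k)) ?x3 // (@out (d :: s4) (f2 k)) ?x4 // (@out (b :: s2) (f2 k)) ?y3 ?orbT // /triangle_edge e e' ee ee'.
by rewrite (neqO x3 m'); move: k1 l1; clear; lia.
Qed.

Lemma snake_edge24 k l : k <= size s2 -> l <= size s4 ->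
  (f2 k != f4 l) && (snake_edge (f2 k) (f4 l) == (k == size s2) && (l == size s4)).
Proof.
move=> k1 l1; have [m e e'] := tri2 k1; have [m' ee ee'] := tri4 l1.
have [_ /(_ m)[x2 x3 x4] _ _] := nots (f2 k); have [_ _ _ /(_ m')[y2 y3 y4]] := nots (f4 l).
rewrite /snake_edge (@out (a :: s1) (f2 k)) ?x2 // (@out (c :: s3) (f2 k)) ?x3 // (@out (d :: s4) (f2 k)) ?x4 // (@out (b :: s2) (f2 k)) ?y3 ?orbT // /triangle_edge e e' ee ee'.
by rewrite (neqO x4 m'); move: k1 l1; clear; lia.
Qed.

Lemma snake_edge34 k l : k <= size s3 -> l <= size s4 -> (f3 k != f4 l) &&
  (snake_edge (f3 k) (f4 l) == (k == 0) && (l == 0) || (k == size s3) && (l == size s4)).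
Proof.
move=> k1 l1; have [m e e'] := tri3 k1; have [m' ee ee'] := tri4 l1.
have [_ _ /(_ m)[x2 x3 x4] _] := nots (f3 k); have [_ _ _ /(_ m')[y2 y3 y4]] := nots (f4 l).
rewrite /snake_edge (@out (a :: s1) (f3 k)) ?x2 // (@out (b :: s2) (f3 k)) ?x3 // (@out (d :: s4) (f3 k)) ?x4 // (@out (c :: s3) (f3 k)) ?y4 ?orbT // /triangle_edge e e' ee ee'.
by rewrite (neqO x4 m'); move: k1 l1; clear; lia.
Qed.
End SnakeEdges.

Section SnakeLists.
Variable H : sgraph.

Lemma path_edge_irr (T : eqType) (s : seq T) u : uniq s -> path_edge s u u = false.
Proof.
move=> us; have [/(nthP u) [i hi <-]|nu] := boolP (u \in s); last by rewrite path_edge_out ?nu.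
by rewrite path_edge_nth //; lia.
Qed.

Lemma snakef_lists (a b c d : H) s1 s2 s3 s4 :
  snakef (nth a (a :: s1)) (size s1) (nth b (b :: s2)) (size s2)
         (nth c (c :: s3)) (size s3) (nth d (d :: s4)) (size s4) <->
  [/\ 0 < size s3, 0 < size s4, uniq ((a :: s1) ++ (b :: s2) ++ (c :: s3) ++ (d :: s4))
    & {in (a :: s1) ++ (b :: s2) ++ (c :: s3) ++ (d :: s4) &,
       forall u v, u -- v = snake_edge a b c d s1 s2 s3 s4 u v}].
Proof.
set f1 := nth a _; set f2 := nth b _; set f3 := nth c _; set f4 := nth d _.
have m1 k : k <= size s1 -> f1 k \in a :: s1 by move=> hk; apply: mem_nth.
have m2 k : k <= size s2 -> f2 k \in b :: s2 by move=> hk; apply: mem_nth.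
have m3 k : k <= size s3 -> f3 k \in c :: s3 by move=> hk; apply: mem_nth.
have m4 k : k <= size s4 -> f4 k \in d :: s4 by move=> hk; apply: mem_nth.
set L := _ ++ _; split=> [sn|[p3 p4 us E]]; last first.
  have M1 k : k <= size s1 -> f1 k \in L by rewrite !mem_cat => /m1 ->.
  have M2 k : k <= size s2 -> f2 k \in L by rewrite !mem_cat => /m2 ->; rewrite !orbT.
  have M3 k : k <= size s3 -> f3 k \in L by rewrite !mem_cat => /m3 ->; rewrite !orbT.
  have M4 k : k <= size s4 -> f4 k \in L by rewrite !mem_cat => /m4 ->; rewrite !orbT.
  have N i (u v : H) : u \in L -> v \in L -> (u != v) && (snake_edge a b c d s1 s2 s3 s4 u v == i) ->
    (u != v) && (u -- v == i) by move=> hu hv; rewrite E.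
  have D (u v : H) : (u != v) && (u -- v == false) -> nadj u v.
    by case/andP=> n /eqP e; rewrite /nadj n e.
  split=> //.
  - by move=> i j _ ij jn; exact: (N _ _ _ (M1 _ (ltnW (leq_trans ij jn))) (M1 _ jn) (snake_edge11 us (introT andP (conj ij jn)))).
  - by move=> i j _ ij jn; exact: (N _ _ _ (M2 _ (ltnW (leq_trans ij jn))) (M2 _ jn) (snake_edge22 us (introT andP (conj ij jn)))).
  - by move=> i j _ ij jn; exact: (N _ _ _ (M3 _ (ltnW (leq_trans ij jn))) (M3 _ jn) (snake_edge33 us (introT andP (conj ij jn)))).
  - by move=> i j _ ij jn; exact: (N _ _ _ (M4 _ (ltnW (leq_trans ij jn))) (M4 _ jn) (snake_edge44 us (introT andP (conj ij jn)))).
  - by move=> i j hi hj; apply/D/N; [apply: M1|apply: M2|apply: (snake_edge12 us)].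
  - move=> i j hi hj h; apply/D/N; [exact: M1|exact: M3|].
    by have := snake_edge13 us hi hj; rewrite (_ : ((i == size s1) && (j == 0)) = false) //; move: h; clear; lia.
  - by have /andP[_] := N _ _ _ (M1 _ (leqnn _)) (M3 0 isT) (snake_edge13 us (leqnn _) (leq0n _)); rewrite ?eqxx => /eqP.
  - move=> i j hi hj h; apply/D/N; [exact: M1|exact: M4|].
    by have := snake_edge14 us hi hj; rewrite (_ : ((i == size s1) && (j == 0)) = false) //; move: h; clear; lia.
  - by have /andP[_] := N _ _ _ (M1 _ (leqnn _)) (M4 0 isT) (snake_edge14 us (leqnn _) (leq0n _)); rewrite ?eqxx => /eqP.
  - move=> i j hi hj h; apply/D/N; [exact: M2|exact: M3|].
    by have := snake_edge23 us hi hj; rewrite (_ : ((i == size s2) && (j == size s3)) = false) //; move: h; clear; lia.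
  - by have /andP[_] := N _ _ _ (M2 _ (leqnn _)) (M3 _ (leqnn _)) (snake_edge23 us (leqnn _) (leqnn _)); rewrite ?eqxx => /eqP.
  - move=> i j hi hj h; apply/D/N; [exact: M2|exact: M4|].
    by have := snake_edge24 us hi hj; rewrite (_ : ((i == size s2) && (j == size s4)) = false) //; move: h; clear; lia.
  - by have /andP[_] := N _ _ _ (M2 _ (leqnn _)) (M4 _ (leqnn _)) (snake_edge24 us (leqnn _) (leqnn _)); rewrite ?eqxx => /eqP.
  - move=> i j hi hj h h'; apply/D/N; [exact: M3|exact: M4|].
    have := snake_edge34 us hi hj.
    by rewrite (_ : ((i == 0) && (j == 0) || (i == size s3) && (j == size s4)) = false) //; move: h h'; clear; lia.
  - by have /andP[_] := N _ _ _ (M3 0 isT) (M4 0 isT) (snake_edge34 us (leq0n _) (leq0n _)); rewrite ?eqxx => /eqP.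
  by have /andP[_] := N _ _ _ (M3 _ (leqnn _)) (M4 _ (leqnn _)) (snake_edge34 us (leqnn _) (leqnn _)); rewrite ?eqxx orbT => /eqP.
have V u v : nadj u v -> (u != v) && (u -- v == false) by case/andP=> -> /negbTE ->.
have A13 i j : i <= size s1 -> j <= size s3 ->
    (f1 i != f3 j) && (f1 i -- f3 j == (i == size s1) && (j == 0)).
  move=> hi hj; have [/andP[/eqP -> /eqP ->]|n] := boolP ((i == size s1) && (j == 0)).
    by rewrite (sn_13e sn) adj_neq // (sn_13e sn).
  by apply/V/(sn_13 sn) => //; rewrite negb_and in n.
have A14 i j : i <= size s1 -> j <= size s4 ->
    (f1 i != f4 j) && (f1 i -- f4 j == (i == size s1) && (j == 0)).
  move=> hi hj; have [/andP[/eqP -> /eqP ->]|n] := boolP ((i == size s1) && (j == 0)).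
    by rewrite (sn_14e sn) adj_neq // (sn_14e sn).
  by apply/V/(sn_14 sn) => //; rewrite negb_and in n.
have A23 i j : i <= size s2 -> j <= size s3 ->
    (f2 i != f3 j) && (f2 i -- f3 j == (i == size s2) && (j == size s3)).
  move=> hi hj; have [/andP[/eqP -> /eqP ->]|n] := boolP ((i == size s2) && (j == size s3)).
    by rewrite (sn_23e sn) adj_neq // (sn_23e sn).
  by apply/V/(sn_23 sn) => //; rewrite negb_and in n.
have A24 i j : i <= size s2 -> j <= size s4 ->
    (f2 i != f4 j) && (f2 i -- f4 j == (i == size s2) && (j == size s4)).
  move=> hi hj; have [/andP[/eqP -> /eqP ->]|n] := boolP ((i == size s2) && (j == size s4)).
    by rewrite (sn_24e sn) adj_neq // (sn_24e sn).
  by apply/V/(sn_24 sn) => //; rewrite negb_and in n.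
have A34 i j : i <= size s3 -> j <= size s4 -> (f3 i != f4 j) &&
    (f3 i -- f4 j == (i == 0) && (j == 0) || (i == size s3) && (j == size s4)).
  move=> hi hj; have [/andP[/eqP -> /eqP ->]|n] := boolP ((i == 0) && (j == 0)).
    by rewrite (sn_34c sn) adj_neq // (sn_34c sn).
  have [/andP[/eqP -> /eqP ->]|n'] := boolP ((i == size s3) && (j == size s4)).
    by rewrite (sn_34c' sn) adj_neq // (sn_34c' sn).
  by apply/V/(sn_34 sn) => //; [rewrite negb_and in n|rewrite negb_and in n'].
have A12 i j : i <= size s1 -> j <= size s2 -> (f1 i != f2 j) && (f1 i -- f2 j == false).
  by move=> hi hj; apply/V/(sn_12 sn).
have I x (s : seq H) v : v \in x :: s -> exists2 k, k <= size s & v = nth x (x :: s) k.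
  by move=> /(nthP x) [k hk <-]; exists k.
have US x (s : seq H) : ipf (nth x (x :: s)) 0 (size s) -> uniq (x :: s).
  by move=> h; apply: ipath_uniq; apply/(ipath_nthP x) => i j /andP[ij jn]; apply: h.
have DJ (x y : H) s t : (forall i j, i <= size s -> j <= size t -> nth x (x :: s) i != nth y (y :: t) j) ->
    forall v, v \in y :: t -> v \notin x :: s.
  move=> h v /I [j hj ->]; apply/negP => /I [i hi e]; have := h i j hi hj.
  by rewrite e eqxx.
have CU (s t : seq H) : uniq s -> uniq t -> (forall v, v \in t -> v \notin s) -> uniq (s ++ t).
  by move=> u1 u2 h; rewrite cat_uniq u1 u2 andbT; apply/hasPn.
have us : uniq L.
  apply: (CU _ _); [exact: US (sn_1 sn)|apply: (CU _ _); [exact: US (sn_2 sn)|apply: (CU _ _)|]|].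
  - exact: US (sn_3 sn).
  - exact: US (sn_4 sn).
  - by apply: DJ => i j hi hj; case/andP: (A34 _ _ hi hj).
  - move=> v; rewrite mem_cat => /orP[]; apply: DJ => i j hi hj.
      by case/andP: (A23 _ _ hi hj).
    by case/andP: (A24 _ _ hi hj).
  move=> v; rewrite !mem_cat => /or3P[]; apply: DJ => i j hi hj.
  - by case/andP: (A12 _ _ hi hj).
  - by case/andP: (A13 _ _ hi hj).
  by case/andP: (A14 _ _ hi hj).
split=> //; [exact: sn_3pos sn|exact: sn_4pos sn|].
pose X (u v : H) := u -- v = snake_edge a b c d s1 s2 s3 s4 u v.
have XC u v : X u v -> X v u by rewrite /X adj_sym snake_edgeC.
have XI u : X u u.
  have u1 := US _ _ (sn_1 sn); have u2 := US _ _ (sn_2 sn).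
  have u3 := US _ _ (sn_3 sn); have u4 := US _ _ (sn_4 sn).
  by rewrite /X adj_irrefl /snake_edge !path_edge_irr // /triangle_edge eqxx.
have XE i (u v : H) : (u != v) && (u -- v == i) -> (u != v) && (snake_edge a b c d s1 s2 s3 s4 u v == i) -> X u v.
  by move=> /andP[_ /eqP e] /andP[_ /eqP e']; rewrite /X e e'.
have XS (f : nat -> H) n : (forall k l, k < l <= n -> X (f k) (f l)) -> forall k l, k <= n -> l <= n -> X (f k) (f l).
  move=> h k l hk hl; have [kl|lk|->] := ltngtP k l; [|apply: XC|exact: XI]; apply: h; lia.
have X11 := XS f1 (size s1) (fun k l h => XE _ _ _ (sn_1 sn (leq0n k) (proj1 (andP h)) (proj2 (andP h))) (snake_edge11 us h)).
have X22 := XS f2 (size s2) (fun k l h => XE _ _ _ (sn_2 sn (leq0n k) (proj1 (andP h)) (proj2 (andP h))) (snake_edge22 us h)).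
have X33 := XS f3 (size s3) (fun k l h => XE _ _ _ (sn_3 sn (leq0n k) (proj1 (andP h)) (proj2 (andP h))) (snake_edge33 us h)).
have X44 := XS f4 (size s4) (fun k l h => XE _ _ _ (sn_4 sn (leq0n k) (proj1 (andP h)) (proj2 (andP h))) (snake_edge44 us h)).
have X12 k l (hk : k <= size s1) (hl : l <= size s2) := XE _ _ _ (A12 k l hk hl) (snake_edge12 us hk hl).
have X13 k l (hk : k <= size s1) (hl : l <= size s3) := XE _ _ _ (A13 k l hk hl) (snake_edge13 us hk hl).
have X14 k l (hk : k <= size s1) (hl : l <= size s4) := XE _ _ _ (A14 k l hk hl) (snake_edge14 us hk hl).
have X23 k l (hk : k <= size s2) (hl : l <= size s3) := XE _ _ _ (A23 k l hk hl) (snake_edge23 us hk hl).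
have X24 k l (hk : k <= size s2) (hl : l <= size s4) := XE _ _ _ (A24 k l hk hl) (snake_edge24 us hk hl).
have X34 k l (hk : k <= size s3) (hl : l <= size s4) := XE _ _ _ (A34 k l hk hl) (snake_edge34 us hk hl).
have P v : v \in L -> [\/ exists2 k, k <= size s1 & v = f1 k, exists2 k, k <= size s2 & v = f2 k,
    exists2 k, k <= size s3 & v = f3 k | exists2 k, k <= size s4 & v = f4 k].
  by rewrite !mem_cat => /or4P[] /I ?; [apply: Or41|apply: Or42|apply: Or43|apply: Or44].
move=> u v /P + /P; case=> -[k hk ->]; case=> -[l hl ->].
- exact: X11. - exact: X12. - exact: X13. - exact: X14.
- exact/XC/X12. - exact: X22. - exact: X23. - exact: X24.
- exact/XC/X13. - exact/XC/X23. - exact: X33. - exact: X34.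
- exact/XC/X14. - exact/XC/X24. - exact/XC/X34. - exact: X44.
Qed.
End SnakeLists.

(** Agreement is asked for on the index ranges only: lifts to an induced subgraph use a default
    vertex and mean nothing beyond them. *)
Lemma snakef_map (H G : sgraph) (h : H -> G) f1 n1 f2 n2 f3 n3 f4 n4 g1 g2 g3 g4 : injective h ->
  (forall u v, h u -- h v = u -- v) ->
  (forall k, k <= n1 -> g1 k = h (f1 k)) -> (forall k, k <= n2 -> g2 k = h (f2 k)) ->
  (forall k, k <= n3 -> g3 k = h (f3 k)) -> (forall k, k <= n4 -> g4 k = h (f4 k)) ->
  snakef g1 n1 g2 n2 g3 n3 g4 n4 <-> snakef f1 n1 f2 n2 f3 n3 f4 n4.
Proof.
move=> hi ha e1 e2 e3 e4.
have N u v : nadj (h u) (h v) = nadj u v by rewrite /nadj (inj_eq hi) ha.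
have I (f : nat -> H) g n : (forall k, k <= n -> g k = h (f k)) -> ipf g 0 n <-> ipf f 0 n.
  by move=> e; split=> hf i j i0 ij jn; have := hf i j i0 ij jn; rewrite !e ?(inj_eq hi) ?ha //; lia.
split; case=> h1 h2 h3 h4 p3 p4 h12 h13 h13e h14 h14e h23 h23e h24 h24e h34 hc hc'; split=> //;
 try (by apply/(I _ _ _ e1)); try (by apply/(I _ _ _ e2)); try (by apply/(I _ _ _ e3));
 try (by apply/(I _ _ _ e4)); try (by move: h13e h14e h23e h24e hc hc'; rewrite !(e1, e2, e3, e4) ?ha);
 move=> i j li lj.
- by have := h12 i j li lj; rewrite e1 // e2 // N.
- by have := h13 i j li lj; rewrite e1 // e3 // N.
- by have := h14 i j li lj; rewrite e1 // e4 // N.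
- by have := h23 i j li lj; rewrite e2 // e3 // N.
- by have := h24 i j li lj; rewrite e2 // e4 // N.
- by have := h34 i j li lj; rewrite e3 // e4 // N.
- by have := h12 i j li lj; rewrite e1 // e2 // N.
- by have := h13 i j li lj; rewrite e1 // e3 // N.
- by have := h14 i j li lj; rewrite e1 // e4 // N.
- by have := h23 i j li lj; rewrite e2 // e3 // N.
- by have := h24 i j li lj; rewrite e2 // e4 // N.
by have := h34 i j li lj; rewrite e3 // e4 // N.
Qed.

Section SpecialLists.
Variable G : sgraph.

Lemma chordless_pathP (x y : G) p :
  chordless_path x p y <-> ipath (x :: p) /\ last x p = y.
Proof.
split=> [[px ly u E]|[ip ly]].
  split=> //; apply/(ipath_nthP x) => i j /andP[ij jn].
  have i_n : i < size (x :: p) := ltn_trans ij jn.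
  rewrite nth_uniq // neq_ltn ij /=; have [e|ji] := eqVneq j i.+1.
    by rewrite e eqb_id; rewrite e in jn; move/(pathP x): px => h; apply: h.
  rewrite eqbF_neg; apply/negP => /(E _ _ (mem_nth _ i_n) (mem_nth _ jn)).
  by rewrite path_edge_nth // (negbTE ji) /=; move: ij; clear; lia.
have u := ipath_uniq ip; split=> //; first exact: ipath_path.
move=> v w /(nthP x) [i hi <-] /(nthP x) [j hj <-]; rewrite path_edge_nth // => a.
have /(ipath_nthP x) h := ip; have [ij|ji|e] := ltngtP i j.
- by have /andP[_ /eqP] := h i j (introT andP (conj ij hj)); rewrite a => <-.
- by have /andP[_ /eqP] := h j i (introT andP (conj ji hi)); rewrite adj_sym a => <-; rewrite orbT.
by rewrite e adj_irrefl in a.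
Qed.

Lemma contains_proper_snakeP (a b : G) : contains_proper_snake a b <->
  exists f1 n1 f2 n2 f3 n3 f4 n4,
    [/\ f1 0 = a, f2 0 = b, 0 < n1 \/ 0 < n2 & snakef f1 n1 f2 n2 f3 n3 f4 n4].
Proof.
split=> [[S [aS [bS [s1 [s2 [c [s3 [d [s4 [[[p3 p4] us _ E] n12]]]]]]]]]]|].
  set x : induced S := exist _ a aS; set y : induced S := exist _ b bS.
  have sn : snakef (nth x (x :: s1)) (size s1) (nth y (y :: s2)) (size s2)
         (nth c (c :: s3)) (size s3) (nth d (d :: s4)) (size s4).
    by apply/snakef_lists; split=> // u v _ _; apply: E.
  exists (fun k => val (nth x (x :: s1) k)), (size s1), (fun k => val (nth y (y :: s2) k)), (size s2),
    (fun k => val (nth c (c :: s3) k)), (size s3), (fun k => val (nth d (d :: s4) k)), (size s4).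
  by split=> //; apply/(@snakef_map (induced S) G val _ _ _ _ _ _ _ _ _ _ _ _ val_inj _ _ _ _ _); last exact: sn.
case=> f1 [n1 [f2 [n2 [f3 [n3 [f4 [n4 [fa fb n12 sn]]]]]]]].
pose L := seg f1 0 n1 ++ seg f2 0 n2 ++ seg f3 0 n3 ++ seg f4 0 n4.
pose S := [set v in L].
have lift f n : {subset seg f 0 n <= L} -> exists x (t : seq (induced S)),
    [/\ size t = n, forall k, k <= n -> f k = val (nth x (x :: t) k) & map val (x :: t) = seg f 0 n].
  move=> sub; have [v vs|s es] := @lift_seq G S (seg f 0 n); first by rewrite inE sub.
  have sz : size s = n.+1 by rewrite -(size_map val) es size_seg sub0n subn0 addn1.
  case: s es sz => [//|x t] es [sz]; exists x, t; split=> // k hk.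
  by rewrite -(nth_map x (f 0)) /= ?sz // -map_cons es nth_seg //; lia.
have [|x1 [t1 [z1 e1 m1]]] := lift f1 n1; first by move=> v; rewrite !mem_cat => ->.
have [|x2 [t2 [z2 e2 m2]]] := lift f2 n2; first by move=> v; rewrite !mem_cat => ->; rewrite !orbT.
have [|x3 [t3 [z3 e3 m3]]] := lift f3 n3; first by move=> v; rewrite !mem_cat => ->; rewrite !orbT.
have [|x4 [t4 [z4 e4 m4]]] := lift f4 n4; first by move=> v; rewrite !mem_cat => ->; rewrite !orbT.
have sn' : snakef (nth x1 (x1 :: t1)) (size t1) (nth x2 (x2 :: t2)) (size t2)
         (nth x3 (x3 :: t3)) (size t3) (nth x4 (x4 :: t4)) (size t4).
  rewrite z1 z2 z3 z4.
  by apply/(@snakef_map (induced S) G val _ _ _ _ _ _ _ _ _ _ _ _ val_inj _ e1 e2 e3 e4); last exact: sn.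
have [p3 p4 us E] := (snakef_lists _ _ _ _ _ _ _ _).1 sn'.
have cov v : v \in (x1 :: t1) ++ (x2 :: t2) ++ (x3 :: t3) ++ (x4 :: t4).
  have : val v \in L by have := valP v; rewrite inE.
  by rewrite /L -m1 -m2 -m3 -m4 -!map_cat mem_map //; apply: val_inj.
have ea : val x1 = a by rewrite -fa e1.
have eb : val x2 = b by rewrite -fb e2.
case: x1 x2 {e1 e2 m1 m2} ea eb sn' us E cov => [a' aS] [b' bS] /= ea eb sn' us E cov; subst a' b'.
exists S, aS, bS, t1, t2, x3, t3, x4, t4; rewrite z1 z2; split=> //.
by split=> // u v; apply: E.
Qed.

Lemma special_even_pairP (a b : G) : special_even_pair a b <->
  [/\ nadj a b, forall f r, ipf f 0 r -> f 0 = a -> f r = b -> odd r = false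
    & forall f1 n1 f2 n2 f3 n3 f4 n4, f1 0 = a -> f2 0 = b -> 0 < n1 \/ 0 < n2 ->
      snakef f1 n1 f2 n2 f3 n3 f4 n4 -> False].
Proof.
split=> [[[ne na ev] ns]|[ab ev ns]].
  split; first by rewrite /nadj ne na.
    move=> f r hf f0 fr; have ip : ipath (seg f 0 r) by apply: (ipath_seg hf); lia.
    have := last_seg a f 0 r; have := size_seg f 0 r; have := head_seg a f 0 r.
    case: (seg f 0 r) ip => [|x s] ip /=; first by lia.
    rewrite f0 fr => ex sz ls; subst x; have := ev s; rewrite (_ : size s = r); last by move: sz; clear; lia.
    by move=> h; apply/negbTE/h/chordless_pathP.
  move=> f1 n1 f2 n2 f3 n3 f4 n4 fa fb n12 sn; apply: ns; apply/contains_proper_snakeP.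
  by exists f1, n1, f2, n2, f3, n3, f4, n4.
split.
  split; [by case/andP: ab|by case/andP: ab|].
  move=> p /chordless_pathP [ip lp]; have := ev (nth a (a :: p)) (size p) (ipath_ipf a ip) erefl.
  by rewrite -lp -(last_nth a) => /(_ erefl) ->.
move=> /contains_proper_snakeP [f1 [n1 [f2 [n2 [f3 [n3 [f4 [n4 [fa fb n12 sn]]]]]]]]].
exact: ns fa fb n12 sn.
Qed.
End SpecialLists.

(** * The case without outer path *)

Section NoOuterPath.
Variables (G : sgraph) (T : {set G}).
Hypothesis no : forall x w y, ~~ outer T x w y.
Let K := [set v | Kc T v].

(** A vertex of [T] is adjacent to both ends, so it cannot lie on an induced path with at least
    three edges. A stretch of vertices that are not complete would therefore be an outer path. *)
Lemma no_outer_path f r : ipf f 0 r -> Kc T (f 0) -> Kc T (f r) -> 2 < r ->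
  forall k, k <= r -> f k \in K.
Proof.
move=> hf K0 Kr r3 k kr; rewrite inE; apply/negPn/negP => nKk.
have nT j : j <= r -> f j \notin T.
  move=> jr; apply/negP => fjT; have a0 := KcP _ _ K0 _ fjT; have ar := KcP _ _ Kr _ fjT.
  have [j0|j0] := posnP j; first by rewrite j0 adj_irrefl in a0.
  have /andP[_ /eqP e0] := hf 0 j isT j0 jr; rewrite a0 in e0.
  have [jr'|jr'] := eqVneq j r; first by rewrite jr' adj_irrefl in ar.
  have jr2 : j < r by rewrite ltn_neqAle jr' jr.
  have /andP[_ /eqP er] := hf j r isT jr2 (leqnn _); rewrite adj_sym ar in er.
  by move: e0 er r3; clear; lia.
have [i [hi Ki ni]] := @last_index (fun l => Kc T (f l)) 0 k isT K0.
have [j [hj Kj nj]] := @first_index (fun l => Kc T (f l)) k r kr Kr.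
have ik : i != k by apply: contraTneq Ki => ->.
have jk : j != k by apply: contraTneq Kj => ->.
have ij : i.+1 < j by range_lia.
have := no (f i) (seg f i.+1 j.-1) (f j); apply/negP; rewrite negbK.
rewrite /outer Ki Kj (ipf_nadj hf) ?rcons_path ?last_seg; try by range_lia.
rewrite path_cons_ipath ?head_seg ?seg_neq0 //.
- rewrite (ipf_adj hf) /=; try by range_lia.
  apply: all_seg => l hl; rewrite nT; last by range_lia.
  by have [lk|kl] := leqP l k; [apply: ni|apply: nj]; range_lia.
- by apply: (ipath_seg hf); range_lia.
by apply: (ipf_adj hf); range_lia.
Qed.

Lemma ipf_lift (a : induced K) f n : (forall k, k <= n -> f k \in K) ->
  forall k, k <= n -> f k = val (insubd a (f k)).
Proof. by move=> h k hk; rewrite val_insubd h. Qed.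

(** A snake is covered by its two induced paths from [a] to [b], both with at least three edges. So
    every proper snake, and every induced path that could be odd, already lies among the complete
    vertices. *)
Lemma special_no_outer (a b : induced K) : special_even_pair a b ->
  special_even_pair (val a) (val b).
Proof.
move=> /special_even_pairP [ab ev ns]; apply/special_even_pairP.
have Ka : Kc T (val a) by have := valP a; rewrite inE.
have Kb : Kc T (val b) by have := valP b; rewrite inE.
have ab' : nadj (val a) (val b) by move: ab; rewrite /nadj.
split=> // [f r hf f0 fr|f1 n1 f2 n2 f3 n3 f4 n4 fa fb n12 sn].
  have [r2|r2] := leqP r 2.
    move: r2 hf fr f0; case: r => [|[|[|//]]] // _ hf fr f0.
    have /andP[_ /eqP e] := hf 0 1 isT isT isT.
    by move: ab'; rewrite -f0 -fr /nadj e andbF.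
  have inK := no_outer_path hf _ _ r2; rewrite f0 fr in inK; have {}inK := inK Ka Kb.
  apply: (ev (fun k => insubd a (f k))).
  - move=> i j i0 ij jr; have := hf i j i0 ij jr.
    by rewrite -(inj_eq val_inj) /= /ind_adj !val_insubd !inK //; range_lia.
  - by apply: val_inj; rewrite val_insubd inK.
  by apply: val_inj; rewrite val_insubd inK.
have [g [hg e1 e3 e2]] := snake_path sn.
have [h [hh e1' e4 e2']] := snake_path (snake_swap sn).
have p3 := sn_3pos sn; have p4 := sn_4pos sn.
have gr : g (n1 + n3 + n2).+2 = f2 0 by rewrite -[X in f2 X](subnn n2) -e2 //; congr g; lia.
have hr : h (n1 + n4 + n2).+2 = f2 0 by rewrite -[X in f2 X](subnn n2) -e2' //; congr h; lia.
have Kg := @no_outer_path g _ hg; have Kh := @no_outer_path h _ hh.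
rewrite gr e1 // fa fb in Kg; rewrite hr e1' // fa fb in Kh.
have {}Kg := Kg Ka Kb ltac:(range_lia); have {}Kh := Kh Ka Kb ltac:(range_lia).
have I1 k : k <= n1 -> f1 k \in K by move=> hk; rewrite -e1 //; apply: Kg; range_lia.
have I2 k : k <= n2 -> f2 k \in K.
  by move=> hk; rewrite -(subKn hk) -e2 ?leq_subr //; apply: Kg; range_lia.
have I3 k : k <= n3 -> f3 k \in K by move=> hk; rewrite -e3 //; apply: Kg; range_lia.
have I4 k : k <= n4 -> f4 k \in K by move=> hk; rewrite -e4 //; apply: Kh; range_lia.
have sn' := (@snakef_map (induced K) G val _ _ _ _ _ _ _ _ _ _ _ _ val_inj (fun u v => erefl)
  (ipf_lift a I1) (ipf_lift a I2) (ipf_lift a I3) (ipf_lift a I4)).1 sn.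
apply: (ns _ _ _ _ _ _ _ _ _ _ n12 sn').
  by apply: val_inj; rewrite val_insubd I1.
by apply: val_inj; rewrite val_insubd I2.
Qed.
End NoOuterPath.

(* No neighbourhood contains two nonadjacent vertices here: the components are complete. *)
Lemma special_disjoint_cliques (G : sgraph) (x y : G) :
  (forall T : {set G}, ~ interesting T) -> nadj x y -> special_even_pair x y.
Proof.
move=> h xy; have cl (t u v : G) : u -- t -> v -- t -> nadj u v -> False.
  move=> ut vt uv; suff : interesting [set t] by apply: h.
  split; first exact: coconn1.
  by exists u, v; split=> //; apply/KcP => w /set1P ->.
apply/special_even_pairP; split=> // [f r hf f0 fr|f1 n1 f2 n2 f3 n3 f4 n4 _ _ _ sn].
  case: r hf fr => [//|[|r]] hf fr.
    by move: xy; rewrite -f0 -fr /nadj (ipf_adj hf (i := 0) (j := 1)) // andbF.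
  exfalso; apply: (cl (f 1) (f 0) (f 2)).
  - by apply: (ipf_adj hf).
  - by apply: (ipf_adj hf).
  by apply: (ipf_nadj hf).
have p3 := sn_3pos sn; apply: (cl (f3 0) (f1 n1) (f3 1)).
- exact: sn_13e sn.
- by apply: (ipf_adj (sn_3 sn)); range_lia.
by apply: (sn_13 sn); range_lia.
Qed.

Theorem special_exists (G : sgraph) : class_A G -> is_clique G \/ exists a b : G, special_even_pair a b.
Proof.
have [m] := ubnP #|G|; elim: m G => // m IH G Gm hG.
have [cl|ncl] := classic (is_clique G); [by left|right].
have [[T0 iT0]|nT] := classic (exists T : {set G}, interesting T); last first.
  have [/existsP [x /existsP [y xy]]|/existsPn h] := boolP [exists x : G, exists y, nadj x y].
    by exists x, y; apply: special_disjoint_cliques xy => T iT; apply: nT; exists T.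
  case: ncl => x y ne; have /existsPn/(_ y) := h x.
  by rewrite /nadj ne negbK.
have [T iT mT] := interesting_maximal iT0.
have [[x [w [y ow]]]|no] := classic (exists x w y, outer T x w y).
  have [z [n [A [B [fr Aa Bb]]]]] := frame_exists hG iT mT ow.
  have [a [b [Aa' Bb' ev ns]]] := frame_special hG fr Aa Bb.
  exists a, b; apply/special_even_pairP; split=> //; first exact: (fr_AB fr).
have no' x w y : ~~ outer T x w y by apply/negP => o; apply: no; exists x, w, y.
pose K := [set v | Kc T v].
have [t tT] := set0Pn _ iT.1.1.
(* A vertex [t] of the nonempty set [T] is not complete, so the complete vertices induce a smaller
   graph. *)
have cK : #|induced K| < m.
  rewrite card_sig -ltnS; apply: leq_trans Gm; rewrite ltnS.
  have -> : #|[pred x in K]| = #|K| by apply: eq_card.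
  apply: (@leq_trans #|K|.+1) => //.
  have -> : #|K|.+1 = #|t |: K| by rewrite cardsU1 inE; case: (boolP (Kc T t)) => [/Kc_notin|//]; rewrite tT.
  exact: max_card.
have [cl|[a [b ab]]] := IH (induced K) cK (class_A_induced K hG); last first.
  by exists (val a), (val b); apply: (special_no_outer no').
have [_ [x [y [Kx Ky /andP[ne nxy]]]]] := iT.
have xK : x \in K by rewrite inE.
have yK : y \in K by rewrite inE.
by have := cl (exist _ x xK) (exist _ y yK); rewrite /= /ind_adj /= (negbTE nxy) => /(_ ltac:(by [])).
Qed.

(** * Contraction *)

Section HoleMaps.
Lemma ihole_rot (G : sgraph) n (s : seq G) : ihole s -> ihole (rot n s).
Proof.
move=> hs; have us := ihole_uniq hs; move/iholeP: hs => [[s3 cs E] s4].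
apply/iholeP; split; last by rewrite size_rot.
split; [by rewrite size_rot|by rewrite rot_ucycle|move=> u v].
by rewrite !mem_rot /cycle_edge !next_rot //; apply: E.
Qed.

Lemma ihole_rot_at (G : sgraph) (s : seq G) x : ihole s -> x \in s -> exists t,
  [/\ ihole (x :: t), size s = (size t).+1, 3 <= size t & x \notin t].
Proof.
move=> hs ns; have := ihole_rot (index x s) hs; rewrite (rot_index ns).
set t := _ ++ _ => ht; have ut := ihole_uniq ht.
have es : size s = (size t).+1 by rewrite -(size_rot (index x s)) rot_index.
by exists t; split=> //; [rewrite -ltnS -es; case: hs|move: ut => /= /andP[]].
Qed.

Lemma ihole_map_in (H G : sgraph) (h : H -> G) s :
  {in s &, forall u v, (h u != h v) = (u != v)} -> {in s &, forall u v, h u -- h v = u -- v} ->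
  ihole s -> ihole (map h s).
Proof.
move=> hi ha [s4 E]; split; first by rewrite size_map.
move=> x0 i j; rewrite size_map => /andP[ij js]; have is_ : i < size s := ltn_trans ij js.
case: s s4 E hi ha js is_ => [//|y s] s4 E hi ha js is_.
rewrite !(nth_map y) // hi ?ha ?mem_nth //.
by apply: E; rewrite ij js.
Qed.
End HoleMaps.

(** * Odd holes through the new vertex *)

Section ContractHoles.
Variables (G : sgraph) (hG : class_A G) (a b : G).
Hypothesis ab : nadj a b.
Hypothesis ev : forall f r, ipf f 0 r -> f 0 = a -> f r = b -> odd r = false.
Let G' := contract a b.

Definition unc (d : G) (v : G') : G := if v is Some z then val z else d.

Lemma unc_eq d (u v : G') : u != None -> v != None -> (unc d u != unc d v) = (u != v).
Proof. by case: u => [u|] //; case: v => [v|] //= _ _; rewrite !(inj_eq val_inj). Qed.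

Lemma unc_adj d (u v : G') : u != None -> v != None -> unc d u -- unc d v = u -- v.
Proof. by case: u => [u|] //; case: v => [v|]. Qed.

Lemma unc_ab d (u : G') : u != None -> (a != unc d u) && (b != unc d u).
Proof.
by case: u => [[u hu]|] //= _; move: hu; rewrite !inE negb_or !(eq_sym u).
Qed.

Lemma None_adj d (u : G') : u != None -> (None : G') -- u = (a -- unc d u) || (b -- unc d u).
Proof. by case: u. Qed.

Lemma unc_in d (s : seq G') : d \in [:: a; b] ->
  (forall v, v \in s -> (None : G') \in s -> (None : G') -- v -> d -- unc d v) ->
  {in s &, forall u v, (unc d u != unc d v) = (u != v)} /\
  {in s &, forall u v, unc d u -- unc d v = u -- v}.
Proof.
move=> hd fa; have nd (u : G') : u != None -> d != unc d u.
  by move=> /(unc_ab d)/andP[]; move: hd; rewrite !inE => /orP[] /eqP ->.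
have ad (u : G') : u != None -> u \in s -> (None : G') \in s -> d -- unc d u = ((None : G') -- u).
  move=> hu us ns; apply/idP/idP; last exact: fa.
  by rewrite (None_adj d) //; move: hd; rewrite !inE => /orP[] /eqP -> ->; rewrite ?orbT.
split=> u v us vs.
  have [eu|nu] := eqVneq u None; have [ev'|nv] := eqVneq v None; last exact: unc_eq.
  - by rewrite eu ev' !eqxx.
  - by rewrite eu [in RHS]eq_sym nv; apply: (nd v).
  by rewrite ev' nu eq_sym; apply: (nd u).
have [eu|nu] := eqVneq u None; have [ev'|nv] := eqVneq v None; last exact: unc_adj.
- by rewrite eu ev' !adj_irrefl.
- by rewrite eu; apply: (ad v) => //; rewrite -eu.
by rewrite ev' (adj_sym u) (adj_sym (unc d u)); apply: (ad u) => //; rewrite -ev'.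
Qed.

Lemma ev_list s : ipath s -> 0 < size s -> head a s = a -> last a s = b -> odd (size s).
Proof.
case: s => // x s ip _ /= ex ls; subst x.
have := ev (ipath_ipf a ip) erefl; rewrite /= -ls -(last_nth a) => /(_ erefl).
by move=> ->.
Qed.

Lemma contract_hole (s : seq G') : ihole s -> ~~ odd (size s).
Proof.
move=> hs; apply/negP => od.
have good d : d \in [:: a; b] ->
    ~ (forall v, v \in s -> (None : G') \in s -> (None : G') -- v -> d -- unc d v).
  move=> hd fa; have [h1 h2] := unc_in hd fa.
  have [/(_ _ (ihole_map_in h1 h2 hs)) + _ _] := (class_A_lists G).1 hG.
  by rewrite size_map od.
have ns : None \in s.
  by apply/negPn/negP => ns; apply: (good a) => [|v _]; rewrite ?inE ?eqxx // (negbTE ns).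
have [t [ht es t3 nt]] := ihole_rot_at hs ns.
set m := size t in es t3; have em : odd m = false by move: od; rewrite es /=; case: odd.
have m4 : 4 <= m by move: t3 em; clear; lia.
pose C := nth None ((None : G') :: t).
have [hC0 hC] := ht; have {}hC := hC None.
have Cn i : 0 < i <= m -> C i != None.
  by case: i => // i hi; apply: contraNneq nt => <-; apply: mem_nth.
pose x i := unc a (C i).
have hx : ipf x 1 m.
  move=> i j i1 ij jm; rewrite unc_eq ?unc_adj ?Cn ?i1 //; try by range_lia.
  have /= := hC i j; rewrite ltnS ij jm => /(_ isT).
  by rewrite (negbTE (_ : i != 0)) ?andFb ?orbF //; rewrite -lt0n.
have w i : 0 < i <= m -> (a -- x i) || (b -- x i) = (i == 1) || (i == m).
  move=> hi; rewrite -None_adj ?Cn //.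
  have /= := hC 0 i; rewrite ltnS; case/andP: (hi) => i0 im; rewrite i0 im => /(_ isT) /andP[_ /eqP].
  by rewrite (_ : (C i) = nth None ((None : G') :: t) i) // => ->.
have nax i : 0 < i <= m -> (a != x i) && (b != x i) by move=> hi; apply: unc_ab; apply: Cn.
have na i : 1 < i < m -> nadj a (x i).
  move=> hi; have := w i ltac:(range_lia); rewrite (_ : (i == 1) || (i == m) = false); last by range_lia.
  by move/norP => [h _]; apply: nadjI h; case/andP: (nax i ltac:(range_lia)).
have nb i : 1 < i < m -> nadj b (x i).
  move=> hi; have := w i ltac:(range_lia); rewrite (_ : (i == 1) || (i == m) = false); last by range_lia.
  by move/norP => [_ h]; apply: nadjI h; case/andP: (nax i ltac:(range_lia)).
have nadjx d i : d \in [:: a; b] -> 0 < i <= m -> ~~ d -- x i -> nadj d (x i).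
  move=> hd hi; apply: nadjI; have := nax i hi.
  by move: hd; rewrite !inE => /orP[] /eqP -> /andP[].
have hole d : d \in [:: a; b] -> (forall i, 1 < i < m -> nadj d (x i)) -> d -- x 1 -> d -- x m -> False.
  move=> hd nd d1 dm.
  have := @hole_even G hG [:: d] (seg x 1 m.-1) (seg x m m).
  rewrite !size_cat !size_seg => /(_ isT ltac:(range_lia) ltac:(range_lia) ltac:(simpl; range_lia) isT).
  suff h : ipath (seg x 1 m.-1 ++ seg x m m) /\ link [:: d] (seg x 1 m.-1) /\
      link (seg x m m) [:: d].
    by case: h => [p1 [p2 p3]] /(_ p1 p2 p3) /=; move: m4 em; clear; lia.
  by split; [|split]; geo.
have aI : a \in [:: a; b] by rewrite inE eqxx.
have bI : b \in [:: a; b] by rewrite !inE eqxx orbT.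
have w1 : (a -- x 1) || (b -- x 1) by rewrite w ?eqxx //; range_lia.
have wm : (a -- x m) || (b -- x m) by rewrite w ?eqxx ?orbT //; range_lia.
(* Neither [a] nor [b] sees both [x 1] and [x m], for it would close an odd hole. So each sees one
   of them, and the even number [m] of vertices lies on an induced path between [a] and [b] with
   [m.+1] edges. *)
have [a1|a1] := boolP (a -- x 1).
  have nam : ~~ a -- x m by apply/negP => am; apply: (hole a).
  have bm : b -- x m by move: wm; rewrite (negbTE nam).
  have nb1 : ~~ b -- x 1 by apply/negP => b1; apply: (hole b).
  have := nadjx _ _ aI _ nam; have := nadjx _ _ bI _ nb1 => nb1' nam'.
  have {}nb1' := nb1' ltac:(range_lia); have {}nam' := nam' ltac:(range_lia).
  have nai i : 1 < i <= m -> nadj a (x i).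
    by have [->//|im] := eqVneq i m => hi; apply: na; range_lia.
  have nbi i : 1 <= i < m -> nadj b (x i).
    by have [->//|im] := eqVneq i 1 => hi; apply: nb; range_lia.
  have ip : ipath ([:: a] ++ seg x 1 m ++ [:: b]) by geo.
  have := ev_list ip isT erefl; rewrite !last_cat !size_cat size_seg => /(_ erefl).
  by rewrite /=; move: em; clear; lia.
have b1 : b -- x 1 by move: w1; rewrite (negbTE a1).
have nbm : ~~ b -- x m by apply/negP => am; apply: (hole b).
have am : a -- x m by move: wm; rewrite (negbTE nbm) orbF.
have := nadjx _ _ aI _ a1; have := nadjx _ _ bI _ nbm => nbm' na1'.
have {}nbm' := nbm' ltac:(range_lia); have {}na1' := na1' ltac:(range_lia).
have nai i : 1 <= i < m -> nadj a (x i).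
  by have [->//|im] := eqVneq i 1 => hi; apply: na; range_lia.
have nbi i : 1 < i <= m -> nadj b (x i).
  by have [->//|im] := eqVneq i m => hi; apply: nb; range_lia.
have ip : ipath ([:: a] ++ seg x m 1 ++ [:: b]) by geo.
have := ev_list ip isT erefl; rewrite !last_cat !size_cat size_seg => /(_ erefl).
by rewrite /=; move: em; clear; lia.
Qed.
End ContractHoles.

(** * Long antiholes through the new vertex *)

Section AntiholeLabels.
Variables (G : sgraph) (hG : class_A G).
Implicit Types (a b d : G).

(** If [d] sees [x 2] and [x 3], its first nonneighbour [x j] after [x 1] has [j >= 4], and
    [d, x 1, ..., x j] is an antihole with at least five vertices. *)
Lemma antihole_low d (x : nat -> compl G) m : ipf x 1 m -> 4 <= m ->
  nadj d (x 1) -> nadj d (x m) -> (forall i, 0 < i <= m -> d != x i) ->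
  ~~ (d -- x 2) || ~~ (d -- x 3).
Proof.
move=> hx m4 d1 dm nd; rewrite -negb_and; apply/negP => /andP[d2 d3].
have [j [hj dj nj]] := @first_index (fun i => ~~ d -- x i) 2 m ltac:(range_lia) (proj2 (andP dm)).
have j4 : 4 <= j.
  have n2 : j != 2 by apply: contraNneq dj => ->.
  have n3 : j != 3 by apply: contraNneq dj => ->.
  by move: hj n2 n3; clear; lia.
have dj' : nadj d (x j) by apply: nadjI dj; apply: nd; range_lia.
pose d' : compl G := d.
have ed1 : d' -- x 1 by [].
have edj : d' -- x j by [].
have nd' i : 1 < i < j -> nadj d' (x i).
  by move=> hi; rewrite nadj_compl; apply/negPn/nj; range_lia.
have : ihole ([:: d'] ++ seg x 1 j.-1 ++ [:: x j]).
  by apply: ihole_catI; rewrite ?size_cat ?size_seg //=; try range_lia; geo.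
by move/(no_antihole hG); rewrite !size_cat !size_seg /=; move: j4; clear; lia.
Qed.

(* [m = 4] gives the odd path [a x2 x4 x1 x3 b] and [m = 5] a proper snake. *)
Lemma antihole_label2 a b (x : nat -> G) m :
  (forall s, ipath s -> 0 < size s -> head a s = a -> last a s = b -> odd (size s)) ->
  (forall f1 n1 f2 n2 f3 n3 f4 n4, f1 0 = a -> f2 0 = b -> 0 < n1 \/ 0 < n2 ->
    snakef f1 n1 f2 n2 f3 n3 f4 n4 -> False) ->
  nadj a b -> 4 <= m ->
  (forall i j, 0 < i <= m -> 0 < j <= m -> (i.+1 < j) || (j.+1 < i) -> x i -- x j) ->
  (forall i, 0 < i < m -> nadj (x i) (x i.+1)) ->
  (forall i, 0 < i <= m -> (a -- x i) || (b -- x i) = (1 < i < m)) ->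
  (forall i, 0 < i <= m -> (a != x i) && (b != x i)) ->
  ~~ (a -- x m.-2) || ~~ (a -- x m.-1) -> ~~ (b -- x m.-2) || ~~ (b -- x m.-1) ->
  ~~ (b -- x 2) -> ~~ (a -- x 3) -> False.
Proof.
move=> ev ns ab m4 xa xn w ne ha hb b2 a3.
have na i : 0 < i <= m -> ~~ a -- x i -> nadj a (x i).
  by move=> hi; apply: nadjI; case/andP: (ne i hi).
have nb i : 0 < i <= m -> ~~ b -- x i -> nadj b (x i).
  by move=> hi; apply: nadjI; case/andP: (ne i hi).
have aI i : 1 < i < m -> ~~ b -- x i -> a -- x i.
  by move=> hi bi; have := w i ltac:(range_lia); rewrite hi (negbTE bi) orbF.
have bI i : 1 < i < m -> ~~ a -- x i -> b -- x i.
  by move=> hi bi; have := w i ltac:(range_lia); rewrite hi (negbTE bi).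
have ends i : (i == 1) || (i == m) -> nadj a (x i) /\ nadj b (x i).
  move=> hi; have hi' : 0 < i <= m by move: hi m4; clear; lia.
  have := w i hi'; rewrite (_ : 1 < i < m = false); last by move: hi m4; clear; lia.
  by case/norP => h1 h2; split; [apply: na|apply: nb].
have [a1 b1] := ends 1 isT; have [am bm] := ends m ltac:(by rewrite eqxx orbT).
(* When [a] misses [x i], [b] misses [x j] and the two vertices are adjacent, [a, x j, x i, b] is an
   induced path with three edges. Applied to [x 2] and the vertex near the far end missed by [a],
   this bounds [m] by 5. *)
have near i j : 1 < i < m -> 1 < j < m -> ~~ a -- x i -> ~~ b -- x j -> i <= j.+1 /\ j <= i.+1.
  move=> hi hj ai bj; suff : ~~ ((i.+1 < j) || (j.+1 < i)) by clear; lia.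
  apply/negP => ij; have aj := aI j hj bj; have bi := bI i hi ai.
  have e := xa i j ltac:(range_lia) ltac:(range_lia) ij; rewrite adj_sym in e.
  have ai' := na i ltac:(range_lia) ai; have bj' := nb j ltac:(range_lia) bj.
  have ip : ipath ([:: a] ++ [:: x j] ++ [:: x i] ++ [:: b]) by geo.
  by have := ev _ ip isT erefl erefl.
have a2 := aI 2 ltac:(range_lia) b2; have b3 := bI 3 ltac:(range_lia) a3.
have m5 : m <= 5.
  by case/orP: ha => h; have := near _ 2 _ _ h b2; move=> /(_ ltac:(range_lia) ltac:(range_lia)) []; move: m4; clear; lia.
have a3' := na 3 ltac:(range_lia) a3; have b2' := nb 2 ltac:(range_lia) b2.
have xn' i j : 0 < i < m -> j = i.+1 -> nadj (x i) (x j) by move=> hi ->; apply: xn.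
have [em|em] : m = 4 \/ m = 5 by move: m4 m5; clear; lia.
  subst m; have ip : ipath ([:: a] ++ [:: x 2] ++ [:: x 4] ++ [:: x 1] ++ [:: x 3] ++ [:: b]) by geo.
  by have := ev _ ip isT erefl erefl.
subst m; have b4 : ~~ b -- x 4 by move: hb; rewrite /= b3.
have a4 := aI 4 isT b4; have b4' := nb 4 isT b4.
pose f2 i := if i is 0 then b else x 3.
pose f3 i := if i is 0 then x 2 else x 5.
pose f4 i := if i is 0 then x 4 else x 1.
have ip2 (u v : G) f : f 0 = u -> f 1 = v -> u -- v -> ipf f 0 1.
  by move=> <- <- uv [|i] [|[|j]] //= _ _ _; rewrite adj_neq ?uv.
apply: (ns (fun=> a) 0 f2 1 f3 1 f4 1) => //; first by right.
split=> //; try by [apply: (xa 2 5)|apply: (xa 4 1)|apply: (xa 3 5)|apply: (xa 3 1)|apply: (xa 2 4)|apply: (xa 5 1)].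
- by move=> i j _ ij; rewrite leqn0 => /eqP j0; rewrite j0 in ij.
- exact: (ip2 b (x 3)).
- by apply: (ip2 (x 2) (x 5)) => //; apply: xa.
- by apply: (ip2 (x 4) (x 1)) => //; apply: xa.
- by move=> i [|[|j]].
- by move=> [|i] [|[|j]].
- by move=> [|i] [|[|j]].
- by move=> [|[|i]] [|[|j]] //= _ _ _; rewrite nadj_sym; apply: xn'.
- by move=> [|[|i]] [|[|j]] //= _ _ _; apply: xn'.
by move=> [|[|i]] [|[|j]] //= _ _ _ _; rewrite nadj_sym; apply: xn'.
Qed.
End AntiholeLabels.

Section ContractAntiholes.
Variables (G : sgraph) (hG : class_A G) (a b : G).
Hypothesis sp : special_even_pair a b.
Let G' := contract a b.

Lemma special_sym : special_even_pair b a.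
Proof.
have [ab ev ns] := (special_even_pairP a b).1 sp; apply/special_even_pairP; split.
- by rewrite nadj_sym.
- move=> f r hf f0 fr; apply: (ev (fun i => f (r - i)) r (ipf_rev hf)); by rewrite ?subn0 ?subnn.
move=> f1 n1 f2 n2 f3 n3 f4 n4 fa fb n12 sn.
by apply: (ns _ _ _ _ _ _ _ _ fb fa _ (snake_flip sn)); case: n12; [right|left].
Qed.

Lemma special_list : forall s, ipath s -> 0 < size s -> head a s = a -> last a s = b -> odd (size s).
Proof. by have [ab ev ns] := (special_even_pairP a b).1 sp; exact: ev_list ev. Qed.
End ContractAntiholes.

(** The new vertex sees both [x 2] and [x 3], while by [antihole_low] each of [a] and [b] misses at
    least one of them. So one of the pair sees only [x 2] and the other only [x 3]; the same bound
    at the other end comes from reversing the antihole. *)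
Lemma contract_antihole (G : sgraph) (hG : class_A G) (a b : G) (s : seq (compl (contract a b))) :
  special_even_pair a b -> ihole s -> size s <= 4.
Proof.
move=> sp hs; rewrite leqNgt; apply/negP => s5.
have [ab ev ns] := (special_even_pairP a b).1 sp; have [_ ev' ns'] := (special_even_pairP b a).1 (special_sym sp).
have C (H H' : sgraph) (h : H -> H') (t : seq H) : {in t &, forall u v, (h u != h v) = (u != v)} ->
    {in t &, forall u v, h u -- h v = u -- v} ->
    {in t &, forall u v, @adj (compl H') (h u) (h v) = @adj (compl H) u v}.
  by move=> h1 h2 u v ut vt; rewrite /= /compl_adj h1 // h2.
have [ns0|ns0] := boolP ((None : contract a b) \in (s : seq (contract a b))); last first.
  have [||h1 h2] := @unc_in G a b a s; [by rewrite inE eqxx|by move=> v _; rewrite (negbTE ns0)|].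
  have := no_antihole hG (@ihole_map_in (compl (contract a b)) (compl G) (@unc G a b a) s h1 (C _ _ _ _ h1 h2) hs).
  by rewrite size_map leqNgt s5.
have [t [ht es t3 nt]] := @ihole_rot_at (compl (contract a b)) s None hs ns0.
set m := size t in es t3; have m4 : 4 <= m by move: s5; rewrite es.
have [_ hC] := ht; have {}hC := hC None.
pose D : nat -> contract a b := nth None ((None : contract a b) :: t).
have Dn i : 0 < i <= m -> D i != None.
  by case: i => // i hi; apply: contraNneq nt => <-; apply: mem_nth.
pose x i : G := unc a (D i).
have xE i j : 0 < i -> i < j -> j <= m -> (x i != x j) && (compl_adj (x i) (x j) == (j == i.+1)).
  move=> i1 ij jm; rewrite /compl_adj unc_eq ?unc_adj ?Dn ?i1 //; try by range_lia.
  have /= := hC i j; rewrite ltnS ij jm => /(_ isT).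
  by rewrite (negbTE (_ : i != 0)) ?andFb ?orbF //; rewrite -lt0n.
have hx : @ipf (compl G) x 1 m by move=> i j i1 ij jm; apply: xE.
have w i : 0 < i <= m -> (a -- x i) || (b -- x i) = (1 < i < m).
  move=> hi; rewrite -(None_adj a) ?Dn //.
  have /= := hC 0 i; rewrite ltnS; case/andP: (hi) => i0 im; rewrite i0 im => /(_ isT) /andP[_ /eqP].
  rewrite -/m /= /compl_adj -/(D i) (eq_sym None) Dn //= => e.
  by apply: negb_inj; rewrite e; move: i0 im m4; clear; lia.
have nax i : 0 < i <= m -> (a != x i) && (b != x i) by move=> hi; apply: unc_ab; apply: Dn.
have xa i j : 0 < i <= m -> 0 < j <= m -> (i.+1 < j) || (j.+1 < i) -> x i -- x j.
  by move=> hi hj ij; rewrite -nadj_compl; apply: (ipf_nadj hx).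
have xn i : 0 < i < m -> nadj (x i) (x i.+1).
  by move=> hi; apply: (ipf_adj hx); rewrite ?eqxx ?orbT //; range_lia.
have hx' : @ipf (compl G) (fun i => x (m.+1 - i)) 1 m.
  move=> i j i1 ij jm; have := hx (m.+1 - j) (m.+1 - i) ltac:(range_lia) ltac:(range_lia) ltac:(range_lia).
  rewrite (eq_sym (x _)) (@adj_sym (compl G)) => /andP[-> /eqP ->] /=; apply/eqP; range_lia.
have endn d i : d \in [:: a; b] -> (i == 1) || (i == m) -> nadj d (x i).
  move=> hd hi; have hi' : 0 < i <= m by move: hi m4; clear; lia.
  have := w i hi'; rewrite (_ : 1 < i < m = false); last by move: hi m4; clear; lia.
  case/norP => h1 h2; have /andP[n1 n2] := nax i hi'.
  by move: hd; rewrite !inE => /orP[] /eqP ->; apply: nadjI.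
have low d : d \in [:: a; b] -> (~~ d -- x 2 || ~~ d -- x 3) /\ (~~ d -- x m.-2 || ~~ d -- x m.-1).
  move=> hd; have nd i : 0 < i <= m -> d != x i.
    by move=> /nax /andP[n1 n2]; move: hd; rewrite !inE => /orP[] /eqP ->.
  have d1 := endn d 1 hd isT; have dm := endn d m hd ltac:(by rewrite eqxx orbT).
  split; first exact: (antihole_low hG hx m4 d1 dm nd).
  have e1 : m.+1 - 1 = m by clear; lia.
  have e2 : m.+1 - 2 = m.-1 by clear; lia.
  have e3 : m.+1 - 3 = m.-2 by clear; lia.
  have em : m.+1 - m = 1 by clear; lia.
  have nd' i : 0 < i <= m -> d != x (m.+1 - i) by move=> hi; apply: nd; range_lia.
  by have := @antihole_low G hG d _ m hx' m4; rewrite e1 e2 e3 em orbC => /(_ dm d1 nd').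
have aI : a \in [:: a; b] by rewrite inE eqxx.
have bI : b \in [:: a; b] by rewrite !inE eqxx orbT.
have [la ha] := low a aI; have [lb hb] := low b bI.
have w2 := w 2 ltac:(range_lia); have w3 := w 3 ltac:(range_lia).
have r2 : 1 < 2 < m by range_lia. have r3 : 1 < 3 < m by range_lia.
rewrite r2 in w2; rewrite r3 in w3.
have [a2|a2] := boolP (a -- x 2).
  have a3 : ~~ a -- x 3 by move: la; rewrite a2.
  have b2 : ~~ b -- x 2 by move: lb w3; rewrite (negbTE a3) /= => + b3; rewrite b3 orbF.
  exact: (antihole_label2 (special_list sp) ns ab m4 xa xn w nax ha hb b2 a3).
have b3 : ~~ b -- x 3 by move: lb w2; rewrite (negbTE a2) /= => + b2; rewrite b2.
have w' i : 0 < i <= m -> (b -- x i) || (a -- x i) = (1 < i < m) by move=> hi; rewrite orbC w.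
have nax' i : 0 < i <= m -> (b != x i) && (a != x i) by move=> hi; rewrite andbC nax.
rewrite nadj_sym in ab.
exact: (antihole_label2 (special_list (special_sym sp)) ns' ab m4 xa xn w' nax' hb ha a2 b3).
Qed.

(** * Prisms through the new vertex *)

Section PrismFunctions.
Variable H : sgraph.
Implicit Types (f g : nat -> H).

Definition rungf f n g m := forall i j, i <= n -> j <= m ->
  (f i != g j) && ((f i -- g j) == (i == 0) && (j == 0) || (i == n) && (j == m)).

Record prismf f1 n1 f2 n2 f3 n3 : Prop := Prismf {
  pf_n : [/\ 0 < n1, 0 < n2 & 0 < n3];
  pf_1 : ipf f1 0 n1;
  pf_2 : ipf f2 0 n2;
  pf_3 : ipf f3 0 n3;
  pf_12 : rungf f1 n1 f2 n2;
  pf_13 : rungf f1 n1 f3 n3;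
  pf_23 : rungf f2 n2 f3 n3 }.

Lemma rungf_sym f n g m : rungf f n g m -> rungf g m f n.
Proof. by move=> h i j hi hj; rewrite eq_sym adj_sym [(i == 0) && _]andbC [(i == m) && _]andbC; apply: h. Qed.

Lemma rungf_rev f n g m : rungf f n g m -> rungf (fun i => f (n - i)) n (fun i => g (m - i)) m.
Proof.
move=> h i j hi hj; have /andP[-> /eqP ->] := h (n - i) (m - j) (leq_subr _ _) (leq_subr _ _).
by apply/eqP; move: hi hj; clear; lia.
Qed.

Lemma prismf_swap12 f1 n1 f2 n2 f3 n3 : prismf f1 n1 f2 n2 f3 n3 -> prismf f2 n2 f1 n1 f3 n3.
Proof. by case=> -[p1 p2 p3] h1 h2 h3 h12 h13 h23; split=> //; apply: rungf_sym. Qed.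

Lemma prismf_swap23 f1 n1 f2 n2 f3 n3 : prismf f1 n1 f2 n2 f3 n3 -> prismf f1 n1 f3 n3 f2 n2.
Proof. by case=> -[p1 p2 p3] h1 h2 h3 h12 h13 h23; split=> //; apply: rungf_sym. Qed.

Lemma prismf_rev f1 n1 f2 n2 f3 n3 : prismf f1 n1 f2 n2 f3 n3 ->
  prismf (fun i => f1 (n1 - i)) n1 (fun i => f2 (n2 - i)) n2 (fun i => f3 (n3 - i)) n3.
Proof.
by case=> -[p1 p2 p3] h1 h2 h3 h12 h13 h23; split=> //; by [apply: ipf_rev|apply: rungf_rev].
Qed.

Lemma iprism_prismf (x0 : H) p1 p2 p3 : iprism p1 p2 p3 ->
  prismf (nth x0 p1) (size p1).-1 (nth x0 p2) (size p2).-1 (nth x0 p3) (size p3).-1.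
Proof.
case=> -[s1 s2 s3] [i1 i2 i3] [l12 l13 l23].
have R (p q : seq H) : 1 < size p -> 1 < size q -> plink p q ->
    rungf (nth x0 p) (size p).-1 (nth x0 q) (size q).-1.
  by move=> sp sq h i j hi hj; apply: h; [move: sp hi|move: sq hj]; clear; lia.
split; try exact: ipath_ipf; try exact: R.
by move: s1 s2 s3; clear; split; lia.
Qed.

Lemma rungf_nadj f n g m i j : rungf f n g m -> i <= n -> j <= m -> (i != 0) || (j != 0) ->
  (i != n) || (j != m) -> nadj (f i) (g j).
Proof.
move=> h hi hj h0 h1; have /andP[n' /eqP e] := h i j hi hj; rewrite /nadj n' e.
by move: h0 h1; clear; lia.
Qed.

Lemma rungf_0 f n g m : rungf f n g m -> f 0 -- g 0.
Proof. by move=> h; have /andP[_ /eqP ->] := h 0 0 isT isT. Qed.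

Lemma rungf_n f n g m : rungf f n g m -> f n -- g m.
Proof. by move=> h; have /andP[_ /eqP ->] := h n m (leqnn _) (leqnn _); rewrite !eqxx orbT. Qed.

Lemma rungf_hole f1 n1 f2 n2 : ipf f1 0 n1 -> ipf f2 0 n2 -> 0 < n1 -> 0 < n2 ->
  rungf f1 n1 f2 n2 -> ihole (seg f1 0 n1 ++ seg f2 n2 1 ++ seg f2 0 0).
Proof.
move=> h1 h2 p1 p2 h; have e0 := rungf_0 h; have en := rungf_n h.
have nh i j : i <= n1 -> j <= n2 -> (i != 0) || (j != 0) -> (i != n1) || (j != n2) -> nadj (f1 i) (f2 j).
  exact: rungf_nadj.
by apply: ihole_catI; rewrite ?size_cat ?size_seg //=; try range_lia; geo.
Qed.

Lemma no_prismf f1 n1 f2 n2 f3 n3 : class_A H -> prismf f1 n1 f2 n2 f3 n3 -> False.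
Proof.
move=> hH [[p1 p2 p3] h1 h2 h3 h12 h13 h23].
have e12 := rungf_0 h12; have e12' := rungf_n h12.
have e13 := rungf_0 h13; have e13' := rungf_n h13.
have e23 := rungf_0 h23; have e23' := rungf_n h23.
have n12 i j : i <= n1 -> j <= n2 -> (i != 0) || (j != 0) -> (i != n1) || (j != n2) -> nadj (f1 i) (f2 j).
  exact: rungf_nadj.
have n13 i j : i <= n1 -> j <= n3 -> (i != 0) || (j != 0) -> (i != n1) || (j != n3) -> nadj (f1 i) (f3 j).
  exact: rungf_nadj.
have n23 i j : i <= n2 -> j <= n3 -> (i != 0) || (j != 0) -> (i != n2) || (j != n3) -> nadj (f2 i) (f3 j).
  exact: rungf_nadj.
by apply: (@no_prism H hH (seg f1 0 0) (seg f1 1 n1) (seg f2 0 0) (seg f2 1 n2) (seg f3 0 0) (seg f3 1 n3));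
  rewrite ?seg_neq0 //; geo.
Qed.
End PrismFunctions.

Section ContractPrism.
Variables (G : sgraph) (hG : class_A G) (a b : G).
Hypothesis sp : special_even_pair a b.
Notation G' := (contract a b).

Lemma unc_pair d (u v : G') : d \in [:: a; b] ->
  (u = None -> (None : G') -- v -> d -- unc d v) -> (v = None -> (None : G') -- u -> d -- unc d u) ->
  (unc d u != unc d v) = (u != v) /\ unc d u -- unc d v = u -- v.
Proof.
move=> hd hu hv; have [|h1 h2] := @unc_in G a b d [:: u; v] hd.
  move=> w; rewrite !inE => /orP[] /eqP -> /orP[] /eqP e; rewrite -?e ?adj_irrefl //; by [apply: hv|apply: hu].
by split; [apply: h1|apply: h2]; rewrite !inE eqxx ?orbT.
Qed.

Lemma prismf_unc d f1 n1 f2 n2 f3 n3 : d \in [:: a; b] -> prismf f1 n1 f2 n2 f3 n3 ->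
  (forall i, i <= n1 -> (None : G') -- f1 i -> d -- unc d (f1 i)) ->
  (forall i, i <= n2 -> (None : G') -- f2 i -> d -- unc d (f2 i)) ->
  (forall i, i <= n3 -> (None : G') -- f3 i -> d -- unc d (f3 i)) -> False.
Proof.
move=> hd [p h1 h2 h3 h12 h13 h23] g1 g2 g3.
have I f n : ipf f 0 n -> (forall i, i <= n -> (None : G') -- f i -> d -- unc d (f i)) ->
    ipf (fun i => unc d (f i)) 0 n.
  move=> h g i j i0 ij jn; have [||-> ->] := @unc_pair d (f i) (f j) hd.
  - by move=> _; apply: g.
  - by move=> _; apply: g; range_lia.
  exact: h.
have R f n g m : rungf f n g m -> (forall i, i <= n -> (None : G') -- f i -> d -- unc d (f i)) ->
    (forall i, i <= m -> (None : G') -- g i -> d -- unc d (g i)) ->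
    rungf (fun i => unc d (f i)) n (fun i => unc d (g i)) m.
  move=> h hf hg i j hi hj; have [||-> ->] := @unc_pair d (f i) (g j) hd.
  - by move=> _; apply: hg.
  - by move=> _; apply: hf.
  exact: h.
apply: (@no_prismf G (fun i => unc d (f1 i)) n1 (fun i => unc d (f2 i)) n2 (fun i => unc d (f3 i)) n3 hG).
by split=> //; by [apply: I|apply: R].
Qed.

Section AtVertex.
Variables (f1 f2 f3 : nat -> G') (n1 n2 n3 i0 : nat).
Hypotheses (pf : prismf f1 n1 f2 n2 f3 n3) (hi0 : i0 < n1) (fN : f1 i0 = None).
Let g1 i : G := unc a (f1 i).
Let g2 i : G := unc a (f2 i).
Let g3 i : G := unc a (f3 i).

Let N1 i : i <= n1 -> i != i0 -> f1 i != None.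
Proof. by move=> hi ne; rewrite -fN; apply: (ipf_neq (pf_1 pf)); range_lia. Qed.
Let N2 j : j <= n2 -> f2 j != None.
Proof. by move=> hj; rewrite -fN eq_sym; case/andP: (pf_12 pf (ltnW hi0) hj). Qed.
Let N3 j : j <= n3 -> f3 j != None.
Proof. by move=> hj; rewrite -fN eq_sym; case/andP: (pf_13 pf (ltnW hi0) hj). Qed.

Let w1 i : i <= n1 -> i != i0 -> (a -- g1 i) || (b -- g1 i) = (i == i0.+1) || (i0 == i.+1).
Proof.
move=> hi ne; rewrite -(None_adj a) ?N1 // -fN; have [lt|lt] : i0 < i \/ i < i0 by move: ne; clear; lia.
  by have /andP[_ /eqP ->] := pf_1 pf (leq0n i0) lt hi; move: lt; clear; lia.
by rewrite adj_sym; have /andP[_ /eqP ->] := pf_1 pf (leq0n i) lt (ltnW hi0); move: lt; clear; lia.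
Qed.
Let w2 j : j <= n2 -> (a -- g2 j) || (b -- g2 j) = (i0 == 0) && (j == 0).
Proof.
move=> hj; rewrite -(None_adj a) ?N2 // -fN; have /andP[_ /eqP ->] := pf_12 pf (ltnW hi0) hj.
by move: hi0; clear; lia.
Qed.
Let w3 j : j <= n3 -> (a -- g3 j) || (b -- g3 j) = (i0 == 0) && (j == 0).
Proof.
move=> hj; rewrite -(None_adj a) ?N3 // -fN; have /andP[_ /eqP ->] := pf_13 pf (ltnW hi0) hj.
by move: hi0; clear; lia.
Qed.

Let ne1 d i : d \in [:: a; b] -> i <= n1 -> i != i0 -> d != g1 i.
Proof.
move=> hd hi ne; have /andP[n n'] := unc_ab a (N1 hi ne).
by move: hd; rewrite !inE => /orP[] /eqP ->.
Qed.
Let ne2 d j : d \in [:: a; b] -> j <= n2 -> d != g2 j.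
Proof.
move=> hd hj; have /andP[n n'] := unc_ab a (N2 hj).
by move: hd; rewrite !inE => /orP[] /eqP ->.
Qed.
Let ne3 d j : d \in [:: a; b] -> j <= n3 -> d != g3 j.
Proof.
move=> hd hj; have /andP[n n'] := unc_ab a (N3 hj).
by move: hd; rewrite !inE => /orP[] /eqP ->.
Qed.

Let G1 i j : i <= n1 -> j <= n1 -> i != i0 -> j != i0 -> i < j -> (g1 i != g1 j) && ((g1 i -- g1 j) == (j == i.+1)).
Proof. by move=> hi hj hi' hj' ij; rewrite unc_eq ?unc_adj ?N1 //; apply: (pf_1 pf). Qed.
Let G2 : ipf g2 0 n2.
Proof.
move=> i j _ ij jn; have hi : i <= n2 := leq_trans (ltnW ij) jn.
by rewrite unc_eq ?unc_adj ?N2 //; apply: (pf_2 pf).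
Qed.
Let G3 : ipf g3 0 n3.
Proof.
move=> i j _ ij jn; have hi : i <= n3 := leq_trans (ltnW ij) jn.
by rewrite unc_eq ?unc_adj ?N3 //; apply: (pf_3 pf).
Qed.
Let G12 i j : i <= n1 -> j <= n2 -> i != i0 ->
  (g1 i != g2 j) && ((g1 i -- g2 j) == (i == 0) && (j == 0) || (i == n1) && (j == n2)).
Proof. by move=> hi hj ne; rewrite unc_eq ?unc_adj ?N1 ?N2 //; apply: (pf_12 pf). Qed.
Let G13 i j : i <= n1 -> j <= n3 -> i != i0 ->
  (g1 i != g3 j) && ((g1 i -- g3 j) == (i == 0) && (j == 0) || (i == n1) && (j == n3)).
Proof. by move=> hi hj ne; rewrite unc_eq ?unc_adj ?N1 ?N3 //; apply: (pf_13 pf). Qed.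
Let G23 : rungf g2 n2 g3 n3.
Proof. by move=> i j hi hj; rewrite unc_eq ?unc_adj ?N2 ?N3 //; apply: (pf_23 pf). Qed.
Let V (c : bool) (u v : G) : (u != v) && ((u -- v) == c) -> c = false -> nadj u v.
Proof. by case/andP=> n /eqP e ec; rewrite /nadj n e ec. Qed.

(** When [x] takes the neighbours of the new vertex on the side of index 0 and [y] the one on the
    other side, splitting the vertex turns the prism into a snake: the first rung breaks into the
    paths from [x] and from [y]. The second has length [n1 - i0], which is positive, so the snake is
    proper. *)
Lemma prism_snake x y : x \in [:: a; b] -> y \in [:: a; b] -> nadj x y ->
  (forall i, i <= n1 -> i != i0 -> x -- g1 i = (i0 == i.+1)) ->
  (forall j, j <= n2 -> x -- g2 j = (i0 == 0) && (j == 0)) ->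
  (forall j, j <= n3 -> x -- g3 j = (i0 == 0) && (j == 0)) ->
  (forall i, i <= n1 -> i != i0 -> y -- g1 i = (i == i0.+1)) ->
  (forall j, j <= n2 -> ~~ y -- g2 j) -> (forall j, j <= n3 -> ~~ y -- g3 j) ->
  snakef (fun k => if k is 0 then x else g1 (i0 - k)) i0
    (fun k => if k is 0 then y else g1 (i0 + k)) (n1 - i0) g2 n2 g3 n3.
Proof.
move=> hx hy xy x1 x2 x3 y1 y2 y3; have [p1 p2 p3] := pf_n pf.
split=> //.
- move=> [|i] [|j] //= _ ij jn.
    by rewrite ne1 ?x1 //; try apply/eqP; move: jn hi0; clear; lia.
  have /andP[n /eqP e] := @G1 (i0 - j.+1) (i0 - i.+1) ltac:(range_lia) ltac:(range_lia) ltac:(range_lia) ltac:(range_lia) ltac:(range_lia).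
  by rewrite eq_sym n adj_sym e; apply/eqP; move: ij jn; clear; lia.
- move=> [|i] [|j] //= _ ij jn.
    by rewrite ne1 ?y1 //; try apply/eqP; move: jn hi0; clear; lia.
  have /andP[-> /eqP ->] := @G1 (i0 + i.+1) (i0 + j.+1) ltac:(range_lia) ltac:(range_lia) ltac:(range_lia) ltac:(range_lia) ltac:(range_lia).
  by apply/eqP; move: ij jn; clear; lia.
- move=> [|i] [|j] hi hj //=.
  + by apply: nadjI; [apply: ne1|rewrite x1]; move: hj hi0 => //; clear; lia.
  + by rewrite nadj_sym; apply: nadjI; [apply: ne1|rewrite y1]; move: hi hi0 => //; clear; lia.
  apply: (V (@G1 (i0 - i.+1) (i0 + j.+1) ltac:(range_lia) ltac:(range_lia) ltac:(range_lia) ltac:(range_lia) ltac:(range_lia))).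
  by move: hi hj; clear; lia.
- move=> [|i] j hi hj h /=.
    by apply: nadjI; [apply: ne2|rewrite x2 //; move: h; clear; lia].
  by apply: (V (@G12 (i0 - i.+1) j ltac:(range_lia) hj ltac:(range_lia))); move: h hi hi0; clear; lia.
- move: (hi0) fN => hi0' _; case: (posnP i0) => [e|ip].
    by rewrite e x2 // e.
  rewrite -(prednK ip) /= prednK // subnn.
  by have /andP[_ /eqP ->] := @G12 0 0 isT isT ltac:(by rewrite eq_sym -lt0n).
- move=> [|i] j hi hj h /=.
    by apply: nadjI; [apply: ne3|rewrite x3 //; move: h; clear; lia].
  by apply: (V (@G13 (i0 - i.+1) j ltac:(range_lia) hj ltac:(range_lia))); move: h hi hi0; clear; lia.
- case: (posnP i0) => [e|ip].
    by rewrite e x3 // e.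
  rewrite -(prednK ip) /= prednK // subnn.
  by have /andP[_ /eqP ->] := @G13 0 0 isT isT ltac:(by rewrite eq_sym -lt0n).
- move=> [|i] j hi hj h /=; first by apply: nadjI; [apply: ne2|apply: y2].
  by apply: (V (@G12 (i0 + i.+1) j ltac:(range_lia) hj ltac:(range_lia))); move: h hi hi0; clear; lia.
- have e : n1 - i0 = (n1 - i0).-1.+1 by move: hi0; clear; lia.
  rewrite e -e subnKC; last exact: ltnW.
  by have /andP[_ /eqP ->] := @G12 n1 n2 (leqnn _) (leqnn _) ltac:(range_lia); rewrite !eqxx orbT.
- move=> [|i] j hi hj h /=; first by apply: nadjI; [apply: ne3|apply: y3].
  by apply: (V (@G13 (i0 + i.+1) j ltac:(range_lia) hj ltac:(range_lia))); move: h hi hi0; clear; lia.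
- have e : n1 - i0 = (n1 - i0).-1.+1 by move: hi0; clear; lia.
  rewrite e -e subnKC; last exact: ltnW.
  by have /andP[_ /eqP ->] := @G13 n1 n3 (leqnn _) (leqnn _) ltac:(range_lia); rewrite !eqxx orbT.
- by move=> i j hi hj; apply: rungf_nadj G23 hi hj.
- exact: rungf_0 G23.
exact: rungf_n G23.
Qed.
Let lab1 d i : d \in [:: a; b] -> i <= n1 -> i != i0 -> d -- g1 i -> (i == i0.+1) || (i0 == i.+1).
Proof. by rewrite !inE => /orP[] /eqP -> hi ne di; rewrite -w1 // di ?orbT. Qed.
Let lab2 d j : d \in [:: a; b] -> j <= n2 -> d -- g2 j -> (i0 == 0) && (j == 0).
Proof. by rewrite !inE => /orP[] /eqP -> hj di; rewrite -w2 // di ?orbT. Qed.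
Let lab3 d j : d \in [:: a; b] -> j <= n3 -> d -- g3 j -> (i0 == 0) && (j == 0).
Proof. by rewrite !inE => /orP[] /eqP -> hj di; rewrite -w3 // di ?orbT. Qed.

(** The new vertex is a corner of the prism. Its first and third rungs form a hole of the contracted
    graph, which is even by [contract_hole]; replacing the new vertex by [v, g2 0] gives a hole of
    [G] with one vertex more. *)
Lemma corner_hole v : i0 = 0 -> v \in [:: a; b] -> v -- g1 1 -> v -- g2 0 -> ~~ v -- g3 0 -> False.
Proof.
move=> e0 hv v1 v2 v3; have [p1 p2 p3] := pf_n pf.
have [ab ev _] := (special_even_pairP a b).1 sp.
have := contract_hole hG ab ev (rungf_hole (pf_1 pf) (pf_3 pf) p1 p3 (pf_13 pf)).
rewrite !size_cat !size_seg => ev13.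
have n1v i : 1 < i <= n1 -> nadj v (g1 i).
  move=> hi; apply: nadjI; first by apply: ne1; rewrite ?e0 //; move: hi; clear; lia.
  apply/negP => /(lab1 hv _ _); rewrite e0 => /(_ ltac:(move: hi; clear; lia) ltac:(move: hi; clear; lia)).
  by move: hi; clear; lia.
have n3v j : j <= n3 -> nadj v (g3 j).
  move=> hj; apply: nadjI; first exact: ne3.
  by have [->|j0] := eqVneq j 0; first exact: v3; apply/negP => /(lab3 hv hj); rewrite (negbTE j0) andbF.
have n23 j : 0 < j <= n3 -> nadj (g2 0) (g3 j).
  by move=> hj; apply: (rungf_nadj G23) => //; move: hj p2; clear; lia.
have n21 i : 1 <= i <= n1 -> nadj (g2 0) (g1 i).
  move=> hi; rewrite nadj_sym; apply: (V (@G12 i 0 _ _ _)) => //; rewrite ?e0; move: hi p2; clear; lia.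
have n31 j i : j <= n3 -> 1 <= i <= n1 -> (j != n3) || (i != n1) -> nadj (g3 j) (g1 i).
  move=> hj hi h; rewrite nadj_sym; apply: (V (@G13 i j _ _ _)) => //; rewrite ?e0; move: hi h; clear; lia.
have e31 : g3 n3 -- g1 n1.
  rewrite adj_sym; have /andP[_ /eqP ->] := @G13 n1 n3 (leqnn _) (leqnn _) ltac:(rewrite e0; move: p1; clear; lia).
  by rewrite !eqxx orbT.
have h1 : ipf g1 1 n1.
  by move=> i j i1 ij jn; apply: G1; rewrite ?e0 //; move: i1 ij jn; clear; lia.
have h3 := G3; have e23 : g2 0 -- g3 0 := rungf_0 G23.
have := @hole_even G hG [:: v] [:: g2 0] (seg g3 0 n3 ++ seg g1 n1 1).
rewrite !size_cat !size_seg => /(_ isT isT ltac:(range_lia) ltac:(simpl; range_lia) isT).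
suff h : ipath ([:: g2 0] ++ (seg g3 0 n3 ++ seg g1 n1 1)) /\ link [:: v] [:: g2 0] /\
    link (seg g3 0 n3 ++ seg g1 n1 1) [:: v].
  by case: h => [q1 [q2 q3]] /(_ q1 q2 q3) /=; move: ev13 p1 p3; clear; lia.
by split; [|split]; geo.
Qed.

Lemma not_all_adj d : d \in [:: a; b] -> d -- g1 i0.+1 -> (0 < i0 -> d -- g1 i0.-1) ->
  (i0 = 0 -> d -- g2 0 /\ d -- g3 0) -> False.
Proof.
move=> hd du dd dc; have E u : u != None -> unc d u = unc a u by case: u.
apply: (prismf_unc hd pf) => i hi.
- have [->|ne] := eqVneq i i0; first by rewrite fN adj_irrefl.
  rewrite E ?N1 // (None_adj a) ?N1 // w1 // => /orP[] /eqP e; first by rewrite e.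
  by have := dd; rewrite e; apply.
- rewrite E ?N2 // (None_adj a) ?N2 // w2 // => /andP[/eqP e /eqP ->].
  by have [] := dc e.
rewrite E ?N3 // (None_adj a) ?N3 // w3 // => /andP[/eqP e /eqP ->].
by have [] := dc e.
Qed.

Lemma split_contra x y : (x = a /\ y = b) \/ (x = b /\ y = a) ->
  ~~ x -- g1 i0.+1 -> y -- g1 i0.+1 -> (0 < i0 -> x -- g1 i0.-1 /\ ~~ y -- g1 i0.-1) ->
  (i0 = 0 -> [/\ x -- g2 0, x -- g3 0, ~~ y -- g2 0 & ~~ y -- g3 0]) -> False.
Proof.
move=> hxy xu yu xd xc; have [hx hy] : x \in [:: a; b] /\ y \in [:: a; b].
  by rewrite !inE; case: hxy => [[-> ->]|[-> ->]]; rewrite !eqxx ?orbT.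
have sp' : special_even_pair x y.
  by case: hxy => [[-> ->]|[-> ->]]; [exact: sp|exact: special_sym].
have [xy _ ns] := (special_even_pairP x y).1 sp'.
have sn : snakef (fun k => if k is 0 then x else g1 (i0 - k)) i0
    (fun k => if k is 0 then y else g1 (i0 + k)) (n1 - i0) g2 n2 g3 n3.
  apply: prism_snake => //.
  - move=> i hi ne; apply/idP/idP => [xi|/eqP e].
      by case/orP: (lab1 hx hi ne xi) => // /eqP e; move: xu; rewrite -e xi.
    by have := xd; rewrite e => /(_ isT) [].
  - move=> j hj; apply/idP/idP => [/(lab2 hx hj)//|/andP[/eqP e /eqP ->]].
    by have [] := xc e.
  - move=> j hj; apply/idP/idP => [/(lab3 hx hj)//|/andP[/eqP e /eqP ->]].
    by have [] := xc e.
  - move=> i hi ne; apply/idP/idP => [yi|/eqP -> //].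
    case/orP: (lab1 hy hi ne yi) => // /eqP e.
    by have := xd; rewrite e /= => /(_ isT) [_]; rewrite yi.
  - move=> j hj; apply/negP => yj; have /andP[/eqP e /eqP ej] := lab2 hy hj yj.
    by have [_ _ + _] := xc e; rewrite -ej yj.
  move=> j hj; apply/negP => yj; have /andP[/eqP e /eqP ej] := lab3 hy hj yj.
  by have [_ _ _ +] := xc e; rewrite -ej yj.
by apply: (ns _ _ _ _ _ _ _ _ _ _ _ sn) => //; right; rewrite subn_gt0.
Qed.

(** The hypothesis is [corner_hole] with the second and third rungs exchanged. Given both versions,
    a vertex of the pair that sees [g1 i0.+1] sees no other neighbour of the new vertex in the
    prism, and the split into a proper snake is forced. *)
Lemma prism_at : (i0 = 0 -> forall v, v \in [:: a; b] -> v -- g1 1 -> v -- g3 0 -> ~~ v -- g2 0 -> False) -> False.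
Proof.
move=> corner'.
have aI : a \in [:: a; b] by rewrite inE eqxx.
have bI : b \in [:: a; b] by rewrite !inE eqxx orbT.
have up : (a -- g1 i0.+1) || (b -- g1 i0.+1) by rewrite w1 ?eqxx //; move: hi0; clear; lia.
have dn : 0 < i0 -> (a -- g1 i0.-1) || (b -- g1 i0.-1).
  by move=> p; rewrite w1; move: p hi0; clear; lia.
have c2 : i0 = 0 -> (a -- g2 0) || (b -- g2 0) by move=> e; rewrite w2 // e.
have c3 : i0 = 0 -> (a -- g3 0) || (b -- g3 0) by move=> e; rewrite w3 // e.
have noc d : d \in [:: a; b] -> i0 = 0 -> d -- g1 1 -> ~~ d -- g2 0 /\ ~~ d -- g3 0.
  move=> hd e d1; have [d2|d2] := boolP (d -- g2 0); have [d3|d3] := boolP (d -- g3 0) => //.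
  - by exfalso; apply: (not_all_adj hd) => //; [rewrite e|rewrite e].
  - by exfalso; apply: (corner_hole e hd d1 d2 d3).
  by exfalso; apply: (corner' e d hd d1 d3 d2).
have go x y : (x = a /\ y = b) \/ (x = b /\ y = a) -> y -- g1 i0.+1 -> False.
  move=> hxy yu; have [hx hy] : x \in [:: a; b] /\ y \in [:: a; b].
    by rewrite !inE; case: hxy => [[-> ->]|[-> ->]]; rewrite !eqxx ?orbT.
  have O u : (a -- u) || (b -- u) -> ~~ y -- u -> x -- u.
    by case: hxy => [[-> ->]|[-> ->]]; case: (a -- u); case: (b -- u).
  have xd : 0 < i0 -> x -- g1 i0.-1 /\ ~~ y -- g1 i0.-1.
    move=> p; have yd : ~~ y -- g1 i0.-1.
      by apply/negP => yd; apply: (not_all_adj hy yu) => // e; rewrite e in p.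
    by split=> //; apply: O (dn p) yd.
  have xc : i0 = 0 -> [/\ x -- g2 0, x -- g3 0, ~~ y -- g2 0 & ~~ y -- g3 0].
    move=> e; have [y2 y3] := noc y hy e ltac:(by move: yu; rewrite e).
    by split=> //; apply: O; rewrite ?c2 ?c3.
  apply: (split_contra hxy _ yu xd xc); apply/negP => xu; apply: (not_all_adj hx xu).
    by move=> /xd [].
  by move=> /xc [].
by case/orP: up => h; [apply: (go b a)|apply: (go a b)]; auto.
Qed.
End AtVertex.

(** Reversing the prism moves a new vertex at the end of the rung to its start, so that a next
    vertex on the rung always exists. *)
Lemma prismf_None (f1 : nat -> G') n1 f2 n2 f3 n3 i0 : prismf f1 n1 f2 n2 f3 n3 -> i0 <= n1 -> f1 i0 = None -> False.
Proof.
have H (g1 : nat -> G') m1 g2 m2 g3 m3 j0 : prismf g1 m1 g2 m2 g3 m3 -> j0 < m1 -> g1 j0 = None -> False.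
  move=> pf hj gN; apply: (prism_at pf hj gN) => e v hv v1 v3 v2.
  exact: (corner_hole (prismf_swap23 pf) hj gN e hv v1 v3 v2).
move=> pf; rewrite leq_eqVlt => /orP[/eqP ->|hi fN]; last exact: H pf hi fN.
move=> fN; apply: (H _ _ _ _ _ _ 0 (prismf_rev pf)); last by rewrite subn0.
by have [] := pf_n pf.
Qed.

Lemma contract_prism (p1 p2 p3 : seq G') : ~ iprism p1 p2 p3.
Proof.
move=> /(iprism_prismf (None : G')); move: (nth _ p1) (nth _ p2) (nth _ p3) => f1 f2 f3.
move: (size p1).-1 (size p2).-1 (size p3).-1 => n1 n2 n3 pf.
have N1 i : i <= n1 -> f1 i != None by move=> hi; apply/eqP => /(prismf_None pf hi).
have N2 i : i <= n2 -> f2 i != None by move=> hi; apply/eqP => /(prismf_None (prismf_swap12 pf) hi).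
have N3 i : i <= n3 -> f3 i != None.
  by move=> hi; apply/eqP => /(prismf_None (prismf_swap12 (prismf_swap23 pf)) hi).
have E (u v : G') : u != None -> v != None ->
    (unc a u != unc a v) = (u != v) /\ unc a u -- unc a v = u -- v.
  by move=> hu hv; rewrite unc_eq ?unc_adj.
apply: (@no_prismf G (fun i => unc a (f1 i)) n1 (fun i => unc a (f2 i)) n2 (fun i => unc a (f3 i)) n3 hG).
case: pf => [p h1 h2 h3 h12 h13 h23].
have I (f : nat -> G') n : ipf f 0 n -> (forall i, i <= n -> f i != None) -> ipf (fun i => unc a (f i)) 0 n.
  move=> h g i j i0 ij jn; have [-> ->] := E (f i) (f j) (g i (leq_trans (ltnW ij) jn)) (g j jn).
  exact: h.
have R (f : nat -> G') n (g : nat -> G') m : rungf f n g m -> (forall i, i <= n -> f i != None) -> (forall i, i <= m -> g i != None) ->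
    rungf (fun i => unc a (f i)) n (fun i => unc a (g i)) m.
  by move=> h hf hg i j hi hj; have [-> ->] := E (f i) (g j) (hf i hi) (hg j hj); exact: h.
by split=> //; by [apply: I|apply: R].
Qed.

Theorem contract_class_A : class_A G'.
Proof.
have [ab ev _] := (special_even_pairP a b).1 sp; apply/class_A_lists; split.
- by move=> s; exact: (contract_hole hG ab ev).
- by move=> s; exact: (contract_antihole hG sp).
exact: contract_prism.
Qed.
End ContractPrism.

Lemma card_contract (G : sgraph) (a b : G) : a != b -> #|contract a b| < #|G|.
Proof.
move=> ab; rewrite card_option card_sig.
have -> : #|[pred z : G | z \notin [:: a; b]]| = #|~: [set a; b]|.
  by apply: eq_card => z; rewrite !inE.
have := cardsC [set a; b]; rewrite cards2 ab => <-.
by rewrite ltnS.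
Qed.

(** Contracting a special pair stays in the class and lowers the number of vertices, so the
    contraction continues until a clique remains. *)
Lemma class_A_contractile (G : sgraph) : class_A G -> even_contractile G.
Proof.
have [m] := ubnP #|G|; elim: m G => // m IH G Gm hG.
have [cl|[a [b sp]]] := special_exists hG; first exact: EvenContractile_clique.
have [ep _] := sp; have [ab _ _] := ep.
apply: (EvenContractile_step ep); apply: IH; last exact: contract_class_A.
exact: leq_trans (card_contract ab) Gm.
Qed.

Theorem corollary1p5 (G : sgraph) (hG : class_A G) :
  (is_clique G \/ exists a b : G, special_even_pair a b) /\
  perfectly_contractile G.
Proof.
split; first exact: special_exists.
by move=> S; apply/class_A_contractile/class_A_induced.
Qed.
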